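(* Let $r\geqslant3$ and let $\mathcal E$ be an $r$th order linear ODE $x^{(r)}+a_{r-1}(t)x^{(r-1)}+\dots+a_1(t)x^{(1)}+a_0(t)x=b(t)$ with smooth $a_{r-1},\dots,a_0,b$. The dimension of the maximal Lie invariance algebra $\mathfrak g^{\mathcal E}$ of $\mathcal E$ takes a value from $\{r+1,r+2,r+4\}$. In the general case $\dim\mathfrak g^{\mathcal E}=r+1$ the algebra $\mathfrak g^{\mathcal E}$ is exhausted by the Lie symmetries that are associated with the linearity of $\mathcal E$. If $\dim\mathfrak g^{\mathcal E}\geqslant r+2$, then the equation $\mathcal E$ is similar to a linear ODE with constant coefficients. In the case $\dim\mathfrak g^{\mathcal E}=r+4$ the equation $\mathcal E$ is reduced by a point transformation of the form $$\tilde t=T(t),\quad \tilde x=X_1(t)x+X_0(t),$$ where $T,X_1,X_0$ are smooth functions of $t$ with $T_tX_1\ne0$, to the elementary equation $x^{(r)}=0$.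
   Context: The underlying field $\mathbb F$ is $\mathbb R$ or $\mathbb C$; all variables, functions and constants are real or complex, respectively. $x=x(t)$ is the unknown function, $x^{(k)}=d^kx/dt^k$. Everything is local: functions, vector fields and transformations are smooth and considered on suitable open domains. The maximal Lie invariance algebra $\mathfrak g^{\mathcal E}$ is the Lie algebra of all vector fields $\tau(t,x)\partial_t+\xi(t,x)\partial_x$ generating local one-parameter groups of point symmetries of $\mathcal E$. Two equations are similar if a point transformation $\tilde t=T(t,x)$, $\tilde x=X(t,x)$ with nonvanishing Jacobian maps one to the other. For homogeneous $\mathcal E$ ($b=0$), the Lie symmetries associated with linearity are those in the $(r+1)$-dimensional algebra $\mathfrak g_0^{\mathcal E}=\langle x\partial_x,\varphi_1(t)\partial_x,\dots,\varphi_r(t)\partial_x\rangle$, where $\varphi_1,\dots,\varphi_r$ form a fundamental set of solutions of $\mathcal E$. An inhomogeneous equation with a particular solution $\varphi_0$ is reduced to the corresponding homogeneous one by $\tilde t=t$, $\tilde x=x-\varphi_0(t)$, so the associated algebra is then $\langle (x-\varphi_0(t))\partial_x,\varphi_1(t)\partial_x,\dots,\varphi_r(t)\partial_x\rangle$ with $\varphi_1,\dots,\varphi_r$ a fundamental set of solutions of the corresponding homogeneous equation. *)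

(* Defs.v *)
From HB Require Import structures.
From mathcomp Require Export all_boot all_order all_algebra.
From mathcomp Require Export complex.
From mathcomp Require Export boolp classical_sets functions reals.
From mathcomp Require Export interval_inference topology normedtype derive convex.
Export Order.TTheory GRing.Theory Num.Theory.
Export numFieldNormedType.Exports.

Set Implicit Arguments.
Unset Strict Implicit.
Unset Printing Implicit Defensive.

#[global] Open Scope classical_set_scope.
#[global] Open Scope ring_scope.

Section Smoothness.
Variable K : numFieldType.

(* Derivatives are taken over [K]: for [K = R[i]] the increments are complex,
   so that [smooth] means holomorphic. *)
Fixpoint Cn (V W : normedModType K) (n : nat) (U : set V) (f : V -> W) : Prop :=
  match n with
  | 0 => forall p, U p -> {for p, continuous f}
  | m.+1 => (forall v p, U p -> derivable f p v) /\
            (forall v, Cn m U (fun p => 'D_v f p))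
  end.

Definition smooth (V W : normedModType K) (U : set V) (f : V -> W) : Prop :=
  forall n, Cn n U f.

(* On sets of scalars, segments are taken with parameter in the real interval
   [0, 1] (for [K = R[i]], [0 <= l <= 1] forces [l] to be real).  A convex
   domain is an arbitrary open interval of R, or e.g. a disc or a half-plane
   of R[i]. *)
Definition domain (D : set K) : Prop :=
  [/\ D !=set0, open D & convex_set (D : set K^o)].

End Smoothness.

Section LinearODE.
Variable K : numFieldType.

(* x^(r) + coef_(r-1)(t) x^(r-1) + ... + coef_0(t) x = rhs(t), with t in dom *)
Record lode (r : nat) := Lode {
  dom : set K;
  coef : 'I_r -> K -> K;
  rhs : K -> K }.

Definition smooth_lode r (E : lode r) : Prop :=
  (forall i, smooth (dom E) (coef E i)) /\ smooth (dom E) (rhs E).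

Definition const_coef_lode r (E : lode r) : Prop :=
  [/\ dom E = setT, forall i, exists c, coef E i = cst c
    & exists c, rhs E = cst c].

Definition homogeneous r (E : lode r) : lode r :=
  Lode (dom E) (coef E) (cst 0).

Definition elementary r : lode r := Lode setT (fun=> cst 0) (cst 0).

Definition solution r (E : lode r) (D : set K) (f : K -> K) : Prop :=
  [/\ D `<=` dom E, smooth D f &
   forall t, D t ->
     derive1n r f t + \sum_(i < r) coef E i t * derive1n i f t = rhs E t].

Definition fundamental r (E : lode r) (phi : 'I_r -> K -> K) : Prop :=
  (forall i, solution (homogeneous E) (dom E) (phi i)) /\
  forall c : 'I_r -> K,
    (forall t, dom E t -> \sum_i c i * phi i t = 0) -> forall i, c i = 0.

Definition jacobian2 (Phi : K * K -> K * K) (p : K * K) : K :=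
  'D_(1, 0) (fst \o Phi) p * 'D_(0, 1) (snd \o Phi) p
  - 'D_(0, 1) (fst \o Phi) p * 'D_(1, 0) (snd \o Phi) p.

Definition point_transformation (V : set (K * K)) (Phi : K * K -> K * K) :=
  [/\ open V, smooth V Phi, {in V &, injective Phi}
    & forall p, V p -> jacobian2 Phi p != 0].

Definition graph (D : set K) (f : K -> K) : set (K * K) :=
  (fun t => (t, f t)) @` D.

(* [Phi] carries graphs of functions to curves that need not be graphs; [g] is
   the function whose graph is the image whenever there is a (smooth) one. *)
Definition maps_lode r (V : set (K * K)) (Phi : K * K -> K * K)
    (E E' : lode r) : Prop :=
  [/\ point_transformation V Phi, V `<=` dom E `*` setT,
      Phi @` V `<=` dom E' `*` setT &
   forall (D D' : set K) (f g : K -> K), open D -> open D' ->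
     smooth D f -> smooth D' g ->
     graph D f `<=` V -> Phi @` graph D f = graph D' g ->
     (solution E D f <-> solution E' D' g)].

(* A point transformation need only exist locally, around each point; the
   target equation does not depend on the point. *)
Definition similar r (E E' : lode r) : Prop :=
  forall p, (dom E `*` setT) p ->
    exists V Phi, V p /\ maps_lode V Phi E E'.

(* the vector field v.1 d/dt + v.2 d/dx *)
Definition vfield := K * K -> K * K.

(* [Phi (e, p)] is the flow of [v] on [B] from [p] at time [e]. *)
Definition local_flow (B : set (K * K)) (v : vfield) (dl : K)
    (V : set (K * K)) (Phi : K * (K * K) -> K * K) : Prop :=
  [/\ open V, smooth (ball (0 : K) dl `*` V) Phi,
      forall p, V p -> Phi (0, p) = p,
      forall e p, ball 0 dl e -> V p ->
        B (Phi (e, p)) /\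
        is_derive e 1 (fun e' : K => Phi (e', p)) (v (Phi (e, p)))
    & forall e1 e2 p, ball 0 dl e1 -> ball 0 dl e2 -> ball 0 dl (e1 + e2) ->
        V p -> V (Phi (e2, p)) -> Phi (e1, Phi (e2, p)) = Phi (e1 + e2, p)].

Definition generates_symmetries r (E : lode r) (B : set (K * K))
    (v : vfield) : Prop :=
  forall p, B p -> exists dl V Phi,
    [/\ 0 < dl, V p, V `<=` B, local_flow B v dl V Phi &
     forall e, ball 0 dl e -> maps_lode V (fun q => Phi (e, q)) E E].

(* Vector fields are total functions of which only the values on [B] matter:
   all notions below are insensitive to the values outside [B].  The dimension
   is that over [K] of the space of their restrictions to [B]. *)
Definition lie_algebra r (E : lode r) (J : set K) : set vfield :=
  [set v | smooth (dom E `*` J) v /\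
           generates_symmetries E (dom E `*` J) v].

Definition vspan (B : set (K * K)) n (e : 'I_n -> vfield) : set vfield :=
  [set v | exists c : 'I_n -> K,
     forall p, B p -> v p = \sum_i c i *: e i p].

Definition vfree (B : set (K * K)) n (e : 'I_n -> vfield) : Prop :=
  forall c : 'I_n -> K,
    (forall p, B p -> \sum_i c i *: e i p = 0) -> forall i, c i = 0.

Definition has_dim (B : set (K * K)) (g : set vfield) (n : nat) : Prop :=
  exists e : 'I_n -> vfield, vfree B e /\ g = vspan B e.

(* The span of (x - phi0(t)) d/dx and the phi_i(t) d/dx; it does not depend on
   phi0 and phi.  For a homogeneous equation phi0 is a combination of the phi_i,
   so that (x - phi0(t)) d/dx can be replaced by x d/dx. *)
Definition linearity_algebra r (E : lode r) (J : set K) : set vfield :=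
  [set v | exists phi0 phi,
    [/\ solution E (dom E) phi0, fundamental E phi &
     exists (c0 : K) (c : 'I_r -> K), forall p, (dom E `*` J) p ->
       v p = (0, c0 * (p.2 - phi0 p.1) + \sum_i c i * phi i p.1)]].

Definition reduced_to_elementary r (E : lode r) : Prop :=
  forall t0, dom E t0 -> exists (D : set K) (T X1 X0 : K -> K),
    [/\ open D, D t0, [/\ smooth D T, smooth D X1 & smooth D X0],
        forall t, D t -> derive1 T t * X1 t != 0 &
     maps_lode (D `*` setT) (fun p => (T p.1, X1 p.1 * p.2 + X0 p.1))
       E (elementary r)].

End LinearODE.

(* Main.v *)
(* By a change of dependent variable x = rho u + phi0, the equation of order r = n+1
   becomes P u = 0, where P is the n-th symmetric power of the operator y'' + q y plus
   terms d_j of order at most n-2.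

   Let v be a symmetry field tau d/dt + xi d/dx. Its flow moves the graph of a solution f
   through graphs of solutions, so the characteristic xi(t, f) - tau(t, f) f' solves the
   homogeneous equation. The second variation of this in the direction of a solution
   vanishing to order n at a point vanishes there to order 2n-1 >= r, hence vanishes
   identically; this gives tau_x = 0 and xi_xx = 0. What is left is the condition that
   al - tau d/dt preserve ker P, which amounts to al = n/2 tau' + c together with linear
   equations for tau: tau''' + 4 q tau' + 2 q' tau = 0 and one first-order equation for
   each d_j.

   The dimension is thus r + 1 + s with s the dimension of the space S of such tau. If a
   nonzero tau in S has a zero, then the equations for the d_j force d = 0; hence either
   s <= 1, or d = 0 and S is the three-dimensional kernel of a third-order operator. If
   d = 0, the coordinate T with T' = 1/y^2, where y'' + q y = 0, carries P to the (n+1)-st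
   derivative. If some tau in S has no zero, the coordinate T with T' = 1/tau makes the
   coefficients constant. The flows integrating the elements of S are translations or
   Moebius transformations in these coordinates. *)

Require Import Defs.
From mathcomp Require Import ring lra.
From mathcomp Require Import sequences prodnormedzmodule.

Set Implicit Arguments.
Unset Strict Implicit.
Unset Printing Implicit Defensive.

(** * Scalars: real and complex *)

(** Jets are recorded by the quantities [FF q n i] instead of derivatives. On them [al - tau d/dt]
    acts by the explicit formula [Bop], up to a defect [Zop] that obeys the recursion of [FF] itself
    with [theta q tau] as its source. Testing on solutions with a single nonzero jet then isolates
    one determining equation at a time.

    Symmetries are known only through local flows, and differentiating a moved solution in the flow
    parameter would require an interchange with up to [n + 1] derivatives in t. Finite dimension
    avoids this: the span of finitely many functions is closed under pointwise limits, so a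
    pointwise limit of difference quotients of solutions is again a solution.

    The bound [2n - 1 >= n + 1] fails for [n = 1], where the projective symmetries of [x'' = 0]
    indeed have [tau] depending on [x].

    In the converse direction an actual flow must be exhibited near every point, zeros of [tau]
    included. At a zero of a nonzero [tau] the coordinate with [T' = 1 / tau] breaks down, and a
    quadratic field in another coordinate takes its place. *)

Section Scalars.

(* What analysis over [R] and over [R[i]] have in common: [io] embeds [R], [re]
   recovers the real norm, and [ell z] is a real-linear functional of norm at most 1
   attaining the norm at [z], which reduces mean value inequalities to real ones. *)
Record kpkg (R : realType) (K : numFieldType) := Kpkg {
  io : {rmorphism R -> K};
  re : K -> R;
  ell : K -> K -> R;
  io_reN : forall x : K, io (re `|x|) = `|x|;
  io_le : {mono io : x y / x <= y};
  ellD : forall z x y, ell z (x + y) = ell z x + ell z y;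
  ellZ : forall z a x, ell z (io a * x) = a * ell z x;
  ell_le : forall z x, ell z x <= re `|x|;
  ell_self : forall z, ell z z = re `|z|;
  kcomplete : forall u : nat -> K,
    (forall e : R, 0 < e -> exists n0, forall m n, (n0 <= m)%N -> (n0 <= n)%N ->
      re `|u m - u n| < e) ->
    exists l, forall e : R, 0 < e -> exists n0, forall n, (n0 <= n)%N ->
      re `|u n - l| < e }.

Lemma real_complete (R : realType) (u : nat -> R) :
    (forall e : R, 0 < e -> exists n0, forall m n, (n0 <= m)%N -> (n0 <= n)%N ->
      `|u m - u n| < e) ->
    exists l, forall e : R, 0 < e -> exists n0, forall n, (n0 <= n)%N ->
      `|u n - l| < e.
Proof.
move=> cu; have : cauchy (u @ \oo).
  apply/cauchy_ballP => e e0; have [n0 h] := cu e e0.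
  pose A : set R := [set u n | n in [set n | (n0 <= n)%N]].
  have FA : (u @ \oo) A by exists n0 => // n hn; exists n.
  exists (A, A) => //= -[_ _] [/= [m hm <-] [n hn <-]].
  by rewrite -ball_normE /= h.
move=> /cauchy_cvg /cvg_ex [l ul]; exists l => e e0.
have /cvgrPdist_lt /(_ e e0) [n0 _ h] := ul.
by exists n0 => n hn; rewrite distrC; exact: h.
Qed.

Lemma sg_mul_le (R : realType) (z x : R) : Num.sg z * x <= `|x|.
Proof.
apply: le_trans (ler_norm _) _; rewrite normrM normr_sg.
by case: (z != 0); rewrite ?mul1r // mul0r.
Qed.

Definition kpkg_real (R : realType) : kpkg R R :=
  @Kpkg R R idfun id (fun z x => Num.sg z * x) (fun=> erefl) (fun _ _ => erefl)
    (fun z => mulrDr (Num.sg z)) (fun z a x => mulrCA (Num.sg z) a x)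
    (@sg_mul_le R) (fun z => esym (normrEsg z)) (@real_complete R).

(** The norming functional is [x |-> Re (z^* x / |z|)]; for [z = 0] it is zero, since division by
    zero gives zero. Completeness is inherited from the real and imaginary parts. *)
Lemma kpkg_complex (R : realType) : kpkg R R[i].
Proof.
have nE (x : R[i]) : `|x| = (complex.Re `|x|)%:C%C.
  by rewrite RRe_real // normr_real.
have Rele (x : R[i]) : complex.Re x <= complex.Re `|x|.
  have := normc_ge_Re x; rewrite [X in _ <= X]nE lecR; apply: le_trans.
  exact: ler_norm.
have RE (a b : R[i]) : complex.Re (a + b) = complex.Re a + complex.Re b.
  by case: a b => [? ?] [? ?].
have RB (a b : R[i]) : complex.Re (a - b) = complex.Re a - complex.Re b.
  by case: a b => [? ?] [? ?].
have IB (a b : R[i]) : complex.Im (a - b) = complex.Im a - complex.Im b.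
  by case: a b => [? ?] [? ?].
have RZ (a : R) (b : R[i]) : complex.Re (a%:C%C * b) = a * complex.Re b.
  by case: b => [? ?] /=; rewrite mul0r subr0.
have nle (x : R[i]) : complex.Re `|x| <= `|complex.Re x| + `|complex.Im x|.
  rewrite normc_def /= -(ger0_norm (addr_ge0 (normr_ge0 _) (normr_ge0 _))).
  rewrite -sqrtr_sqr ler_wsqrtr // sqrrD !real_normK ?num_real //.
  by rewrite lerD2r lerDl mulrn_wge0 // mulr_ge0.
apply: (@Kpkg R R[i] (real_complex R) (@complex.Re R)
  (fun z x => complex.Re (z^*%C / `|z| * x))) => //.
- exact: lecR.
- by move=> z x y; rewrite mulrDr RE.
- by move=> z a x; rewrite mulrCA RZ.
- move=> z x; apply: le_trans (Rele _) _.
  have [->|z0] := eqVneq z 0; first by rewrite normr0 invr0 mulr0 mul0r -lecR -!nE normr0.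
  by rewrite !normrM normfV normr_id normcJ mulfV ?normr_eq0 // mul1r.
- move=> z; have [->|z0] := eqVneq z 0; first by rewrite normr0 mulr0.
  by rewrite mulrAC mulrC [_ * z]mulrC -sqr_normc expr2 mulKf ?normr_eq0.
- move=> u cu.
  have [|a ua] := @real_complete R (fun n => complex.Re (u n)).
    move=> e /cu [n0 h]; exists n0 => m n hm hn; rewrite -RB.
    apply: le_lt_trans (h m n hm hn); have := normc_ge_Re (u m - u n).
    by rewrite [X in _ <= X]nE lecR.
  have [|b ub] := @real_complete R (fun n => complex.Im (u n)).
    move=> e /cu [n0 h]; exists n0 => m n hm hn; rewrite -IB.
    apply: le_lt_trans (h m n hm hn); rewrite normc_def /= -sqrtr_sqr.
    by rewrite ler_wsqrtr // lerDr sqr_ge0.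
  exists (a +i* b)%C => e e0; have e20 : 0 < e / 2 by rewrite divr_gt0.
  have [n1 h1] := ua _ e20; have [n2 h2] := ub _ e20.
  exists (maxn n1 n2) => n; rewrite geq_max => /andP[hn1 hn2].
  apply: le_lt_trans (nle _) _; rewrite RB IB /= [e]splitr.
  by rewrite ltrD // ?h1 ?h2.
Qed.

End Scalars.

Existing Class kpkg.

(** * Real-valued norms and epsilon-delta forms of the topological notions *)

Section RealNorm.
Context {R : realType} {K : numFieldType} {pk : kpkg R K}.
Implicit Types (V W : normedModType K).

(** Norms of modules over [K] take values in [K]; reading them in [R] gives a total order and makes
    [lra] available. *)
Definition nm V (v : V) : R := re pk `|v|.

Lemma io_nm V (v : V) : io pk (nm v) = `|v|.
Proof. by rewrite /nm -[`|v|]normr_id io_reN normr_id. Qed.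

Lemma io_lt : {mono io pk : x y / x < y}.
Proof. exact: leW_mono (io_le pk). Qed.

Lemma io_inj : injective (io pk).
Proof. exact: inc_inj (io_le pk). Qed.

Lemma nm_io (a : R) : nm (io pk a : K) = `|a|.
Proof.
apply: io_inj; rewrite io_nm; case: (leP 0 a) => a0.
  by rewrite (ger0_norm a0) ger0_norm // -(rmorph0 (io pk)) io_le.
by rewrite (ltr0_norm a0) ltr0_norm ?rmorphN // -(rmorph0 (io pk)) io_lt.
Qed.

Lemma nm_ge0 V (v : V) : 0 <= nm v.
Proof. by rewrite -(io_le pk) rmorph0 io_nm. Qed.

Lemma nm0 V : nm (0 : V) = 0.
Proof. by apply: io_inj; rewrite io_nm normr0 rmorph0. Qed.

Lemma nm_eq0 V (v : V) : (nm v == 0) = (v == 0).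
Proof. by rewrite -(inj_eq io_inj) io_nm rmorph0 normr_eq0. Qed.

Lemma nm_gt0 V (v : V) : (0 < nm v) = (v != 0).
Proof. by rewrite lt_def nm_ge0 nm_eq0 andbT. Qed.

Lemma nmN V (v : V) : nm (- v) = nm v.
Proof. by rewrite /nm normrN. Qed.

Lemma nmC V (v w : V) : nm (v - w) = nm (w - v).
Proof. by rewrite -nmN opprB. Qed.

Lemma nmD V (v w : V) : nm (v + w) <= nm v + nm w.
Proof. by rewrite -(io_le pk) rmorphD !io_nm ler_normD. Qed.

Lemma nmB V (v w : V) : nm (v - w) <= nm v + nm w.
Proof. by rewrite -(nmN w) nmD. Qed.

Lemma nm_tri V (u v w : V) : nm (u - w) <= nm (u - v) + nm (v - w).
Proof. by have := nmD (u - v) (v - w); rewrite addrA subrK. Qed.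

Lemma nmBr V (v w : V) : nm v - nm w <= nm (v - w).
Proof. by rewrite lerBlDr; have := nmD (v - w) w; rewrite subrK. Qed.

Lemma nmZ V (a : K) (v : V) : nm (a *: v) = nm a * nm v.
Proof. by apply: io_inj; rewrite rmorphM !io_nm normrZ. Qed.

Lemma nmM (a b : K) : nm (a * b) = nm a * nm b.
Proof. by apply: io_inj; rewrite rmorphM !io_nm normrM. Qed.

Lemma nm1 : nm (1 : K) = 1.
Proof. by apply: io_inj; rewrite io_nm normr1 rmorph1. Qed.

Lemma nmV (a : K) : nm a^-1 = (nm a)^-1.
Proof. by apply: io_inj; rewrite fmorphV !io_nm normfV. Qed.

Lemma nmX (a : K) n : nm (a ^+ n) = nm a ^+ n.
Proof. by apply: io_inj; rewrite rmorphXn !io_nm normrX. Qed.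

Lemma nm_nat n : nm (n%:R : K) = n%:R.
Proof. by rewrite -(rmorph_nat (io pk)) nm_io ger0_norm. Qed.

Lemma nm_sum V I (r : seq I) (P : pred I) (F : I -> V) :
  nm (\sum_(i <- r | P i) F i) <= \sum_(i <- r | P i) nm (F i).
Proof.
elim/big_ind2: _ => [|x a y b xa yb|//]; first by rewrite nm0.
by apply: le_trans (nmD _ _) _; apply: lerD.
Qed.

Lemma nm_pair V W (p : V * W) : nm p = Num.max (nm p.1) (nm p.2).
Proof.
apply: io_inj; rewrite io_nm prod_normE.
by by rewrite -!io_nm /Order.max io_lt; case: ifP.
Qed.

Lemma nm_fst V W (p : V * W) : nm p.1 <= nm p.
Proof. by rewrite nm_pair le_max lexx. Qed.

Lemma nm_snd V W (p : V * W) : nm p.2 <= nm p.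
Proof. by rewrite nm_pair le_max lexx orbT. Qed.

Lemma posK (e : K) : 0 < e -> 0 < nm e /\ e = io pk (nm e).
Proof.
by move=> e0; rewrite nm_gt0 gt_eqF // io_nm gtr0_norm.
Qed.

Lemma nbhsE V (p : V) (A : set V) :
  nbhs p A <-> exists2 d : R, 0 < d & forall q, nm (q - p) < d -> A q.
Proof.
split.
  move=> /nbhs_normP[e /= e0 h]; have [e1 eE] := posK e0.
  exists (nm e) => // q hq; apply: h; rewrite /= distrC eE -io_nm.
  by rewrite io_lt.
move=> [d d0 h]; apply/nbhs_normP; exists (io pk d).
  by rewrite /= -(rmorph0 (io pk)) io_lt.
by move=> q; rewrite /= distrC -io_nm io_lt; exact: h.
Qed.

Lemma openP V (U : set V) :
  open U <-> forall p, U p -> exists2 d : R, 0 < d & forall q, nm (q - p) < d -> U q.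
Proof.
rewrite openE; split => h p Up.
  by apply/nbhsE/h.
by apply/nbhsE/h.
Qed.

Lemma contP V W (f : V -> W) p :
  {for p, continuous f} <-> forall e : R, 0 < e ->
    exists2 d : R, 0 < d & forall q, nm (q - p) < d -> nm (f q - f p) < e.
Proof.
split.
  move=> /cvgrPdist_lt h e e0.
  have /h /nbhsE[d d0 hd] : 0 < io pk e by rewrite -(rmorph0 (io pk)) io_lt.
  by exists d => // q /hd; rewrite distrC -io_nm io_lt.
move=> h; apply/cvgrPdist_lt => e /posK[e0 ->]; have [d d0 hd] := h _ e0.
by apply/nbhsE; exists d => // q /hd; rewrite distrC -io_nm io_lt.
Qed.

(** The defining quotient is multiplied out by [nm h], so that later estimates handle neither
    inverses nor punctured filters. *)
Lemma derivP V W (f : V -> W) p v l :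
  is_derive p v f l <-> forall e : R, 0 < e ->
    exists2 d : R, 0 < d & forall h : K, h != 0 -> nm h < d ->
      nm (f (p + h *: v) - f p - h *: l) <= e * nm h.
Proof.
have E (h : K) : h != 0 -> nm (f (p + h *: v) - f p - h *: l) =
    nm (l - h^-1 *: (f (h *: v + p) - f p)) * nm h.
  move=> h0; rewrite [RHS]mulrC -nmZ scalerBr (scalerA _ h^-1) mulfV //.
  by rewrite scale1r [RHS]nmC [h *: v + p]addrC.
have cE : (is_derive p v f l <->
   (fun h => h^-1 *: ((f \o shift p) (h *: v) - f p)) @ 0^' --> l).
  split=> [[/cvg_ex[l' hl'] <-]|hl].
    by rewrite /derive (cvg_lim _ hl').
  by split; [apply/cvg_ex; exists l|exact: cvg_lim].
rewrite cE; split.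
  move=> /cvgrPdist_le h e e0.
  have /h : 0 < io pk e by rewrite -(rmorph0 (io pk)) io_lt.
  rewrite near_withinE => /nbhsE[d d0 hd]; exists d => // x x0 xd.
  rewrite E // ler_wpM2r ?nm_ge0 // -(io_le pk) io_nm.
  by apply: (hd x) => //; rewrite subr0.
move=> h; apply/cvgrPdist_le => e /posK[e0 ->]; have [d d0 hd] := h _ e0.
rewrite near_withinE; apply/nbhsE; exists d => // x; rewrite subr0 => xd x0.
rewrite -io_nm io_le /=.
by have := hd x x0 xd; rewrite E // ler_pM2r // nm_gt0.
Qed.

(* The following restatements fix the path along which the operations of [K]
   are elaborated, so that [lra] sees syntactically equal atoms. *)
Lemma triK (u v w : K) : nm (u - w) <= nm (u - v) + nm (v - w).
Proof. exact: nm_tri. Qed.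

Lemma nmDK (u v : K) : nm (u + v) <= nm u + nm v.
Proof. exact: nmD. Qed.

Lemma nmBK (u v : K) : nm (u - v) <= nm u + nm v.
Proof. exact: nmB. Qed.

Lemma nmBrK (v w : K) : nm v - nm w <= nm (v - w).
Proof. exact: nmBr. Qed.

Lemma nmCK (u v : K) : nm (u - v) = nm (v - u).
Proof. exact: nmC. Qed.

Lemma nmNK (u : K) : nm (- u) = nm u.
Proof. exact: nmN. Qed.

Lemma nmK0 : nm (0 : K) = 0.
Proof. exact: nm0. Qed.

Lemma nmK_ge0 (u : K) : 0 <= nm u.
Proof. exact: nm_ge0. Qed.

Lemma nm_sumK I (r : seq I) (P : pred I) (F : I -> K) :
  nm (\sum_(i <- r | P i) F i) <= \sum_(i <- r | P i) nm (F i).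
Proof. exact: nm_sum. Qed.

Lemma openPK (U : set K) :
  open U <-> forall p : K, U p -> exists2 d : R, 0 < d & forall q : K, nm (q - p) < d -> U q.
Proof. exact: openP. Qed.

Lemma contPK (f : K -> K) (p : K) :
  {for p, continuous f} <-> forall e : R, 0 < e ->
    exists2 d : R, 0 < d & forall q : K, nm (q - p) < d -> nm (f q - f p) < e.
Proof. exact: contP. Qed.

Lemma derivPK (f : K -> K) (p l : K) :
  is_derive p 1 f l <-> forall e : R, 0 < e ->
    exists2 d : R, 0 < d & forall q : K, nm (q - p) < d ->
      nm (f q - f p - l * (q - p)) <= e * nm (q - p).
Proof.
split=> [/derivP h e e0|h].
  have [d d0 hd] := h e e0; exists d => // q hq.
  have [->|qp] := eqVneq q p; first by rewrite !subrr mulr0 subrr nm0 mulr0.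
  have := hd (q - p); rewrite subr_eq0 => /(_ qp hq).
  rewrite /GRing.scale /= mulr1 [_ * l]mulrC; have -> : p + (q - p) = q by ring.
  by [].
apply/derivP => e e0; have [d d0 hd] := h e e0; exists d => // x x0 hx.
have E : p + x - p = x by ring.
have := hd (p + x); rewrite !E => /(_ hx).
by rewrite /GRing.scale /= mulr1 [x * l]mulrC.
Qed.

End RealNorm.

Arguments triK {R K} pk u v w.
Arguments nm_tri {R K} pk {V} u v w.
Arguments nmK_ge0 {R K} pk u.
Arguments nm_ge0 {R K} pk {V} v.
Arguments nmDK {R K} pk u v.
Arguments nmBK {R K} pk u v.
Arguments nmBrK {R K} pk v w.
Arguments nmCK {R K} pk u v.
Arguments nm_fst {R K} pk {V W} p.
Arguments nm_snd {R K} pk {V W} p.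

Lemma nm_real (R : realType) (x : R) : nm (pk := kpkg_real R) x = `|x|.
Proof. by []. Qed.

(** * Smooth functions *)
Section Smooth.
Context {K : numFieldType}.
Implicit Types (V W X : normedModType K).

Lemma near_open V (U : set V) (P : V -> Prop) p :
  open U -> U p -> (forall q, U q -> P q) -> \near p, P p.
Proof.
by move=> oU Up h; move/open_nbhs_nbhs: (conj oU Up); exact: filterS.
Qed.

Lemma is_derive_ext V W (U : set V) (f g : V -> W) p v l : open U -> U p ->
  (forall q, U q -> f q = g q) -> is_derive p v f l -> is_derive p v g l.
Proof.
by move=> oU Up fg; apply: near_eq_is_derive; exact: near_open Up fg.
Qed.

Lemma derive_ext V W (U : set V) (f g : V -> W) p v : open U -> U p ->
  (forall q, U q -> f q = g q) -> 'D_v f p = 'D_v g p.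
Proof.
by move=> oU Up fg; apply: near_eq_derive; exact: near_open Up fg.
Qed.

Lemma derive1_ext W (U : set K) (f g : K -> W) t : open U -> U t ->
  (forall q, U q -> f q = g q) -> derive1 f t = derive1 g t.
Proof. by move=> oU Ut fg; rewrite !derive1E; exact: derive_ext fg. Qed.

Lemma derive1_val W (f : K -> W) (t : K) l : is_derive t 1 f l -> derive1 f t = l.
Proof. by move=> h; rewrite derive1E derive_val. Qed.

Lemma derivable1P W (f : K -> W) (t : K) : derivable f t 1 -> is_derive t 1 f (derive1 f t).
Proof. by rewrite derive1E => /derivableP. Qed.

(** [Cn] asks for continuity of the last derivatives only, and in several variables directional
    derivability does not give continuity. Asking for it at each order makes [Dn] decreasing in [n]
    and fit for induction; over all orders the two notions agree. *)
Fixpoint Dn V W (n : nat) (U : set V) (f : V -> W) : Prop :=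
  (forall p, U p -> {for p, continuous f}) /\
  match n with
  | 0 => True
  | m.+1 => (forall v p, U p -> derivable f p v) /\
            (forall v, Dn m U (fun p => 'D_v f p))
  end.

Lemma Dn_cont V W n (U : set V) (f : V -> W) p :
  Dn n U f -> U p -> {for p, continuous f}.
Proof. by case: n => [|n] [h _]; exact: h. Qed.

Lemma Dn_pred V W n (U : set V) (f : V -> W) : Dn n.+1 U f -> Dn n U f.
Proof.
elim: n f => [|n IH] f; first by case.
by case=> cf [df Df]; split=> //; split=> // v; exact: IH.
Qed.

Lemma smoothDn V W (U : set V) (f : V -> W) : smooth U f <-> forall n, Dn n U f.
Proof.
split=> [sf n|h n].
  elim: n f sf => [|n IH] f sf; first by split=> //; exact: (sf 0%N).
  split; first exact: (sf 0%N).
  split; first by have [] := sf 1%N.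
  by move=> v; apply: IH => m; have [_] := sf m.+1; apply.
elim: n f h => [|n IH] f h; first by have [] := h 0%N.
split; first by have [_ []] := h 1%N.
by move=> v; apply: IH => m; have [_ [_]] := h m.+1; apply.
Qed.

Lemma smoothP V W (U : set V) (f : V -> W) : smooth U f <->
  [/\ forall p, U p -> {for p, continuous f},
      forall v p, U p -> derivable f p v & forall v, smooth U ('D_v f)].
Proof.
split=> [/smoothDn h|[cf df Df]].
  split; first by have [] := h 0%N.
    by have [_ []] := h 1%N.
  by move=> v; apply/smoothDn => n; have [_ [_]] := h n.+1; apply.
apply/smoothDn => -[|n]; first by split.
by split=> //; split=> // v; move/smoothDn: (Df v).
Qed.

Lemma smooth_cont V W (U : set V) (f : V -> W) p :
  smooth U f -> U p -> {for p, continuous f}.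
Proof. by move=> /smoothP[+ _ _]; exact. Qed.

Lemma smooth_derivable V W (U : set V) (f : V -> W) v p :
  smooth U f -> U p -> derivable f p v.
Proof. by move=> /smoothP[_ + _]; exact. Qed.

Lemma smooth_D V W (U : set V) (f : V -> W) v : smooth U f -> smooth U ('D_v f).
Proof. by move=> /smoothP[_ _ +]; exact. Qed.

Lemma smooth_is_derive V W (U : set V) (f : V -> W) v p :
  smooth U f -> U p -> is_derive p v f ('D_v f p).
Proof. by move=> sf Up; apply/derivableP; exact: smooth_derivable sf Up. Qed.

Lemma smooth_is_derive1 W (U : set K) (f : K -> W) (t : K) :
  smooth U f -> U t -> is_derive t 1 f (derive1 f t).
Proof. by move=> sf Ut; apply/derivable1P; exact: smooth_derivable sf Ut. Qed.

Lemma Dn_sub V W n (U U' : set V) (f : V -> W) : U' `<=` U -> Dn n U f -> Dn n U' f.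
Proof.
move=> sU; elim: n f => [|n IH] f; first by move=> [h _]; split=> // p /sU /h.
move=> [h [d D]]; split; first by move=> p /sU /h.
by split=> [v p /sU|v]; [exact: d|exact/IH/D].
Qed.

Lemma smooth_sub V W (U U' : set V) (f : V -> W) :
  U' `<=` U -> smooth U f -> smooth U' f.
Proof. by move=> sU /smoothDn h; apply/smoothDn => n; exact: Dn_sub (h n). Qed.

(** Derivatives are those of the total function at points of the set, so smoothness is a condition
    on each point separately. *)
Lemma Dn_local V W n (U : set V) (f : V -> W) :
  (forall p, U p -> exists2 A : set V, A p & Dn n A f) -> Dn n U f.
Proof.
elim: n f => [|n IH] f h.
  by split=> // p Up; have [A Ap Af] := h _ Up; exact: Dn_cont Af Ap.
split; first by move=> p Up; have [A Ap Af] := h _ Up; exact: Dn_cont Af Ap.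
split=> [v p Up|v]; first by have [A Ap [_ [Ad _]]] := h _ Up; exact: Ad.
by apply: IH => p Up; have [A Ap [_ [_ AD]]] := h _ Up; exists A; last exact: AD.
Qed.

Lemma smooth_local V W (U : set V) (f : V -> W) :
  (forall p, U p -> exists2 A : set V, A p & smooth A f) -> smooth U f.
Proof.
move=> h; apply/smoothDn => n; apply: Dn_local => p /h[A Ap Af]; exists A => //.
by move/smoothDn: Af.
Qed.

Lemma Dn_ext V W n (U : set V) (f g : V -> W) : open U ->
  (forall p, U p -> f p = g p) -> Dn n U f -> Dn n U g.
Proof.
move=> oU; elim: n f g => [|n IH] f g fg.
  move=> [cf _]; split=> // p Up; have := cf p Up.
  suff : f @ p --> f p -> g @ p --> g p by [].
  rewrite (fg _ Up); apply: cvg_trans.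
  by apply: near_eq_cvg; apply: near_open Up _ => // q Uq; rewrite fg.
move=> h; split.
  move=> p Up; have [cf _] := h; have := cf p Up.
  suff : f @ p --> f p -> g @ p --> g p by [].
  rewrite (fg _ Up); apply: cvg_trans.
  by apply: near_eq_cvg; apply: near_open Up _ => // q Uq; rewrite fg.
have [_ [df Df]] := h; split=> [v p Up|v].
  by apply: near_eq_derivable (df v p Up); apply: near_open Up _.
by apply: IH (Df v) => p Up; apply: derive_ext Up fg.
Qed.

Lemma smooth_ext V W (U : set V) (f g : V -> W) : open U ->
  (forall p, U p -> f p = g p) -> smooth U f -> smooth U g.
Proof.
by move=> oU fg /smoothDn h; apply/smoothDn => n; exact: Dn_ext fg (h n).
Qed.

Lemma Dn_cst V W n (U : set V) (c : W) : Dn n U (fun=> c).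
Proof.
elim: n c => [|n IH] c; first by split=> // p _; exact: cst_continuous.
split; first by move=> p _; exact: cst_continuous.
split=> [v p _|v]; first exact: derivable_cst.
have -> : (fun p : V => 'D_v (fun=> c) p) = (fun=> 0).
  by apply/funext => p; rewrite derive_cst.
exact: IH.
Qed.

Lemma smooth_cst V W (U : set V) (c : W) : smooth U (fun=> c).
Proof. by apply/smoothDn => n; exact: Dn_cst. Qed.

Lemma smooth_id V (U : set V) : smooth U id.
Proof.
apply/smoothP; split=> [p _|v p _|v]; [exact: cvg_id|exact: derivable_id|].
have -> : 'D_v id = (fun=> v) by apply/funext => p; rewrite derive_id.
exact: smooth_cst.
Qed.

Lemma is_derive_linear V W (l : {linear V -> W}) p v : is_derive p v l (l v).
Proof.
split.
  apply: (is_cvg_near_cst (l v)) => //=.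
  near=> h; rewrite -linearB /= addrK linearZ scalerA mulVf ?scale1r //.
  by near: h; exact: nbhs_dnbhs_neq.
apply: lim_near_cst => //=.
near=> h; rewrite -linearB /= addrK linearZ scalerA mulVf ?scale1r //.
by near: h; exact: nbhs_dnbhs_neq.
Unshelve. all: by end_near. Qed.

Lemma smooth_linear V W (U : set V) (l : {linear V -> W}) :
  continuous l -> smooth U l.
Proof.
move=> cl; apply/smoothP; split=> [p _|v p _|v]; first exact: cl.
  by have [] := is_derive_linear l p v.
have -> : 'D_v l = (fun=> l v).
  by apply/funext => p; have [] := is_derive_linear l p v.
exact: smooth_cst.
Qed.

Lemma smooth_fst V W (U : set (V * W)) : smooth U fst.
Proof. by apply: (@smooth_linear _ _ U fst) => p; exact: cvg_fst. Qed.

Lemma smooth_snd V W (U : set (V * W)) : smooth U snd.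
Proof. by apply: (@smooth_linear _ _ U snd) => p; exact: cvg_snd. Qed.

Section Closure.
Variables (V : normedModType K) (U : set V) (oU : open U).

Lemma Dn_add W n (f g : V -> W) :
  Dn n U f -> Dn n U g -> Dn n U (fun p => f p + g p).
Proof.
elim: n f g => [|n IH] f g hf hg.
  by split=> // p Up; apply: cvgD; [exact: (Dn_cont hf)|exact: (Dn_cont hg)].
have [cf [df Df]] := hf; have [cg [dg Dg]] := hg.
split; first by move=> p Up; apply: cvgD; [exact: cf|exact: cg].
split=> [v p Up|v]; first by apply: derivableD; [exact: df|exact: dg].
apply: Dn_ext oU _ (IH _ _ (Df v) (Dg v)) => p Up /=.
by rewrite -deriveD //; [exact: df|exact: dg].
Qed.

Lemma Dn_mul n (f g : V -> K) :
  Dn n U f -> Dn n U g -> Dn n U (fun p => f p * g p).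
Proof.
elim: n f g => [|n IH] f g hf hg.
  by split=> // p Up; apply: cvgM; [exact: (Dn_cont hf)|exact: (Dn_cont hg)].
have [cf [df Df]] := hf; have [cg [dg Dg]] := hg.
split; first by move=> p Up; apply: cvgM; [exact: cf|exact: cg].
split=> [v p Up|v]; first by apply: derivableM; [exact: df|exact: dg].
apply: Dn_ext oU _ (Dn_add (IH _ _ (Df v) (Dn_pred hg)) (IH _ _ (Dn_pred hf) (Dg v))).
move=> p Up /=; rewrite (@deriveM _ _ f g) //; [|exact: df|exact: dg].
by rewrite /GRing.scale /= addrC [g p * _]mulrC.
Qed.

Lemma Dn_opp W n (f : V -> W) : Dn n U f -> Dn n U (fun p => - f p).
Proof.
elim: n f => [|n IH] f hf.
  by split=> // p Up; apply: cvgN; exact: (Dn_cont hf).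
have [cf [df Df]] := hf.
split; first by move=> p Up; apply: cvgN; exact: cf.
split=> [v p Up|v]; first by apply: derivableN; exact: df.
by apply: Dn_ext oU _ (IH _ (Df v)) => p Up /=; rewrite -deriveN //; exact: df.
Qed.

Lemma Dn_inv n (f : V -> K) : (forall p, U p -> f p != 0) ->
  Dn n U f -> Dn n U (fun p => (f p)^-1).
Proof.
move=> f0; elim: n => [|n IH] hf.
  by split=> // p Up; apply: cvgV; [exact: f0|exact: (Dn_cont hf)].
have [cf [df Df]] := hf.
split; first by move=> p Up; apply: cvgV; [exact: f0|exact: cf].
split=> [v p Up|v]; first by apply: derivableV; [exact: f0|exact: df].
have IH' := IH (Dn_pred hf).
apply: Dn_ext oU _ (Dn_opp (Dn_mul (Dn_mul IH' IH') (Df v))) => p Up /=.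
rewrite deriveV; [|exact: f0|exact: df].
by rewrite /GRing.scale /= mulNr -exprVn expr2.
Qed.

Lemma smoothD W (f g : V -> W) :
  smooth U f -> smooth U g -> smooth U (fun p => f p + g p).
Proof.
by move=> /smoothDn hf /smoothDn hg; apply/smoothDn => n; exact: Dn_add.
Qed.

Lemma smoothM (f g : V -> K) :
  smooth U f -> smooth U g -> smooth U (fun p => f p * g p).
Proof.
by move=> /smoothDn hf /smoothDn hg; apply/smoothDn => n; exact: Dn_mul.
Qed.

Lemma smoothN W (f : V -> W) : smooth U f -> smooth U (fun p => - f p).
Proof. by move=> /smoothDn hf; apply/smoothDn => n; exact: Dn_opp. Qed.

Lemma smoothB W (f g : V -> W) :
  smooth U f -> smooth U g -> smooth U (fun p => f p - g p).
Proof. by move=> hf hg; apply: smoothD => //; exact: smoothN. Qed.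

Lemma smoothV (f : V -> K) : (forall p, U p -> f p != 0) ->
  smooth U f -> smooth U (fun p => (f p)^-1).
Proof. by move=> f0 /smoothDn hf; apply/smoothDn => n; exact: Dn_inv. Qed.

Lemma smooth_sum W I (r : seq I) (P : pred I) (f : I -> V -> W) :
  (forall i, P i -> smooth U (f i)) -> smooth U (fun p => \sum_(i <- r | P i) f i p).
Proof.
move=> h; elim: r => [|i r IH].
  by apply: smooth_ext oU _ (smooth_cst U 0) => p _; rewrite big_nil.
case Pi : (P i).
  by apply: smooth_ext oU _ (smoothD (h i Pi) IH) => p _; rewrite big_cons Pi.
by apply: smooth_ext oU _ IH => p _; rewrite big_cons Pi.
Qed.

Lemma smoothX (f : V -> K) n : smooth U f -> smooth U (fun p => f p ^+ n).
Proof.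
move=> hf; elim: n => [|n IH].
  by apply: smooth_ext oU _ (smooth_cst U (1 : K)) => p _; rewrite expr0.
by apply: smooth_ext oU _ (smoothM hf IH) => p _; rewrite exprS.
Qed.

End Closure.
End Smooth.

(** * Composition, pairs and slices of smooth functions *)

Section SmoothComp.
Context {K : numFieldType}.
Implicit Types (V W X : normedModType K).

Lemma is_derive_line V W (f : V -> W) (p v : V) (s : K) l :
  is_derive (p + s *: v) v f l <-> is_derive s 1 (fun h : K => f (p + h *: v)) l.
Proof.
have E : (fun h : K => h^-1 *: ((f \o shift (p + s *: v)) (h *: v) - f (p + s *: v))) =
  (fun h : K => h^-1 *: (((fun h : K => f (p + h *: v)) \o shift s) (h *: (1 : K)) -
      f (p + s *: v))).
  apply/funext => h /=; congr (_ *: (f _ - _)).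
  by rewrite scalerDl /GRing.scale /= mulr1 addrCA.
split=> -[d <-]; split; try by rewrite /derivable /= E in d *.
  by rewrite /derive E.
by rewrite /derive E.
Qed.

Lemma is_derive_line0 V W (f : V -> W) (p v : V) l :
  is_derive p v f l <-> is_derive (0 : K) 1 (fun h : K => f (p + h *: v)) l.
Proof. by rewrite -is_derive_line scale0r addr0. Qed.

Lemma is_derive_comp1 (f g : K -> K) (s a b : K) :
  is_derive s 1 f a -> is_derive (f s) 1 g b ->
  is_derive s 1 (fun h => g (f h)) (a * b).
Proof.
move=> [df <-] [dg <-].
have /derivable1_diffP hf := df; have /derivable1_diffP hg := dg.
have hgf : differentiable (g \o f) s by exact: differentiable_comp.
split; first by apply/derivable1_diffP.
have -> : 'D_1 (fun h => g (f h)) s = 'd (g \o f) s 1 by rewrite deriveE.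
rewrite diff_comp //= !deriveE //.
by rewrite -[X in 'd g _ X]mulr1; exact: linearZ.
Qed.

Lemma is_derive_comp V (f : V -> K) (g : K -> K) (p v : V) (a b : K) :
  is_derive p v f a -> is_derive (f p) 1 g b ->
  is_derive p v (fun q => g (f q)) (a * b).
Proof.
move=> /is_derive_line0 hf hg; apply/is_derive_line0.
by apply: is_derive_comp1 hf _; rewrite scale0r addr0.
Qed.

Lemma is_derive_dir W (f : K -> W) (v t : K) :
  derivable f t 1 -> is_derive t v f (v *: derive1 f t).
Proof.
move=> df; have /derivable1_diffP hf := df; split; first exact: diff_derivable.
rewrite deriveE // derive1E deriveE //.
by rewrite -[X in 'd f t X]mulr1 [LHS]linearZ.
Qed.

Lemma Dn_scale V W n (U : set V) (v : K) (g : V -> W) : open U ->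
  Dn n U g -> Dn n U (fun t => v *: g t).
Proof.
move=> oU; elim: n g => [|n IH] g hg.
  by split=> // p Up; exact: (cvgZr (Dn_cont hg Up)).
split; first by move=> p Up; exact: (cvgZr (Dn_cont hg Up)).
have [_ [dg Dg]] := hg; split=> [w p Up|w]; first by apply: derivableZ; exact: dg.
by apply: Dn_ext oU _ (IH _ (Dg w)) => p Up; rewrite -deriveZ //; exact: dg.
Qed.

(** In one variable ['D_v f = v *: derive1 f], so a single derivative controls all directions. *)
Lemma Dn1 W n (U : set K) (f : K -> W) : open U ->
  (forall t, U t -> derivable f t 1) -> Dn n U (derive1 f) -> Dn n.+1 U f.
Proof.
move=> oU df sf; split; last split=> [v t Ut|v].
- by move=> t Ut; apply: differentiable_continuous; apply/derivable1_diffP/df.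
- by have [] := is_derive_dir v (df t Ut).
- apply: Dn_ext oU _ (Dn_scale v oU sf) => t Ut.
  by have [_ ->] := is_derive_dir v (df t Ut).
Qed.

Lemma smooth1P W (U : set K) (f : K -> W) : open U ->
  (forall t, U t -> derivable f t 1) -> smooth U (derive1 f) -> smooth U f.
Proof.
by move=> oU df /smoothDn sf; apply/smoothDn => -[|n];
  [exact: Dn_pred (Dn1 oU df (sf 0%N))|exact: Dn1].
Qed.

Lemma smooth_derive1 W (U : set K) (f : K -> W) :
  smooth U f -> smooth U (derive1 f).
Proof.
move=> sf; have -> : derive1 f = 'D_1 f by apply/funext => t; rewrite derive1E.
exact: smooth_D.
Qed.

Lemma smooth_derive1n W (U : set K) (f : K -> W) n :
  smooth U f -> smooth U (derive1n n f).
Proof. by move=> sf; elim: n => [//|n IH]; rewrite derive1nS; exact: smooth_derive1. Qed.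

Lemma derive1n_ext W (U : set K) (f g : K -> W) n : open U ->
  (forall t, U t -> f t = g t) -> forall t, U t -> derive1n n f t = derive1n n g t.
Proof.
move=> oU fg; elim: n => [//|n IH] t Ut.
by rewrite !derive1nS; exact: derive1_ext Ut IH.
Qed.

Section Comp.
Variables (V : normedModType K) (U : set V) (oU : open U).

Lemma Dn_comp n (U' : set K) (f : V -> K) (g : K -> K) :
  (forall p, U p -> U' (f p)) -> Dn n U f -> Dn n U' g ->
  Dn n U (fun p => g (f p)).
Proof.
move=> UU'; elim: n g => [|n IH] g hf hg.
  split=> // p Up; apply: continuous_comp; first exact: (Dn_cont hf).
  by apply: (Dn_cont hg); exact: UU'.
split.
  move=> p Up; apply: continuous_comp; first exact: (Dn_cont hf).
  by apply: (Dn_cont hg); exact: UU'.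
have [_ [df Df]] := hf; have [_ [dg Dg]] := hg.
have D v p : U p -> is_derive p v (fun q => g (f q)) ('D_v f p * 'D_1 g (f p)).
  move=> Up; apply: is_derive_comp; first exact/derivableP/df.
  exact/derivableP/dg/UU'.
split=> [v p Up|v]; first by have [] := D v p Up.
apply: Dn_ext oU _ (Dn_mul oU (Df v) (IH _ (Dn_pred hf) (Dg 1))).
by move=> p Up /=; have [_ ->] := D v p Up.
Qed.

Lemma smooth_comp (U' : set K) (f : V -> K) (g : K -> K) :
  (forall p, U p -> U' (f p)) -> smooth U f -> smooth U' g ->
  smooth U (fun p => g (f p)).
Proof.
move=> UU' /smoothDn hf /smoothDn hg; apply/smoothDn => n.
exact: Dn_comp UU' (hf n) (hg n).
Qed.

Lemma is_derive_pair W1 W2 (f : V -> W1) (g : V -> W2) p v a b :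
  is_derive p v f a -> is_derive p v g b ->
  is_derive p v (fun q => (f q, g q)) (a, b).
Proof.
move=> [df fE] [dg gE].
have df' : (fun h : K => h^-1 *: ((f \o shift p) (h *: v) - f p)) @ 0^' --> a.
  by rewrite -fE; exact: df.
have dg' : (fun h : K => h^-1 *: ((g \o shift p) (h *: v) - g p)) @ 0^' --> b.
  by rewrite -gE; exact: dg.
have h := cvg_pair df' dg'.
have h2 : (fun h : K => h^-1 *: (((fun q => (f q, g q)) \o shift p) (h *: v) -
    (f p, g p))) @ 0^' --> (a, b) by exact: h.
by split; [apply/cvg_ex; exists (a, b)|exact: cvg_lim].
Qed.

Lemma smooth_pair W1 W2 (f : V -> W1) (g : V -> W2) :
  smooth U f -> smooth U g -> smooth U (fun p => (f p, g p)).
Proof.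
move=> /smoothDn hf /smoothDn hg; apply/smoothDn => n.
elim: n f g {hf hg}(hf n) (hg n) => [|n IH] f g hf hg.
  by split=> // p Up; apply: cvg_pair; [exact: (Dn_cont hf)|exact: (Dn_cont hg)].
split.
  by move=> p Up; apply: cvg_pair; [exact: (Dn_cont hf)|exact: (Dn_cont hg)].
have [_ [df Df]] := hf; have [_ [dg Dg]] := hg.
have D v p : U p -> is_derive p v (fun q => (f q, g q)) ('D_v f p, 'D_v g p).
  by move=> Up; apply: is_derive_pair; apply/derivableP; [exact: df|exact: dg].
split=> [v p Up|v]; first by have [] := D v p Up.
by apply: Dn_ext oU _ (IH _ _ (Df v) (Dg v)) => p Up /=; have [_ ->] := D v p Up.
Qed.

Lemma is_derive_lin W1 W2 (l : {linear W1 -> W2}) (f : V -> W1) p v a :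
  continuous l -> is_derive p v f a -> is_derive p v (fun q => l (f q)) (l a).
Proof.
move=> cl [df fE].
have df' : (fun h : K => h^-1 *: ((f \o shift p) (h *: v) - f p)) @ 0^' --> a.
  by rewrite -fE; exact: df.
have h := cvg_comp _ _ df' (cl a).
have h2 : (fun h : K => h^-1 *: (((fun q => l (f q)) \o shift p) (h *: v) -
    l (f p))) @ 0^' --> l a.
  apply: cvg_trans h; apply: near_eq_cvg; apply: nearW => x /=.
  by rewrite linearZ linearB.
by split; [apply/cvg_ex; exists (l a)|exact: cvg_lim].
Qed.

Lemma smooth_lin W1 W2 (l : {linear W1 -> W2}) (f : V -> W1) :
  continuous l -> smooth U f -> smooth U (fun p => l (f p)).
Proof.
move=> cl /smoothDn hf; apply/smoothDn => n.
elim: n f {hf}(hf n) => [|n IH] f hf.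
  by split=> // p Up; apply: continuous_comp; [exact: (Dn_cont hf)|exact: cl].
split.
  by move=> p Up; apply: continuous_comp; [exact: (Dn_cont hf)|exact: cl].
have [_ [df Df]] := hf.
have D v p : U p -> is_derive p v (fun q => l (f q)) (l ('D_v f p)).
  by move=> Up; apply: is_derive_lin cl _; apply/derivableP; exact: df.
split=> [v p Up|v]; first by have [] := D v p Up.
by apply: Dn_ext oU _ (IH _ (Df v)) => p Up /=; have [_ ->] := D v p Up.
Qed.

End Comp.

Lemma is_derive_fst V W1 W2 (f : V -> W1 * W2) p v a :
  is_derive p v f a -> is_derive p v (fun q => (f q).1) a.1.
Proof. by apply: (@is_derive_lin _ _ _ fst) => q; exact: cvg_fst. Qed.

Lemma is_derive_snd V W1 W2 (f : V -> W1 * W2) p v a :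
  is_derive p v f a -> is_derive p v (fun q => (f q).2) a.2.
Proof. by apply: (@is_derive_lin _ _ _ snd) => q; exact: cvg_snd. Qed.

Lemma smooth_pfst V W1 W2 (U : set V) (f : V -> W1 * W2) :
  open U -> smooth U f -> smooth U (fun q => (f q).1).
Proof. by move=> oU; apply: (@smooth_lin _ _ oU _ _ fst) => q; exact: cvg_fst. Qed.

Lemma smooth_psnd V W1 W2 (U : set V) (f : V -> W1 * W2) :
  open U -> smooth U f -> smooth U (fun q => (f q).2).
Proof. by move=> oU; apply: (@smooth_lin _ _ oU _ _ snd) => q; exact: cvg_snd. Qed.

Lemma is_derive_slice2 V1 V2 W (f : V1 * V2 -> W) (x : V1) (y v : V2) l :
  is_derive (x, y) (0, v) f l <-> is_derive y v (fun y => f (x, y)) l.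
Proof.
split=> /is_derive_line0 h; apply/is_derive_line0.
  have E : (fun s : K => f (x, y + s *: v)) = (fun s : K => f ((x, y) + s *: (0, v))).
    apply/funext => s; congr f; congr (_, _).
    by rewrite /= scaler0 addr0.
  by rewrite E.
have E : (fun s : K => f ((x, y) + s *: (0, v))) = (fun s : K => f (x, y + s *: v)).
  apply/funext => s; congr f; congr (_, _).
  by rewrite /= scaler0 addr0.
by rewrite E.
Qed.

Lemma is_derive_slice1 V1 V2 W (f : V1 * V2 -> W) (x v : V1) (y : V2) l :
  is_derive (x, y) (v, 0) f l <-> is_derive x v (fun x => f (x, y)) l.
Proof.
split=> /is_derive_line0 h; apply/is_derive_line0.
  have E : (fun s : K => f (x + s *: v, y)) = (fun s : K => f ((x, y) + s *: (v, 0))).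
    apply/funext => s; congr f; congr (_, _).
    by rewrite /= scaler0 addr0.
  by rewrite E.
have E : (fun s : K => f ((x, y) + s *: (v, 0))) = (fun s : K => f (x + s *: v, y)).
  apply/funext => s; congr f; congr (_, _).
  by rewrite /= scaler0 addr0.
by rewrite E.
Qed.

Lemma continuous_pairl V1 V2 (x : V1) : continuous (fun y : V2 => (x, y)).
Proof. by move=> y; apply: cvg_pair; [exact: cvg_cst|exact: cvg_id]. Qed.

Lemma continuous_pairr V1 V2 (y : V2) : continuous (fun x : V1 => (x, y)).
Proof. by move=> x; apply: cvg_pair; [exact: cvg_id|exact: cvg_cst]. Qed.

Lemma smooth_slice2 V1 V2 W (A : set (V1 * V2)) (f : V1 * V2 -> W) (x : V1) :
  open A -> smooth A f -> smooth [set y | A (x, y)] (fun y => f (x, y)).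
Proof.
move=> oA /smoothDn hf; apply/smoothDn => n.
have oS : open [set y | A (x, y)].
  by apply: (open_comp (f := fun y => (x, y))) => // y _; exact: continuous_pairl.
elim: n f {hf}(hf n) => [|n IH] f hf.
  split=> // y Ay; apply: (@continuous_comp _ _ _ (fun y => (x, y))).
    exact: continuous_pairl.
  exact: (Dn_cont hf).
split.
  move=> y Ay; apply: (@continuous_comp _ _ _ (fun y => (x, y))).
    exact: continuous_pairl.
  exact: (Dn_cont hf).
have [_ [df Df]] := hf.
have D v y : A (x, y) -> is_derive y v (fun y => f (x, y)) ('D_(0, v) f (x, y)).
  by move=> Ay; apply/is_derive_slice2/derivableP/df.
split=> [v y Ay|v]; first by have [] := D v y Ay.
by apply: (Dn_ext oS _ (IH _ (Df (0, v)))) => y Ay /=; have [_ ->] := D v y Ay.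
Qed.

Lemma smooth_slice1 V1 V2 W (A : set (V1 * V2)) (f : V1 * V2 -> W) (y : V2) :
  open A -> smooth A f -> smooth [set x | A (x, y)] (fun x => f (x, y)).
Proof.
move=> oA /smoothDn hf; apply/smoothDn => n.
have oS : open [set x | A (x, y)].
  by apply: (open_comp (f := fun x => (x, y))) => // x _; exact: continuous_pairr.
elim: n f {hf}(hf n) => [|n IH] f hf.
  split=> // x Ax; apply: (@continuous_comp _ _ _ (fun x => (x, y))).
    exact: continuous_pairr.
  exact: (Dn_cont hf).
split.
  move=> x Ax; apply: (@continuous_comp _ _ _ (fun x => (x, y))).
    exact: continuous_pairr.
  exact: (Dn_cont hf).
have [_ [df Df]] := hf.
have D v x : A (x, y) -> is_derive x v (fun x => f (x, y)) ('D_(v, 0) f (x, y)).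
  by move=> Ax; apply/is_derive_slice1/derivableP/df.
split=> [v x Ax|v]; first by have [] := D v x Ax.
by apply: (Dn_ext oS _ (IH _ (Df (v, 0)))) => x Ax /=; have [_ ->] := D v x Ax.
Qed.

End SmoothComp.

(** * Mean value inequalities, primitives and linear systems *)
Section MVT.
Context {R : realType} {K : numFieldType} {pk : kpkg R K}.
Implicit Types (V W : normedModType K).
Local Notation nm := (@nm R K pk _).

Lemma is_derive_ell (z : K) (F : K -> K) (p w : K) (s : R) l :
  is_derive (p + io pk s * w) 1 F l ->
  is_derive s 1 (fun s : R => ell pk z (F (p + io pk s * w))) (ell pk z (l * w)).
Proof.
move=> hF; have hl : is_derive (p + io pk s *: w) w F (w * l).
  by apply: (is_derive_comp (f := id) (g := F)) => //; exact: is_derive_id.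
have ellB x y : ell pk z (x - y) = ell pk z x - ell pk z y.
  by rewrite ellD -[- y]mulN1r -(rmorph1 (io pk)) -rmorphN ellZ mulN1r.
have elln x : `|ell pk z x| <= nm x.
  rewrite ler_norml ell_le andbT lerNl -mulN1r -ellZ rmorphN rmorph1 mulN1r.
  by apply: le_trans (ell_le _ _ _) _; rewrite -/(nm _) nmN.
apply/(derivP (pk := kpkg_real R)) => e e0.
have [d d0 hd] := (derivP _ _ _ _).1 hl e e0; exists d => // h h0 hhd.
rewrite !nm_real in hhd *.
have := hd (io pk h); rewrite nm_io -(rmorph0 (io pk)) (inj_eq io_inj) => /(_ h0 hhd).
apply: le_trans; apply: le_trans (elln _).
have -> : p + io pk (s + h *: 1) * w = p + io pk s *: w + io pk h *: w.
  by rewrite /GRing.scale /= mulr1 rmorphD mulrDl addrA.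
have -> : io pk h *: (w * l) = io pk h * (l * w) by rewrite [w * l]mulrC.
by rewrite !ellB ellZ.
Qed.

(** For [z = F (p + w) - F p] the functional [ell z] attains the norm of the increment. Thus
    [s |-> g s - ell z (F (p + s w))] is a real function with nonnegative derivative, and comparing
    its values at 0 and 1 gives the bound. *)
Lemma MVTc (F : K -> K) (p w : K) (g dg : R -> R) :
  (forall s : R, 0 <= s <= 1 -> derivable F (p + io pk s * w) 1) ->
  (forall s : R, is_derive s 1 g (dg s)) ->
  (forall s : R, 0 <= s <= 1 -> nm (derive1 F (p + io pk s * w) * w) <= dg s) ->
  nm (F (p + w) - F p) <= g 1 - g 0.
Proof.
move=> dF dg' hg; set z := F (p + w) - F p.
pose h (s : R) := g s - ell pk z (F (p + io pk s * w)).
have dh (s : R) : 0 <= s <= 1 ->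
    is_derive s 1 h (dg s - ell pk z (derive1 F (p + io pk s * w) * w)).
  move=> hs; apply: is_deriveB; apply: is_derive_ell.
  exact: derivable1P (dF s hs).
have hle : h 0 <= h 1.
  apply: (@ger0_derive1_le_cc R h 0 1) => //; rewrite ?in_itv /= ?lexx ?ler01 //.
  - move=> x; rewrite in_itv /= => /andP[x0 x1].
    by have [] := dh x _; rewrite ?(ltW x0) ?(ltW x1).
  - move=> x; rewrite in_itv /= => /andP[x0 x1].
    have xx : 0 <= x <= 1 by rewrite (ltW x0) (ltW x1).
    rewrite (derive1_val (dh x xx)) subr_ge0.
    by apply: le_trans (hg x xx); exact: ell_le.
  - apply: derivable_within_continuous => x; rewrite in_itv /= => xx.
    by have [] := dh x xx.
have ellB x y : ell pk z (x - y) = ell pk z x - ell pk z y.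
  by rewrite ellD -[- y]mulN1r -(rmorph1 (io pk)) -rmorphN ellZ mulN1r.
have -> : nm z = ell pk z z by rewrite ell_self.
rewrite {2}/z ellB; move: hle; rewrite /h rmorph0 rmorph1 mul0r mul1r addr0.
by lra.
Qed.

(** Integrating the bound [s ^+ k] yields the denominator [k + 1]; iterated, these produce the
    factorials in the estimate of Picard iterates. *)
Lemma MVTpow (F : K -> K) (p w : K) (M : R) k :
  (forall s : R, 0 <= s <= 1 -> derivable F (p + io pk s * w) 1) ->
  (forall s : R, 0 <= s <= 1 -> nm (derive1 F (p + io pk s * w)) <= M * s ^+ k) ->
  nm (F (p + w) - F p) <= M * nm w / k.+1%:R.
Proof.
move=> dF hF; have k0 : (k.+1%:R : R) != 0 by rewrite pnatr_eq0.
pose g (s : R) := M * nm w / k.+1%:R * s ^+ k.+1.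
have -> : M * nm w / k.+1%:R = g 1 - g 0.
  by rewrite /g expr1n expr0n /= mulr0 subr0 mulr1.
have dg (s : R) : is_derive s 1 g (M * nm w * s ^+ k).
  have -> : g = (M * nm w / k.+1%:R) *: (id ^+ k.+1 : R -> R).
    by apply/funext => x; rewrite /g fctE ; congr (_ * _); elim: k.+1 => [//|m IH]; rewrite !exprS IH.
  have [d dE] := is_deriveZ (M * nm w / k.+1%:R) (is_deriveX k.+1 (is_derive_id s (1 : R))).
  by split=> //; rewrite dE /GRing.scale /=; field.
apply: (MVTc dF dg) => s hs.
by rewrite nmM mulrAC ler_wpM2r ?nmK_ge0 ?hF.
Qed.

Lemma MVT0 (F : K -> K) (p q : K) (M : R) :
  (forall s : R, 0 <= s <= 1 -> derivable F (p + io pk s * (q - p)) 1) ->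
  (forall s : R, 0 <= s <= 1 -> nm (derive1 F (p + io pk s * (q - p))) <= M) ->
  nm (F q - F p) <= M * nm (q - p).
Proof.
move=> dF hF; have := @MVTpow F p (q - p) M 0 dF.
rewrite (addrC p) subrK divr1; apply => s hs; rewrite expr0 mulr1; exact: hF.
Qed.

Lemma MVTlin (F : K -> K) (p q c : K) (M : R) :
  (forall s : R, 0 <= s <= 1 -> derivable F (p + io pk s * (q - p)) 1) ->
  (forall s : R, 0 <= s <= 1 -> nm (derive1 F (p + io pk s * (q - p)) - c) <= M) ->
  nm (F q - F p - c * (q - p)) <= M * nm (q - p).
Proof.
move=> dF hF; have D t : derivable F t 1 ->
    is_derive t 1 (fun t => F t - c * t) (derive1 F t - c).
  move=> /derivable1P h.
  have H := is_deriveB h (is_deriveZ c (is_derive_id t (1 : K))).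
  by move: H; rewrite /GRing.scale /= mulr1.
have := @MVT0 (fun t => F t - c * t) p q M.
have -> : F q - c * q - (F p - c * p) = F q - F p - c * (q - p) by ring.
apply=> s hs; first by have [] := D _ (dF s hs).
by rewrite (derive1_val (D _ (dF s hs))) hF.
Qed.

Lemma domain_seg (D : set K) (p q : K) (s : R) : domain D -> D p -> D q ->
  0 <= s <= 1 -> D (p + io pk s * (q - p)).
Proof.
move=> [_ _ cD] Dp Dq /andP[s0 s1].
have i0 : 0 <= io pk (1 - s) by rewrite -(rmorph0 (io pk)) io_le subr_ge0.
have i1 : io pk (1 - s) <= 1 by rewrite -(rmorph1 (io pk)) io_le lerBlDr lerDl.
pose l : {i01 K} := Itv01 i0 i1.
have := cD p q l; rewrite !inE => /(_ Dp Dq).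
rewrite /conv /= /unstable.onem rmorphB rmorph1 /GRing.scale /=.
by congr D; ring.
Qed.

Lemma domain_ball (p : K) (d : R) : 0 < d -> domain [set q | nm (q - p) < d].
Proof.
move=> d0; split.
- by exists p; rewrite /= subrr nm0.
- apply/openPK => q /= hq; exists (d - nm (q - p)); first by rewrite subr_gt0.
  by move=> x hx /=; have := triK pk x q p; move: hx; lra.
- move=> x y l; rewrite !inE /conv /= /unstable.onem /GRing.scale /= => xp yp.
  have l0 : 0 <= l%:num :> K by [].
  have l1 : l%:num <= 1 :> K by [].
  set a : K := l%:num in l0 l1 *; set b := 1 - a.
  have b0 : 0 <= b by rewrite subr_ge0.
  have ab : nm a + nm b = 1.
    by apply: (io_inj (pk := pk)); rewrite rmorphD !io_nm !ger0_norm // rmorph1 /b addrC subrK.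
  have -> : a * x + b * y - p = a * (x - p) + b * (y - p) by rewrite /b; ring.
  apply: le_lt_trans (nmDK _ _ _) _; rewrite !nmM.
  have na0 : 0 <= nm a := nmK_ge0 _ _; have nb0 : 0 <= nm b := nmK_ge0 _ _.
  have : nm a * nm (x - p) <= nm a * d by rewrite ler_wpM2l // ltW.
  have : nm b * nm (y - p) <= nm b * d by rewrite ler_wpM2l // ltW.
  have [b00|] := eqVneq (nm b) 0.
    have a1 : nm a = 1 by lra.
    by rewrite b00 a1; lra.
  move=> bn; have : nm b * nm (y - p) < nm b * d by rewrite ltr_pM2l // lt_def bn.
  have -> : nm a = 1 - nm b by lra.
  by lra.
Qed.

Lemma domain_setT : domain [set: K].
Proof. by split; [exists 0|exact: openT|move=> x y l; rewrite !inE]. Qed.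

Lemma domainI (A B : set K) (p : K) : domain A -> domain B -> A p -> B p ->
  domain (A `&` B).
Proof.
move=> [_ oA cA] [_ oB cB] Ap Bp; split; [by exists p|exact: openI|].
move=> x y l; rewrite !inE => -[Ax Bx] [Ay By].
have := cA x y l; have := cB x y l; rewrite !inE.
by move=> /(_ Bx By) ? /(_ Ax Ay) ?; split.
Qed.

(** Compactness of [[0, 1]]: finitely many of the local neighbourhoods cover the segment from [t0]
    to [t1] and all nearby segments, and monotonicity in [n] merges their indices. *)
Lemma seg_near (D : set K) (t0 t1 : K) (P : nat -> K -> Prop) :
  domain D -> D t0 -> D t1 -> (forall n m t, (n <= m)%N -> P n t -> P m t) ->
  (forall t, D t -> exists n, exists2 d : R, 0 < d & forall t', nm (t' - t) < d -> P n t') ->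
  exists n, exists2 d : R, 0 < d & forall t', nm (t' - t1) < d ->
    forall s : R, 0 <= s <= 1 -> P n (t0 + io pk s * (t' - t0)).
Proof.
move=> dD D0 D1 Pm Ploc.
have /compact_near_coveringP cpt : compact `[(0 : R), 1]%classic.
  exact: segment_compact.
pose Q (n : nat) (s : R) := forall t', nm (t' - t1) < n.+1%:R^-1 ->
  P n (t0 + io pk s * (t' - t0)).
have [|N _ hN] := cpt nat \oo Q _ _.
  move=> s; rewrite /= in_itv /= => hs.
  have [n [d d0 h]] := Ploc _ (domain_seg dD D0 D1 hs).
  (* Moving [t'] shifts the point by less than [d / 4]; moving [s], with [nm (t' - t0) <= 2 c],
     shifts it by at most [d / 2]. *)
  pose c := nm (t1 - t0) + 1; have c0 : 0 < c by have := nmK_ge0 pk (t1 - t0); rewrite /c; lra.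
  have d20 : 0 < d / 2 by rewrite divr_gt0.
  have [m hm] : exists m : nat, m.+1%:R^-1 < Num.min (d / 4) 1.
    have e0 : 0 < Num.min (d / 4) 1 by rewrite lt_min ltr01 divr_gt0.
    exists (Num.truncn (Num.min (d / 4) 1)^-1).
    rewrite invf_plt ?posrE //; exact: truncnS_gt.
  move: hm; rewrite lt_min => /andP[hm1 hm2].
  exists ([set s' : R | `|s' - s| < Num.min (d / (4 * c)) 1 ], [set k | (maxn n m <= k)%N]).
    split=> /=; last by exists (maxn n m).
    apply/nbhs_normP; exists (Num.min (d / (4 * c)) 1).
      by rewrite /= lt_min ltr01 divr_gt0 // mulr_gt0.
    by move=> x /=; rewrite distrC.
  move=> [s' k] [/= hs' hk] t' ht'.
  apply: (Pm n); first by apply: leq_trans hk; rewrite leq_maxl.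
  have k1 : k.+1%:R^-1 <= m.+1%:R^-1 :> R.
    by rewrite lef_pV2 ?posrE // ler_nat ltnS; apply: leq_trans hk; rewrite leq_maxr.
  apply: h.
  have -> : t0 + io pk s' * (t' - t0) - (t0 + io pk s * (t1 - t0)) =
      io pk s * (t' - t1) + io pk (s' - s) * (t' - t0) by rewrite rmorphB; ring.
  apply: le_lt_trans (nmDK _ _ _) _; rewrite !nmM !nm_io.
  have A1 : `|s| * nm (t' - t1) <= nm (t' - t1).
    move: hs => /andP[s0 s1]; rewrite ger0_norm // ler_piMl ?nmK_ge0 //.
  have B1 : nm (t' - t1) < 1 by exact: lt_trans (lt_le_trans ht' k1) hm2.
  have B2 : nm (t' - t1) < d / 4 by exact: lt_trans (lt_le_trans ht' k1) hm1.
  have A2 : nm (t' - t0) <= c + c.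
    apply: le_trans (triK _ _ t1 _) _; rewrite /c.
    by have := nmK_ge0 pk (t1 - t0); move: B1; lra.
  move: hs'; rewrite lt_min => /andP[hs' _].
  have A3 : `|s' - s| * nm (t' - t0) <= d / (4 * c) * (c + c).
    by rewrite ler_pM ?normr_ge0 ?nmK_ge0 // ltW.
  have A4 : d / (4 * c) * (c + c) = d / 2 by field; rewrite gt_eqF.
  by move: A1 A3 B2; rewrite A4; lra.
exists N; exists N.+1%:R^-1; first by rewrite invr_gt0 ltr0n.
by move=> t' ht' s hs; apply: (hN N (leqnn N) s).
Qed.

End MVT.

(** * Differentiation rules in one variable *)

Section Calculus.
Context {K : numFieldType}.
Implicit Types (f g : K -> K) (t a b c : K).

Lemma dval (V W : normedModType K) (f : V -> W) p v (a b : W) :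
  is_derive p v f a -> a = b -> is_derive p v f b.
Proof. by move=> h <-. Qed.

Lemma dfun (V W : normedModType K) (f g : V -> W) p v (a : W) :
  is_derive p v f a -> f =1 g -> is_derive p v g a.
Proof. by move=> h /funext <-. Qed.

Lemma dC c t : is_derive t 1 (fun=> c) 0.
Proof. exact: is_derive_cst. Qed.

Lemma dI t : is_derive t 1 (fun x : K => x) 1.
Proof. exact: is_derive_id. Qed.

Lemma dD f g t a b : is_derive t 1 f a -> is_derive t 1 g b ->
  is_derive t 1 (fun x => f x + g x) (a + b).
Proof. by move=> ha hb; exact: is_deriveD. Qed.

Lemma dB f g t a b : is_derive t 1 f a -> is_derive t 1 g b ->
  is_derive t 1 (fun x => f x - g x) (a - b).
Proof. by move=> ha hb; exact: is_deriveB. Qed.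

Lemma dN f t a : is_derive t 1 f a -> is_derive t 1 (fun x => - f x) (- a).
Proof. by move=> ha; exact: is_deriveN. Qed.

Lemma dM f g t a b : is_derive t 1 f a -> is_derive t 1 g b ->
  is_derive t 1 (fun x => f x * g x) (a * g t + f t * b).
Proof.
move=> ha hb; apply: dval (is_deriveM ha hb) _.
by rewrite /GRing.scale /= addrC [g t * a]mulrC.
Qed.

Lemma dZ c f t a : is_derive t 1 f a -> is_derive t 1 (fun x => c * f x) (c * a).
Proof. by move=> ha; apply: dval (dM (dC c t) ha) _; rewrite mul0r add0r. Qed.

Lemma dX f n t a : is_derive t 1 f a ->
  is_derive t 1 (fun x => f x ^+ n) (n%:R * f t ^+ n.-1 * a).
Proof.
move=> ha; elim: n => [|n IH].
  by apply: dval (dC 1 t) _; rewrite !mul0r.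
apply: dval (dfun (dM ha IH) _) _; first by move=> x; rewrite exprS.
case: n {IH} => [|n]; first by rewrite !mul0r mulr0 addr0 expr0 !mul1r mulr1.
by rewrite /= -natr1 exprS; ring.
Qed.

Lemma dV f t a : f t != 0 -> is_derive t 1 f a ->
  is_derive t 1 (fun x => (f x)^-1) (- a / f t ^+ 2).
Proof.
move=> f0 [df <-]; split; first exact: derivableV.
by rewrite deriveV // /GRing.scale /= mulNr mulrC mulNr.
Qed.

Lemma dcomp f g t a b : is_derive t 1 f a -> is_derive (f t) 1 g b ->
  is_derive t 1 (fun x => g (f x)) (a * b).
Proof. exact: is_derive_comp. Qed.

Lemma dsum n (f : 'I_n -> K -> K) t (a : 'I_n -> K) :
  (forall i, is_derive t 1 (f i) (a i)) ->
  is_derive t 1 (fun x => \sum_(i < n) f i x) (\sum_(i < n) a i).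
Proof.
elim: n f a => [|n IH] f a h.
  apply: dval (dfun (dC 0 t) _) _; last by rewrite big_ord0.
  by move=> x; rewrite big_ord0.
have H := dD (IH (fun i => f (widen_ord (leqnSn n) i)) _ (fun i => h _)) (h ord_max).
apply: dval (dfun H _) _; last by rewrite big_ord_recr.
by move=> x; rewrite big_ord_recr.
Qed.

End Calculus.

(** * Limits of derivatives and primitives *)

Section ODE.
Context {R : realType} {K : numFieldType} {pk : kpkg R K}.
Local Notation nm := (@nm R K pk _).
Local Notation io := (io pk).

Lemma nm_small (x : K) : (forall e : R, 0 < e -> nm x <= e) -> x = 0.
Proof.
move=> h; apply/eqP; rewrite -(nm_eq0 (pk := pk)) eq_le nm_ge0 andbT.
by apply/ler_addgt0Pr => e e0; rewrite add0r h.
Qed.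

Lemma seg1 (p q : K) : p + io 1 * (q - p) = q.
Proof. by rewrite rmorph1; ring. Qed.

(** All [u n] vanish at [t0], so the mean value inequality on segments from [t0] turns convergence
    of the derivatives into convergence of the functions. Uniformity near [t1] then lets the
    increments of a single [u n0] approximate those of the limit. *)
Lemma limit_derive (D : set K) (t0 : K) (u : nat -> K -> K) (g : K -> K) :
  domain D -> D t0 -> (forall n t, D t -> derivable (u n) t 1) ->
  (forall n, u n t0 = 0) ->
  (forall t1, D t1 -> exists2 d : R, 0 < d & forall e : R, 0 < e ->
    exists n0, forall n, (n0 <= n)%N -> forall t', nm (t' - t1) < d ->
    forall s : R, 0 <= s <= 1 ->
      nm (derive1 (u n) (t0 + io s * (t' - t0)) - g (t0 + io s * (t' - t0))) <= e) ->
  exists2 F : K -> K, F t0 = 0 & forall t, D t -> is_derive t 1 F (g t) /\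
    forall e : R, 0 < e -> exists n0, forall n, (n0 <= n)%N -> nm (u n t - F t) <= e.
Proof.
move=> domD D0 du u0 hu.
have dub m n t : D t -> is_derive t 1 (fun t => u m t - u n t) (derive1 (u m) t - derive1 (u n) t).
  by move=> Dt; apply: dB; apply: derivable1P; exact: du.
have C t1 : D t1 -> forall e : R, 0 < e -> exists n0, forall m n, (n0 <= m)%N ->
    (n0 <= n)%N -> nm (u m t1 - u n t1) < e.
  move=> D1 e e0; have [d d0 hd] := hu _ D1; set c := nm (t1 - t0) + 1.
  have c0 : 0 < c by have := nmK_ge0 pk (t1 - t0); rewrite /c; lra.
  have [n0 h] := hd (e / (4 * c)) (divr_gt0 e0 (mulr_gt0 (ltr0n _ 4) c0)).
  exists n0 => m n hm hn.
  have t11 : nm (t1 - t1) < d by rewrite subrr nm0.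
  have := @MVT0 R K pk (fun t => u m t - u n t) t0 t1 (e / (2 * c)).
  rewrite !u0 subrr subr0 => H; apply: le_lt_trans (H _ _) _.
  - by move=> s hs; have [] := dub m n _ (domain_seg domD D0 D1 hs).
  - move=> s hs; rewrite (derive1_val (dub m n _ (domain_seg domD D0 D1 hs))).
    have h1 := h m hm t1 t11 s hs; have h2 := h n hn t1 t11 s hs.
    apply: le_trans (triK pk _ (g (t0 + io s * (t1 - t0))) _) _.
    rewrite [nm (g _ - _)]nmCK; apply: le_trans (lerD h1 h2) _.
    by rewrite le_eqVlt; apply/orP; left; apply/eqP; field; rewrite gt_eqF.
  - have : nm (t1 - t0) < c by rewrite /c; lra.
    move=> hc; apply: le_lt_trans (_ : _ <= e / (2 * c) * c) _.
      apply: ler_wpM2l (ltW hc); apply: divr_ge0; first exact: ltW.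
      by apply: mulr_ge0 => //; exact: ltW.
    have -> : e / (2 * c) * c = e / 2 by field; rewrite gt_eqF.
    by lra.
have /choice [F hF] : forall t, exists l, D t -> forall e : R, 0 < e ->
    exists n0, forall n, (n0 <= n)%N -> nm (u n t - l) < e.
  move=> t; have [Dt|nDt] := pselect (D t); last by exists 0.
  by have [l hl] := kcomplete (C t Dt); exists l.
exists F.
  apply: nm_small => e e0; have [n0 h] := hF _ D0 e e0.
  by have := h n0 (leqnn _); rewrite u0 sub0r nmN => /ltW.
move=> t1 D1; split; last first.
  by move=> e e0; have [n0 h] := hF _ D1 e e0; exists n0 => n hn; rewrite ltW ?h.
have [d d0 hd] := hu _ D1.
have [_ /openPK oD _] := domD; have [d' d'0 hd'] := oD _ D1.
apply/(derivPK (pk := pk)) => e e0; have e40 : 0 < e / 4 by rewrite divr_gt0.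
have [n0 hn0] := hd _ e40.
have [d2 d20 hd2] := (derivPK (pk := pk) _ _ _).1 (derivable1P (du n0 t1 D1)) _ e40.
exists (Num.min d (Num.min d' d2)); first by rewrite !lt_min d0 d'0 d20.
move=> t; rewrite !lt_min => /and3P[td td' td2].
have Dt := hd' _ td'.
have A n : (n0 <= n)%N -> nm (derive1 (u n) t1 - g t1) <= e / 4.
  move=> hn; have := hn0 n hn t1; rewrite subrr nm0 => /(_ d0 1).
  by rewrite seg1 ler01 lexx; apply.
have B m : (n0 <= m)%N -> nm ((u n0 t - u m t) - (u n0 t1 - u m t1)) <=
    e / 2 * nm (t - t1).
  move=> hm; apply: (@MVT0 R K pk (fun t => u n0 t - u m t)).
    by move=> s hs; have [] := dub n0 m _ (domain_seg domD D1 Dt hs).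
  move=> s hs; rewrite (derive1_val (dub n0 m _ (domain_seg domD D1 Dt hs))).
  set q := t1 + _; have hq : nm (q - t1) < d.
    rewrite /q addrC addKr nmM nm_io; move: hs => /andP[s0 s1].
    by rewrite ger0_norm //; apply: le_lt_trans td; rewrite ler_piMl ?nm_ge0.
  have h01 : 0 <= (1 : R) <= 1 by rewrite ler01 lexx.
  have := hn0 n0 (leqnn _) q hq 1 h01; have := hn0 m hm q hq 1 h01.
  rewrite seg1 => h1 h2; apply: le_trans (triK pk _ (g q) _) _.
  by rewrite [nm (g q - _)]nmCK; move: h1 h2; lra.
have B' : nm ((u n0 t - F t) - (u n0 t1 - F t1)) <= e / 2 * nm (t - t1).
  apply/ler_addgt0Pr => x x0; have x20 : 0 < x / 2 by rewrite divr_gt0.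
  have [na ha] := hF _ Dt _ x20; have [nb hb] := hF _ D1 _ x20.
  pose m := maxn n0 (maxn na nb).
  have hm : (n0 <= m)%N by rewrite leq_maxl.
  have := B m hm.
  have := ha m; rewrite /m !leq_max leqnn orbT => /(_ isT) h1.
  have := hb m; rewrite /m !leq_max leqnn !orbT => /(_ isT) h2.
  rewrite -/m in h1 h2 *.
  have -> : u n0 t - F t - (u n0 t1 - F t1) = (u n0 t - u m t - (u n0 t1 - u m t1)) +
    ((u m t - F t) - (u m t1 - F t1)) by ring.
  move=> h3; apply: le_trans (nmDK pk _ _) _.
  have := nmBK pk (u m t - F t) (u m t1 - F t1).
  by move: h1 h2 h3; lra.
have C' := hd2 _ td2.
have -> : F t - F t1 - g t1 * (t - t1) = (u n0 t - u n0 t1 - derive1 (u n0) t1 * (t - t1))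
  - ((u n0 t - F t) - (u n0 t1 - F t1)) + (derive1 (u n0) t1 - g t1) * (t - t1) by ring.
apply: le_trans (nmDK pk _ _) _; apply: le_trans (lerD (nmBK pk _ _) (lexx _)) _.
rewrite nmM; have := ler_wpM2r (nmK_ge0 pk (t - t1)) (A n0 (leqnn _)).
by move: B' C'; lra.
Qed.

Lemma cont_bound (f : K -> K) t : {for t, continuous f} ->
  exists n : nat, exists2 d : R, 0 < d & forall t', nm (t' - t) < d -> nm (f t') <= n%:R.
Proof.
move=> /(contPK (pk := pk)) /(_ 1 ltr01) [d d0 h].
exists (Num.truncn (nm (f t) + 1)).+1, d => // t' /h h'.
have := nmBrK pk (f t') (f t); have := truncnS_gt (nm (f t) + 1).
by move: h'; lra.
Qed.

Lemma seg_bound I (r : seq I) (f : I -> K -> K) (D : set K) (t0 t1 : K) :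
  domain D -> D t0 -> D t1 -> (forall i t, D t -> {for t, continuous (f i)}) ->
  exists n : nat, exists2 d : R, 0 < d & forall t', nm (t' - t1) < d ->
    forall s : R, 0 <= s <= 1 -> D (t0 + io s * (t' - t0)) /\
      forall i, List.In i r -> nm (f i (t0 + io s * (t' - t0))) <= n%:R.
Proof.
move=> domD D0 D1 cf.
apply: (@seg_near R K pk D t0 t1 (fun n t => D t /\
   forall i, List.In i r -> nm (f i t) <= n%:R)) => //.
  move=> n m t nm [Dt h]; split=> // i /h hi; apply: le_trans hi _.
  by rewrite ler_nat.
move=> t Dt; have [_ /openPK oD _] := domD; have [d d0 hd] := oD _ Dt.
have [n [d' d'0 hd']] : exists n : nat, exists2 d : R, 0 < d & forall t', nm (t' - t) < d ->
    forall i, List.In i r -> nm (f i t') <= n%:R.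
  elim: r => [|i r [n [e e0 he]]]; first by exists 0%N, 1.
  have [n' [e' e'0 he']] := cont_bound (cf i t Dt).
  exists (maxn n n'), (Num.min e e'); first by rewrite lt_min e0 e'0.
  move=> t'; rewrite lt_min => /andP[te te'] j [<-|jr].
    by apply: le_trans (he' _ te') _; rewrite ler_nat leq_maxr.
  by apply: le_trans (he _ te _ jr) _; rewrite ler_nat leq_maxl.
exists n, (Num.min d d'); first by rewrite lt_min d0.
by move=> t'; rewrite lt_min => /andP[/hd ? /hd' ?].
Qed.

Lemma seg_seg (t0 w : K) (a b s : R) :
  (t0 + io a * w) + io s * ((t0 + io b * w) - (t0 + io a * w)) =
  t0 + io (a + s * (b - a)) * w.
Proof. by rewrite rmorphD rmorphM rmorphB; ring. Qed.

Lemma seg01 (a b s : R) : 0 <= a <= 1 -> 0 <= b <= 1 -> 0 <= s <= 1 ->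
  0 <= a + s * (b - a) <= 1.
Proof.
move=> /andP[a0 a1] /andP[b0 b1] /andP[s0 s1].
have -> : a + s * (b - a) = (1 - s) * a + s * b by ring.
rewrite addr_ge0 ?mulr_ge0 ?subr_ge0 //=.
have : (1 - s) * a <= (1 - s) * 1 by rewrite ler_wpM2l ?subr_ge0.
have : s * b <= s * 1 by rewrite ler_wpM2l.
by lra.
Qed.

(** The Riemann sums along the segment from [t0] to [t] are themselves differentiable in [t]. With
    division points [t_k] and weights [c_k = k / (N + 1)], the value [f t] telescopes into the terms
    [c_(k+1) f t_(k+1) - c_k f t_k], each within [O (N ^ -2)] of the corresponding term of the
    derivative of the sum. The argument serves both fields alike. *)
Lemma primitive (D : set K) (t0 : K) (f : K -> K) :
  domain D -> D t0 -> smooth D f ->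
  exists2 F : K -> K, F t0 = 0 & forall t, D t -> is_derive t 1 F (f t).
Proof.
move=> domD D0 sf; have [_ oD _] := domD.
pose c (N k : nat) : R := k%:R / N.+1%:R.
have N0 N : (N.+1%:R : R) != 0 by rewrite pnatr_eq0.
have N0' N : (N.+1%:R : K) != 0 by rewrite pnatr_eq0.
have c01 N k : (k <= N.+1)%N -> 0 <= c N k <= 1.
  by move=> kN; rewrite divr_ge0 //= ler_pdivrMr ?ltr0n // mul1r ler_nat.
pose u (N : nat) (t : K) := \sum_(k < N.+1) f (t0 + io (c N k) * (t - t0)) * ((t - t0) / N.+1%:R).
pose du (N : nat) (t : K) := \sum_(k < N.+1)
  (io (c N k) * derive1 f (t0 + io (c N k) * (t - t0)) * ((t - t0) / N.+1%:R) +
   f (t0 + io (c N k) * (t - t0)) / N.+1%:R).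
have Du N t : D t -> is_derive t 1 (u N) (du N t).
  move=> Dt; apply: dsum => k.
  have d1 : is_derive t 1 (fun t : K => t - t0) 1.
    by apply: dval (dB (dI t) (dC t0 t)) _; rewrite subr0.
  apply: dM; last by apply: dval (dM d1 (dC (N.+1%:R^-1) t)) _; rewrite mulr0 addr0 mul1r.
  apply: (dcomp (f := fun t => t0 + io (c N k) * (t - t0))).
    by apply: dval (dD (dC t0 t) (dZ (io (c N k)) d1)) _; rewrite add0r mulr1.
  apply: smooth_is_derive1 sf _; apply: domain_seg domD D0 Dt _.
  exact/c01/ltnW/ltn_ord.
have [//|||F F0 hF] := @limit_derive D t0 u f domD D0.
- by move=> N t Dt; have [] := Du N t Dt.
- by move=> N; rewrite /u big1 // => k _; rewrite subrr mul0r mulr0.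
- move=> t1 D1.
  pose fs (i : bool) := if i then derive1 f else derive1 (derive1 f).
  have [|M [d d0 hM]] := @seg_bound bool [:: true; false] fs D t0 t1 domD D0 D1.
    by move=> [] t Dt; apply: smooth_cont Dt; do ?apply: smooth_derive1.
  exists d => // e e0; set r := nm (t1 - t0) + d.
  have r0 : 0 < r by have := nmK_ge0 pk (t1 - t0); rewrite /r; lra.
  (* [M] bounds [f'] and [f''], and [r] bounds the distance to [t0]. The summand [r] comes from the
     first-order differences of [f], the summand [r ^+ 2] from the second-order ones. *)
  pose Q := M%:R * (r + r ^+ 2) : R.
  have Q0 : 0 <= Q.
    apply: mulr_ge0; [exact: ler0n|apply: addr_ge0; first exact: ltW].
    by apply: exprn_ge0; exact: ltW.
  exists (Num.truncn (Q / e)) => N hN t' ht' s hs.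
  have QN : Q / N.+1%:R <= e.
    rewrite ler_pdivrMr ?ltr0n // mulrC -ler_pdivrMr //; apply: ltW.
    by apply: lt_le_trans (truncnS_gt _) _; rewrite ler_nat.
  apply: le_trans QN.
  set pt := t0 + _; have Dpt : D pt by have [] := hM t' ht' s hs.
  rewrite (derive1_val (Du N pt Dpt)).
  set w := pt - t0; have wE : w = io s * (t' - t0) by rewrite /w /pt; ring.
  have wr : nm w <= r.
    rewrite wE nmM nm_io; move: hs => /andP[s0 s1]; rewrite ger0_norm //.
    have := triK pk t' t1 t0; have : s * nm (t' - t0) <= nm (t' - t0).
      by rewrite ler_piMl ?nm_ge0.
    by rewrite /r; move: ht'; lra.
  have G (a : R) : 0 <= a <= 1 -> [/\ D (t0 + io a * w),
      nm (derive1 f (t0 + io a * w)) <= M%:R &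
      nm (derive1 (derive1 f) (t0 + io a * w)) <= M%:R].
    move=> /andP[a0 a1]; rewrite wE mulrA -rmorphM.
    have as1 : 0 <= a * s <= 1.
      by move: hs => /andP[s0 s1]; rewrite mulr_ge0 //= mulr_ile1.
    have [Da h] := hM t' ht' _ as1; split=> //.
      by apply: (h true); left.
    by apply: (h false); right; left.
  pose tk k := t0 + io (c N k) * w.
  pose h := w / N.+1%:R.
  have hr : nm h <= r / N.+1%:R.
    by rewrite /h nmM nmV nm_nat ler_wpM2r // invr_ge0.
  have tS k : tk k.+1 - tk k = h.
    rewrite /tk /c -natr1 !rmorphM rmorphD rmorph1 fmorphV !rmorph_nat.
    by rewrite /h; field.
  have Gk k a : (k <= N)%N -> 0 <= a <= 1 ->
      [/\ D (tk k + io a * (tk k.+1 - tk k)),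
      nm (derive1 f (tk k + io a * (tk k.+1 - tk k))) <= M%:R &
      nm (derive1 (derive1 f) (tk k + io a * (tk k.+1 - tk k))) <= M%:R].
    by move=> kN ha; rewrite seg_seg; apply/G/seg01 => //; apply: c01 => //; rewrite ltnW.
  have E1 k : (k <= N)%N -> nm (f (tk k.+1) - f (tk k)) <= M%:R * nm h.
    move=> kN; rewrite -(tS k); apply: MVT0 => a /(Gk k a kN) [Da ? ?] //.
    exact: smooth_derivable sf Da.
  have E2 k : (k <= N)%N -> nm (f (tk k.+1) - f (tk k) - derive1 f (tk k) * h) <=
      M%:R * nm h * nm h.
    move=> kN; rewrite -{1 3}(tS k); apply: MVTlin => a ha.
      by have [Da _ _] := Gk k a kN ha; exact: smooth_derivable sf Da.
    set q := tk k + _.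
    have : nm (q - tk k) <= nm h.
      rewrite /q addrC addKr tS nmM nm_io; move: ha => /andP[a0 a1].
      by rewrite ger0_norm // ler_piMl ?nm_ge0.
    move=> /(ler_wpM2l (ler0n R M)); apply: le_trans.
    have -> : q = t0 + io (c N k + a * (c N k.+1 - c N k)) * w by rewrite /q /tk seg_seg.
    have ck : 0 <= c N k <= 1 by apply: c01; exact: ltnW.
    have cS : 0 <= c N k.+1 <= 1 by apply: c01.
    apply: MVT0 => b hb; have [Db _ h2] := G _ (seg01 ck (seg01 ck cS ha) hb);
      rewrite /tk seg_seg //.
    by apply: smooth_derivable Db; exact: smooth_derive1.
  have fpt : f pt = \sum_(k < N.+1) (io (c N k.+1) * f (tk k.+1) - io (c N k) * f (tk k)).
    rewrite -(big_mkord xpredT (fun k => io (c N k.+1) * f (tk k.+1) - io (c N k) * f (tk k))).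
    rewrite (telescope_sumr (fun k => io (c N k) * f (tk k))) // /c mul0r rmorph0 mul0r subr0 divff // rmorph1 mul1r.
    by congr f; rewrite /tk /c divff // rmorph1 mul1r /w addrC subrK.
  rewrite fpt /du -sumrB -/w.
  apply: le_trans (nm_sumK _ _ _) _.
  apply: le_trans (_ : \sum_(k < N.+1) (Q / N.+1%:R ^+ 2) <= _); last first.
    by rewrite sumr_const card_ord -mulr_natr le_eqVlt; apply/orP; left; apply/eqP; field.
  apply: ler_sum => k _; have kN : (k <= N)%N by rewrite -ltnS ltn_ord.
  rewrite -/(tk k) -/h.
  have cS : io (c N k.+1) = io (c N k) + N.+1%:R^-1.
    by rewrite /c -natr1 mulrDl rmorphD mul1r fmorphV rmorph_nat.
  rewrite cS; set x := f (tk k.+1); set y := f (tk k); set z := derive1 f (tk k).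
  have -> : io (c N k) * z * h + y / N.+1%:R - ((io (c N k) + N.+1%:R^-1) * x - io (c N k) * y) =
    - (N.+1%:R^-1 * (x - y)) - io (c N k) * (x - y - z * h) by ring.
  apply: le_trans (nmBK pk _ _) _; rewrite nmNK !nmM nmV nm_nat nm_io.
  have := c01 N k (ltnW (ltn_ord k)) => /andP[ck0 ck1]; rewrite ger0_norm //.
  have F1 : N.+1%:R^-1 * nm (x - y) <= N.+1%:R^-1 * (M%:R * (r / N.+1%:R)).
    rewrite ler_wpM2l ?invr_ge0 //; apply: le_trans (E1 k kN) _.
    by rewrite ler_wpM2l.
  have F2 : c N k * nm (x - y - z * h) <= M%:R * (r / N.+1%:R) * (r / N.+1%:R).
    apply: le_trans (_ : _ <= nm (x - y - z * h)) _; first by rewrite ler_piMl ?nm_ge0.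
    apply: le_trans (E2 k kN) _; rewrite -[X in X <= _]mulrA -[X in _ <= X]mulrA.
    by apply: ler_wpM2l => //; apply: ler_pM => //; exact: nm_ge0.
  apply: le_trans (lerD F1 F2) _; rewrite le_eqVlt; apply/orP; left; apply/eqP.
  by rewrite /Q; field.
by exists F => // t Dt; have [] := hF t Dt.
Qed.

End ODE.

(** * Linear systems by Picard iteration *)

Section LinearSystems.
Context {R : realType} {K : numFieldType} {pk : kpkg R K}.
Local Notation nm := (@nm R K pk _).
Local Notation io := (io pk).

(** Each step integrates the previous bound along the segment by [MVTpow]. The sequence [Y] serves
    both for differences of Picard iterates and, taken constant, for a solution with zero initial
    value. *)
Lemma growth m (A : 'I_m -> 'I_m -> K -> K) (Y : nat -> 'I_m -> K -> K)
    (t0 w : K) (C M : R) : 0 <= C -> 0 <= M ->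
  (forall i j (s : R), 0 <= s <= 1 -> nm (A i j (t0 + io s * w)) <= C) ->
  (forall k i (s : R), 0 <= s <= 1 -> is_derive (t0 + io s * w) 1 (Y k.+1 i)
    (\sum_j A i j (t0 + io s * w) * Y k j (t0 + io s * w))) ->
  (forall k i, Y k.+1 i t0 = 0) ->
  (forall i (s : R), 0 <= s <= 1 -> nm (Y 0%N i (t0 + io s * w)) <= M) ->
  forall k i (s : R), 0 <= s <= 1 -> nm (Y k i (t0 + io s * w)) <=
    M * (m%:R * C * nm w) ^+ k / k`!%:R * s ^+ k.
Proof.
move=> C0 M0 AC dY Y0 YM; set L := m%:R * C * nm w.
have L0 : 0 <= L by rewrite !mulr_ge0 ?nm_ge0.
elim=> [|k IH] i s hs; first by rewrite !expr0 divr1 !mulr1 YM.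
have [s0 s1] : 0 <= s /\ s <= 1 by move/andP: hs.
have f0 : (k`!%:R : R) != 0 by rewrite pnatr_eq0 -lt0n fact_gt0.
have k0 : (k.+1%:R : R) != 0 by rewrite pnatr_eq0.
have := @MVTpow R K pk (Y k.+1 i) t0 (io s * w)
  (m%:R * C * (M * L ^+ k / k`!%:R) * s ^+ k) k.
have E x : t0 + io x * (io s * w) = t0 + io (x * s) * w by rewrite rmorphM mulrA.
have xs (x : R) : 0 <= x <= 1 -> 0 <= x * s <= 1.
  by move=> /andP[x0 x1]; rewrite mulr_ge0 // mulr_ile1.
rewrite Y0 subr0 => H; apply: le_trans (H _ _) _.
- by move=> x hx; rewrite E; have [] := dY k i _ (xs x hx).
- move=> x hx; rewrite E (derive1_val (dY k i _ (xs x hx))).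
  apply: le_trans (nm_sumK _ _ _) _.
  apply: le_trans (_ : \sum_(j < m) C * (M * L ^+ k / k`!%:R * (x * s) ^+ k) <= _).
    apply: ler_sum => j _; rewrite nmM.
    by apply: ler_pM; rewrite ?nm_ge0 ?AC ?IH ?xs.
  rewrite sumr_const card_ord -[X in X <= _]mulr_natl [(x * s) ^+ k]exprMn le_eqVlt; apply/orP; left.
  by apply/eqP; ring.
- rewrite nmM nm_io ger0_norm // le_eqVlt; apply/orP; left; apply/eqP.
  have -> : (k.+1)`!%:R = k.+1%:R * k`!%:R :> R by rewrite factS natrM.
  by rewrite !exprS {2}/L; field; rewrite f0 nat1r k0.
Qed.

Lemma exp_tail (L e : R) : 0 < e -> exists n0, forall m n, (n0 <= m)%N -> (m <= n)%N ->
  \sum_(m <= k < n) L ^+ k / k`!%:R < e.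
Proof.
move=> e0; have /cvg_ex[l hl] := is_cvg_series_exp_coeff L.
have /cvgrPdist_lt /(_ _ (divr_gt0 e0 (ltr0n _ 2))) [n0 _ h] := hl.
exists n0 => m n hm hn; have := h m hm; have := h n (leq_trans hm hn).
have -> : \sum_(m <= k < n) L ^+ k / k`!%:R = series (exp_coeff L) n - series (exp_coeff L) m.
  by rewrite sub_series_geq.
move=> h1 h2; apply: le_lt_trans (ler_norm _) _.
have -> : series (exp_coeff L) n - series (exp_coeff L) m =
  (l - series (exp_coeff L) m) - (l - series (exp_coeff L) n) by ring.
apply: le_lt_trans (ler_normB _ _) _; rewrite [e]splitr; exact: ltrD.
Qed.

Lemma seg_boundF (I : finType) (f : I -> K -> K) (D : set K) (t0 t1 : K) :
  domain D -> D t0 -> D t1 -> (forall i t, D t -> {for t, continuous (f i)}) ->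
  exists n : nat, exists2 d : R, 0 < d & forall t', nm (t' - t1) < d ->
    forall s : R, 0 <= s <= 1 -> D (t0 + io s * (t' - t0)) /\
      forall i, nm (f i (t0 + io s * (t' - t0))) <= n%:R.
Proof.
move=> domD D0 D1 cf.
have [n [d d0 h]] := @seg_bound R K pk I (enum I) f D t0 t1 domD D0 D1 cf.
exists n, d => // t' /h {}h s /h [Ds hs]; split=> // i; apply: hs.
have : i \in enum I by rewrite mem_enum.
by elim: (enum I) => [//|a l IH]; rewrite inE => /orP[/eqP ->|/IH]; [left|right].
Qed.

(** A solution vanishing at [t0] reproduces itself under integration of [A X], so [growth] applied
    to the constant sequence bounds it by a multiple of [L ^ k / k!] for every [k]. *)
Lemma lin_unique m (A : 'I_m -> 'I_m -> K -> K) (X : 'I_m -> K -> K) (D : set K) t0 :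
  domain D -> D t0 -> (forall i j t, D t -> {for t, continuous (A i j)}) ->
  (forall i t, D t -> is_derive t 1 (X i) (\sum_j A i j t * X j t)) ->
  (forall i, X i t0 = 0) -> forall i t, D t -> X i t = 0.
Proof.
move=> domD D0 cA dX X0 i t Dt.
pose f (x : 'I_m * 'I_m + 'I_m) := match x with inl (i, j) => A i j | inr i => X i end.
have [|n [d d0 h]] := @seg_boundF _ f D t0 t domD D0 Dt.
  move=> [[j k]|j] u Du /=; first exact: cA.
  by apply: differentiable_continuous; apply/derivable1_diffP; have [] := dX j u Du.
have tt : nm (t - t) < d by rewrite subrr nm0.
pose L := m%:R * n%:R * nm (t - t0).
have H k j (s : R) : 0 <= s <= 1 ->
    nm (X j (t0 + io s * (t - t0))) <= n%:R * L ^+ k / k`!%:R * s ^+ k.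
  move: k j s; apply: (@growth m A (fun=> X)) => //.
  - by move=> j k s hs; have [_ /(_ (inl (j, k)))] := h t tt s hs.
  - by move=> _ j s hs; apply: dX; have [] := h t tt s hs.
  - by move=> j s hs; have [_ /(_ (inr j))] := h t tt s hs.
apply: nm_small => e e0.
have [n0 hn0] := exp_tail L (divr_gt0 e0 (ltr0Sn _ n)).
have := H n0 i 1; rewrite ler01 lexx seg1 expr1n mulr1 => /(_ isT) H1.
have := hn0 n0 n0.+1 (leqnn _) (leqnSn _); rewrite big_nat1 => H2.
apply: le_trans H1 _; rewrite -mulrA.
apply: le_trans (_ : n%:R * (e / n.+1%:R) <= _).
  by rewrite ler_wpM2l // ltW.
rewrite mulrCA ler_piMr ?(ltW e0) // ler_pdivrMr ?ltr0n // mul1r ler_nat.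
exact: leqnSn.
Qed.

(** Bootstrapping: the equation expresses the derivative through functions already known to be of
    class [n]. *)
Lemma lin_smooth m (A : 'I_m -> 'I_m -> K -> K) (B X : 'I_m -> K -> K) (D : set K) :
  open D -> (forall i j, smooth D (A i j)) -> (forall i, smooth D (B i)) ->
  (forall i t, D t -> is_derive t 1 (X i) (\sum_j A i j t * X j t + B i t)) ->
  forall i, smooth D (X i).
Proof.
move=> oD sA sB dX; suff h : forall n i, Dn n D (X i) by move=> j; apply/smoothDn => n.
have dXd i t : D t -> derivable (X i) t 1 by move=> Dt; have [] := dX i t Dt.
elim=> [|n IH] i.
  split=> // t Dt; apply: differentiable_continuous; apply/derivable1_diffP.
  exact: dXd.
apply: Dn1 => //; first exact: dXd.
apply: (@Dn_ext _ _ _ _ D (fun t => \sum_j A i j t * X j t + B i t)) => //.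
  by move=> t Dt; rewrite (derive1_val (dX i t Dt)).
apply: Dn_add => //; last by move/smoothDn: (sB i).
elim: (index_enum 'I_m) => [|j r IHr].
  by apply: (Dn_ext oD _ (Dn_cst n D (0 : K))) => t _; rewrite big_nil.
have Aj : Dn n D (A i j) by move/smoothDn: (sA i j).
apply: (Dn_ext oD _ (Dn_add oD (Dn_mul oD Aj (IH j)) IHr)).
by move=> t _; rewrite big_cons.
Qed.

(** By linearity the Picard differences satisfy a homogeneous recursion, and the factorial bounds of
    [growth] make the iterates converge on the whole convex domain, not only near [t0]. *)
Lemma lin_exists m (A : 'I_m -> 'I_m -> K -> K) (B : 'I_m -> K -> K) (D : set K) t0
    (x0 : 'I_m -> K) :
  domain D -> D t0 -> (forall i j, smooth D (A i j)) -> (forall i, smooth D (B i)) ->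
  exists X : 'I_m -> K -> K, [/\ forall i, X i t0 = x0 i, forall i, smooth D (X i) &
    forall i t, D t -> is_derive t 1 (X i) (\sum_j A i j t * X j t + B i t)].
Proof.
move=> domD D0 sA sB; have [_ oD _] := domD.
(* [I] is a total primitive operator, with arbitrary values on nonsmooth functions; all iterates
   below are smooth. *)
have /choice [I hI] : forall f : K -> K, exists F : K -> K, smooth D f ->
    F t0 = 0 /\ forall t, D t -> is_derive t 1 F (f t).
  move=> f; have [sf|nsf] := pselect (smooth D f); last by exists f.
  by have [F F0 hF] := primitive domD D0 sf; exists F.
pose rhs (X : 'I_m -> K -> K) i t := \sum_j A i j t * X j t + B i t.
have srhs X i : (forall i, smooth D (X i)) -> smooth D (rhs X i).
  move=> sX; apply: smoothD => //.
  by apply: smooth_sum => // j _; apply: smoothM.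
pose X k := iter k (fun X i t => x0 i + I (rhs X i) t) (fun i t => x0 i).
have SX k i : smooth D (X k i).
  elim: k i => [|k IH] i; first exact: smooth_cst.
  have [_ hk] := hI _ (srhs (X k) i IH).
  apply: smoothD => //; first exact: smooth_cst.
  apply: smooth1P => //; first by move=> t Dt; have [] := hk t Dt.
  by apply: smooth_ext oD _ (srhs (X k) i IH) => t Dt; rewrite (derive1_val (hk t Dt)).
have dX k i t : D t -> is_derive t 1 (X k.+1 i) (rhs (X k) i t).
  move=> Dt; have [_ hk] := hI _ (srhs (X k) i (SX k)).
  by apply: dval (dD (dC (x0 i) t) (hk t Dt)) _; rewrite add0r.
have X0 k i : X k i t0 = x0 i.
  by case: k => [//|k] /=; have [-> _] := hI _ (srhs (X k) i (SX k)); rewrite addr0.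
pose Y k i t := X k.+1 i t - X k i t.
have dY k i t : D t -> is_derive t 1 (Y k.+1 i) (\sum_j A i j t * Y k j t).
  move=> Dt; apply: dval (dB (dX k.+1 i t Dt) (dX k i t Dt)) _.
  rewrite /rhs opprD addrACA subrr addr0 -sumrB.
  by apply: eq_bigr => j _; rewrite -mulrBr.
have U t1 : D t1 -> exists2 d : R, 0 < d & forall e : R, 0 < e -> exists n0,
   forall p q, (n0 <= q)%N -> (q <= p)%N -> forall t', nm (t' - t1) < d ->
   forall s : R, 0 <= s <= 1 -> forall i, nm (X p i (t0 + io s * (t' - t0)) -
     X q i (t0 + io s * (t' - t0))) < e.
  move=> D1.
  pose f (x : 'I_m * 'I_m + 'I_m) := match x with inl (i, j) => A i j | inr i => Y 0%N i end.
  have [|n [d d0 h]] := @seg_boundF _ f D t0 t1 domD D0 D1.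
    move=> [[i j]|i] t Dt; first by apply: smooth_cont Dt; exact: sA.
    by apply: smooth_cont Dt; apply: smoothB.
  exists d => // e e0; set r := nm (t1 - t0) + d.
  set L := m%:R * n%:R * r.
  have [n0 hn0] := exp_tail L (divr_gt0 e0 (ltr0Sn _ n)).
  exists n0 => p q hq hp t' ht' s hs i; set pt := t0 + _.
  have w_le : nm (t' - t0) <= r.
    by have := triK pk t' t1 t0; rewrite /r; move: ht'; lra.
  have YL k : nm (Y k i pt) <= n%:R * (L ^+ k / k`!%:R).
    have H := @growth m A Y t0 (t' - t0) n%:R n%:R (ler0n _ _) (ler0n _ _).
    apply: le_trans (H _ _ _ _ k i s hs) _.
    - by move=> j l x hx; have [_ /(_ (inl (j, l)))] := h t' ht' x hx.
    - by move=> l j x hx; apply: dY; have [] := h t' ht' x hx.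
    - by move=> l j; rewrite /Y !X0 subrr.
    - by move=> j x hx; have [_ /(_ (inr j))] := h t' ht' x hx.
    have [s0 s1] : 0 <= s /\ s <= 1 by move/andP: hs.
    have L1 : 0 <= m%:R * n%:R * nm (t' - t0) by rewrite !mulr_ge0 ?nm_ge0.
    have LL : m%:R * n%:R * nm (t' - t0) <= L by rewrite ler_wpM2l ?mulr_ge0.
    rewrite -[X in X <= _]mulrA -[X in X <= _]mulrA ler_wpM2l //.
    apply: ler_pM.
    - exact: exprn_ge0.
    - by apply: mulr_ge0; rewrite ?invr_ge0 ?exprn_ge0.
    - by apply: lerXn2r => //; rewrite nnegrE // (le_trans L1).
    - by rewrite ler_piMr ?invr_ge0 // exprn_ile1.
  have -> : X p i pt - X q i pt = \sum_(q <= k < p) Y k i pt.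
    by rewrite (telescope_sumr (fun k => X k i pt)).
  apply: le_lt_trans (nm_sumK _ _ _) _.
  apply: le_lt_trans (_ : \sum_(q <= k < p) n%:R * (L ^+ k / k`!%:R) < _).
    by apply: ler_sum => k _.
  rewrite -mulr_sumr; have H := hn0 q p hq hp.
  apply: le_lt_trans (_ : n%:R * (e / n.+1%:R) < _).
    by rewrite ler_wpM2l // ltW.
  by rewrite mulrCA gtr_pMr // ltr_pdivrMr ?ltr0n // mul1r ltr_nat.
have /choice [Xl hXl] : forall ti : K * 'I_m, exists l, D ti.1 -> forall e : R, 0 < e ->
    exists n0, forall n, (n0 <= n)%N -> nm (X n ti.2 ti.1 - l) < e.
  move=> [t i]; have [Dt|nDt] := pselect (D t); last by exists 0.
  have [d d0 hd] := U t Dt.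
  have [|l hl] := @kcomplete R K pk (fun n => X n i t); last by exists l.
  move=> e e0; have [n0 h] := hd e e0; exists n0 => p q hp hq.
  have tt : nm (t - t) < d by rewrite subrr nm0.
  have h01 : 0 <= (1 : R) <= 1 by rewrite ler01 lexx.
  have [qp|pq] := leqP q p.
    by have := h p q hq qp t tt 1 h01 i; rewrite seg1.
  by have := h q p hp (ltnW pq) t tt 1 h01 i; rewrite seg1 -/(nm _) nmCK.
have lim_le (u : nat -> K) (l c : K) (e : R) n0 :
    (forall e : R, 0 < e -> exists n0, forall n, (n0 <= n)%N -> nm (u n - l) < e) ->
    (forall n, (n0 <= n)%N -> nm (u n - c) <= e) -> nm (l - c) <= e.
  move=> hl hc; apply/ler_addgt0Pr => x xgt0; have [n1 h1] := hl x xgt0.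
  have := h1 _ (leq_maxr n0 n1); have := hc _ (leq_maxl n0 n1).
  have := triK pk l (u (maxn n0 n1)) c; rewrite [nm (l - u _)]nmCK.
  by lra.
have U2 t1 : D t1 -> exists2 d : R, 0 < d & forall e : R, 0 < e -> exists n0,
   forall q, (n0 <= q)%N -> forall t', nm (t' - t1) < d ->
   forall s : R, 0 <= s <= 1 -> forall i, nm (X q i (t0 + io s * (t' - t0)) -
     Xl (t0 + io s * (t' - t0), i)) <= e.
  move=> D1; have [d d0 hd] := U t1 D1; have [_ /(openPK (pk := pk)) oD' _] := domD.
  have [d' d'0 hd'] := oD' _ D1.
  exists (Num.min d d') => [|e e0]; first by rewrite lt_min d0.
  have [n0 h] := hd e e0; exists n0 => q hq t'; rewrite lt_min => /andP[ht' ht''] s hs i.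
  rewrite nmCK; apply: (lim_le (fun n => X n i (t0 + io s * (t' - t0))) _ _ _ q).
    by apply: (hXl (_, i)); exact: domain_seg domD D0 (hd' _ ht'') hs.
  by move=> n hn; apply: ltW; exact: h.
have XlE i : exists2 F : K -> K, F t0 = 0 & forall t, D t ->
    is_derive t 1 F (rhs (fun i t => Xl (t, i)) i t) /\ Xl (t, i) = x0 i + F t.
  have [||t1 D1|F F0 hF] := @limit_derive R K pk D t0 (fun k t => X k.+1 i t - x0 i)
      (rhs (fun i t => Xl (t, i)) i) domD D0.
  - move=> n t Dt; have [] // := dB (dX n i t Dt) (dC (x0 i) t).
  - by move=> n; rewrite X0 subrr.
  - have [d d0 hd] := U2 t1 D1.
    have [|n [d' d'0 hd']] := @seg_boundF 'I_m (A i) D t0 t1 domD D0 D1.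
      by move=> j t Dt; apply: smooth_cont Dt; exact: sA.
    exists (Num.min d d') => [|e e0]; first by rewrite lt_min d0.
    have c0 : 0 < (m%:R * n%:R + 1 : R) by rewrite ltr_wpDl ?mulr_ge0.
    have [n0 h] := hd _ (divr_gt0 e0 c0); exists n0 => k hk t'.
    rewrite lt_min => /andP[ht' ht''] s hs; set pt := t0 + _.
    have [Dpt hA] := hd' t' ht'' s hs.
    rewrite (derive1_val (dB (dX k i _ Dpt) (dC (x0 i) pt))) subr0 /rhs.
    rewrite opprD addrACA subrr addr0 -sumrB.
    apply: le_trans (nm_sumK _ _ _) _.
    apply: le_trans (_ : \sum_(j < m) n%:R * (e / (m%:R * n%:R + 1)) <= _).
      apply: ler_sum => j _; rewrite -mulrBr nmM; apply: ler_pM; rewrite ?nm_ge0 //.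
      exact: h.
    rewrite sumr_const card_ord -[X in X <= _]mulr_natl mulrA mulrCA ler_piMr ?(ltW e0) //.
    by rewrite ler_pdivrMr // mul1r lerDl.
  - exists F => // t Dt; have [h1 h2] := hF t Dt; split=> //.
    apply/eqP; rewrite addrC -subr_eq -subr_eq0; apply/eqP/nm_small => e e0.
    have [n0 h] := h2 _ e0; apply: (lim_le (fun n => X n.+1 i t - x0 i) _ _ _ n0) => //.
    move=> x /(hXl (t, i) Dt) [n1 hn1]; exists n1 => n hn.
    have -> : X n.+1 i t - x0 i - (Xl (t, i) - x0 i) = X n.+1 i t - Xl (t, i) by ring.
    by apply: hn1; apply: leq_trans hn _; exact: leqnSn.
have dXl i t : D t -> is_derive t 1 (fun t => Xl (t, i)) (rhs (fun i t => Xl (t, i)) i t).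
  move=> Dt; have [F F0 hF] := XlE i.
  apply: (@is_derive_ext _ _ _ D (fun t => x0 i + F t)) => //.
    by move=> u Du; have [_ ->] := hF u Du.
  by have [h _] := hF t Dt; apply: dval (dD (dC _ _) h) _; rewrite add0r.
exists (fun i t => Xl (t, i)); split=> //.
  by move=> i; have [F F0 hF] := XlE i; have [_ ->] := hF _ D0; rewrite F0 addr0.
exact: lin_smooth oD sA sB dXl.
Qed.

End LinearSystems.

(** * Taylor expansion and local inversion *)
Section Calculus2.
Context {R : realType} {K : numFieldType} {pk : kpkg R K}.
Local Notation nm := (@nm R K pk _).
Local Notation io := (io pk).

Lemma seg_le (p q : K) (s : R) : 0 <= s <= 1 -> nm (p + io s * (q - p) - p) <= nm (q - p).
Proof.
move=> /andP[s0 s1]; rewrite addrC addKr nmM nm_io ger0_norm //.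
by rewrite ler_piMl ?nm_ge0.
Qed.

(** Peano's form of the remainder, obtained by applying the statement of order [m] to [derive1 g]
    and integrating with the mean value inequality. *)
Lemma taylor m (g : K -> K) (U : set K) (t0 : K) : open U -> U t0 -> smooth U g ->
  (forall i, (i < m)%N -> derive1n i g t0 = 0) ->
  forall e : R, 0 < e -> exists2 d : R, 0 < d & forall t, nm (t - t0) < d ->
    nm (g t - derive1n m g t0 / m`!%:R * (t - t0) ^+ m) <= e * nm (t - t0) ^+ m.
Proof.
move=> oU U0; elim: m g => [|m IH] g sg g0 e e0.
  have [d d0 h] := (contPK (pk := pk) _ _).1 (smooth_cont sg U0) e e0.
  by exists d => // t /h; rewrite !expr0 !mulr1 divr1 => /ltW.
have sg' := smooth_derive1 sg.
have [|d d0 h] := IH _ sg' _ e e0; first by move=> i im; rewrite -derive1Sn g0.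
have [d' d'0 hd'] := (openPK (pk := pk) _).1 oU _ U0.
exists (Num.min d d'); first by rewrite lt_min d0.
move=> t; rewrite lt_min => /andP[td td'].
set c := derive1n m.+1 g t0; pose F t := g t - c / (m.+1)`!%:R * (t - t0) ^+ m.+1.
have m0 : (m.+1%:R : K) != 0 by rewrite pnatr_eq0.
have f0 : (m`!%:R : K) != 0 by rewrite pnatr_eq0 -lt0n fact_gt0.
have dF u : U u -> is_derive u 1 F (derive1 g u - c / m`!%:R * (u - t0) ^+ m).
  move=> Uu; apply: dval (dB (smooth_is_derive1 sg Uu)
    (dZ (c / (m.+1)`!%:R) (dX m.+1 (dB (dI u) (dC t0 u))))) _.
  by rewrite factS natrM /= subr0 mulr1; congr (_ - _); field; rewrite f0 nat1r m0.
have Us (s : R) : 0 <= s <= 1 -> nm (t0 + io s * (t - t0) - t0) < Num.min d d'.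
  by move=> hs; apply: le_lt_trans (seg_le _ _ hs) _; rewrite lt_min td.
have := @MVT0 R K pk F t0 t (e * nm (t - t0) ^+ m).
have -> : F t0 = 0.
  by rewrite /F subrr expr0n mulr0 subr0; have := g0 0%N isT.
rewrite subr0 /F [nm (t - t0) ^+ m.+1]exprSr mulrA; apply.
- move=> s /Us; rewrite lt_min => /andP[_ h']; have [] // := dF _ (hd' _ h').
- move=> s hs; have := Us s hs; rewrite lt_min => /andP[h1 h2].
  rewrite (derive1_val (dF _ (hd' _ h2))).
  have := h _ h1; rewrite -derive1Sn => /le_trans; apply.
  by rewrite ler_wpM2l ?(ltW e0) // lerXn2r ?nnegrE ?nm_ge0 ?seg_le.
Qed.

(** The map [u |-> u - (s u - z)] contracts with factor 1/2. The radii are explicit because the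
    lemma is applied to a family of maps indexed by the flow parameter, and the neighbourhoods must
    not depend on that parameter. *)
Lemma inverse (s : K -> K) (a : K) (r : R) : 0 < r ->
  smooth [set t | nm (t - a) < r] s ->
  (forall t, nm (t - a) < r -> nm (derive1 s t - 1) <= 1 / 2) ->
  (forall u v, nm (u - a) < r -> nm (v - a) < r -> nm (u - v) <= 2 * nm (s u - s v)) /\
  exists2 si : K -> K, smooth [set z | nm (z - s a) < r / 4] si &
    forall z, nm (z - s a) < r / 4 -> nm (si z - a) < r /\ s (si z) = z.
Proof.
move=> r0 ss s1; pose U := [set t | nm (t - a) < r].
have domU : domain U by exact: domain_ball.
have oU : open U by have [] := domU.
have Ua : U a by rewrite /U /= subrr nm0.
pose ph u := u - s u.
have dph u : U u -> is_derive u 1 ph (1 - derive1 s u).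
  by move=> Uu; apply: dB (dI u) (smooth_is_derive1 ss Uu).
have phL u v : U u -> U v -> nm (ph u - ph v) <= 1 / 2 * nm (u - v).
  move=> Uu Uv; apply: MVT0 => x hx.
    by have [] := dph _ (domain_seg domU Uv Uu hx).
  rewrite (derive1_val (dph _ (domain_seg domU Uv Uu hx))) nmCK.
  exact: s1 (domain_seg domU Uv Uu hx).
have L u v : U u -> U v -> nm (u - v) <= 2 * nm (s u - s v).
  move=> Uu Uv; have := phL u v Uu Uv.
  have E : u - v = (ph u - ph v) + (s u - s v) by rewrite /ph; ring.
  by have := nmDK pk (ph u - ph v) (s u - s v); rewrite -E; lra.
split=> //.
have exi z : nm (z - s a) < r / 4 -> exists u, U u /\ s u = z.
  move=> hz; set c := nm (z - s a) in hz.
  have c0 : 0 <= c := nmK_ge0 pk _.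
  pose u k := iter k (fun u => u - (s u - z)) a.
  pose h (k : nat) : R := (1 / 2) ^+ k.
  have h0 k : 0 <= h k by rewrite exprn_ge0.
  have hS k : h k.+1 = h k / 2 by rewrite /h exprSr; lra.
  have c2r : 2 * c < r by move: hz; lra.
  have ck j : 2 * c * (1 - h j) <= 2 * c by rewrite ler_piMr ?mulr_ge0 // gerBl.
  have uS k : u k.+1 = u k - (s (u k) - z) by [].
  have A k : nm (u k.+1 - u k) <= c * h k /\ nm (u k - a) <= 2 * c * (1 - h k).
    elim: k => [|k [I1 I2]].
      have -> : u 1%N - u 0%N = z - s a by rewrite uS /u /=; ring.
      by rewrite -/c /u /= subrr nm0 /h expr0 subrr mulr0 mulr1.
    have I3 : nm (u k.+1 - a) <= 2 * c * (1 - h k.+1).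
      by have := triK pk (u k.+1) (u k) a; rewrite hS; move: I1 I2; lra.
    have Uk : U (u k) by apply: le_lt_trans I2 (le_lt_trans (ck _) c2r).
    have Uk1 : U (u k.+1) by apply: le_lt_trans I3 (le_lt_trans (ck _) c2r).
    have E : u k.+2 - u k.+1 = ph (u k.+1) - ph (u k) by rewrite !uS /ph; ring.
    by split=> //; rewrite E; have := phL _ _ Uk1 Uk; rewrite hS; move: I1; lra.
  have B n j : nm (u (n + j)%N - u n) <= 2 * c * (h n - h (n + j)%N).
    elim: j => [|j IH]; first by rewrite addn0 !subrr nm0 mulr0.
    rewrite addnS; have [I1 _] := A (n + j)%N; rewrite hS.
    by have := triK pk (u (n + j).+1) (u (n + j)%N) (u n); move: I1 IH; lra.
  (* The elementary rate [2 ^ k >= k + 1] suffices to make [h k] arbitrarily small. *)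
  have hn k : h k * k.+1%:R <= 1.
    elim: k => [|k IH]; first by rewrite /h expr0 mul1r.
    apply: le_trans IH; rewrite hS -mulrA ler_wpM2l //.
    by rewrite ler_pdivrMl // -!natr1; have := ler0n R k; lra.
  have hsmall (e : R) : 0 < e -> exists n0, forall n, (n0 <= n)%N -> 2 * c * h n < e.
    move=> e0; exists (Num.truncn (2 * c / e)) => n hnn.
    have n0 : (0 : R) < n.+1%:R by rewrite ltr0n.
    have h1 : 2 * c / e < n.+1%:R.
      by apply: lt_le_trans (truncnS_gt _) _; rewrite ler_nat.
    have h2 : 2 * c < n.+1%:R * e by rewrite -ltr_pdivrMr.
    rewrite -(ltr_pM2r n0) [e * _]mulrC; apply: le_lt_trans h2.
    by rewrite -[X in X <= _]mulrA ler_piMr // mulr_ge0.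
  have [|l hl] := @kcomplete R K pk u.
    move=> e e0; have [n0 hn0] := hsmall (e / 2) (divr_gt0 e0 (ltr0n _ 2)).
    exists n0 => m n hm hn'; rewrite -/(nm _).
    have C k : (n0 <= k)%N -> nm (u k - u n0) < e / 2.
      move=> hk; rewrite -(subnKC hk); apply: le_lt_trans (B _ _) _.
      by apply: le_lt_trans (hn0 n0 (leqnn _)); rewrite ler_wpM2l ?mulr_ge0 // gerBl.
    have := triK pk (u m) (u n0) (u n); rewrite [nm (u n0 - _)]nmCK.
    by have := C m hm; have := C n hn'; lra.
  have Ul : nm (l - a) <= 2 * c.
    apply/ler_addgt0Pr => e e0; have [n0 hn0] := hl e e0.
    have := hn0 n0 (leqnn _); rewrite -/(nm _) nmCK.
    have [_ I2] := A n0; have := ck n0; have := triK pk l (u n0) a.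
    by move: I2; lra.
  have Ul' : U l by apply: le_lt_trans Ul c2r.
  exists l; split=> //; apply/eqP; rewrite -subr_eq0; apply/eqP; apply: nm_small => e e0.
  have [d d0 hd] := (contPK (pk := pk) _ _).1 (smooth_cont ss Ul') (e / 2) (divr_gt0 e0 (ltr0n _ 2)).
  have [n0 hn0] := hl d d0; have [n1 hn1] := hsmall (e / 2) (divr_gt0 e0 (ltr0n _ 2)).
  pose n := maxn n0 n1; have := hd _ (hn0 n (leq_maxl _ _)); rewrite nmCK => h1.
  have h2 := hn1 n (leq_maxr _ _); have [I1 _] := A n.
  have E : s (u n) - z = u n - u n.+1 by rewrite uS; ring.
  have := triK pk (s l) (s (u n)) z; rewrite E [nm (u n - _)]nmCK.
  have : c * h n <= 2 * c * h n by rewrite ler_wpM2r // ler_peMl //; lra.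
  by move: h1 h2 I1; lra.
have /choice [si hsi] : forall z, exists u, nm (z - s a) < r / 4 -> U u /\ s u = z.
  move=> z; have [hz|nz] := pselect (nm (z - s a) < r / 4); last by exists a.
  by have [u hu] := exi z hz; exists u.
exists si => //; pose W := [set z | nm (z - s a) < r / 4].
have [_ oW _] : domain W by apply: domain_ball; rewrite divr_gt0.
have s'h u : U u -> 1 / 2 <= nm (derive1 s u).
  move=> Uu; have := s1 u Uu.
  have := nmBrK pk 1 (1 - derive1 s u); rewrite nm1.
  have -> : 1 - (1 - derive1 s u) = derive1 s u by ring.
  by rewrite (nmCK pk 1); lra.
have s'0 u : U u -> derive1 s u != 0.
  move=> Uu; rewrite -(nm_gt0 (pk := pk)); apply: lt_le_trans (s'h u Uu).
  by rewrite divr_gt0.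
have dsi z : W z -> is_derive z 1 si (derive1 s (si z))^-1.
  move=> Wz; have [Uz sz] := hsi z Wz; set u := si z in Uz sz *.
  apply/(derivPK (pk := pk)) => e e0.
  have e40 : 0 < e / 4 by rewrite divr_gt0.
  have [d d0 hd] := (derivPK (pk := pk) _ _ _).1 (smooth_is_derive1 ss Uz) _ e40.
  have [d' d'0 hd'] := (openPK (pk := pk) _).1 oW _ Wz.
  exists (Num.min d' (d / 2)); first by rewrite lt_min d'0 divr_gt0.
  move=> z'; rewrite lt_min => /andP[/hd' Wz' zd].
  have [Uz' sz'] := hsi z' Wz'; have := L _ _ Uz' Uz; rewrite sz sz'.
  set u' := si z' in Uz' sz' *; move=> hL.
  have hu : nm (u' - u) < d by apply: le_lt_trans hL _; move: zd; lra.
  have := hd _ hu; rewrite sz sz' => hu'.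
  have E : u' - u - (derive1 s u)^-1 * (z' - z) =
      - ((derive1 s u)^-1 * (z' - z - derive1 s u * (u' - u))).
    by field; exact: s'0.
  rewrite E nmNK nmM nmV.
  have i2 : (nm (derive1 s u))^-1 <= 2.
    rewrite invf_ple ?posrE ?nm_gt0 ?s'0 //.
    by have := s'h u Uz; rewrite div1r.
  apply: le_trans (_ : 2 * (e / 4 * nm (u' - u)) <= _).
    by apply: ler_pM; rewrite ?invr_ge0 ?nm_ge0.
  have : e / 4 * nm (u' - u) <= e / 4 * (2 * nm (z' - z)) by rewrite ler_wpM2l // ltW.
  by lra.
apply/smoothDn; elim=> [|n IH].
  split=> // z Wz; apply: differentiable_continuous; apply/derivable1_diffP.
  by have [] := dsi z Wz.
apply: Dn1 => //; first by move=> z Wz; have [] := dsi z Wz.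
have hcomp : Dn n W (fun z => (derive1 s (si z))^-1).
  apply: Dn_inv => //; first by move=> z /hsi[/s'0].
  apply: (@Dn_comp _ _ _ oW n U) => //; first by move=> z /hsi[].
  by move/smoothDn: (smooth_derive1 ss).
by apply: (Dn_ext oW _ hcomp) => z Wz; rewrite (derive1_val (dsi z Wz)).
Qed.

(** The increment is split at [(t, f u)]. The step in the second variable uses the mean value
    inequality and continuity of the second partial derivative; the step in the first only needs its
    derivative at the base point. *)
Lemma chain2_derive (h : K * K -> K) (V : set (K * K)) (f : K -> K) (u b : K) :
  open V -> V (u, f u) -> (forall v p, V p -> derivable h p v) ->
  {for (u, f u), continuous (fun p => 'D_(0, 1) h p)} -> is_derive u 1 f b ->
  is_derive u 1 (fun t => h (t, f t)) ('D_(1, 0) h (u, f u) + b * 'D_(0, 1) h (u, f u)).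
Proof.
move=> oV Vu dh ch df; set A := 'D_(1, 0) h _; set B := 'D_(0, 1) h _.
have dA : is_derive u 1 (fun t => h (t, f u)) A.
  by apply/is_derive_slice1/derivableP/dh.
have [dV dV0 hdV] := (openP (pk := pk) _).1 oV _ Vu.
apply/(derivPK (pk := pk)) => e e0.
(* The three errors below add up to [e1 * c * nm (t - u)]. *)
set c := nm b + nm B + 2; have c0 : 0 < c.
  by have := nmK_ge0 pk b; have := nmK_ge0 pk B; rewrite /c; lra.
pose e1 := Num.min 1 (e / (4 * c)).
have e10 : 0 < e1 by rewrite lt_min ltr01 divr_gt0 // mulr_gt0.
have e11 : e1 <= 1 by rewrite /e1 ge_min lexx.
have e1c : e1 * c <= e / 4.
  have : e1 <= e / (4 * c) by rewrite /e1 ge_min lexx orbT.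
  move/(ler_wpM2r (ltW c0)) => /le_trans; apply.
  by rewrite le_eqVlt; apply/orP; left; apply/eqP; field; rewrite gt_eqF.
have [d1 d10 h1] := (derivPK (pk := pk) _ _ _).1 dA _ e10.
have [d2 d20 h2] := (derivPK (pk := pk) _ _ _).1 df _ e10.
have [d3 d30 h3] := (contP (pk := pk) _ _).1 ch _ e10.
pose dm := Num.min dV d3; have dm0 : 0 < dm by rewrite lt_min dV0.
have cf : {for u, continuous f}.
  by apply: differentiable_continuous; apply/derivable1_diffP; have [] := df.
have [d4 d40 h4] := (contPK (pk := pk) _ _).1 cf _ dm0.
exists (Num.min (Num.min d1 d2) (Num.min dm d4)).
  by rewrite !lt_min d10 d20 dV0 d30.
move=> t; rewrite [in X in X -> _]lt_min => /andP[].
rewrite lt_min => /andP[t1 t2]; rewrite lt_min => /andP[tm t4].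
have H1 := h1 t t1; have H2 := h2 t t2; have H4 := h4 t t4.
have near y : nm (y - f u) < dm -> nm ((t, y) - (u, f u)) < dm.
  by move=> hy; rewrite nm_pair /= gt_max tm.
have dmV : dm <= dV by rewrite /dm ge_min lexx.
have dm3 : dm <= d3 by rewrite /dm ge_min lexx orbT.
have dy y : nm (y - f u) < dm -> is_derive y 1 (fun y => h (t, y)) ('D_(0, 1) h (t, y)).
  move=> /near hy; apply/is_derive_slice2/derivableP/dh/hdV.
  exact: lt_le_trans hy dmV.
have seg (s : R) : 0 <= s <= 1 -> nm (f u + io s * (f t - f u) - f u) < dm.
  by move=> hs; apply: le_lt_trans (seg_le _ _ hs) _.
have H3 : nm (h (t, f t) - h (t, f u) - B * (f t - f u)) <= e1 * nm (f t - f u).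
  apply: (@MVTlin R K pk (fun y => h (t, y))) => s hs.
    by have [] := dy _ (seg s hs).
  rewrite (derive1_val (dy _ (seg s hs))); apply: ltW; apply: h3.
  exact: lt_le_trans (near _ (seg s hs)) dm3.
have E : h (t, f t) - h (u, f u) - (A + b * B) * (t - u) =
  (h (t, f t) - h (t, f u) - B * (f t - f u)) + (h (t, f u) - h (u, f u) - A * (t - u)) +
  B * (f t - f u - b * (t - u)) by ring.
rewrite E; apply: le_trans (nmDK pk _ _) _; apply: le_trans (lerD (nmDK pk _ _) (lexx _)) _.
rewrite nmM; set x := nm (t - u) in H1 H2 *; have x0 : 0 <= x := nm_ge0 pk _.
have F : nm (f t - f u) <= (nm b + 1) * x.
  have := nmBrK pk (f t - f u) (b * (t - u)); rewrite nmM -/x.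
  have : e1 * x <= x by rewrite ler_piMl.
  by move: H2; lra.
have G1 : e1 * nm (f t - f u) <= e1 * ((nm b + 1) * x) by rewrite ler_wpM2l // ltW.
have G2 : nm B * nm (f t - f u - b * (t - u)) <= nm B * (e1 * x).
  by rewrite ler_wpM2l ?nm_ge0.
have G3 : e1 * c * x <= e / 4 * x by rewrite ler_wpM2r.
have ex : 0 <= e * x by rewrite mulr_ge0 // ltW.
have : e1 * c * x = e1 * ((nm b + 1) * x) + nm B * (e1 * x) + e1 * x by rewrite /c; ring.
by move: G1 G2 G3 H3 H1 ex; lra.
Qed.

Lemma chain2_smooth (h : K * K -> K) (V : set (K * K)) (f : K -> K) (U : set K) :
  open V -> open U -> (forall u, U u -> V (u, f u)) -> smooth V h -> smooth U f ->
  smooth U (fun t => h (t, f t)).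
Proof.
move=> oV oU UV sh sf; apply/smoothDn => n.
have dD (h' : K * K -> K) u : smooth V h' -> U u -> is_derive u 1 (fun t => h' (t, f t))
    ('D_(1, 0) h' (u, f u) + derive1 f u * 'D_(0, 1) h' (u, f u)).
  move=> sh' Uu; apply: (chain2_derive oV (UV u Uu)).
  - by move=> v p Vp; exact: smooth_derivable sh' Vp.
  - exact: smooth_cont (smooth_D ((0, 1) : K * K) sh') (UV u Uu).
  - exact: smooth_is_derive1 sf Uu.
elim: n h sh => [|n IH] h sh.
  split=> // u Uu; apply: differentiable_continuous; apply/derivable1_diffP.
  by have [] := dD h u sh Uu.
apply: Dn1 => //; first by move=> u Uu; have [] := dD h u sh Uu.
have sf' : Dn n U (derive1 f) by move/smoothDn: (smooth_derive1 sf).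
have IH1 := IH _ (smooth_D ((1, 0) : K * K) sh); have IH2 := IH _ (smooth_D ((0, 1) : K * K) sh).
apply: (Dn_ext oU _ (Dn_add oU IH1 (Dn_mul oU sf' IH2))) => u Uu /=.
by rewrite (derive1_val (dD h u sh Uu)).
Qed.

Lemma lim_uniq (u : nat -> K) (l l' : K) :
  (forall e : R, 0 < e -> exists n0, forall n, (n0 <= n)%N -> nm (u n - l) <= e) ->
  (forall e : R, 0 < e -> exists n0, forall n, (n0 <= n)%N -> nm (u n - l') <= e) -> l = l'.
Proof.
move=> h h'; apply/eqP; rewrite -subr_eq0; apply/eqP/nm_small => e e0.
have e20 : 0 < e / 2 by rewrite divr_gt0.
have [n0 hn] := h _ e20; have [n1 hn'] := h' _ e20.
have := hn _ (leq_maxl n0 n1); have := hn' _ (leq_maxr n0 n1).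
by have := triK pk l (u (maxn n0 n1)) l'; rewrite [nm (l - u _)]nmCK; lra.
Qed.

(** Elimination of the last generator: at a point where it does not vanish, its coefficient is
    determined by the value there and so converges, once the other generators are corrected to
    vanish at that point. A generator vanishing on all of [S] is dropped. *)
Lemma span_closed (S : set K) m (phi h : nat -> K -> K) (Q : K -> K) :
  (forall n, exists c : nat -> K, forall t, S t -> h n t = \sum_(j < m) c j * phi j t) ->
  (forall t, S t -> forall e : R, 0 < e ->
     exists n0, forall n, (n0 <= n)%N -> nm (h n t - Q t) <= e) ->
  exists c : nat -> K, forall t, S t -> Q t = \sum_(j < m) c j * phi j t.
Proof.
elim: m phi h Q => [|m IH] phi h Q hspan hlim.
  exists (fun=> 0) => t St; rewrite big_ord0; apply: lim_uniq (hlim t St) _ => e e0.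
  exists 0%N => n _; have [c hc] := hspan n; rewrite hc // big_ord0 subrr nm0; exact: ltW.
have [[t0 St0 p0]|np] := pselect (exists2 t0, S t0 & phi m t0 != 0); last first.
  have p0 t : S t -> phi m t = 0.
    by move=> St; apply/eqP; apply/negPn/negP => p0; apply: np; exists t.
  have [|c hc] := IH phi h Q _ hlim.
    move=> n; have [c hc] := hspan n; exists c => t St.
    by rewrite hc // big_ord_recr /= p0 // mulr0 addr0.
  by exists c => t St; rewrite big_ord_recr /= p0 // mulr0 addr0 hc.
pose a j := phi j t0 / phi m t0.
have [|t St e e0|c hc] := IH (fun j t => phi j t - a j * phi m t)
    (fun n t => h n t - h n t0 / phi m t0 * phi m t)
    (fun t => Q t - Q t0 / phi m t0 * phi m t).
- move=> n; have [c hc] := hspan n; exists c => t St.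
  rewrite !hc // !big_ord_recr /=; under [RHS]eq_bigr do rewrite mulrBr.
  have E : \sum_(j < m) c j * (a j * phi m t) =
      (\sum_(j < m) c j * phi j t0) / phi m t0 * phi m t.
    by rewrite !mulr_suml; apply: eq_bigr => j _; rewrite /a; ring.
  by rewrite sumrB E; field.
- have c0 : 0 < nm (phi m t / phi m t0) + 1.
    by have := nmK_ge0 pk (phi m t / phi m t0); lra.
  have [n0 h0] := hlim t St (e / 2) (divr_gt0 e0 (ltr0n _ 2)).
  have [n1 h1] := hlim t0 St0 (e / (2 * (nm (phi m t / phi m t0) + 1)))
    (divr_gt0 e0 (mulr_gt0 (ltr0n _ 2) c0)).
  exists (maxn n0 n1) => n; rewrite geq_max => /andP[hn0 hn1].
  have := h0 n hn0; have := h1 n hn1.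
  have -> : h n t - h n t0 / phi m t0 * phi m t - (Q t - Q t0 / phi m t0 * phi m t) =
    (h n t - Q t) - (h n t0 - Q t0) * (phi m t / phi m t0) by ring.
  set x := phi m t / _ in c0 *; move=> k1 k0; apply: le_trans (nmBK pk _ _) _; rewrite nmM.
  have : nm (h n t0 - Q t0) * nm x <= e / (2 * (nm x + 1)) * (nm x + 1).
    by apply: ler_pM; rewrite ?nm_ge0 // lerDl.
  have -> : e / (2 * (nm x + 1)) * (nm x + 1) = e / 2 by field; rewrite gt_eqF.
  by move: k0; lra.
- exists (fun j => if (j < m)%N then c j
     else Q t0 / phi m t0 - \sum_(j < m) c j * a j) => t St.
  rewrite big_ord_recr /= ltnn.
  under eq_bigr => j _ do rewrite ltn_ord.
  have /= := hc t St; under eq_bigr do rewrite mulrBr.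
  have E : \sum_(j < m) c j * (a j * phi m t) = (\sum_(j < m) c j * a j) * phi m t.
    by rewrite mulr_suml; apply: eq_bigr => j _; rewrite mulrA.
  by rewrite sumrB E => H; rewrite mulrBl -[LHS](subrK (Q t0 / phi m t0 * phi m t)) H; ring.
Qed.

End Calculus2.

(** * Symmetric powers of y'' + q y *)
Section SymmetricPower.
Context {K : numFieldType}.
Implicit Types (g h : K -> K) (U : set K).

Lemma der1D U g h t : smooth U g -> smooth U h -> U t ->
  derive1 (fun t => g t + h t) t = derive1 g t + derive1 h t.
Proof.
by move=> sg sh Ut; apply: derive1_val; apply: dD; [exact: smooth_is_derive1 sg Ut|exact: smooth_is_derive1 sh Ut].
Qed.

Lemma der1B U g h t : smooth U g -> smooth U h -> U t ->
  derive1 (fun t => g t - h t) t = derive1 g t - derive1 h t.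
Proof.
by move=> sg sh Ut; apply: derive1_val; apply: dB; [exact: smooth_is_derive1 sg Ut|exact: smooth_is_derive1 sh Ut].
Qed.

Lemma der1M U g h t : smooth U g -> smooth U h -> U t ->
  derive1 (fun t => g t * h t) t = derive1 g t * h t + g t * derive1 h t.
Proof.
by move=> sg sh Ut; apply: derive1_val; apply: dM; [exact: smooth_is_derive1 sg Ut|exact: smooth_is_derive1 sh Ut].
Qed.

Lemma der1Z U (c : K) g t : smooth U g -> U t ->
  derive1 (fun t => c * g t) t = c * derive1 g t.
Proof. by move=> sg Ut; apply: derive1_val; apply: dZ; exact: smooth_is_derive1 sg Ut. Qed.

Lemma der1sum U m (f : 'I_m -> K -> K) t : (forall i, smooth U (f i)) -> U t ->
  derive1 (fun t => \sum_(i < m) f i t) t = \sum_(i < m) derive1 (f i) t.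
Proof.
by move=> sf Ut; apply: derive1_val; apply: dsum => i; exact: smooth_is_derive1 (sf i) Ut.
Qed.

Lemma smoothZ U (c : K) g : open U -> smooth U g -> smooth U (fun t => c * g t).
Proof. by move=> oU sg; apply: smoothM => //; exact: smooth_cst. Qed.

(** For [F_i = n (n-1) ... (n-i+1) y^(n-i) y'^i] and [y'' = - q y] one has
    [F_i' = F_(i+1) - i (n + 1 - i) q F_(i-1)]. The same numbers occur in the (n+1)-dimensional
    irreducible representation of sl2. *)
Definition kap (n i : nat) : K := (i * (n.+1 - i))%:R.

(* [FF q n i g] evaluates to n(n-1)...(n-i+1) y^(n-i) y'^i at g = y^n when
   y'' + q y = 0; in particular [FF q n n.+1] is the n-th symmetric power of
   the operator g'' + q g. *)
Fixpoint FF (q : K -> K) (n i : nat) g {struct i} : K -> K :=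
  match i with
  | 0 => g
  | i'.+1 => match i' with
    | 0 => derive1 g
    | i''.+1 => fun t => derive1 (FF q n i' g) t + kap n i' * q t * FF q n i'' g t
    end
  end.

Lemma kap0 n : kap n 0 = 0. Proof. by []. Qed.

Lemma kapS n i : (i <= n)%N -> kap n i.+1 = kap n i + n%:R - 2 * i%:R.
Proof.
move=> le_in; rewrite /kap subSS.
have -> : (n.+1 - i = (n - i).+1)%N by rewrite subSn.
by rewrite !natrM -!natr1 natrB //; ring.
Qed.

Lemma kapE n i : (i <= n.+1)%N -> kap n i = i%:R * (n%:R + 1 - i%:R).
Proof. by move=> hi; rewrite /kap natrM natrB // natr1. Qed.

Lemma FFS q n i g t :
  FF q n i.+1 g t = derive1 (FF q n i g) t + kap n i * q t * FF q n i.-1 g t.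
Proof. by case: i => [|i] //=; rewrite kap0 !mul0r addr0. Qed.

(** The recursion of [FF] reaches back two steps, so here and below inductions carry two consecutive
    orders. *)
Lemma FF_smooth q n i U g : open U -> smooth U q -> smooth U g -> smooth U (FF q n i g).
Proof.
move=> oU sq sg; have [] : smooth U (FF q n i g) /\ smooth U (FF q n i.+1 g); last by [].
elim: i => [|i [IH1 IH2]]; first by split; [|exact: smooth_derive1].
split=> //=; apply: smoothD => //; first exact: smooth_derive1 IH2.
by apply: smoothM => //; apply: smoothZ.
Qed.

Lemma FF_ext q n i U g h : open U -> (forall t, U t -> g t = h t) ->
  forall t, U t -> FF q n i g t = FF q n i h t.
Proof.
move=> oU gh; have [] : (forall t, U t -> FF q n i g t = FF q n i h t) /\
  (forall t, U t -> FF q n i.+1 g t = FF q n i.+1 h t); last by [].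
elim: i => [|i [IH1 IH2]]; first by split=> // t Ut; exact: derive1_ext Ut gh.
by split=> // t Ut /=; rewrite (derive1_ext oU Ut IH2) IH1.
Qed.

Lemma FF_lin q n i U g h (a b : K) : open U -> smooth U q -> smooth U g -> smooth U h ->
  forall t, U t -> FF q n i (fun t => a * g t + b * h t) t =
    a * FF q n i g t + b * FF q n i h t.
Proof.
move=> oU sq sg sh.
have sF j := FF_smooth n j oU sq sg; have sH j := FF_smooth n j oU sq sh.
pose E j := forall t, U t -> FF q n j (fun t => a * g t + b * h t) t =
  a * FF q n j g t + b * FF q n j h t.
suff [] : E i /\ E i.+1 by [].
have dE j : E j -> forall t, U t -> derive1 (FF q n j (fun t => a * g t + b * h t)) t =
    a * derive1 (FF q n j g) t + b * derive1 (FF q n j h) t.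
  move=> Ej t Ut; rewrite (derive1_ext oU Ut Ej).
  rewrite (@der1D U) //; [|exact: smoothZ|exact: smoothZ].
  by rewrite !(@der1Z U).
elim: i => [|i [IH1 IH2]]; first by split=> //; exact: (dE 0%N).
split=> // t Ut; rewrite FFS (dE i.+1 IH2 t Ut) (FFS q n i.+1 g) (FFS q n i.+1 h) /=.
by rewrite IH1 //; ring.
Qed.

Lemma FF0 n i g : FF (fun=> 0) n i g = derive1n i g.
Proof.
suff [] : FF (fun=> 0) n i g = derive1n i g /\ FF (fun=> 0) n i.+1 g = derive1n i.+1 g by [].
elim: i => [|i [IH1 IH2]]; first by [].
split=> //; apply/funext => t; rewrite FFS IH2 mulr0 mul0r addr0.
by rewrite [in RHS]derive1nS.
Qed.

End SymmetricPower.

(** * Differential operators of bounded order *)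

Section LowOrder.
Context {K : numFieldType}.
Variables (D : set K) (oD : open D).
Implicit Types (g h w : K -> K) (U : set K) (Z : (K -> K) -> K -> K).

(* [Z] is a differential operator of order less than [m] *)
Definition low (q : K -> K) (n m : nat) Z := exists w : nat -> K -> K,
  (forall k, smooth D (w k)) /\ forall U g, open U -> U `<=` D -> smooth U g ->
  forall t, U t -> Z g t = \sum_(k < m) w k t * FF q n k g t.

Lemma low_ext q n m Z Z' : (forall U g, open U -> U `<=` D -> smooth U g ->
  forall t, U t -> Z' g t = Z g t) -> low q n m Z -> low q n m Z'.
Proof.
move=> E [w [sw h]]; exists w; split=> // U g oU UD sg t Ut.
by rewrite (E U) // (h U).
Qed.

Lemma low_0 q n m : low q n m (fun _ _ => 0).
Proof.
exists (fun _ _ => 0); split=> [k|U g _ _ _ t _]; first exact: smooth_cst.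
by rewrite big1 // => k _; rewrite mul0r.
Qed.

Lemma low_mono q n m m' Z : (m <= m')%N -> low q n m Z -> low q n m' Z.
Proof.
move=> mm' [w [sw h]]; exists (fun k t => if (k < m)%N then w k t else 0).
split=> [k|U g oU UD sg t Ut]; first by case: (k < m)%N => //; exact: smooth_cst.
rewrite (h U) // (big_ord_widen m' (fun k => w k t * FF q n k g t) mm') big_mkcond.
by apply: eq_bigr => k _ /=; case: ifP; rewrite ?mul0r.
Qed.

Lemma low_add q n m Z Z' : low q n m Z -> low q n m Z' ->
  low q n m (fun g t => Z g t + Z' g t).
Proof.
move=> [w [sw h]] [w' [sw' h']]; exists (fun k t => w k t + w' k t); split.
  by move=> k; apply: smoothD.
move=> U g oU UD sg t Ut; rewrite (h U) // (h' U) // -big_split /=.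
by apply: eq_bigr => k _; rewrite mulrDl.
Qed.

Lemma low_mul q n m (a : K -> K) Z : smooth D a -> low q n m Z ->
  low q n m (fun g t => a t * Z g t).
Proof.
move=> sa [w [sw h]]; exists (fun k t => a t * w k t); split.
  by move=> k; apply: smoothM.
move=> U g oU UD sg t Ut; rewrite (h U) // mulr_sumr.
by apply: eq_bigr => k _; rewrite mulrA.
Qed.

Lemma low_sum q n m p (Z : 'I_p -> (K -> K) -> K -> K) : (forall i, low q n m (Z i)) ->
  low q n m (fun g t => \sum_(i < p) Z i g t).
Proof.
move=> h; elim: p Z h => [|p IH] Z h.
  by apply: low_ext (low_0 q n m) => U g _ _ _ t _; rewrite big_ord0.
apply: low_ext (low_add (IH (fun i => Z (widen_ord (leqnSn p) i)) (fun i => h _)) (h ord_max)).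
by move=> U g _ _ _ t _; rewrite big_ord_recr.
Qed.

Lemma low_FF q n i m : (i < m)%N -> low q n m (FF q n i).
Proof.
move=> im; exists (fun k _ => (k == i)%:R); split=> [k|U g _ _ _ t _].
  exact: smooth_cst.
rewrite (bigD1 (Ordinal im)) //= eqxx mul1r big1 ?addr0 // => k ki.
by rewrite -val_eqE /= in ki; rewrite (negbTE ki) mul0r.
Qed.

Variables (q : K -> K) (sq : smooth D q).

Lemma low_der n m Z : low q n m Z -> low q n m.+1 (fun g => derive1 (Z g)).
Proof.
move=> [w [sw h]].
apply: (@low_ext _ _ _ (fun g t => \sum_(k < m) (derive1 (w k) t * FF q n k g t +
   (w k t * FF q n k.+1 g t + (- (w k t * (kap n k * q t))) * FF q n k.-1 g t)))).
  move=> U g oU UD sg t Ut.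
  have sF k : smooth U (FF q n k g) by apply: FF_smooth => //; exact: smooth_sub sq.
  have sw' k : smooth U (w k) by exact: smooth_sub (sw k).
  rewrite (derive1_ext oU Ut (h U g oU UD sg)).
  rewrite (@der1sum _ U) //; last by move=> k; apply: smoothM.
  apply: eq_bigr => k _; rewrite (@der1M _ U) // FFS.
  by ring.
apply: low_sum => k; apply: low_add; [|apply: low_add].
- apply: low_mul; first exact: smooth_derive1.
  by apply: low_FF; apply: leq_trans (ltn_ord k) _.
- by apply: low_mul => //; apply: low_FF; rewrite ltnS.
- apply: low_mul; first by apply: smoothN => //; apply: smoothM => //; exact: smoothZ.
  apply: low_FF; apply: leq_ltn_trans (leq_pred k) _.
  by apply: leq_trans (ltn_ord k) _.
Qed.

(** Differentiation raises the order by one whatever [q] and [n] are, hence the order bound does not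
    depend on the family [FF q n] used to expand an operator. *)
Lemma FF_low (q' : K -> K) n n' i : smooth D q' -> low q n i.+1 (FF q' n' i).
Proof.
move=> sq'.
suff [] : low q n i.+1 (FF q' n' i) /\ low q n i.+2 (FF q' n' i.+1) by [].
have FF1 : low q n 1 (FF q' n' 0).
  by apply: low_ext (low_FF q n (ltn0Sn 0)) => U g _ _ _ t _.
elim: i => [|i [IH1 IH2]]; first by split=> //; exact: low_der.
split=> //; apply: low_add; first exact: low_der IH2.
apply: low_mul; first exact: smoothZ.
by apply: low_mono IH1; rewrite -addn2 leq_addr.
Qed.

Lemma low_basis (q' : K -> K) n n' m Z : smooth D q' -> low q' n' m Z -> low q n m Z.
Proof.
move=> sq' [w [sw h]].
apply: (@low_ext _ _ _ (fun g t => \sum_(k < m) w k t * FF q' n' k g t)).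
  exact: h.
apply: low_sum => k; apply: low_mul => //.
by apply: low_mono (FF_low n n' k sq').
Qed.

End LowOrder.

(** * Leading terms of Leibniz' rule and of [FF] *)

Section NormalForm.
Context {K : numFieldType}.
Variables (D : set K) (oD : open D).
Implicit Types (g h w : K -> K) (U : set K) (Z : (K -> K) -> K -> K).
Let z0 : K -> K := fun=> 0.
Let sz0 : smooth D z0. Proof. exact: smooth_cst. Qed.

Lemma low_d1n n i m : (i < m)%N -> low D z0 n m (fun g => derive1n i g).
Proof.
move=> im; apply: low_ext (low_FF D z0 n im) => U g _ _ _ t _.
by rewrite FF0.
Qed.

Lemma leibniz_alg (X r r1 r2 g g1 g2 k : K) : X - r * g2 - (k + 1) * r1 * g1 =
  X - (r1 * g1 + r * g2) - (k * r2 * g + k * r1 * g1) + k * r2 * g.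
Proof. by ring. Qed.

(** Two terms of Leibniz' rule suffice: in [k rho' g^(k-1)] the factor [rho'] will be chosen so as
    to remove the coefficient next to the leading one. *)
Lemma leibniz_low (rho : K -> K) k : smooth D rho -> low D z0 0 k.-1
  (fun g t => derive1n k (fun t => rho t * g t) t - rho t * derive1n k g t
     - k%:R * derive1 rho t * derive1n k.-1 g t).
Proof.
move=> sr; have R1 U : U `<=` D -> smooth U rho by move=> UD; exact: smooth_sub sr.
case: k => [|k].
  by apply: low_ext (low_0 D z0 0 0) => U g _ _ _ t _ /=; rewrite !mul0r subr0 subrr.
elim: k => [|k IH].
  apply: low_ext (low_0 D z0 0 0) => U g oU UD sg t Ut /=.
  by rewrite (@der1M _ U) //; [ring|exact: R1].
have H1 := low_der oD sz0 IH.
have H2 := low_mul oD (smoothZ (k.+1)%:R oD (smooth_derive1 (smooth_derive1 sr)))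
  (low_d1n 0 (leqnn k.+1)).
apply: low_ext (low_add oD H1 H2) => U g oU UD sg t Ut.
have sg' j : smooth U (derive1n j g) by exact: smooth_derive1n.
have sr' : smooth U (derive1 rho) by apply: smooth_derive1; exact: R1.
rewrite [in RHS](@der1B _ U) //; last first.
- by apply: smoothM => //; exact: smoothZ.
- apply: smoothB => //; last by apply: smoothM => //; exact: R1.
  by apply: smooth_derive1n; apply: smoothM => //; exact: R1.
rewrite (@der1B _ U) //; last first.
- by apply: smoothM => //; exact: R1.
- by apply: smooth_derive1n; apply: smoothM => //; exact: R1.
rewrite (@der1M _ U rho) //; last exact: R1.
rewrite (@der1M _ U (fun t => _ * _)) //; last exact: smoothZ.
rewrite (@der1Z _ U) //= -!derive1nS /=.
by rewrite -[k.+2%:R](natr1 k.+1); exact: leibniz_alg.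
Qed.

(** The coefficient of [q * g^(k-2)] in [FF q n k g]. *)
Definition sig n k : K := \sum_(i < k) kap n i.

Lemma FF_d1n_low1 q n k : smooth D q ->
  low D z0 0 k (fun g t => FF q n k g t - derive1n k g t).
Proof.
move=> sq; elim: k => [|k IH].
  by apply: low_ext (low_0 D z0 0 0) => U g _ _ _ t _ /=; rewrite subrr.
have H : low D z0 0 k.+1 (fun g t => kap n k * q t * FF q n k.-1 g t).
  apply: low_mul => //; first exact: smoothZ.
  by apply: low_mono (FF_low oD sz0 0 n k.-1 sq); rewrite ltnS leq_pred.
apply: low_ext (low_add oD (low_der oD sz0 IH) H) => U g oU UD sg t Ut.
have sg' j : smooth U (derive1n j g) by exact: smooth_derive1n.
have sq' : smooth U q by exact: smooth_sub sq.
have sF j : smooth U (FF q n j g) by exact: FF_smooth.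
by rewrite (@der1B _ U) // -derive1nS FFS; ring.
Qed.

(** The recursion adds [kap n k * q * g^(k-1)] at each step. The resulting coefficient is nonzero
    for the full order, so a suitable [q] absorbs the coefficient two orders below the leading
    one. *)
Lemma FF_d1n_low q n k : smooth D q -> low D z0 0 k.-2
  (fun g t => FF q n k g t - derive1n k g t - sig n k * q t * derive1n k.-2 g t).
Proof.
move=> sq; case: k => [|[|k]].
- apply: low_ext (low_0 D z0 0 0) => U g _ _ _ t _ /=.
  by rewrite /sig big_ord0 !mul0r subr0 subrr.
- apply: low_ext (low_0 D z0 0 0) => U g _ _ _ t _ /=.
  by rewrite /sig big_ord1 kap0 !mul0r subr0 subrr.
elim: k => [|k IH].
  apply: low_ext (low_0 D z0 0 0) => U g oU UD sg t Ut /=.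
  by rewrite /sig !big_ord_recr big_ord0 /= kap0 !add0r; ring.
have H1 := low_der oD sz0 IH.
have H2 := low_mul oD (smoothZ (sig n k.+2) oD (smooth_derive1 sq)) (low_d1n 0 (leqnn k.+1)).
have H3 : low D z0 0 k.+1 (fun g t => kap n k.+2 * q t * (FF q n k.+1 g t - derive1n k.+1 g t)).
  apply: low_mul => //; first exact: smoothZ.
  exact: FF_d1n_low1.
apply: low_ext (low_add oD (low_add oD H1 H2) H3) => U g oU UD sg t Ut.
have sg' j : smooth U (derive1n j g) by exact: smooth_derive1n.
have sq' : smooth U q by exact: smooth_sub sq.
have sF j : smooth U (FF q n j g) by exact: FF_smooth.
rewrite [in RHS](@der1B _ U) //; last first.
- by apply: smoothM => //; exact: smoothZ.
- exact: smoothB.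
rewrite (@der1B _ U) // (@der1M _ U (fun t => _ * _)) //; last exact: smoothZ.
rewrite (@der1Z _ U) // -!derive1nS [in LHS]FFS /sig [in LHS]big_ord_recr /=.
by ring.
Qed.

End NormalForm.

Lemma FF00 (K : numFieldType) (q : K -> K) n g : FF q n 0 g = g.
Proof. by []. Qed.

Lemma FF01 (K : numFieldType) (q : K -> K) n g : FF q n 1 g = derive1 g.
Proof. by []. Qed.

Arguments FF {K} q n i g t : simpl never.

(** * The action of a field on the jets [FF] *)

Section Algebra.

Lemma Zop_identity (K : numFieldType)
    (G' G1 k km N I Im t0 t1 t2 t3 q q1 f f' f'' f1 f1' f2 : K) :
  k = 0 \/ (f1' = f - km * q * f2 /\ Im = I - 1) ->
  G' + k * q * G1 - ((k + N - 2 * I) / 2 * t2 * f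
    + (N / 2 - (I + 1)) * t1 * (f' + k * q * f1)
    - t0 * (f'' + (k * q1 * f1 + k * q * f1'))) =
  (G' - (k / 2 * t3 * f1 + k / 2 * t2 * f1' + ((N / 2 - I) * t2 * f + (N / 2 - I) * t1 * f')
    - (t1 * f' + t0 * f'')))
  + k * q * (G1 - (km / 2 * t2 * f2 + (N / 2 - Im) * t1 * f1 - t0 * f1'))
  + k / 2 * (t3 + 4 * q * t1 + 2 * q1 * t0) * f1.
Proof. by case=> [->|[-> ->]]; field. Qed.

End Algebra.

Section Operator.
Context {K : numFieldType}.
Implicit Types (g h w : K -> K) (U : set K).

Definition Pop (q : K -> K) (n : nat) (d : nat -> K -> K) g (t : K) : K :=
  FF q n n.+1 g t + \sum_(j < n.+1) d j t * FF q n j g t.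

(** The characteristic of the field [tau d/dt + al u d/du] along the graph of [g]. *)
Definition Mop (al tau : K -> K) g (t : K) : K := al t * g t - tau t * derive1 g t.

(** The second symmetric power of [y'' + q y]; it annihilates products of two solutions. *)
Definition theta (q tau : K -> K) (t : K) : K :=
  derive1n 3 tau t + 4 * q t * derive1 tau t + 2 * derive1 q t * tau t.

(** The value that [FF q n i (Mop al tau g)] takes when [al = n/2 tau'] and [theta q tau = 0]. [Zop]
    below is the defect from it. *)
Definition Bop (q : K -> K) (n : nat) (tau : K -> K) i g (t : K) : K :=
  kap n i / 2 * derive1n 2 tau t * FF q n i.-1 g t
  + (n%:R / 2 - i%:R) * derive1 tau t * FF q n i g t - tau t * derive1 (FF q n i g) t.

Definition Zop (q : K -> K) (n : nat) (al tau : K -> K) i g (t : K) : K :=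
  FF q n i (Mop al tau g) t - Bop q n tau i g t.

(** The coefficient with which [FF q n j] enters when [Mop] is moved past the lower-order part of
    [Pop]. *)
Definition eop (n : nat) (d : nat -> K -> K) (tau : K -> K) j (t : K) : K :=
  tau t * derive1 (d j) t + (n.+1%:R - j%:R) * derive1 tau t * d j t
  + kap n j.+1 / 2 * derive1n 2 tau t * d j.+1 t.

Section Local.
Variables (U : set K) (oU : open U) (q : K -> K) (sq : smooth U q) (n : nat).
Variables (al tau : K -> K) (sal : smooth U al) (stau : smooth U tau).
Variables (g : K -> K) (sg : smooth U g).

Lemma Mop_smooth : smooth U (Mop al tau g).
Proof.
by apply: smoothB => //; apply: smoothM => //; exact: smooth_derive1.
Qed.

Lemma Bop_smooth i : smooth U (Bop q n tau i g).
Proof.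
have sF j : smooth U (FF q n j g) by exact: FF_smooth.
apply: smoothB => //; last by apply: smoothM => //; exact: smooth_derive1.
apply: smoothD => //; apply: smoothM => //; apply: smoothZ => //.
  exact: smooth_derive1n.
exact: smooth_derive1.
Qed.

Lemma Zop_smooth i : smooth U (Zop q n al tau i g).
Proof.
apply: smoothB => //; last exact: Bop_smooth.
by apply: FF_smooth => //; exact: Mop_smooth.
Qed.

Lemma FF_der t i : U t ->
  derive1 (FF q n i g) t = FF q n i.+1 g t - kap n i * q t * FF q n i.-1 g t.
Proof. by move=> Ut; rewrite FFS addrK. Qed.

Lemma Zop0 t : U t -> Zop q n al tau 0 g t = (al t - n%:R / 2 * derive1 tau t) * g t.
Proof.
by move=> Ut; rewrite /Zop /Bop /Mop /FF kap0 mulr0n !mul0r subr0 add0r; ring.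
Qed.

(** The weights in [Bop] are those for which the terms in [tau], [tau'] and [tau''] cancel, so the
    defect inherits the recursion of [FF] with a source proportional to [theta q tau]. *)
Lemma ZopS t i : (i <= n)%N -> U t -> Zop q n al tau i.+1 g t =
  derive1 (Zop q n al tau i g) t + kap n i * q t * Zop q n al tau i.-1 g t
  + kap n i / 2 * theta q tau t * FF q n i.-1 g t.
Proof.
move=> le_in Ut.
have sF j : smooth U (FF q n j g) by exact: FF_smooth.
have dF j : is_derive t 1 (FF q n j g) (derive1 (FF q n j g) t).
  exact: smooth_is_derive1 (sF j) Ut.
have ddF : is_derive t 1 (derive1 (FF q n i g)) (derive1n 2 (FF q n i g) t).
  exact: smooth_is_derive1 (smooth_derive1 (sF i)) Ut.
have dG : is_derive t 1 (FF q n i (Mop al tau g)) (derive1 (FF q n i (Mop al tau g)) t).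
  by apply: smooth_is_derive1 Ut; apply: FF_smooth => //; exact: Mop_smooth.
have dt k : is_derive t 1 (derive1n k tau) (derive1n k.+1 tau t).
  exact: smooth_is_derive1 (smooth_derive1n k stau) Ut.
have dq : is_derive t 1 q (derive1 q t) by exact: smooth_is_derive1 sq Ut.
have E1 := derive1_val (dB dG (dB (dD (dM (dZ (kap n i / 2) (dt 2)) (dF i.-1))
  (dM (dZ (n%:R / 2 - i%:R) (dt 1%N)) (dF i))) (dM (dt 0%N) ddF))).
have E2 := derive1_val (dD ddF (dM (dZ (kap n i) dq) (dF i.-1))).
rewrite [derive1 (Zop _ _ _ _ _ _) t]E1 /Zop FFS [Bop q n tau i.+1 g t]/Bop.
have -> : derive1 (FF q n i.+1 g) t = derive1n 2 (FF q n i g) t +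
    (kap n i * derive1 q t * FF q n i.-1 g t + kap n i * q t * derive1 (FF q n i.-1 g) t).
  by rewrite -E2; congr (derive1 _ t); apply/funext => x; rewrite FFS.
rewrite /Bop /theta succnK (FFS q n i g) kapS // -(natr1 i).
apply: Zop_identity.
case: i le_in {sF dF ddF dG E1 E2} => [|i] le_in; [by left|right].
by rewrite !succnK -natr1 addrK; split=> //; exact: FF_der.
Qed.

Lemma Zop_const (c : K) : (forall t, U t -> al t = n%:R / 2 * derive1 tau t + c) ->
  (forall t, U t -> theta q tau t = 0) -> forall i, (i <= n.+1)%N -> forall t, U t ->
  Zop q n al tau i g t = c * FF q n i g t.
Proof.
move=> alE th0 i hi.
pose Y j := (j <= n.+1)%N -> forall t, U t -> Zop q n al tau j g t = c * FF q n j g t.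
suff [] : Y i /\ Y i.+1 by move=> h _; exact: h.
have Y0 : Y 0%N by move=> _ t Ut; rewrite Zop0 // alE // /FF; ring.
have step j : Y j -> Y j.-1 -> Y j.+1.
  move=> Yj Yj1 hj t Ut; rewrite ZopS // th0 // mulr0 mul0r addr0.
  have h := Yj (ltnW hj); rewrite (derive1_ext oU Ut h) Yj1 //; last first.
    by apply: leq_trans (leq_pred j) _; exact: ltnW.
  by rewrite (@der1Z _ U) ?FFS //; [ring|exact: FF_smooth].
by elim: i {hi} => [|i [I1 I2]]; split=> //; exact: step.
Qed.

Variables (d : nat -> K -> K) (sd : forall j, smooth U (d j)).
Hypothesis dn0 : forall t, U t -> d n.+1 t = 0.

(** Each [FF q n j (Mop al tau g)] is replaced by [Zop + Bop]. The part of [Bop] with [FF q n j.-1]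
    shifts the index and brings in [d j.+1]; at the upper end of the shifted sum the term vanishes
    by [dn0]. *)
Lemma Pop_Mop t : U t -> Pop q n d (Mop al tau g) t =
  (n%:R / 2 - n.+1%:R) * derive1 tau t * Pop q n d g t - tau t * derive1 (Pop q n d g) t
  + \sum_(j < n.+1) eop n d tau j t * FF q n j g t
  + (Zop q n al tau n.+1 g t + \sum_(j < n.+1) d j t * Zop q n al tau j g t).
Proof.
move=> Ut.
have sF j : smooth U (FF q n j g) by exact: FF_smooth.
have E j : FF q n j (Mop al tau g) t = Zop q n al tau j g t + Bop q n tau j g t.
  by rewrite /Zop subrK.
have dP : derive1 (Pop q n d g) t = derive1 (FF q n n.+1 g) t +
    \sum_(j < n.+1) (derive1 (d j) t * FF q n j g t + d j t * derive1 (FF q n j g) t).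
  rewrite (@der1D _ U) //; last first.
    by apply: smooth_sum => // j _; exact: smoothM.
  rewrite (@der1sum _ U) //; last by move=> j; exact: smoothM.
  by congr (_ + _); apply: eq_bigr => j _; rewrite (@der1M _ U).
rewrite {1}/Pop E dP /Pop; under eq_bigr do rewrite E mulrDr.
rewrite big_split /=.
(* At the top order the term of [Bop] with [tau''] disappears, so [FF q n n.+1] contributes only
   multiples of itself and of its derivative. *)
have kn : kap n n.+1 = 0 :> K by rewrite /kap subnn muln0.
have -> : \sum_(j < n.+1) d j t * Bop q n tau j g t =
  \sum_(j < n.+1) ((n%:R / 2 - j%:R) * derive1 tau t * (d j t * FF q n j g t)
     - tau t * (d j t * derive1 (FF q n j g) t)) +
  \sum_(j < n.+1) kap n j.+1 / 2 * derive1n 2 tau t * d j.+1 t * FF q n j g t.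
  pose a j := kap n j / 2 * derive1n 2 tau t * d j t * FF q n j.-1 g t.
  have -> : \sum_(j < n.+1) kap n j.+1 / 2 * derive1n 2 tau t * d j.+1 t * FF q n j g t
      = \sum_(j < n.+1) a j.
    rewrite [RHS]big_ord_recl [LHS]big_ord_recr /= dn0 // /a kap0 !mulr0 !mul0r addr0 add0r.
    by apply: eq_bigr.
  by rewrite -big_split /=; apply: eq_bigr => j _; rewrite /a /Bop; ring.
rewrite {1}/Bop kn !mul0r add0r /eop.
have -> : \sum_(j < n.+1) (tau t * derive1 (d j) t + (n.+1%:R - j%:R) * derive1 tau t * d j t
  + kap n j.+1 / 2 * derive1n 2 tau t * d j.+1 t) * FF q n j g t =
  \sum_(j < n.+1) (tau t * derive1 (d j) t + (n.+1%:R - j%:R) * derive1 tau t * d j t)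
     * FF q n j g t +
  \sum_(j < n.+1) kap n j.+1 / 2 * derive1n 2 tau t * d j.+1 t * FF q n j g t.
  by rewrite -big_split /=; apply: eq_bigr => j _; rewrite mulrDl.
have -> : \sum_(j < n.+1) ((n%:R / 2 - j%:R) * derive1 tau t * (d j t * FF q n j g t)
     - tau t * (d j t * derive1 (FF q n j g) t)) =
  (n%:R / 2 - n.+1%:R) * derive1 tau t * (\sum_(j < n.+1) d j t * FF q n j g t)
  - tau t * (\sum_(j < n.+1) (derive1 (d j) t * FF q n j g t + d j t * derive1 (FF q n j g) t))
  + \sum_(j < n.+1) (tau t * derive1 (d j) t + (n.+1%:R - j%:R) * derive1 tau t * d j t)
     * FF q n j g t.
  rewrite !mulr_sumr -sumrB -big_split /=; apply: eq_bigr => j _; ring.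
ring.
Qed.

Lemma Pop_sym (c : K) : (forall t, U t -> al t = n%:R / 2 * derive1 tau t + c) ->
  (forall t, U t -> theta q tau t = 0) ->
  (forall j t, U t -> eop n d tau j t = 0) -> forall t, U t ->
  Pop q n d (Mop al tau g) t =
    ((n%:R / 2 - n.+1%:R) * derive1 tau t + c) * Pop q n d g t
    - tau t * derive1 (Pop q n d g) t.
Proof.
move=> alE th0 e0 t Ut; rewrite Pop_Mop // [X in _ + X + _]big1 ?addr0; last first.
  by move=> j _; rewrite e0 // mul0r.
rewrite (Zop_const alE th0) //.
under eq_bigr => j _ do rewrite (Zop_const alE th0 (ltnW (ltn_ord j))) // mulrCA.
by rewrite -mulr_sumr /Pop; ring.
Qed.

End Local.
End Operator.

(** * Kernels of the normal form *)
Section Solutions.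
Context {R : realType} {K : numFieldType} {pk : kpkg R K}.
Local Notation nm := (@nm R K pk _).
Local Notation io := (io pk).
Implicit Types (g h w : K -> K) (U : set K).

Lemma const_of_der0 (D : set K) g : domain D -> (forall t, D t -> is_derive t 1 g 0) ->
  forall s t, D s -> D t -> g s = g t.
Proof.
move=> domD dg s t Ds Dt; apply/eqP; rewrite -subr_eq0 -(nm_eq0 (pk := pk)).
rewrite eq_le nm_ge0 andbT -[X in _ <= X](mul0r (nm (s - t))).
apply: MVT0 => x hx; first by have [] := dg _ (domain_seg domD Dt Ds hx).
by rewrite (derive1_val (dg _ (domain_seg domD Dt Ds hx))) nm0.
Qed.

Lemma scalar_unique (D : set K) t0 (f chi : K -> K) : domain D -> D t0 ->
  (forall t, D t -> {for t, continuous f}) ->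
  (forall t, D t -> is_derive t 1 chi (f t * chi t)) -> chi t0 = 0 ->
  forall t, D t -> chi t = 0.
Proof.
move=> domD D0 cf dchi chi0 t Dt.
have dX (i : 'I_1) u : D u -> is_derive u 1 chi (\sum_(j < 1) f u * chi u).
  by move=> Du; apply: dval (dchi u Du) _; rewrite big_ord1.
have H := @lin_unique R K pk 1 (fun _ _ => f) (fun=> chi) D t0 domD D0 (fun _ _ => cf) dX.
by apply: (H (fun=> chi0) ord0).
Qed.

(** A zero of the solution would, by uniqueness from that point, force its value at [t0] to
    vanish. *)
Lemma scalar_exists (D : set K) t0 (f : K -> K) : domain D -> D t0 -> smooth D f ->
  exists chi : K -> K, [/\ chi t0 = 1, smooth D chi, forall t, D t -> chi t != 0 &
    forall t, D t -> is_derive t 1 chi (f t * chi t)].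
Proof.
move=> domD D0 sf.
have [X [X0 sX dX]] := @lin_exists R K pk 1 (fun _ _ => f) (fun _ _ => 0) D t0 (fun=> 1)
  domD D0 (fun _ _ => sf) (fun _ => smooth_cst D (0 : K)).
have dX' t : D t -> is_derive t 1 (X ord0) (f t * X ord0 t).
  by move=> Dt; apply: dval (dX ord0 t Dt) _; rewrite big_ord1 addr0.
exists (X ord0); split=> // t Dt; apply/eqP => Xt0.
have := scalar_unique domD Dt (fun u Du => smooth_cont sf Du) dX' Xt0 D0.
by move=> X00; have := oner_neq0 K; rewrite -(X0 ord0) X00 eqxx.
Qed.

Lemma pick_sum m (a : nat) (X : nat -> K) :
  \sum_(j < m) (j == a :> nat)%:R * X j = if (a < m)%N then X a else 0.
Proof.
case: ltnP => am.
  rewrite (bigD1 (Ordinal am)) //= eqxx mul1r big1 ?addr0 // => j ja.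
  by rewrite -val_eqE /= in ja; rewrite (negbTE ja) mul0r.
rewrite big1 // => j _; case: eqP => [ja|]; last by rewrite mul0r.
by have := ltn_ord j; rewrite ja ltnNge am.
Qed.

(** The companion matrix of [Pop q n d] in the coordinates [FF q n 0, ..., FF q n n]. In the last
    row the first indicator falls outside the range of columns and the coefficients [d] take its
    place. *)
Definition Pmx (q : K -> K) n (d : nat -> K -> K) (i j : nat) (t : K) : K :=
  (j == i.+1 :> nat)%:R + (j.+1 == i :> nat)%:R * (- (kap n i * q t))
  + (i == n :> nat)%:R * (- d j t).

Lemma Pmx_sum q n d (X : nat -> K) i t : (i < n.+1)%N ->
  \sum_(j < n.+1) Pmx q n d i j t * X j =
  (if (i < n)%N then X i.+1 else - \sum_(j < n.+1) d j t * X j) - kap n i * q t * X i.-1.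
Proof.
move=> hi; pose c (i : nat) := - (kap n i * q t).
have -> : \sum_(j < n.+1) Pmx q n d i j t * X j =
  \sum_(j < n.+1) (j == i.+1 :> nat)%:R * X j +
  c i * (\sum_(j < n.+1) (j.+1 == i :> nat)%:R * X j)
  - (i == n :> nat)%:R * \sum_(j < n.+1) d j t * X j.
  rewrite !mulr_sumr -big_split -sumrB /=; apply: eq_bigr => j _.
  by rewrite /Pmx /c; ring.
rewrite pick_sum ltnS.
have -> : c i * (\sum_(j < n.+1) (j.+1 == i :> nat)%:R * X j) = c i * X i.-1.
  case: i hi => [|i] hi; first by rewrite /c kap0 !mul0r oppr0 !mul0r.
  by congr (_ * _); rewrite -[LHS]/(\sum_(j < n.+1) (j == i :> nat)%:R * X j) pick_sum (ltnW hi).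
case: (ltngtP i n) => [h|h|h].
- by rewrite mul0r subr0 /c mulNr.
- by move: hi; rewrite ltnS leqNgt h.
- by rewrite mul1r /c add0r addrC mulNr.
Qed.

Lemma Pmx_smooth (D : set K) q n d i j : open D -> smooth D q -> (forall j, smooth D (d j)) ->
  smooth D (Pmx q n d i j).
Proof.
move=> oD sq sd; apply: smoothD => //; first apply: smoothD => //.
- exact: smooth_cst.
- by apply: smoothZ => //; apply: smoothN => //; exact: smoothZ.
- by apply: smoothZ => //; apply: smoothN => //.
Qed.

Lemma Pop_exists (D : set K) t0 q n d (b : K -> K) (x0 : nat -> K) :
  domain D -> D t0 -> smooth D q -> (forall j, smooth D (d j)) -> smooth D b ->
  exists g, [/\ smooth D g, forall i, (i < n.+1)%N -> FF q n i g t0 = x0 i &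
    forall t, D t -> Pop q n d g t = b t].
Proof.
move=> domD D0 sq sd sb; have [_ oD _] := domD.
have [X [X0 sX dX]] := @lin_exists R K pk n.+1 (fun i j => Pmx q n d i j)
  (fun i t => (i == n :> nat)%:R * b t) D t0 (fun i => x0 i) domD D0
  (fun i j => Pmx_smooth n i j oD sq sd) (fun i => smoothZ _ oD sb).
pose Y k := X (inord k).
have dY i t : (i < n.+1)%N -> D t -> is_derive t 1 (Y i)
    ((if (i < n)%N then Y i.+1 t else - \sum_(j < n.+1) d j t * Y j t)
       - kap n i * q t * Y i.-1 t + (i == n :> nat)%:R * b t).
  move=> hi Dt; apply: dval (dX (inord i) t Dt) _; rewrite inordK //; congr (_ + _).
  rewrite -(Pmx_sum q d (fun j => Y j t)) //; apply: eq_bigr => j _.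
  by rewrite /Y inord_val.
(* The rows of the system are the recursion of [FF], so its components are the jets of the first
   one. *)
pose E i := (i < n.+1)%N -> forall t, D t -> FF q n i (Y 0%N) t = Y i t.
have step i : E i -> E i.-1 -> E i.+1.
  move=> Ei Ei1 hi t Dt; rewrite FFS (derive1_ext oD Dt (Ei (ltnW hi))) Ei1 //; last first.
    by apply: leq_ltn_trans (leq_pred i) _; exact: ltnW.
  rewrite (derive1_val (dY i t (ltnW hi) Dt)) -ltnS hi.
  by move: hi; rewrite ltnS => hi; rewrite (ltn_eqF hi) mul0r addr0 subrK.
have FE i : E i.
  have [] // : E i /\ E i.+1.
  have E0 : E 0%N by [].
  by elim: i => [|i [I1 I2]]; split=> //; exact: step.
exists (Y 0%N); split=> [|i hi|t Dt]; first exact: sX.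
  by rewrite FE // /Y X0 inordK.
rewrite /Pop FFS (derive1_ext oD Dt (FE n (ltnSn n))) (FE n.-1) //; last first.
  by rewrite ltnS leq_pred.
rewrite (derive1_val (dY n t (ltnSn n) Dt)) ltnn eqxx mul1r.
under [X in _ + X = _]eq_bigr => j _ do rewrite (FE j (ltn_ord j)) //.
by ring.
Qed.

Lemma Pop_unique (U : set K) t0 q n d g : domain U -> U t0 ->
  smooth U q -> (forall j, smooth U (d j)) -> smooth U g ->
  (forall i, (i < n.+1)%N -> FF q n i g t0 = 0) ->
  (forall t, U t -> Pop q n d g t = 0) -> forall t, U t -> g t = 0.
Proof.
move=> domU U0 sq sd sg g0 Pg t Ut; have [_ oU _] := domU.
have sF i : smooth U (FF q n i g) by exact: FF_smooth.
have cA (i j : 'I_n.+1) u : U u -> {for u, continuous (Pmx q n d i j)}.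
  by move=> Uu; apply: smooth_cont Uu; exact: Pmx_smooth.
have dX (i : 'I_n.+1) u : U u -> is_derive u 1 (FF q n i g)
    (\sum_(j < n.+1) Pmx q n d i j u * FF q n j g u).
  move=> Uu; apply: dval (smooth_is_derive1 (sF i) Uu) _.
  rewrite (Pmx_sum q d (fun j => FF q n j g u)) // (@FF_der K U q n g u i Uu).
  case: ltnP => // hi; have -> : (i : nat) = n.
    by apply/eqP; rewrite eqn_leq hi -ltnS ltn_ord.
  by congr (_ - _); apply/eqP; rewrite -addr_eq0; apply/eqP; exact: Pg.
have H := @lin_unique R K pk n.+1 (fun i j => Pmx q n d i j) (fun i => FF q n i g) U t0
  domU U0 cA dX.
by apply: (H _ ord0) => // i; rewrite g0.
Qed.

Lemma FF_sum q n i U m (c : 'I_m -> K) (G : 'I_m -> K -> K) : open U -> smooth U q ->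
  (forall j, smooth U (G j)) -> forall t, U t ->
  FF q n i (fun t => \sum_(j < m) c j * G j t) t = \sum_(j < m) c j * FF q n i (G j) t.
Proof.
move=> oU sq; elim: m c G => [|m IH] c G sG t Ut.
  have := @FF_lin K q n i U (fun=> 0) (fun=> 0) 0 0 oU sq (smooth_cst _ _) (smooth_cst _ _) t Ut.
  rewrite !mul0r addr0 => E; rewrite [RHS]big_ord0 -[RHS]E.
  by apply: (FF_ext _ _ _ oU) => // u Uu; rewrite big_ord0 ?mul0r ?addr0.
pose G' j := G (widen_ord (leqnSn m) j); pose c' j := c (widen_ord (leqnSn m) j).
have sG' : smooth U (fun t => \sum_(j < m) c' j * G' j t).
  by apply: smooth_sum => // j _; exact: (smoothZ _ oU (sG _)).
have := @FF_lin K q n i U _ (G ord_max) 1 (c ord_max) oU sq sG' (sG _) t Ut.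
rewrite (IH c' G' (fun j => sG _) t Ut) mul1r => E; rewrite [RHS]big_ord_recr -[RHS]E.
by apply: (FF_ext _ _ _ oU) => // u Uu; rewrite big_ord_recr mul1r.
Qed.

Lemma Pop_sum q n d U m (c : 'I_m -> K) (G : 'I_m -> K -> K) : open U -> smooth U q ->
  (forall j, smooth U (G j)) -> forall t, U t ->
  Pop q n d (fun t => \sum_(j < m) c j * G j t) t = \sum_(j < m) c j * Pop q n d (G j) t.
Proof.
move=> oU sq sG t Ut; rewrite /Pop (FF_sum n n.+1 c oU sq sG Ut).
have -> : \sum_(i < n.+1) d i t * FF q n i (fun t => \sum_(j < m) c j * G j t) t =
    \sum_(i < n.+1) \sum_(j < m) d i t * (c j * FF q n i (G j) t).
  by apply: eq_bigr => i _; rewrite (FF_sum n i c oU sq sG Ut) mulr_sumr.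
rewrite exchange_big -big_split /=; apply: eq_bigr => j _; rewrite mulrDr; congr (_ + _).
by rewrite mulr_sumr; apply: eq_bigr => i _; ring.
Qed.

Lemma Pop_lin q n d U g h (a b : K) : open U -> smooth U q -> smooth U g -> smooth U h ->
  forall t, U t -> Pop q n d (fun t => a * g t + b * h t) t =
    a * Pop q n d g t + b * Pop q n d h t.
Proof.
move=> oU sq sg sh t Ut; rewrite /Pop (FF_lin n n.+1 a b oU sq sg sh Ut).
under eq_bigr => j _ do rewrite (FF_lin n j a b oU sq sg sh Ut) mulrDr.
by rewrite big_split /= !mulrDr !mulr_sumr addrACA; congr (_ + _ + (_ + _));
  apply: eq_bigr => j _; ring.
Qed.

Lemma Pop_ext q n d U g h : open U -> (forall t, U t -> g t = h t) ->
  forall t, U t -> Pop q n d g t = Pop q n d h t.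
Proof.
move=> oU gh t Ut; rewrite /Pop (FF_ext q n n.+1 oU gh Ut); congr (_ + _).
by apply: eq_bigr => j _; rewrite (FF_ext q n j oU gh Ut).
Qed.

Lemma thetaE q tau U : open U -> smooth U q -> smooth U tau ->
  forall t, U t -> theta q tau t = Pop q 2 (fun _ _ => 0) tau t.
Proof.
move=> oU sq st t Ut; rewrite /Pop big1 ?addr0; last by move=> j _; rewrite mul0r.
rewrite FFS /theta; have -> : derive1 (FF q 2 2 tau) t =
    derive1n 3 tau t + (2 * derive1 q t * tau t + 2 * q t * derive1 tau t).
  rewrite -[RHS](derive1_val (dD
    (smooth_is_derive1 (smooth_derive1n 2 st) Ut)
    (dM (dZ 2 (smooth_is_derive1 sq Ut)) (smooth_is_derive1 st Ut)))).
  by congr (derive1 _ t); apply/funext => x; rewrite FFS /kap /FF.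
by rewrite /kap /FF /= -[(2 * (3 - 2))%:R]/(2%:R); ring.
Qed.

(** By uniqueness for the third-order equation a nonzero solution has some nonvanishing derivative
    at [t]; Taylor's formula with the first of these keeps [tau] away from zero near [t]. *)
Lemma theta_isolated q tau D t1 t : domain D -> smooth D q -> smooth D tau ->
  (forall t, D t -> theta q tau t = 0) -> D t1 -> tau t1 != 0 -> D t ->
  exists2 e : R, 0 < e & forall u, nm (u - t) < e -> u != t -> tau u != 0.
Proof.
move=> domD sq st th D1 t10 Dt; have [_ oD _] := domD.
have [m mP] : exists m, derive1n m tau t != 0.
  apply: contrapT => nm0; have z m : derive1n m tau t = 0.
    by apply/eqP; apply/negPn/negP => h; apply: nm0; exists m.
  have F0 i : (i < 3)%N -> FF q 2 i tau t = 0.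
    case: i => [|[|[|i]]] // _; first exact: (z 0%N).
    - exact: (z 1%N).
    - by rewrite FFS /= -[FF q 2 0 tau t]/(derive1n 0 tau t) z mulr0 addr0; exact: (z 2).
  have := Pop_unique domD Dt sq (fun j => smooth_cst D (0 : K)) st F0 _ D1.
  by move=> H; move: t10; rewrite H ?eqxx // => u Du; rewrite -(thetaE oD sq st) // th.
have exP : exists m, (fun m => derive1n m tau t != 0) m by exists m.
case: (ex_minnP exP) => k kP kmin {m mP exP}.
have jets i : (i < k)%N -> derive1n i tau t = 0.
  by move=> ik; apply/eqP; apply/negPn/negP => /kmin; rewrite leqNgt ik.
set c := derive1n k tau t / k`!%:R.
have c0 : 0 < nm c.
  by rewrite nm_gt0 mulf_neq0 // invr_eq0 pnatr_eq0 -lt0n fact_gt0.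
have [e e0 h] := taylor oD Dt st jets (divr_gt0 c0 (ltr0n R 2)).
exists e => // u ue ut; apply/eqP => u0; have := h u ue.
rewrite u0 sub0r nmN nmM nmX -/c; apply/negP; rewrite -ltNge.
have x0 : 0 < nm (u - t) ^+ k by rewrite exprn_gt0 // nm_gt0 subr_eq0.
by rewrite ltr_pM2r // ltr_pdivrMr // ltr_pMr // ltr1n.
Qed.

(** Descending induction on [j]: once [d j.+1 = 0], the equation for [d j] says that
    [tau ^+ (n + 1 - j) * d j] is constant. The constant is zero because [tau t0 = 0], so [d j]
    vanishes wherever [tau] does not, and by continuity also at the isolated zeros of [tau]. *)
Lemma rigidity (D : set K) q n d tau t0 t1 : domain D -> smooth D q ->
  (forall j, smooth D (d j)) -> (forall j, (n.-1 <= j)%N -> forall t, D t -> d j t = 0) ->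
  smooth D tau -> (forall t, D t -> theta q tau t = 0) ->
  (forall j t, D t -> eop n d tau j t = 0) ->
  D t0 -> tau t0 = 0 -> D t1 -> tau t1 != 0 -> forall j t, D t -> d j t = 0.
Proof.
move=> domD sq sd dn st th e0 D0 tau0 D1 tau1; have [_ oD _] := domD.
suff H m j : (n.-1 <= j + m)%N -> forall t, D t -> d j t = 0.
  by move=> j; apply: (H n.-1); exact: leq_addl.
elim: m j => [|m IH] j hj; first by apply: dn; rewrite addn0 in hj.
have dS t : D t -> d j.+1 t = 0 by apply: IH; rewrite addSnnS.
have [jn|jn] := leqP n.-1 j; first exact: dn.
have jr : (j < n.+1)%N.
  by apply: leq_trans jn _; apply: leq_trans (leq_pred n) _; exact: leqnSn.
pose k := (n.+1 - j)%N; have k0 : (0 < k)%N by rewrite subn_gt0.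
have kE : k%:R = n.+1%:R - j%:R :> K by rewrite natrB // ltnW.
have dW t : D t -> is_derive t 1 (fun t => tau t ^+ k * d j t) 0.
  move=> Dt; apply: dval (dM (dX k (smooth_is_derive1 st Dt)) (smooth_is_derive1 (sd j) Dt)) _.
  have := e0 j t Dt; rewrite /eop dS // mulr0 addr0 -kE -(prednK k0) exprS => E.
  transitivity (tau t ^+ k.-1 * (tau t * derive1 (d j) t + k.-1.+1%:R * derive1 tau t * d j t)).
    by rewrite [k.-1.+1.-1]/=; ring.
  by rewrite E mulr0.
have W t : D t -> tau t != 0 -> d j t = 0.
  move=> Dt tt; have := const_of_der0 domD dW Dt D0.
  rewrite tau0 expr0n (gtn_eqF k0) mul0r => /eqP; rewrite mulf_eq0 expf_eq0.
  by rewrite (negbTE tt) andbF orFb => /eqP.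
move=> t Dt; have [tt|tt] := eqVneq (tau t) 0; last exact: W.
have [e e0' iso] := theta_isolated domD sq st th D1 tau1 Dt.
have [e1 e10 hD] := (openPK (pk := pk) _).1 oD _ Dt.
apply: nm_small => x x0.
have [e2 e20 hc] := (contPK (pk := pk) _ _).1 (smooth_cont (sd j) Dt) x x0.
pose y := Num.min e (Num.min e1 e2) / 2.
have y0 : 0 < y by rewrite divr_gt0 // !lt_min e0' e10.
have : y < Num.min e (Num.min e1 e2).
  by rewrite ltr_pdivrMr // ltr_pMr ?ltr1n // !lt_min e0' e10.
rewrite !lt_min => /and3P[ye ye1 ye2].
have E : t + io y - t = io y by ring.
have ny : nm (t + io y - t) = y by rewrite E nm_io gtr0_norm.
have Dy : D (t + io y) by apply: hD; rewrite ny.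
have : d j (t + io y) = 0.
  apply: W => //; apply: iso; first by rewrite ny.
  by rewrite -subr_eq0 -(nm_eq0 (pk := pk)) ny gt_eqF.
move=> dy; have := hc (t + io y); rewrite ny dy sub0r nmN => /(_ ye2).
exact: ltW.
Qed.

End Solutions.

(** * The determining equations for tau *)
Section Determining.
Context {R : realType} {K : numFieldType} {pk : kpkg R K}.
Local Notation nm := (@nm R K pk _).
Local Notation io := (io pk).
Implicit Types (g h w : K -> K) (U : set K).
Let z0 : K -> K := fun=> 0.

Lemma sig_neq0 n : (0 < n)%N -> sig n n.+1 != 0 :> K.
Proof.
move=> n0; rewrite /sig /kap -natr_sum pnatr_eq0 -lt0n.
rewrite lt0n sum_nat_eq0 negb_forall; apply/existsP.
have h1 : (1 < n.+1)%N by [].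
by exists (Ordinal h1); rewrite /= mul1n subn1 -lt0n.
Qed.

(** The factor [rho] removes the coefficient of order [n], the function [q] accounts for the one of
    order [n - 1], and the rest, re-expanded in [FF q n], is [d]. *)
Lemma normal_form (D : set K) n (a : nat -> K -> K) : domain D -> (0 < n)%N ->
  (forall i, smooth D (a i)) -> exists (rho q : K -> K) (d : nat -> K -> K),
  [/\ smooth D rho, forall t, D t -> rho t != 0, smooth D q, forall j, smooth D (d j) &
    (forall j, (n.-1 <= j)%N -> d j = fun=> 0) /\
    forall U g, open U -> U `<=` D -> smooth U g -> forall t, U t ->
      derive1n n.+1 (fun t => rho t * g t) t +
        \sum_(i < n.+1) a i t * derive1n i (fun t => rho t * g t) t =
      rho t * Pop q n d g t].
Proof.
move=> domD n0 sa; have [[t0 D0] oD _] := domD.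
have sz : smooth D z0 by exact: smooth_cst.
have n1 : (n.+1%:R : K) != 0 by rewrite pnatr_eq0.
(* [rho' = - a_n rho / (n + 1)] cancels [a_n rho] against the second Leibniz term [(n + 1) rho']. *)
have [rho [_ srho rho0 drho]] := scalar_exists domD D0
  (smoothN oD (smoothZ (n.+1%:R^-1) oD (sa n))).
pose LG i g t := derive1n i (fun t => rho t * g t) t.
pose Z1 k g t := LG k g t - rho t * derive1n k g t.
have L1 k : low D z0 0 k (Z1 k).
  have h := leibniz_low oD k srho.
  case: k h => [|k] h.
    by apply: low_ext h => U g _ _ _ t _; rewrite /Z1 /LG /= !mul0r subr0.
  have h' := low_mul oD (smoothZ (k.+1)%:R oD (smooth_derive1 srho)) (low_d1n D 0 (ltnSn k)).
  apply: low_ext (low_add oD (low_mono (leqnSn k) h) h') => U g _ _ _ t _.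
  by rewrite /Z1 /LG /=; ring.
have L2 k : low D z0 0 k.+1 (LG k).
  have h := low_mul oD srho (low_d1n D 0 (ltnSn k)).
  apply: low_ext (low_add oD (low_mono (leqnSn k) (L1 k)) h) => U g _ _ _ t _.
  by rewrite /Z1; ring.
pose Z g t := LG n.+1 g t + \sum_(i < n.+1) a i t * LG i g t - rho t * derive1n n.+1 g t.
have LZ : low D z0 0 n Z.
  have h1 := leibniz_low oD n.+1 srho.
  have h2 : low D z0 0 n (fun g t => \sum_(i < n) a i t * LG i g t).
    apply: low_sum => // i; apply: low_mul => //.
    by apply: low_mono (L2 i).
  have h3 := low_mul oD (sa n) (L1 n).
  apply: low_ext (low_add oD (low_add oD h1 h2) h3) => U g oU UD sg t Ut.
  have e : derive1 rho t = - (n.+1%:R^-1 * a n t) * rho t.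
    exact: derive1_val (drho t (UD t Ut)).
  by rewrite /Z /Z1 /LG big_ord_recr /= e; field.
have [w [sw hw]] := LZ.
pose b := w n.-1; pose s : K := sig n n.+1.
have s0 : s != 0 := sig_neq0 n0.
(* After division by [rho] the coefficient of order [n - 1] is [b / rho]; it has to equal
   [sig n n.+1 * q]. *)
pose q t := b t * (rho t * s)^-1.
have sq : smooth D q.
  apply: smoothM => //; first exact: sw.
  apply: smoothV => //; first by move=> t Dt; rewrite mulf_neq0 ?rho0.
  by apply: smoothM => //; exact: smooth_cst.
have h1 := low_mul oD (smoothN oD srho) (FF_d1n_low oD n n.+1 sq).
have h2 : low D z0 0 n.-1 (fun g t => \sum_(k < n.-1) w k t * derive1n k g t).
  by apply: low_sum => // k; apply: low_mul => //; exact: low_d1n.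
have h3 : low D z0 0 n.-1 (fun g t => LG n.+1 g t + \sum_(i < n.+1) a i t * LG i g t
    - rho t * FF q n n.+1 g t).
  apply: low_ext (low_add oD h1 h2) => U g oU UD sg t Ut.
  have E := hw U g oU UD sg t Ut.
  have -> : LG n.+1 g t + \sum_(i < n.+1) a i t * LG i g t - rho t * FF q n n.+1 g t =
    Z g t - rho t * (FF q n n.+1 g t - derive1n n.+1 g t) by rewrite /Z; ring.
  have E2 (m : nat) (F : nat -> K) : (0 < m)%N ->
    \sum_(k < m) F k = \sum_(k < m.-1) F k + F m.-1 by case: m => // m _; rewrite big_ord_recr.
  rewrite E (E2 n (fun k => w k t * FF z0 0 k g t) n0) FF0 /q -/b -/s.
  under eq_bigr do rewrite FF0.
  by rewrite /=; field; rewrite s0 rho0 //; exact: UD.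
have [d [sd hd]] := low_mul oD (smoothV oD rho0 srho) (low_basis oD sq n sz h3).
exists rho, q, (fun j => if (j < n.-1)%N then d j else fun=> 0); split=> //.
  by move=> j; case: ifP => _ //; exact: smooth_cst.
split=> [j nj|U g oU UD sg t Ut]; first by rewrite ltnNge nj.
have := hd U g oU UD sg t Ut; rewrite /Pop.
have -> : \sum_(j < n.+1) (if (j < n.-1)%N then d j else fun=> 0) t * FF q n j g t =
    \sum_(j < n.-1) d j t * FF q n j g t.
  have le1 : (n.-1 <= n.+1)%N by apply: leq_trans (leq_pred n) (leqnSn n).
  rewrite [RHS](big_ord_widen n.+1 (fun j => d j t * FF q n j g t) le1) [RHS]big_mkcond.
  by apply: eq_bigr => j _; case: ifP => // _; rewrite mul0r.
have r0 := rho0 t (UD t Ut).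
move=> E; rewrite mulrDr -E mulrA mulfV // mul1r /LG; ring.
Qed.

Lemma low_eval D q n m Z g t : low D q n m Z -> open D -> smooth D g -> D t ->
  (forall k, (k < m)%N -> FF q n k g t = 0) -> Z g t = 0.
Proof.
move=> [w [sw h]] oD sg Dt z; rewrite (h D) // big1 // => k _.
by rewrite z ?mulr0.
Qed.

(** * Leading coefficients of the defect *)

Section Necessity.
Variables (D : set K) (domD : domain D) (q : K -> K) (n : nat) (d : nat -> K -> K).
Hypotheses (sq : smooth D q) (sd : forall j, smooth D (d j)) (n2 : (2 <= n)%N).
Hypothesis dn : forall j, (n.-1 <= j)%N -> d j = fun=> 0.
Variables (al tau : K -> K) (sal : smooth D al) (stau : smooth D tau).
Let kp t := al t - n%:R / 2 * derive1 tau t.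
Let oD : open D. Proof. by have [] := domD. Qed.
Let skp : smooth D kp.
Proof. by apply: smoothB => //; apply: smoothZ => //; exact: smooth_derive1. Qed.
Let sth : smooth D (theta q tau).
Proof.
apply: smoothD => //; first apply: smoothD => //.
- exact: smooth_derive1n.
- by apply: smoothM => //; [exact: smoothZ|exact: smooth_derive1].
- by apply: smoothM => //; apply: smoothZ => //; exact: smooth_derive1.
Qed.
Let Zo := Zop q n al tau.

Let sub1 U : U `<=` D -> [/\ smooth U q, smooth U al & smooth U tau].
Proof. by move=> UD; split; exact: smooth_sub UD _. Qed.

Lemma Zop_low i : (i <= n.+1)%N -> low D q n i.+1 (Zo i).
Proof.
move=> hi; pose Y j := (j <= n.+1)%N -> low D q n j.+1 (Zo j).
suff [] : Y i /\ Y i.+1 by move=> h _; exact: h.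
have Y0 : Y 0%N.
  move=> _; apply: low_ext (low_mul oD skp (low_FF D q n (ltnSn 0))).
  move=> U g oU UD sg t Ut; have [sq' sal' st'] := sub1 UD.
  by rewrite /Zo (@Zop0 K U) // /FF /kp.
have step j : Y j -> Y j.-1 -> Y j.+1.
  move=> Yj Yj1 hj; have h1 := low_der oD sq (Yj (ltnW hj)).
  have j1 : (j.-1 <= n.+1)%N by apply: leq_trans (leq_pred j) (ltnW hj).
  have le : (j.-1.+1 <= j.+2)%N by rewrite ltnS; apply: leq_trans (leq_pred j) (leqnSn j).
  have h2 := low_mono le (low_mul oD (smoothZ (kap n j) oD sq) (Yj1 j1)).
  have h3 := low_mono le (low_mul oD (smoothZ (kap n j / 2) oD sth) (low_FF D q n (ltnSn j.-1))).
  apply: low_ext (low_add oD (low_add oD h1 h2) h3).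
  move=> U g oU UD sg t Ut; have [sq' sal' st'] := sub1 UD.
  by rewrite /Zo (@ZopS K U).
by elim: i {hi} => [|i [I1 I2]]; split=> //; exact: step.
Qed.

(** Each step of the recursion differentiates the leading coefficient [kp] once more, which explains
    the factor [i]. The term in [theta] is of lower order and does not interfere. *)
Lemma Zop_top i : (i <= n.+1)%N -> low D q n i.-1 (fun g t => Zo i g t - kp t * FF q n i g t
  - i%:R * derive1 kp t * FF q n i.-1 g t).
Proof.
have skp' := smooth_derive1 skp.
case: i => [_|].
  apply: low_ext (low_0 D q n 0) => U g oU UD sg t Ut; have [sq' sal' st'] := sub1 UD.
  by rewrite /Zo (@Zop0 K U) // FF00 /kp; ring.
elim=> [_|i IH hi].
  apply: low_ext (low_0 D q n 0) => U g oU UD sg t Ut; have [sq' sal' st'] := sub1 UD.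
  have skp1 : smooth U kp by exact: smooth_sub UD _.
  rewrite /Zo (@ZopS K U) // kap0 !mul0r !addr0.
  have -> : derive1 (Zop q n al tau 0 g) t = derive1 (fun t => kp t * g t) t.
    by apply: (derive1_ext oU Ut) => u Uu; rewrite (@Zop0 K U).
  by rewrite (@der1M _ U) //= FF01 FF00; ring.
have h1 := low_der oD sq (IH (ltnW hi)).
have h2 := low_mul oD (smoothZ (i.+1)%:R oD (smooth_derive1 skp')) (low_FF D q n (ltnSn i)).
have h3 : low D q n i.+1 (fun g t => (- (i.+1%:R * kap n i)) * (derive1 kp t * (q t * FF q n i.-1 g t))).
  apply: low_mul => //; first exact: smooth_cst.
  apply: low_mul => //; apply: low_mul => //; apply: low_FF.
  by rewrite ltnS leq_pred.
have hi' : (i <= n.+1)%N by rewrite ltnW // ltnW.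
have h4 := low_mul oD (smoothZ (kap n i.+1) oD sq) (Zop_low hi').
have h5 := low_mul oD (smoothZ (kap n i.+1 / 2) oD sth) (low_FF D q n (ltnSn i)).
have h6 := low_mul oD (smoothZ (- kap n i.+1) oD (smoothM oD skp sq)) (low_FF D q n (ltnSn i)).
apply: low_ext (low_add oD (low_add oD (low_add oD h1 h2) (low_add oD h3 h4)) (low_add oD h5 h6)).
move=> U g oU UD sg t Ut; have [sq' sal' st'] := sub1 UD.
have sF j : smooth U (FF q n j g) by exact: FF_smooth.
have skp1 : smooth U kp by exact: smooth_sub UD _.
have skp2 : smooth U (derive1 kp) by exact: smooth_derive1.
have sZ : smooth U (Zo i.+1 g) by exact: Zop_smooth.
rewrite succnK (@der1B _ U) //; last first.
- by apply: smoothM => //; exact: smoothZ.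
- by apply: smoothB => //; exact: smoothM.
rewrite (@der1B _ U) //; last by apply: smoothM.
rewrite (@der1M _ U kp) // (@der1M _ U (fun t => _ * _)) //; last exact: smoothZ.
rewrite (@der1Z _ U) // [in LHS]/Zo (@ZopS K U) // -/Zo.
rewrite (FFS q n i.+1) succnK (FFS q n i g) -!natr1; ring.
Qed.

(** With [kp] constant, [kp * FF] satisfies the recursion exactly, and the first remaining term
    collects the sources [kap n i / 2 * theta], two orders down. *)
Lemma Zop_top2 i : (forall t, D t -> derive1 kp t = 0) -> (i <= n.+1)%N ->
  low D q n i.-2 (fun g t => Zo i g t - kp t * FF q n i g t
    - sig n i / 2 * theta q tau t * FF q n i.-2 g t).
Proof.
move=> kp0; pose Y i g t := Zo i g t - kp t * FF q n i g t.
have Y0 : forall U g, open U -> U `<=` D -> smooth U g -> forall t, U t -> Y 0%N g t = 0.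
  move=> U g oU UD sg t Ut; have [sq' sal' st'] := sub1 UD.
  by rewrite /Y /Zo (@Zop0 K U) // /FF /kp; ring.
have YS j : (j <= n)%N -> forall U g, open U -> U `<=` D -> smooth U g -> forall t, U t ->
    Y j.+1 g t = derive1 (Y j g) t + kap n j * q t * Y j.-1 g t
      + kap n j / 2 * theta q tau t * FF q n j.-1 g t.
  move=> hj U g oU UD sg t Ut; have [sq' sal' st'] := sub1 UD.
  have sF k : smooth U (FF q n k g) by exact: FF_smooth.
  have skp1 : smooth U kp by exact: smooth_sub UD _.
  have sZ : smooth U (Zo j g) by exact: Zop_smooth.
  rewrite /Y (@der1B _ U) //; last exact: smoothM.
  rewrite (@der1M _ U kp) // kp0; last exact: UD.
  by rewrite /Zo (@ZopS K U) // (FFS q n j g); ring.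
have sY j U g : open U -> U `<=` D -> smooth U g -> smooth U (Y j g).
  move=> oU UD sg; have [sq' sal' st'] := sub1 UD.
  apply: smoothB => //; first exact: Zop_smooth.
  by apply: smoothM => //; [exact: smooth_sub UD _|exact: FF_smooth].
have Y1 : forall U g, open U -> U `<=` D -> smooth U g -> forall t, U t -> Y 1%N g t = 0.
  move=> U g oU UD sg t Ut; rewrite (YS 0%N _ U) // kap0 !mul0r !addr0.
  by rewrite (derive1_ext oU Ut (Y0 U g oU UD sg)) derive1_cst.
suff H j : (j <= n.+1)%N -> low D q n j.-2 (fun g t => Y j g t
    - sig n j / 2 * theta q tau t * FF q n j.-2 g t) by exact: H.
case: j => [_|[_|]].
- apply: low_ext (low_0 D q n 0) => U g oU UD sg t Ut.
  by rewrite (Y0 U) // /sig big_ord0 !mul0r subr0.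
- apply: low_ext (low_0 D q n 0) => U g oU UD sg t Ut.
  by rewrite (Y1 U) // /sig big_ord1 kap0 !mul0r subr0.
elim=> [hn|j IH hj].
  apply: low_ext (low_0 D q n 0) => U g oU UD sg t Ut.
  rewrite (YS 1%N _ U) //= (derive1_ext oU Ut (Y1 U g oU UD sg)) derive1_cst.
  by rewrite (Y0 U) // /sig !big_ord_recr big_ord0 /= kap0; ring.
have LY k : (k <= n.+1)%N -> low D q n k.+1 (Y k).
  move=> hk; have := low_add oD (Zop_low hk) (low_mul oD (smoothN oD skp) (low_FF D q n (ltnSn k))).
  by apply: low_ext => U g _ _ _ t _; rewrite /Y mulNr.
have h1 := low_der oD sq (IH (ltnW hj)).
have h2 := low_mul oD (smoothZ (sig n j.+2 / 2) oD (smooth_derive1 sth)) (low_FF D q n (ltnSn j)).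
have h3 : low D q n j.+1 (fun g t => (- (sig n j.+2 / 2 * kap n j)) *
    (theta q tau t * (q t * FF q n j.-1 g t))).
  apply: low_mul => //; first exact: smooth_cst.
  apply: low_mul => //; apply: low_mul => //; apply: low_FF.
  by rewrite ltnS leq_pred.
have h4 : low D q n j.+1 (fun g t => kap n j.+2 * q t * Y j.+1 g t).
  apply: low_mul => //; first exact: smoothZ.
  apply: low_mono (leqnSn j) _; apply: low_ext (Zop_top (ltnW (ltnW hj))) => U g _ UD _ t Ut.
  by rewrite kp0 ?mulr0 ?mul0r ?subr0 //; exact: UD.
apply: low_ext (low_add oD (low_add oD h1 h2) (low_add oD h3 h4)).
move=> U g oU UD sg t Ut; have [sq' sal' st'] := sub1 UD.
have sF k : smooth U (FF q n k g) by exact: FF_smooth.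
have sth1 : smooth U (theta q tau) by exact: smooth_sub UD _.
rewrite !succnK (@der1B _ U) //; last first.
- by apply: smoothM => //; exact: smoothZ.
- exact: sY.
rewrite (@der1M _ U (fun t => _ * _)) //; last exact: smoothZ.
rewrite (@der1Z _ U) // (YS j.+2 _ U) //= (FFS q n j g).
rewrite [sig n j.+3]/sig big_ord_recr /= -/(sig n j.+2).
by ring.
Qed.

End Necessity.
End Determining.

(** * Determining equations from invariance of the kernel; change of independent variable *)

Section Necessity2.
Context {R : realType} {K : numFieldType} {pk : kpkg R K}.
Implicit Types (g h w : K -> K) (U : set K).

Lemma eop_high n (d : nat -> K -> K) tau j t :
  (forall j, (n.-1 <= j)%N -> d j = fun=> 0) -> (n.-1 <= j)%N -> eop n d tau j t = 0.
Proof.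
move=> dn hj; rewrite /eop !dn //; last exact: leq_trans hj (leqnSn j).
by rewrite derive1_cst !mulr0 !addr0.
Qed.

(** Invariance is tested at each point on the solution with a single unit jet there. The jet of
    order [n] yields [kp' = 0], the one of order [n - 1] yields [theta = 0], and after that the jet
    of order [j] reads off [eop j]. The order matters: each step uses the vanishing found before. *)
Lemma necessity (D : set K) (q : K -> K) (n : nat) (d : nat -> K -> K) (al tau : K -> K) :
  domain D -> smooth D q -> (forall j, smooth D (d j)) -> (2 <= n)%N ->
  (forall j, (n.-1 <= j)%N -> d j = fun=> 0) -> smooth D al -> smooth D tau ->
  (forall g, smooth D g -> (forall t, D t -> Pop q n d g t = 0) ->
     forall t, D t -> Pop q n d (Mop al tau g) t = 0) ->
  exists c, [/\ forall t, D t -> al t = n%:R / 2 * derive1 tau t + c,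
    forall t, D t -> theta q tau t = 0 & forall j t, D t -> eop n d tau j t = 0].
Proof.
move=> domD sq sd n2 dn sal st H; have [[t0 D0] oD _] := domD.
have n0 : (0 < n)%N by apply: leq_trans n2.
pose kp t := al t - n%:R / 2 * derive1 tau t.
have skp : smooth D kp.
  by apply: smoothB => //; apply: smoothZ => //; exact: smooth_derive1.
have dr t : D t -> d n.+1 t = 0.
  by rewrite dn //; apply: leq_trans (leq_pred n) (leqnSn n).
have I g : smooth D g -> (forall t, D t -> Pop q n d g t = 0) -> forall t, D t ->
    \sum_(j < n.+1) eop n d tau j t * FF q n j g t +
    (Zop q n al tau n.+1 g t + \sum_(j < n.+1) d j t * Zop q n al tau j g t) = 0.
  move=> sg Pg t Dt; have := H g sg Pg t Dt; rewrite (@Pop_Mop K D) // Pg //.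
  by rewrite (derive1_ext oD Dt Pg) derive1_cst mulr0 mulr0 subr0 add0r.
have jet k u : (k <= n)%N -> D u -> exists g, [/\ smooth D g,
    forall i, (i < n.+1)%N -> FF q n i g u = (i == k)%:R &
    forall t, D t -> Pop q n d g t = 0].
  move=> hk Du; have [g [h1 h2 h3]] := @Pop_exists R K pk D u q n d (fun=> 0)
    (fun i => (i == k)%:R) domD Du sq sd (smooth_cst _ _).
  by exists g.
(* The coefficients [d j] stop at [j = n - 2], so even nonzero jets of order [n - 1] and [n] do not
   influence the top one. *)
have top0 u g : D u -> (forall i, (i < n.-1)%N -> FF q n i g u = 0) -> Pop q n d g u = 0 ->
    FF q n n.+1 g u = 0.
  move=> Du hF; rewrite /Pop big1 ?addr0 // => j _.
  by have [hj|hj] := leqP n.-1 j; [rewrite dn // mul0r|rewrite hF // mulr0].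
have dZ0 u g m : D u -> smooth D g -> (n.-1 <= m)%N -> (forall i, (i < m)%N -> FF q n i g u = 0) ->
    \sum_(j < n.+1) d j u * Zop q n al tau j g u = 0.
  move=> Du sg nm hF; rewrite big1 // => j _.
  have [hj|hj] := leqP n.-1 j; first by rewrite dn // mul0r.
  have hj' : (j <= n.+1)%N by apply: ltnW.
  rewrite (low_eval (Zop_low domD sq sal st hj') oD sg Du) ?mulr0 // => k hk.
  by apply: hF; apply: leq_trans hk _; apply: leq_trans hj nm.
have kp0 t : D t -> derive1 kp t = 0.
  move=> Dt; have [g [sg jg Pg]] := jet n t (leqnn n) Dt.
  have jl i : (i < n)%N -> FF q n i g t = 0.
    by move=> hi; rewrite jg ?(ltn_eqF hi) // ltnS ltnW.
  have := I g sg Pg t Dt.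
  rewrite (dZ0 t g n Dt sg (leq_pred n) jl) addr0.
  have -> : \sum_(j < n.+1) eop n d tau j t * FF q n j g t = 0.
    rewrite big1 // => j _; have [hj|hj] := leqP n.-1 j; first by rewrite eop_high ?mul0r.
    by rewrite jl ?mulr0 //; apply: leq_trans hj (leq_pred n).
  rewrite add0r => Z0.
  have := low_eval (Zop_top domD sq sal st (leqnn n.+1)) oD sg Dt jl.
  rewrite Z0 (top0 t) ?Pg //; last first.
    by move=> i hi; apply: jl; apply: leq_trans hi (leq_pred n).
  rewrite jg // eqxx mulr0 mulr1 !sub0r oppr0 add0r => /eqP; rewrite oppr_eq0 mulf_eq0.
  by rewrite pnatr_eq0 => /eqP.
have dkp t : D t -> is_derive t 1 kp 0.
  by move=> Dt; rewrite -(kp0 t Dt); exact: smooth_is_derive1 skp Dt.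
pose c := kp t0.
have alE t : D t -> al t = n%:R / 2 * derive1 tau t + c.
  by move=> Dt; rewrite /c (const_of_der0 domD dkp D0 Dt) /kp addrC subrK.
have th0 t : D t -> theta q tau t = 0.
  move=> Dt; have [g [sg jg Pg]] := jet n.-1 t (leq_pred n) Dt.
  have jl i : (i < n.-1)%N -> FF q n i g t = 0.
    by move=> hi; rewrite jg ?(ltn_eqF hi) // ltnS; apply: leq_trans (ltnW hi) (leq_pred n).
  have := I g sg Pg t Dt.
  rewrite (dZ0 t g n.-1 Dt sg (leqnn _) jl) addr0.
  have -> : \sum_(j < n.+1) eop n d tau j t * FF q n j g t = 0.
    rewrite big1 // => j _; have [hj|hj] := leqP n.-1 j; first by rewrite eop_high ?mul0r.
    by rewrite jl ?mulr0.
  rewrite add0r => Z0.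
  have := low_eval (Zop_top2 domD sq sal st kp0 (leqnn n.+1)) oD sg Dt jl.
  rewrite Z0 (top0 t) ?Pg // succnK jg ?eqxx ?mulr0 ?mulr1 ?subr0 ?sub0r; last first.
    by rewrite ltnS leq_pred.
  move/eqP; rewrite oppr_eq0 mulf_eq0 => /orP[|/eqP //].
  by rewrite mulf_eq0 (negbTE (sig_neq0 n0)) invr_eq0 pnatr_eq0.
exists c; split=> // j t Dt.
have [hj|hj] := leqP n.-1 j; first exact: eop_high.
have hjn : (j <= n)%N by apply: leq_trans (ltnW hj) (leq_pred n).
have [g [sg jg Pg]] := jet j t hjn Dt.
have := I g sg Pg t Dt.
have Zc i : (i <= n.+1)%N -> Zop q n al tau i g t = c * FF q n i g t.
  by move=> hi; apply: (@Zop_const K D).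
rewrite Zc //; under [X in _ + (_ + X)]eq_bigr => i _ do rewrite (Zc i (ltnW (ltn_ord i))) mulrCA.
rewrite -mulr_sumr -mulrDr -/(Pop q n d g t) Pg // mulr0 addr0.
have hjr : (j < n.+1)%N by [].
rewrite (bigD1 (Ordinal hjr)) //= jg // eqxx mulr1 big1 ?addr0 // => i ij.
by rewrite jg //; rewrite -val_eqE /= in ij; rewrite (negbTE ij) mulr0.
Qed.

(** For [i <= n + 1] this is the binomial coefficient of [i] over [j] times
    [(n - j) (n - j - 1) ... (n - i + 1)]. *)
Fixpoint Cf (n i j : nat) : K :=
  match i with
  | 0 => (j == 0%N)%:R
  | i'.+1 => (n%:R - i'%:R - j%:R) * Cf n i' j + (if j is j'.+1 then Cf n i' j' else 0)
  end.

Lemma Cf_high n i j : (i < j)%N -> Cf n i j = 0.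
Proof.
elim: i j => [|i IH] [|j] //= ij.
by rewrite !IH ?mulr0 ?addr0 // ltnW.
Qed.

Lemma Cf_diag n i : Cf n i i = 1.
Proof. by elim: i => [|i IH] //=; rewrite Cf_high // mulr0 add0r IH. Qed.

Lemma Cf_identity (N I J k C1 C1j a b : K) : C1 = (N - I - (J + 1)) * a + b ->
  (I + 1 - J) * C1j = k * b -> (I + 1 - (J + 1)) * C1 = k * a -> k = (I + 1) * (N + 1 - (I + 1)) ->
  (I + 1 + 1 - (J + 1)) * ((N - (I + 1) - (J + 1)) * C1 + C1j) = (k + N - 2 * (I + 1)) * C1.
Proof.
move=> hC e1 e2 hk; have hb : b = C1 - (N - I - (J + 1)) * a by rewrite hC; ring.
transitivity ((I + 1 - J) * (N - (I + 1) - (J + 1)) * C1 + (I + 1 - J) * C1j); first by ring.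
transitivity ((I + 1 - J) * (N - (I + 1) - (J + 1)) * C1 + (k * C1 - (N - I - (J + 1)) * (k * a))).
  by rewrite e1 hb; ring.
by rewrite -e2 hk; ring.
Qed.

(** The ratio of neighbouring coefficients in the closed form. It makes the terms containing [q]
    cancel, and at [i = n] its right-hand side vanishes. *)
Lemma Cf_rel n i j : (i <= n)%N ->
  (i.+1%:R - j%:R) * Cf n i.+1 j = kap n i.+1 * Cf n i j.
Proof.
elim: i j => [|i IH] j hi.
  rewrite kapS // kap0; case: j => [|[|j]] /=.
  - by ring.
  - by rewrite subrr mul0r mulr0.
  - by rewrite !mulr0 addr0 mulr0.
have hi' := ltnW hi; rewrite kapS //; case: j => [|j].
  rewrite [Cf n i.+2 0]/= -/(Cf n i.+1 0) !subr0 addr0 kapE ?ltnS //.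
  by rewrite -(natr1 i.+1) -(natr1 i); ring.
have := IH j hi'; have := IH j.+1 hi'.
rewrite [Cf n i.+2 j.+1]/= -/(Cf n i.+1 j.+1) -/(Cf n i.+1 j) -!(natr1 i.+1) -!(natr1 i) -!(natr1 j).
move=> E2 E1; apply: (Cf_identity _ E1 E2); first by rewrite /= -(natr1 j).
by rewrite kapE ?ltnS // -(natr1 i).
Qed.

Lemma CfS0 n i : Cf n i.+1 0 = (n%:R - i%:R - 0%:R) * Cf n i 0.
Proof. by rewrite /= addr0. Qed.

Lemma CfS n i j : Cf n i.+1 j.+1 = (n%:R - i%:R - j.+1%:R) * Cf n i j.+1 + Cf n i j.
Proof. by []. Qed.

Local Arguments Cf n i j : simpl never.

(* In the independent variable T, the n-th symmetric power of y'' + q y = 0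
   becomes the equation h^(n+1) = 0. *)
Lemma FF_straight (U : set K) (q y T : K -> K) n : open U -> smooth U q -> smooth U y -> smooth U T ->
  (forall t, U t -> y t != 0) -> (forall t, U t -> derive1n 2 y t = - q t * y t) ->
  (forall t, U t -> derive1 T t = (y t ^+ 2)^-1) ->
  forall (U' : set K) h, open U' -> smooth U' h -> (forall t, U t -> U' (T t)) ->
  forall i, (i <= n.+1)%N -> forall t, U t -> FF q n i (fun t => y t ^+ n * h (T t)) t =
  \sum_(j < i.+1) Cf n i j * (y t ^+ n * (y t)^-1 ^+ (i + j) * derive1 y t ^+ (i - j)
    * derive1n j h (T t)).
Proof.
move=> oU sq sy sT y0 ddy dT U' h oU' sh UU'; set g := fun t => _.
pose H j t := derive1n j h (T t).
pose X i j t := y t ^+ n * (y t)^-1 ^+ (i + j) * derive1 y t ^+ (i - j) * H j t.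
pose E i := (i <= n.+1)%N -> forall t, U t -> FF q n i g t =
  \sum_(j < i.+1) Cf n i j * X i j t.
have dH j t : U t -> is_derive t 1 (H j) ((y t)^-1 ^+ 2 * H j.+1 t).
  move=> Ut; have hT := smooth_is_derive1 sT Ut; rewrite dT // in hT.
  have hh := smooth_is_derive1 (smooth_derive1n j sh) (UU' t Ut).
  by apply: dval (dcomp hT hh) _; rewrite -exprVn -derive1nS.
have dX i j t : (j <= i)%N -> U t -> is_derive t 1 (X i j)
    ((n%:R - i%:R - j%:R) * X i.+1 j t - (i%:R - j%:R) * q t * X i.-1 j t + X i.+1 j.+1 t).
  move=> ji Ut; have yt := y0 t Ut.
  have dy := smooth_is_derive1 sy Ut.
  have dy' : is_derive t 1 (derive1 y) (- q t * y t).
    by apply: dval (smooth_is_derive1 (smooth_derive1 sy) Ut) _; exact: ddy.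
  have D := dM (dM (dM (dX n dy) (dX (i + j) (dV yt dy))) (dX (i - j) dy')) (dH j t Ut).
  apply: dval D _.
  (* The form with [y^-1] also covers [m = 0], where the truncated exponent [m.-1] would need a
     separate case. *)
  have e1 m : m%:R * y t ^+ m.-1 = m%:R * y t ^+ m * (y t)^-1.
    by case: m => [|m]; rewrite ?mul0r // exprS; field.
  have e2 : (i + j)%:R * (y t)^-1 ^+ (i + j).-1 =
      (i + j)%:R * (y t)^-1 ^+ (i + j) * y t.
    by case: (i + j)%N => [|m]; rewrite ?mul0r // exprS /=; field.
  rewrite e1 e2 /X subSS addSn addnS natrD -/(H j.+1 t).
  case: (ltnP j i) ji => [|jgei] ji.
    case: i ji {e2} => [//|i] ji _; rewrite ltnS in ji.
    rewrite succnK (subSn (leqW ji)) (subSn ji) !addSn.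
    have -> : (i - j).+1%:R = i.+1%:R - j%:R :> K by rewrite -subSn // natrB // leqW.
    move: (i - j)%N (i + j)%N (i.+1%:R) => m p I; rewrite /= !exprS; field.
    exact: yt.
  have -> : i = j by apply/eqP; rewrite eqn_leq jgei ji.
  rewrite !subnn subSnn /= ?addSn expr0 expr1; move: (j.-1 + j)%N (j.-1 - j)%N (j + j)%N => a b p.
  by rewrite !exprS; field; exact: yt.
have step i : E i -> E i.-1 -> E i.+1.
  move=> Ei Ei1 hi t Ut; rewrite FFS (derive1_ext oU Ut (Ei (ltnW hi))).
  have S : is_derive t 1 (fun t => \sum_(j < i.+1) Cf n i j * X i j t)
     (\sum_(j < i.+1) Cf n i j * ((n%:R - i%:R - j%:R) * X i.+1 j t
        - (i%:R - j%:R) * q t * X i.-1 j t + X i.+1 j.+1 t)).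
    by apply: dsum => j; apply: dZ; apply: dX => //; rewrite -ltnS.
  rewrite (derive1_val S).
  (* By [Cf_rel] the term with [q] in the recursion of [FF] is exactly what [y'' = - q y] produced
     in the derivative. *)
  have -> : kap n i * q t * FF q n i.-1 g t =
      \sum_(j < i.+1) Cf n i j * ((i%:R - j%:R) * q t * X i.-1 j t).
    case: i Ei Ei1 hi S => [|i] Ei Ei1 hi S.
      by rewrite kap0 !mul0r big_ord1 subrr !mul0r mulr0.
    rewrite Ei1 //; last by apply: ltnW; exact: ltnW.
    rewrite [RHS]big_ord_recr /= subrr !mul0r mulr0 addr0 mulr_sumr.
    apply: eq_bigr => j _; have C := Cf_rel j (ltnW (hi : i < n)%N).
    transitivity ((kap n i.+1 * Cf n i j) * (q t * X i j t)); first by ring.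
    by rewrite -C; ring.
  rewrite -big_split /=.
  transitivity (\sum_(j < i.+1) ((n%:R - i%:R - j%:R) * Cf n i j * X i.+1 j t +
     Cf n i j * X i.+1 j.+1 t)); first by apply: eq_bigr => j _; ring.
  rewrite big_split /= [RHS]big_ord_recl CfS0.
  under [X in _ = _ + X]eq_bigr => j _ do rewrite lift0 CfS mulrDl.
  rewrite [X in _ = _ + X]big_split /= addrA; congr (_ + _).
  rewrite [LHS]big_ord_recl; congr (_ + _).
  rewrite [RHS]big_ord_recr /= (@Cf_high n i i.+1) // mulr0 mul0r addr0.
  by apply: eq_bigr => j _; rewrite ?lift0.
move=> i; have [] // : E i /\ E i.+1.
have E0 : E 0%N.
  by move=> _ t Ut; rewrite big_ord1 /= Cf_diag mul1r /X /H /= !expr0 !mulr1 FF00.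
by elim: i => [|i [I1 I2]]; split=> //; exact: step.
Qed.

(** Since [kap n n.+1 = 0], the relation [Cf_rel] annihilates every coefficient of the top order
    except the diagonal one. *)
Lemma FF_straight_top (U : set K) (q y T : K -> K) n : open U -> smooth U q -> smooth U y -> smooth U T ->
  (forall t, U t -> y t != 0) -> (forall t, U t -> derive1n 2 y t = - q t * y t) ->
  (forall t, U t -> derive1 T t = (y t ^+ 2)^-1) ->
  forall (U' : set K) h, open U' -> smooth U' h -> (forall t, U t -> U' (T t)) ->
  forall t, U t -> FF q n n.+1 (fun t => y t ^+ n * h (T t)) t =
  y t ^+ n * (y t)^-1 ^+ (n.+1 + n.+1) * derive1n n.+1 h (T t).
Proof.
move=> oU sq sy sT y0 ddy dT U' h oU' sh UU' t Ut.
rewrite (FF_straight oU sq sy sT y0 ddy dT oU' sh UU' (leqnn _) Ut) big_ord_recr /=.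
rewrite Cf_diag subnn expr0 mulr1 mul1r big1 ?add0r // => j _.
have := Cf_rel j (leqnn n).
rewrite /kap subnn muln0 mul0r => /eqP; rewrite mulf_eq0 => /orP[|/eqP h0].
  by rewrite subr_eq0 eqr_nat => /eqP jn; have := ltn_ord j; rewrite -jn ltnn.
by rewrite h0 mul0r.
Qed.

End Necessity2.

(** * Constant coefficients along a nonvanishing [tau] *)

Section Straighten.
Context {R : realType} {K : numFieldType} {pk : kpkg R K}.
Implicit Types (g h w : K -> K) (U : set K).

Lemma smooth_pow (U : set K) (a : K) k : open U -> smooth U (fun s : K => (s - a) ^+ k).
Proof.
move=> oU; apply: smoothX => //; apply: smoothB => //; last exact: smooth_cst.
exact: smooth_id.
Qed.

Lemma derive1n_pow (a : K) k j s :
  derive1n j (fun s : K => (s - a) ^+ k) s = (k ^_ j)%:R * (s - a) ^+ (k - j).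
Proof.
elim: j s => [|j IH] s; first by rewrite ffactn0 mul1r subn0.
rewrite derive1nS; have -> : derive1n j (fun s : K => (s - a) ^+ k) =
    (fun s => (k ^_ j)%:R * (s - a) ^+ (k - j)) by apply/funext.
apply: derive1_val.
apply: dval (dZ (k ^_ j)%:R (dX (k - j) (dB (dI s) (dC a s)))) _.
by rewrite subr0 mulr1 ffactnSr natrM subnS mulrA.
Qed.

Lemma derive1n_pow_at (a : K) k j :
  derive1n j (fun s : K => (s - a) ^+ k) a = (j == k)%:R * k`!%:R.
Proof.
rewrite derive1n_pow subrr; case: (ltngtP j k) => [jk|kj|->].
- by rewrite expr0n subn_eq0 leqNgt jk mulr0 mul0r.
- by rewrite ffact_small // !mul0r.
- by rewrite subnn expr0 mulr1 mul1r ffactnn.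
Qed.

Lemma straight_alg1 (F : fieldType) (a x v f f1 k z : F) :
  a * f + x * (v * f1) + k * (z * f) = (a + k * z) * f + x * v * f1.
Proof. by ring. Qed.

Lemma straight_alg2 (F : fieldType) (a x k f : F) :
  (a + k) * f + x * f = (a + x + k) * f.
Proof. by ring. Qed.

Lemma straight_alg3 (F : fieldType) (u v b b' f f1 : F) : v != 0 ->
  u * (b * f) - v * (b' * f + b * (v^-1 * f1)) + b * f1 = (u * b - v * b') * f.
Proof. by move=> v0; field. Qed.

Section Fix.
Variables (U : set K) (domU : domain U) (q : K -> K) (n : nat) (d : nat -> K -> K).
Variables (tau chi T : K -> K) (c : K).
Hypotheses (sq : smooth U q) (sd : forall j, smooth U (d j)) (dn0 : forall t, U t -> d n.+1 t = 0).
Hypotheses (stau : smooth U tau) (schi : smooth U chi) (sT : smooth U T).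
Hypotheses (tau0 : forall t, U t -> tau t != 0) (chi0 : forall t, U t -> chi t != 0).
Hypothesis dT : forall t, U t -> is_derive t 1 T (tau t)^-1.
Let oU : open U. Proof. by have [] := domU. Qed.

Lemma comp_smooth W (U' : set K) h : open W -> W `<=` U -> smooth U' h ->
  (forall t, W t -> U' (T t)) -> smooth W (fun t => h (T t)).
Proof.
by move=> oW WU sh WU'; apply: (smooth_comp oW WU' _ sh); exact: smooth_sub WU _.
Qed.

(** The coefficients depend on [chi] and [tau] but not on [h] or on the subdomain, which is why
    these are quantified inside. The free bound [N] lets expansions of different orders be summed
    over one range. *)
Lemma straight_expand i : exists A : nat -> K -> K,
  [/\ forall j, smooth U (A j), forall j, (i < j)%N -> A j = fun=> 0,
    forall t, U t -> A i t = chi t * (tau t)^-1 ^+ i &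
    forall N W (U' : set K) h, (i < N)%N -> open W -> W `<=` U -> open U' -> smooth U' h ->
      (forall t, W t -> U' (T t)) -> forall t, W t ->
      FF q n i (fun t => chi t * h (T t)) t = \sum_(j < N) A j t * derive1n j h (T t)].
Proof.
pose Q i := exists A : nat -> K -> K,
  [/\ forall j, smooth U (A j), forall j, (i < j)%N -> A j = fun=> 0,
    forall t, U t -> A i t = chi t * (tau t)^-1 ^+ i &
    forall N W (U' : set K) h, (i < N)%N -> open W -> W `<=` U -> open U' -> smooth U' h ->
      (forall t, W t -> U' (T t)) -> forall t, W t ->
      FF q n i (fun t => chi t * h (T t)) t = \sum_(j < N) A j t * derive1n j h (T t)].
suff [] : Q i /\ Q i.+1 by [].
have Q0 : Q 0%N.
  exists (fun j => if j == 0%N then chi else fun=> 0); split=> //.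
  - by move=> j; case: eqP => // _; exact: smooth_cst.
  - by case.
  - by move=> t _; rewrite eqxx expr0 mulr1.
  - move=> [|N] // W U' h _ oW WU oU' sh WU' t Wt.
    rewrite FF00 big_ord_recl /= big1 ?addr0 // => j _.
    by rewrite mul0r.
have step k : Q k -> Q k.-1 -> Q k.+1.
  move=> [A1 [s1 z1 t1 f1]] [A0 [s0 z0 t0 f0]].
  pose A j t := derive1 (A1 j) t + (if j is j'.+1 then A1 j' t * (tau t)^-1 else 0)
    + kap n k * q t * A0 j t.
  have stV : smooth U (fun t => (tau t)^-1) by exact: smoothV.
  exists A; split.
  - move=> j; apply: smoothD => //; last by apply: smoothM => //; exact: smoothZ.
    apply: smoothD => //; first exact: smooth_derive1.
    by case: j => [|j]; [exact: smooth_cst|exact: smoothM].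
  - move=> [|j] // hj; apply/funext => t; rewrite /A.
    rewrite (z1 j.+1) ?derive1_cst; last by apply: leq_trans hj.
    rewrite (z1 j) // (z0 j.+1) ?mul0r ?mulr0 ?addr0 //.
    by apply: leq_ltn_trans (leq_pred k) _; apply: ltnW.
  - move=> t Ut; rewrite /A (z1 k.+1) // derive1_cst (z0 k.+1) ?ltnS ?leq_pred //.
    by rewrite mulr0 addr0 add0r t1 // exprSr mulrA.
  - move=> [|N] // W U' h hN oW WU oU' sh WU' t Wt; set g := fun t => _.
    rewrite ltnS in hN; have hN1 : (k < N.+1)%N by apply: ltnW.
    have sH j : smooth W (fun t => derive1n j h (T t)).
      by apply: (comp_smooth oW WU (smooth_derive1n j sh)).
    have dH j : is_derive t 1 (fun t => derive1n j h (T t)) ((tau t)^-1 * derive1n j.+1 h (T t)).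
      exact: dcomp (dT (WU t Wt)) (smooth_is_derive1 (smooth_derive1n j sh) (WU' t Wt)).
    rewrite FFS (derive1_ext oW Wt (f1 N.+1 W U' h hN1 oW WU oU' sh WU')).
    have D : is_derive t 1 (fun t => \sum_(j < N.+1) A1 j t * derive1n j h (T t))
      (\sum_(j < N.+1) (derive1 (A1 j) t * derive1n j h (T t) +
         A1 j t * ((tau t)^-1 * derive1n j.+1 h (T t)))).
      by apply: dsum => j; apply: dM (dH j); exact: smooth_is_derive1 (s1 j) (WU t Wt).
    rewrite (derive1_val D).
    have k1 : (k.-1 < N.+1)%N by apply: leq_ltn_trans (leq_pred k) hN1.
    rewrite (f0 N.+1 W U' h k1 oW WU oU' sh WU' t Wt) mulr_sumr.
    transitivity (\sum_(j < N.+1) (derive1 (A1 j) t + kap n k * q t * A0 j t) * derive1n j h (T t)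
      + \sum_(j < N.+1) A1 j t * (tau t)^-1 * derive1n j.+1 h (T t)).
      rewrite -!big_split; apply: eq_bigr => j _; exact: straight_alg1.
    rewrite [X in _ + X]big_ord_recr /= (z1 N) // !mul0r addr0.
    transitivity (\sum_(j < N.+1) (derive1 (A1 j) t + kap n k * q t * A0 j t) * derive1n j h (T t)
      + \sum_(j < N.+1) (if (j : nat) is j'.+1 then A1 j' t * (tau t)^-1 else 0) * derive1n j h (T t)).
      by congr (_ + _); rewrite [RHS]big_ord_recl mul0r add0r; apply: eq_bigr => j _; rewrite lift0.
    rewrite -big_split; apply: eq_bigr => j _; exact: straight_alg2.
by elim: i => [|i [I1 I2]]; split=> //; exact: step.
Qed.

Hypothesis dchi : forall t, U t ->
  is_derive t 1 chi ((n%:R / 2 * derive1 tau t + c) / tau t * chi t).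
Hypothesis th0 : forall t, U t -> theta q tau t = 0.
Hypothesis e0 : forall j t, U t -> eop n d tau j t = 0.

(** By the choice of [chi] and [T], [Mop] acts on [chi * h (T)] as minus the derivative of [h].
    Commuting it past [Pop] shows that all coefficients [B j] of the transformed operator satisfy
    the same equation [tau B' = nu B], so their ratios to the leading one are constant. *)
Lemma straighten : exists k : nat -> K, forall W (U' : set K) h, open W -> W `<=` U ->
  open U' -> smooth U' h -> (forall t, W t -> U' (T t)) -> forall t, W t ->
  Pop q n d (fun t => chi t * h (T t)) t = chi t * (tau t)^-1 ^+ n.+1 *
    (derive1n n.+1 h (T t) + \sum_(j < n.+1) k j * derive1n j h (T t)).
Proof.
have /choice [A hA] := straight_expand.
pose B j t := A n.+1 j t + \sum_(i < n.+1) d i t * A i j t.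
have sA i j : smooth U (A i j) by have [] := hA i.
have sB j : smooth U (B j).
  by apply: smoothD => //; apply: smooth_sum => // i _; exact: smoothM.
have Br t : U t -> B n.+1 t = chi t * (tau t)^-1 ^+ n.+1.
  move=> Ut; have [_ _ h _] := hA n.+1; rewrite /B h // big1 ?addr0 // => i _.
  by have [_ z _ _] := hA i; rewrite z ?mulr0.
have PB W (U' : set K) h : open W -> W `<=` U -> open U' -> smooth U' h ->
    (forall t, W t -> U' (T t)) -> forall t, W t ->
    Pop q n d (fun t => chi t * h (T t)) t = \sum_(j < n.+2) B j t * derive1n j h (T t).
  move=> oW WU oU' sh WU' t Wt; rewrite /Pop.
  have E i : (i < n.+2)%N -> FF q n i (fun t => chi t * h (T t)) t =
      \sum_(j < n.+2) A i j t * derive1n j h (T t).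
    by move=> hi; have [_ _ _ f] := hA i; exact: (f n.+2 W U').
  rewrite E //.
  have -> : \sum_(j < n.+1) d j t * FF q n j (fun t => chi t * h (T t)) t =
      \sum_(i < n.+1) \sum_(j < n.+2) d i t * (A i j t * derive1n j h (T t)).
    by apply: eq_bigr => i _; rewrite E ?mulr_sumr // ltnW // ltnS.
  rewrite exchange_big -big_split /=; apply: eq_bigr => j _.
  by rewrite /B mulrDl mulr_suml; congr (_ + _); apply: eq_bigr => i _; rewrite mulrA.
have Br0 t : U t -> B n.+1 t != 0.
  by move=> Ut; rewrite Br // mulf_neq0 ?chi0 // expf_neq0 // invr_neq0 // tau0.
pose nu t := (n%:R / 2 - n.+1%:R) * derive1 tau t + c.
have dB' k t : (k < n.+2)%N -> U t -> tau t * derive1 (B k) t = nu t * B k t.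
  (* At [T t] this test function has only its [k]-th derivative nonzero, which isolates the
     coefficient [B k]. *)
  move=> hk Ut; pose h s := (s - T t) ^+ k.
  have sh : smooth setT h by apply: smooth_pow; exact: openT.
  have sh' : smooth setT (derive1 h) by exact: smooth_derive1.
  pose g u := chi u * h (T u); pose g' u := chi u * derive1 h (T u).
  have UT : forall u, U u -> [set: K] (T u) by [].
  have Pg := PB U setT h oU (@subset_refl _ U) openT sh UT.
  have Pg' := PB U setT (derive1 h) oU (@subset_refl _ U) openT sh' UT.
  have shT : smooth U (fun t => h (T t)) by exact: comp_smooth sh UT.
  have shT' : smooth U (fun t => derive1 h (T t)) by exact: comp_smooth sh' UT.
  have sg : smooth U g by exact: smoothM.
  have sg' : smooth U g' by exact: smoothM.
  have sal : smooth U (fun t => n%:R / 2 * derive1 tau t + c).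
    apply: smoothD => //; last exact: smooth_cst.
    by apply: smoothZ => //; exact: smooth_derive1.
  have dg u : U u -> Mop (fun t => n%:R / 2 * derive1 tau t + c) tau g u = (-1) * g' u + 0 * g' u.
    move=> Uu; have D := dM (dchi Uu) (dcomp (dT Uu)
      (smooth_is_derive1 sh (I : [set: K] (T u)))).
    by rewrite /Mop (derive1_val D) /g /g'; field; exact: tau0.
  have S := @Pop_sym K U oU q sq n _ tau sal stau g sg d sd dn0 c (fun t _ => erefl) th0 e0 t Ut.
  move: S; rewrite (Pop_ext q n d oU dg Ut) (Pop_lin n d _ _ oU sq sg' sg' Ut) mul0r addr0.
  rewrite -/(nu t) Pg' // (derive1_ext oU Ut Pg) Pg //.
  have D : is_derive t 1 (fun u => \sum_(j < n.+2) B j u * derive1n j h (T u))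
      (\sum_(j < n.+2) (derive1 (B j) t * derive1n j h (T t) +
         B j t * ((tau t)^-1 * derive1n j.+1 h (T t)))).
    apply: dsum => j; apply: dM; first exact: smooth_is_derive1 (sB j) Ut.
    exact: dcomp (dT Ut) (smooth_is_derive1 (smooth_derive1n j sh) I).
  rewrite (derive1_val D) => S.
  have Z : \sum_(j < n.+2) (nu t * B j t - tau t * derive1 (B j) t) * derive1n j h (T t) = 0.
    transitivity (nu t * (\sum_(j < n.+2) B j t * derive1n j h (T t)) - tau t *
      (\sum_(j < n.+2) (derive1 (B j) t * derive1n j h (T t) +
         B j t * ((tau t)^-1 * derive1n j.+1 h (T t)))) +
      \sum_(j < n.+2) B j t * derive1n j (derive1 h) (T t)).
      rewrite !mulr_sumr -sumrB -big_split /=; apply: eq_bigr => j _.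
      by rewrite -derive1Sn straight_alg3 // tau0.
    by rewrite -S; ring.
  move: Z; rewrite (bigD1 (Ordinal hk)) //= big1 ?addr0; last first.
    move=> j jk; rewrite -val_eqE /= in jk.
    by rewrite derive1n_pow_at (negbTE jk) mul0r mulr0.
  rewrite derive1n_pow_at eqxx mul1r => /eqP; rewrite mulf_eq0.
  by rewrite [k`!%:R == 0]pnatr_eq0 -[(k`! == 0)%N]negbK -lt0n fact_gt0 orbF subr_eq0 => /eqP.
have [[ts Us] _ _] := domU.
have cst_ratio j t : (j < n.+2)%N -> U t -> B j t = B j ts / B n.+1 ts * B n.+1 t.
  move=> hj Ut; have D u : U u -> is_derive u 1 (fun u => B j u * (B n.+1 u)^-1) 0.
    move=> Uu; apply: dval (dM (smooth_is_derive1 (sB j) Uu)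
      (dV (Br0 u Uu) (smooth_is_derive1 (sB n.+1) Uu))) _.
    have E1 := dB' j u hj Uu; have E2 := dB' n.+1 u (ltnSn _) Uu.
    have tu := tau0 Uu; have bu := Br0 u Uu.
    have -> : derive1 (B j) u = nu u * B j u / tau u by rewrite -E1; field.
    have -> : derive1 (B n.+1) u = nu u * B n.+1 u / tau u by rewrite -E2; field.
    by field; rewrite tu bu.
  have := const_of_der0 domU D Ut Us => <-.
  by field; exact: Br0.
exists (fun j => B j ts / B n.+1 ts) => W U' h oW WU oU' sh WU' t Wt.
have Ut := WU t Wt.
rewrite (PB W U' h) // big_ord_recr /= -Br // mulrDr mulr_sumr addrC; congr (_ + _).
apply: eq_bigr => j _; rewrite (cst_ratio j t) ?Ut //; first by ring.
exact: ltnW (ltn_ord j).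
Qed.

End Fix.
End Straighten.

(** * Equations in normal form and triangular maps *)
Section Gauge.
Context {R : realType} {K : numFieldType} {pk : kpkg R K}.
Local Notation nm := (@nm R K pk _).

(* In the coordinate [u = (x - phi0) / rho] the equation reads [P u = 0]. *)
Definition gauge r (E : lode K r) (rho phi0 : K -> K) (P : (K -> K) -> K -> K) : Prop :=
  [/\ smooth (dom E) rho, forall t, dom E t -> rho t != 0, smooth (dom E) phi0,
    (forall U g h, open U -> (forall t, U t -> g t = h t) -> forall t, U t -> P g t = P h t) &
    forall U f, open U -> U `<=` dom E -> smooth U f -> (solution E U f <->
      forall t, U t -> P (fun t => (f t - phi0 t) / rho t) t = 0)].

(** [phi0 = rho * g0] with [Pop g0 = b / rho] is a particular solution. The same [rho], [q] and [d]
    serve the homogeneous equation, with zero in place of [phi0]. *)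
Lemma gauge_exists n (E : lode K n.+1) : (2 <= n)%N -> domain (dom E) -> smooth_lode E ->
  exists (rho q : K -> K) (d : nat -> K -> K) (phi0 : K -> K),
  [/\ smooth (dom E) q, forall j, smooth (dom E) (d j), forall j, (n.-1 <= j)%N -> d j = fun=> 0,
    gauge E rho phi0 (Pop q n d) & gauge (homogeneous E) rho (fun=> 0) (Pop q n d)].
Proof.
case: E => D a b n2 domD [/= sa sb]; have [[ts Dts] oD _] := domD.
have [rho [q [d [srho rho0 sq sd [dn L]]]]] :=
  normal_form (a := fun i => a (inord i)) domD (ltnW n2) (fun i => sa (inord i)).
have sV : smooth D (fun t => (rho t)^-1) by exact: smoothV.
have sbr : smooth D (fun t => b t / rho t) by exact: smoothM.
have [g0 [sg0 _ Pg0]] := Pop_exists n (fun=> 0) domD Dts sq sd sbr.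
have loc U g h : open U -> (forall t, U t -> g t = h t) ->
    forall t, U t -> Pop q n d g t = Pop q n d h t by exact: Pop_ext.
have key U f : open U -> U `<=` D -> smooth U f -> forall t, U t ->
    derive1n n.+1 f t + \sum_(i < n.+1) a i t * derive1n i f t =
    rho t * Pop q n d (fun t => f t / rho t) t.
  move=> oU UD sf t Ut; rewrite -(L U _ oU UD _ t Ut); last first.
    by apply: smoothM => //; exact: smooth_sub UD _.
  have E s : U s -> f s = rho s * (f s / rho s).
    by move=> Us; rewrite mulrCA divff ?mulr1 //; exact: rho0 (UD s Us).
  rewrite (derive1n_ext n.+1 oU E Ut); congr (_ + _); apply: eq_bigr => i _.
  by rewrite inord_val (derive1n_ext i oU E Ut).
exists rho, q, d, (fun t => rho t * g0 t); split=> //; split=> //=.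
- exact: smoothM.
- move=> U f oU UD sf; have sfr : smooth U (fun t => f t / rho t).
    by apply: smoothM => //; exact: smooth_sub UD _.
  have sg0U := smooth_sub UD sg0; have sqU := smooth_sub UD sq.
  have e t : U t -> Pop q n d (fun t => (f t - rho t * g0 t) / rho t) t =
      Pop q n d (fun t => f t / rho t) t - b t / rho t.
    move=> Ut; have E s : U s -> (f s - rho s * g0 s) / rho s =
        1 * (f s / rho s) + (-1) * g0 s.
      by move=> Us; have := rho0 s (UD s Us) => h; field.
    rewrite (loc U _ _ oU E t Ut) (Pop_lin n d _ _ oU sqU sfr sg0U Ut) Pg0; last exact: UD.
    by rewrite mul1r mulN1r.
  split=> [[_ _ /= h] t Ut|h]; last split=> //= t Ut.
    by rewrite e // -h // (key U) // mulrAC divff ?mul1r ?subrr //; exact: rho0 (UD t Ut).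
  rewrite (key U) //; have /eqP := h t Ut; rewrite e // subr_eq0 => /eqP ->.
  by rewrite mulrCA divff ?mulr1 //; exact: rho0 (UD t Ut).
- exact: smooth_cst.
- move=> U f oU UD sf.
  have e t : U t -> Pop q n d (fun t => (f t - 0) / rho t) t = Pop q n d (fun t => f t / rho t) t.
    by move=> Ut; apply: (loc U) => // s _; rewrite subr0.
  split=> [[_ _ /= h] t Ut|h]; last split=> //= t Ut.
    rewrite e //; have /eqP := h t Ut; rewrite (key U) // mulf_eq0.
    by rewrite (negbTE (rho0 t (UD t Ut))) /= => /eqP.
  by rewrite (key U) // -e // h // mulr0.
Qed.

Lemma graph_image (D D' : set K) (om : K -> K) (Y : K * K -> K) f g :
  (fun p => (om p.1, Y p)) @` graph D f = graph D' g ->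
  (forall t, D t -> D' (om t) /\ g (om t) = Y (t, f t)) /\
  (forall z, D' z -> exists2 t, D t & om t = z).
Proof.
move=> e; split=> [t Dt|z Dz].
  have : graph D' g (om t, Y (t, f t)).
    by rewrite -e; exists (t, f t) => //; exists t.
  by case=> s Ds [<- <-].
have : graph D' g (z, g z) by exists z.
by rewrite -e => -[_ [t Dt <-] [/= <- _]]; exists t.
Qed.

(** In the coordinates [u] of the two gauges the map is [(t, u) |-> (om t, m t * u + k (om t))]; the
    formulas for [X1] and [X0] express this in [x]. The last hypothesis is the invariance of the
    operators under the corresponding pullback of functions. *)
Lemma tri_maps r (E E' : lode K r) rho phi0 P rho' phi0' P' (V : set (K * K)) (W : set K)
    (om m k X1 X0 : K -> K) :
  gauge E rho phi0 P -> gauge E' rho' phi0' P' ->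
  open (dom E) -> open (dom E') -> open V -> open W -> W `<=` dom E ->
  (forall p, V p -> W p.1) ->
  smooth W om -> {in W &, injective om} -> (forall t, W t -> derive1 om t != 0) ->
  (forall t, W t -> dom E' (om t)) -> smooth W m -> (forall t, W t -> m t != 0) ->
  smooth (dom E') k ->
  (forall t, W t -> X1 t = rho' (om t) * m t / rho t) ->
  (forall t, W t -> X0 t = rho' (om t) * (k (om t) - m t * phi0 t / rho t) + phi0' (om t)) ->
  (forall W' U' h, open W' -> W' `<=` W -> open U' -> U' `<=` dom E' -> smooth U' h ->
     (forall t, W' t -> U' (om t)) -> forall t, W' t ->
     (P (fun t => (m t)^-1 * (h (om t) - k (om t))) t = 0 <-> P' h (om t) = 0)) ->
  maps_lode V (fun p => (om p.1, X1 p.1 * p.2 + X0 p.1)) E E'.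
Proof.
move=> [srho rho0 sphi0 loc sol] [srho' rho0' sphi0' loc' sol'] oD oD' oV oW WD VW som iom om'
  WD' sm m0 sk X1E X0E inv.
have scomp (h : K -> K) : smooth (dom E') h -> smooth W (fun t => h (om t)).
  by move=> sh; exact: (smooth_comp oW WD' som sh).
have srW := smooth_sub WD srho; have spW := smooth_sub WD sphi0.
have srV : smooth W (fun t => (rho t)^-1) by apply: smoothV => // t Wt; exact: rho0 (WD t Wt).
have sX1 : smooth W X1.
  apply: (smooth_ext oW (fun t Wt => esym (X1E t Wt))).
  by do 2![apply: smoothM => //]; exact: scomp.
have sX0 : smooth W X0.
  apply: (smooth_ext oW (fun t Wt => esym (X0E t Wt))).
  apply: smoothD => //; last exact: scomp.
  apply: smoothM => //; first exact: scomp.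
  by apply: smoothB => //; [exact: scomp|do 2![apply: smoothM => //]].
have X10 t : W t -> X1 t != 0.
  move=> Wt; rewrite X1E // !mulf_neq0 ?m0 ?invr_neq0 //; first exact: rho0' (WD' t Wt).
  exact: rho0 (WD t Wt).
have s1 : smooth V (fun p : K * K => p.1) by exact: smooth_fst.
have sp (h : K -> K) : smooth W h -> smooth V (fun p : K * K => h p.1).
  by move=> sh; exact: (smooth_comp oV VW s1 sh).
split.
- split=> //.
  + apply: smooth_pair => //; first exact: sp.
    apply: smoothD => //; last exact: sp.
    by apply: smoothM => //; [exact: sp|exact: smooth_snd].
  + move=> [t x] [t' x'] /set_mem Vt /set_mem Vt' /= [e1].
    have tt' : t = t' by apply: iom e1; apply/mem_set; [exact: VW Vt|exact: VW Vt'].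
    rewrite tt' => /addIr /mulfI e; congr pair; apply: e.
    by rewrite X10 //; exact: VW Vt'.
  + move=> [t x] Vp; have Wt : W t := VW _ Vp; rewrite /jacobian2 /=.
    have d1 : is_derive (t, x) (1, 0) (fst \o (fun p : K * K => (om p.1, X1 p.1 * p.2 + X0 p.1)))
        (derive1 om t).
      by apply/is_derive_slice1; exact: smooth_is_derive1 som Wt.
    have d2 : is_derive (t, x) (0, 1) (fst \o (fun p : K * K => (om p.1, X1 p.1 * p.2 + X0 p.1))) 0.
      by apply/is_derive_slice2; exact: (dC (om t) x).
    have d3 : is_derive (t, x) (0, 1) (snd \o (fun p : K * K => (om p.1, X1 p.1 * p.2 + X0 p.1)))
        (X1 t).
      apply/is_derive_slice2 => /=; apply: dval (dD (dZ (X1 t) (dI x)) (dC (X0 t) x)) _.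
      by rewrite mulr1 addr0.
    by rewrite !derive_val mul0r subr0 mulf_neq0 ?om' ?X10.
- by move=> p Vp; split=> //; apply: WD; exact: VW.
- by move=> _ [p Vp <-]; split=> //=; apply: WD'; exact: VW.
move=> A A' f g oA oA' sf sg gV /graph_image [h1 h2].
have AW : A `<=` W by move=> t At; apply: (VW (t, f t)); apply: gV; exists t.
have AD : A `<=` dom E by move=> t At; exact: WD (AW t At).
have AD' : A' `<=` dom E' by move=> z /h2 [t At <-]; exact: WD' (AW t At).
rewrite sol // sol' //; pose h z := (g z - phi0' z) / rho' z.
have sh : smooth A' h.
  apply: smoothM => //; first by apply: smoothB => //; exact: smooth_sub AD' _.
  by apply: smoothV => [//|z /AD' /rho0' //|]; exact: smooth_sub AD' _.
have e t : A t -> (f t - phi0 t) / rho t = (m t)^-1 * (h (om t) - k (om t)).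
  move=> At; have [_ e] := h1 t At; have Wt := AW t At.
  rewrite /h e /= X1E // X0E //; have a := m0 t Wt; have b := rho0 t (WD t Wt).
  have c := rho0' _ (WD' t Wt).
  by field; rewrite a b c.
have key t : A t -> (P (fun t => (f t - phi0 t) / rho t) t = 0 <-> P' h (om t) = 0).
  by move=> At; rewrite (loc A _ _ oA e t At); apply: (inv A A') => // s /h1 [].
split=> H; first by move=> z /h2 [t At <-]; apply/key => //; exact: H.
by move=> t At; apply/key => //; apply: H; have [] := h1 t At.
Qed.

(** Division by [derive1 T t1] makes the derivative close to one near [t1], the situation of
    [inverse]. *)
Lemma local_inverse (D : set K) (T : K -> K) (t1 : K) : open D -> D t1 -> smooth D T ->
  derive1 T t1 != 0 -> exists (r r' : R) (Ti : K -> K),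
  [/\ 0 < r, 0 < r', forall t, nm (t - t1) < r -> D t /\ derive1 T t != 0,
    forall u v, nm (u - t1) < r -> nm (v - t1) < r -> T u = T v -> u = v &
    smooth [set z | nm (z - T t1) < r'] Ti /\
    forall z, nm (z - T t1) < r' -> nm (Ti z - t1) < r /\ T (Ti z) = z].
Proof.
move=> oD D1 sT; set a := derive1 T t1 => a0.
have sT' := smooth_derive1 sT.
have na : 0 < nm a by rewrite nm_gt0.
have [d1 d1_gt0 H1] := (@openPK _ _ pk D).1 oD t1 D1.
have h2 : 0 < nm a / 2 by rewrite divr_gt0.
have [d2 d2_gt0 H2] := (@contPK _ _ pk (derive1 T) t1).1 (smooth_cont sT' D1) _ h2.
pose r := Num.min d1 d2; have r0 : 0 < r by rewrite lt_min d1_gt0 d2_gt0.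
have HD t : nm (t - t1) < r -> D t by rewrite lt_min => /andP[/H1].
have Hd t : nm (t - t1) < r -> nm (derive1 T t - a) < nm a / 2.
  by rewrite lt_min => /andP[_ /H2].
have oB : open [set t | nm (t - t1) < r] by have [] := domain_ball t1 r0.
pose s t := a^-1 * T t.
have ss : smooth [set t | nm (t - t1) < r] s.
  by apply: smoothZ => //; exact: smooth_sub HD _.
have s' t : nm (t - t1) < r -> derive1 s t = a^-1 * derive1 T t.
  by move=> h; rewrite (der1Z _ sT (HD t h)).
have s1 t : nm (t - t1) < r -> nm (derive1 s t - 1) <= 1 / 2.
  move=> h; rewrite s' //; have -> : a^-1 * derive1 T t - 1 = a^-1 * (derive1 T t - a).
    by rewrite mulrBr mulVf.
  rewrite nmM nmV mulrC ler_pdivrMr //; apply: ltW; apply: lt_le_trans (Hd t h) _.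
  by rewrite mulrC mul1r.
have [inj [si ssi Hsi]] := inverse r0 ss s1.
have b0 : 0 < r / 4 * nm a by rewrite mulr_gt0 // divr_gt0.
have bs z : nm (z - T t1) < r / 4 * nm a -> nm (a^-1 * z - s t1) < r / 4.
  by move=> h; rewrite /s -mulrBr nmM nmV mulrC ltr_pdivrMr.
exists r, (r / 4 * nm a), (fun z => si (a^-1 * z)); split=> //.
- move=> t h; split; first exact: HD.
  apply/eqP => e; have := Hd t h; rewrite e sub0r nmN; move: na; clear; lra.
- move=> u v hu hv e; apply/eqP; rewrite -subr_eq0 -(nm_eq0 (pk := pk)).
  have := inj u v hu hv; rewrite /s e subrr nmK0 mulr0 => h.
  by rewrite eq_le h /= nmK_ge0.
- split.
    have oZ : open [set z | nm (z - T t1) < r / 4 * nm a].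
      by have [] := domain_ball (pk := pk) (T t1) b0.
    apply: (smooth_comp oZ _ _ ssi); first exact: bs.
    by apply: smoothZ => //; exact: smooth_id.
  move=> z /bs /Hsi [h e]; split=> //.
  by have := congr1 ( *%R a) e; rewrite /s !mulVKf.
Qed.

End Gauge.

(** * The space of solutions and its limits *)

Section SolutionSpace.
Context {R : realType} {K : numFieldType} {pk : kpkg R K}.
Local Notation nm := (@nm R K pk _).
Local Notation io := (io pk).
Variables (n : nat) (E : lode K n.+1) (rho q : K -> K) (d : nat -> K -> K) (phi0 : K -> K).
Hypotheses (domD : domain (dom E)) (sq : smooth (dom E) q) (sd : forall j, smooth (dom E) (d j)).
Hypothesis gE : gauge E rho phi0 (Pop q n d).
Hypothesis gH : gauge (homogeneous E) rho (fun=> 0) (Pop q n d).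
Let D := dom E.
Let oD : open D. Proof. by have [] := domD. Qed.
Let srho : smooth D rho. Proof. by have [] := gE. Qed.
Let rho0 t : D t -> rho t != 0. Proof. by move=> Dt; have [_ h _ _ _] := gE; exact: h. Qed.
Local Notation hom := (solution (homogeneous E)).

Lemma solution_local r (F : lode K r) U f : U `<=` dom F ->
  (forall t, U t -> exists2 W : set K, W t & solution F W f) -> solution F U f.
Proof.
move=> UD H; split=> //.
  by apply: smooth_local => t /H [W Wt [_ sf _]]; exists W.
by move=> t /H [W Wt [_ _ h]]; exact: h.
Qed.

Lemma solution_sub r (F : lode K r) U W f : W `<=` U -> solution F U f -> solution F W f.
Proof.
move=> WU [UD sf h]; split; first exact: subset_trans WU UD.
  exact: smooth_sub WU sf.
by move=> t /WU /h.
Qed.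

Lemma solution_ext r (F : lode K r) U f g : open U -> (forall t, U t -> f t = g t) ->
  solution F U f -> solution F U g.
Proof.
move=> oU e [UD sf h]; split=> //; first exact: smooth_ext e sf.
move=> t Ut; rewrite -h //; congr (_ + _); first by rewrite (derive1n_ext _ oU e Ut).
by apply: eq_bigr => i _; rewrite (derive1n_ext _ oU e Ut).
Qed.

Let ssV (U : set K) (f : K -> K) : U `<=` D -> open U -> smooth U f -> smooth U (fun t => f t / rho t).
Proof.
move=> UD oU sf; apply: smoothM => //; apply: smoothV => //; last exact: smooth_sub UD _.
by move=> t /UD /rho0.
Qed.

Lemma homP (U : set K) (f : K -> K) : open U -> U `<=` D -> smooth U f ->
  (hom U f <-> forall t, U t -> Pop q n d (fun t => f t / rho t) t = 0).
Proof.
move=> oU UD sf; have [_ _ _ loc sol] := gH; rewrite sol //.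
have e t : U t -> Pop q n d (fun t => (f t - 0) / rho t) t = Pop q n d (fun t => f t / rho t) t.
  by move=> Ut; apply: (loc U) => // s _; rewrite subr0.
by split=> h t Ut; [rewrite -e|rewrite e] => //; exact: h.
Qed.

Lemma hom_comb U (a b : K) f g : open U -> hom U f -> hom U g ->
  hom U (fun t => a * f t + b * g t).
Proof.
move=> oU hf hg; have [UD sf _] := hf; have [_ sg _] := hg.
have sl : smooth U (fun t => a * f t + b * g t) by apply: smoothD => //; exact: smoothZ.
apply/homP => // t Ut.
have e s : U s -> (a * f s + b * g s) / rho s = a * (f s / rho s) + b * (g s / rho s).
  by move=> _; rewrite mulrDl !mulrA.
rewrite (Pop_ext q n d oU e Ut) (Pop_lin n d a b oU (smooth_sub UD sq) _ _ Ut); try exact: ssV.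
by rewrite (homP oU UD sf).1 // (homP oU UD sg).1 // !mulr0 addr0.
Qed.

Lemma hom_Z U (a : K) f : open U -> hom U f -> hom U (fun t => a * f t).
Proof.
move=> oU hf; apply: (@solution_ext _ _ _ (fun t => a * f t + 0 * f t)) => //.
  by move=> t _; rewrite mul0r addr0.
exact: hom_comb.
Qed.

Lemma solP (U : set K) (f : K -> K) : open U -> U `<=` D -> smooth U f ->
  (solution E U f <-> hom U (fun t => f t - phi0 t)).
Proof.
move=> oU UD sf; have [_ _ sp _ sol] := gE; rewrite sol // homP //.
by apply: smoothB => //; exact: smooth_sub UD _.
Qed.

Lemma sol_add U (a : K) f g : open U -> solution E U f -> hom U g ->
  solution E U (fun t => f t + a * g t).
Proof.
move=> oU sf hg; have [UD ssf _] := sf; have [_ ssg _] := hg.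
apply/solP => //; first by apply: smoothD => //; exact: smoothZ.
apply: (@solution_ext _ _ _ (fun t => 1 * (f t - phi0 t) + a * g t)) => //.
  by move=> t _; rewrite mul1r addrAC.
by apply: hom_comb => //; apply/solP.
Qed.

Lemma sol_diff U f g : open U -> solution E U f -> solution E U g ->
  hom U (fun t => f t - g t).
Proof.
move=> oU sf sg; have [UD ssf _] := sf; have [_ ssg _] := sg.
apply: (@solution_ext _ _ _ (fun t => 1 * (f t - phi0 t) + (-1) * (g t - phi0 t))) => //.
  by move=> t _; ring.
by apply: hom_comb => //; apply/solP.
Qed.

Lemma hom_jets t1 (x0 : nat -> K) : D t1 ->
  exists g, [/\ smooth D g, forall i, (i < n.+1)%N -> FF q n i g t1 = x0 i &
    hom D (fun t => rho t * g t)].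
Proof.
move=> D1; have s0 : smooth D (fun=> 0 : K) by exact: smooth_cst.
have [g [sg jg Pg]] := Pop_exists n x0 domD D1 sq sd s0.
exists g; split=> //; apply/homP => //; first exact: smoothM.
move=> t Dt; rewrite -(Pg t Dt); apply: (Pop_ext q n d oD) => // s Ds.
by rewrite mulrAC divff ?mul1r //; exact: rho0.
Qed.

(** The basis is dual to the jets at [t1], so the coefficients of a solution are its own jets. A
    solution on a smaller convex domain through [t1] is thereby expressed by functions on all of
    [D]. *)
Lemma hom_basis t1 : D t1 -> exists phi : nat -> K -> K,
  [/\ forall j, hom D (phi j),
    forall U f, domain U -> U t1 -> hom U f ->
      exists c : nat -> K, forall t, U t -> f t = \sum_(j < n.+1) c j * phi j t &
    forall (c : nat -> K) U, open U -> U `<=` D -> U t1 ->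
      (forall t, U t -> \sum_(j < n.+1) c j * phi j t = 0) ->
      forall j, (j < n.+1)%N -> c j = 0].
Proof.
move=> D1; have /choice [g hg] : forall j : nat, exists g, [/\ smooth D g,
    forall i, (i < n.+1)%N -> FF q n i g t1 = (i == j)%:R & hom D (fun t => rho t * g t)].
  by move=> j; exact: hom_jets.
have sg j : smooth D (g j) by have [] := hg j.
have jets U (c : nat -> K) i : open U -> U `<=` D -> U t1 -> (i < n.+1)%N ->
    FF q n i (fun t => \sum_(j < n.+1) c j * g j t) t1 = c i.
  move=> oU UD U1 hi.
  rewrite (FF_sum n i (fun j : 'I_n.+1 => c j) oU (smooth_sub UD sq) (fun j => smooth_sub UD (sg j)) U1).
  rewrite (bigD1 (Ordinal hi)) //= big1 ?addr0.
    by have [_ h _] := hg i; rewrite h // eqxx mulr1.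
  move=> j ji; have [_ h _] := hg j; rewrite h //.
  by rewrite (_ : (i == j :> nat) = false) ?mulr0 //; apply/negbTE; rewrite eq_sym.
exists (fun j t => rho t * g j t); split=> [j|U f domU U1 hf|c U oU UD U1 h j hj].
- by have [] := hg j.
- have [UD sf _] := hf; have [_ oU _] := domU.
  have sfr := ssV UD oU sf; have sqU := smooth_sub UD sq.
  pose c j := FF q n j (fun t => f t / rho t) t1.
  pose S t := \sum_(j < n.+1) c j * g j t.
  have sS : smooth U S by apply: smooth_sum => // j _; apply: smoothZ => //; exact: smooth_sub UD (sg j).
  exists c => t Ut.
  have : 1 * (f t / rho t) + (-1) * S t = 0.
    pose k t := 1 * (f t / rho t) + (-1) * S t.
    apply: (@Pop_unique _ _ pk U t1 q n d k) => //.
    + by move=> j; exact: smooth_sub UD (sd j).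
    + by apply: smoothD => //; exact: smoothZ.
    + move=> i hi; rewrite (FF_lin n i _ _ oU sqU sfr sS U1) (jets U c i oU UD U1 hi).
      by rewrite mul1r mulN1r subrr.
    + move=> s Us; rewrite (Pop_lin n d _ _ oU sqU sfr sS Us) (homP oU UD sf).1 //.
      rewrite (Pop_sum n d (fun j : 'I_n.+1 => c j) oU sqU (fun j => smooth_sub UD (sg j)) Us).
      rewrite big1 ?mulr0 ?addr0 // => j _.
      have [sgj _ hj] := hg j; have := (homP oD (@subset_refl _ _) (smoothM oD srho sgj)).1 hj s (UD s Us).
      have e u : D u -> rho u * g j u / rho u = g j u.
        by move=> Du; rewrite mulrAC divff ?mul1r //; exact: rho0.
      by rewrite (Pop_ext q n d oD e (UD s Us)) => ->; rewrite mulr0.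
  rewrite mul1r mulN1r => /eqP; rewrite subr_eq0 => /eqP e.
  have r0 := rho0 (UD t Ut); rewrite -[LHS](divfK r0) e mulr_suml.
  by apply: eq_bigr => j _; rewrite -mulrA [g j t * _]mulrC.
- rewrite -(jets U c j oU UD U1 hj).
  have e t : U t -> \sum_(j < n.+1) c j * g j t = 0.
    move=> Ut; apply: (mulfI (rho0 (UD t Ut))); rewrite mulr0 mulr_sumr -[RHS](h t Ut).
    by apply: eq_bigr => i _; rewrite mulrCA.
  have s0 : smooth U (fun=> 0 : K) by exact: smooth_cst.
  rewrite (FF_ext q n j oU e U1) (FF_ext q n j oU (h := fun t => 0 * 0 + 0 * 0)).
  + by rewrite (FF_lin n j 0 0 oU (smooth_sub UD sq) s0 s0 U1) !mul0r addr0.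
  + by move=> t _; rewrite !mul0r addr0.
  + exact: U1.
Qed.

(** [Q] is the pointwise limit of the solutions [k s / s], hence lies in their finite-dimensional
    span by [span_closed]. Pointwise control suffices; no derivative in [t] is exchanged with the
    limit. *)
Lemma var_limit W t1 (k : K -> K -> K) (Q : K -> K) (dl : R) : domain W -> W t1 -> W `<=` D ->
  0 < dl -> (forall s, s != 0 -> nm s < dl -> hom W (k s)) ->
  (forall t, W t -> forall e : R, 0 < e -> exists2 h : R, 0 < h & forall s, s != 0 -> nm s < h ->
    nm (k s t - s * Q t) <= e * nm s) -> hom W Q.
Proof.
move=> domW W1 WD dl0 hk lim; have [_ oW _] := domW.
have [phi [hphi span _]] := hom_basis (WD _ W1).
(* The denominators start at 2 so that every parameter lies strictly below [dl]. *)
pose sr (m : nat) : R := dl / m.+2%:R; pose s m : K := io (sr m).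
have sr0 m : 0 < sr m by rewrite divr_gt0.
have ns m : nm (s m) = sr m by rewrite nm_io gtr0_norm.
have s0 m : s m != 0 by rewrite -(nm_gt0 (pk := pk)) ns.
have sdl m : nm (s m) < dl.
  rewrite ns ltr_pdivrMr // -[X in X < _]mulr1 ltr_pM2l //.
  by rewrite -[1]/(1%:R) ltr_nat.
have [c hc] : exists c : nat -> K, forall t, W t -> Q t = \sum_(j < n.+1) c j * phi j t.
  apply: (@span_closed _ _ pk W n.+1 phi (fun m t => (s m)^-1 * k (s m) t)).
    by move=> m; apply: span => //; apply: hom_Z => //; exact: hk.
  move=> t Wt e e0; have [h h0 H] := lim t Wt e e0.
  have [N hN] : exists N : nat, dl / h < N%:R.
    by exists (Num.bound (dl / h)); apply: archi_boundP; rewrite ltW // divr_gt0.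
  exists N => m hm; have hs : nm (s m) < h.
    rewrite ns ltr_pdivrMr // mulrC -ltr_pdivrMr //; apply: lt_le_trans hN _.
    by rewrite ler_nat; apply: leq_trans hm _; rewrite -addn2 leq_addr.
  have -> : (s m)^-1 * k (s m) t - Q t = (s m)^-1 * (k (s m) t - s m * Q t).
    by rewrite mulrBr mulKf.
  by rewrite nmM nmV mulrC ler_pdivrMr ?nm_gt0 //; exact: H.
have hom_sum m : hom W (fun t => \sum_(j < m) c j * phi j t).
  elim: m => [|m IH].
    apply: (@solution_ext _ _ _ (fun t => 0 * phi 0%N t)) => //.
      by move=> t _; rewrite big_ord0 mul0r.
    by apply: hom_Z => //; exact: solution_sub WD _.
  apply: (@solution_ext _ _ _ (fun t => 1 * (\sum_(j < m) c j * phi j t) + c m * phi m t)) => //.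
    by move=> t _; rewrite big_ord_recr mul1r.
  by apply: hom_comb => //; exact: solution_sub WD _.
apply: solution_ext (hom_sum n.+1) => // t Wt; exact: esym (hc t Wt).
Qed.

End SolutionSpace.

(** * Symmetries act on solutions *)
Section FlowOnSolutions.
Context {R : realType} {K : numFieldType} {pk : kpkg R K}.
Local Notation nm := (@nm R K pk _).
Local Notation io := (io pk).

Lemma ball0E (dl e : K) : 0 < dl -> ball (0 : K) dl e <-> nm e < nm dl.
Proof.
move=> /(posK (pk := pk)) [_ h]; rewrite -ball_normE /= sub0r normrN {1}h.
by rewrite -(io_nm (pk := pk)) io_lt.
Qed.

Lemma open_prod (V1 V2 : normedModType K) (A : set V1) (B : set V2) :
  open A -> open B -> open (A `*` B).
Proof.
move=> /(openP (pk := pk)) oA /(openP (pk := pk)) oB; apply/(openP (pk := pk)) => -[x y] [/= Ax By].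
have [a a0 ha] := oA x Ax; have [b b0 hb] := oB y By.
exists (Num.min a b); first by rewrite lt_min a0 b0.
move=> [x' y']; rewrite lt_min => /andP[h1 h2]; split=> /=.
  by apply: ha; apply: le_lt_trans h1; exact: (nm_fst pk ((x', y') - (x, y))).
by apply: hb; apply: le_lt_trans h2; exact: (nm_snd pk ((x', y') - (x, y))).
Qed.

Lemma curve_cont (A : set (K * (K * K))) (X : K * (K * K) -> K) (f : K -> K) (t1 : K) :
  open A -> A (0, (t1, f t1)) -> smooth A X -> {for t1, continuous f} ->
  forall e : R, 0 < e -> exists2 d : R, 0 < d & forall s u, nm s < d -> nm (u - t1) < d ->
    A (s, (u, f u)) /\ nm (X (s, (u, f u)) - X (0, (t1, f t1))) < e.
Proof.
move=> oA A1 sX cf e e0.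
have [d1 d10 h1] := (openP (pk := pk) A).1 oA _ A1.
have [d2 d20 h2] := (contP (pk := pk) X _).1 (smooth_cont sX A1) e e0.
pose d := Num.min d1 d2; have d0 : 0 < d by rewrite lt_min d10 d20.
have [d3 d30 h3] := (contPK (pk := pk) f t1).1 cf d d0.
exists (Num.min d d3); first by rewrite lt_min d0 d30.
move=> s u; rewrite !lt_min => /andP[/andP[s1 s2] _] /andP[/andP[u1 u2] /h3].
rewrite lt_min => /andP[f1 f2].
have e1 : (s, (u, f u)) - (0, (t1, f t1)) = (s, (u - t1, f u - f t1)) :> K * (K * K).
  by congr pair; rewrite subr0.
split; [apply: h1|apply: h2]; rewrite e1 !nm_pair /= !gt_max ?s1 ?s2 ?u1 ?u2 ?f1 ?f2.
  by [].
by [].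
Qed.

Variables (n : nat) (E : lode K n.+1) (rho q : K -> K) (d : nat -> K -> K) (phi0 : K -> K).
Hypotheses (domD : domain (dom E)) (sq : smooth (dom E) q) (sd : forall j, smooth (dom E) (d j)).
Hypothesis gE : gauge E rho phi0 (Pop q n d).
Hypothesis gH : gauge (homogeneous E) rho (fun=> 0) (Pop q n d).
Variables (J : set K) (domJ : domain J) (v : vfield K).
Hypotheses (sv : smooth (dom E `*` J) v) (gv : generates_symmetries E (dom E `*` J) v).
Let D := dom E.
Let oD : open D. Proof. by have [] := domD. Qed.
Let oJ : open J. Proof. by have [] := domJ. Qed.
Let B := D `*` J.
Let oB : open B. Proof. exact: open_prod. Qed.
Local Notation hom := (solution (homogeneous E)).

(** For small [e] the projection [u |-> (Phi (e, (u, f u))).1] is close to the identity, so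
    [inverse] makes the moved curve a graph over a ball whose radius does not depend on [e]. The
    final estimate is the Lipschitz bound of the inverse. *)
Lemma flow_image (U : set K) f (t1 : K) dl V Phi : open U -> solution E U f -> U t1 ->
  0 < dl -> V (t1, f t1) -> local_flow B v dl V Phi ->
  (forall e, ball 0 dl e -> maps_lode V (fun q => Phi (e, q)) E E) ->
  exists2 r : R, 0 < r & (forall t, nm (t - t1) < r -> U t /\ V (t, f t)) /\
  exists2 e0 : R, 0 < e0 & forall e : K, nm e < e0 -> nm e < nm dl /\ exists g : K -> K,
   solution E [set t | nm (t - t1) < r] g /\
   forall z, nm (z - t1) < r -> exists u, [/\ U u, V (u, f u), Phi (e, (u, f u)) = (z, g z) &
     nm (u - z) <= 2 * nm (z - (Phi (e, (z, f z))).1)].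
Proof.
move=> oU sol U1 dl0 V1 [oV sPhi Phi0 _ _] maps; have [UD sf _] := sol.
pose A := ball (0 : K) dl `*` V.
have bE e : ball (0 : K) dl e <-> nm e < nm dl := ball0E e dl0.
have oA : open A by apply: open_prod => //; exact: ball_open.
have A1 : A (0, (t1, f t1)) by split=> //=; exact: ballxx.
have cf := smooth_cont sf U1.
have sF := smooth_pfst oA sPhi; have sG := smooth_psnd oA sPhi.
have sF1 := smooth_D (0, ((1, 0) : K * K)) sF.
have sF2 := smooth_D (0, ((0, 1) : K * K)) sF.
set F := fun _ => _ in sF sF1 sF2; set G := fun _ => _ in sG.
(* At time zero the flow is the identity, so the partial derivatives of its first component are 1
   and 0. *)
have F10 w : 'D_(0, w) F (0, (t1, f t1)) = w.1.
  have h : is_derive ((t1, f t1) : K * K) w (fun p => F (0, p)) w.1.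
    apply: (is_derive_ext (f := fst) oV V1); first by move=> p Vp; rewrite /F Phi0.
    exact: is_derive_linear.
  have /is_derive_slice2 h' := h.
  exact: derive_val.
have F11 : 'D_(0, ((1, 0) : K * K)) F (0, (t1, f t1)) = 1 := F10 (1, 0).
have F01 : 'D_(0, ((0, 1) : K * K)) F (0, (t1, f t1)) = 0 := F10 (0, 1).
have [d1 d10 H1] := (openPK (pk := pk) U).1 oU t1 U1.
have [d2 d20 H2] := curve_cont oA A1 sF1 cf (e := 1 / 4) ltac:(by rewrite divr_gt0).
(* [N] bounds [f'] near [t1]. The deviation of the derivative of the projection from 1 is then at
   most [1/4 + N / (4 N) = 1/2]. *)
pose N := nm (derive1 f t1) + 1.
have N0 : 0 < N by rewrite ltr_wpDl // nmK_ge0.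
have [d3 d30 H3] := curve_cont oA A1 sF2 cf (e := 1 / (4 * N)) ltac:(by rewrite divr_gt0 // mulr_gt0).
have [d4 d40 H4] := (contPK (pk := pk) (derive1 f) t1).1 (smooth_cont (smooth_derive1 sf) U1) 1 ltr01.
have [r r0 Hr] : exists2 r : R, 0 < r & forall x, x < r -> [/\ x < d1, x < d2, x < d3 & x < d4].
  exists (Num.min (Num.min d1 d2) (Num.min d3 d4)); first by rewrite !lt_min d10 d20 d30 d40.
  by move=> x; rewrite !lt_min => /andP[/andP[-> ->] /andP[-> ->]].
have UV u : nm (u - t1) < r -> U u /\ V (u, f u).
  move=> /Hr [/H1 Uu h _ _]; split=> //.
  by have [] := H2 0 u ltac:(by rewrite nmK0) h => -[].
have [d5 d50 H5] := curve_cont oA A1 sF cf (e := r / 8) ltac:(by rewrite divr_gt0).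
have oBr : open [set t : K | nm (t - t1) < r] by have [] := domain_ball (pk := pk) t1 r0.
have r80 : 0 < r / 8 by rewrite divr_gt0.
have rr u : nm (u - t1) < r / 8 -> nm (u - t1) < r by move: r0; lra.
exists (r / 8) => //; split; first by move=> t /rr /UV.
exists (Num.min (Num.min r (nm dl)) d5); first by rewrite !lt_min r0 d50 nm_gt0 gt_eqF.
move=> e; rewrite !lt_min => /andP[/andP[er edl] e5]; split=> //.
have be : ball 0 dl e by apply/bE.
have oBr8 : open [set t : K | nm (t - t1) < r / 8] by have [] := domain_ball (pk := pk) t1 r80.
have sPe : smooth V (fun p => Phi (e, p)).
  by apply: smooth_sub (smooth_slice2 e oA sPhi) => p Vp.
have sFe := smooth_pfst oV sPe; have sGe := smooth_psnd oV sPe.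
have sfr : smooth [set t : K | nm (t - t1) < r] f by apply: smooth_sub sf => t /UV [].
pose sg u := F (e, (u, f u)); pose ze u := G (e, (u, f u)).
have Vr u : nm (u - t1) < r -> V (u, f u) by move=> /UV [].
have ssg : smooth [set t : K | nm (t - t1) < r] sg by exact: (chain2_smooth oV oBr Vr sFe sfr).
have sze : smooth [set t : K | nm (t - t1) < r] ze by exact: (chain2_smooth oV oBr Vr sGe sfr).
have dsg u : nm (u - t1) < r -> nm (derive1 sg u - 1) <= 1 / 2.
  move=> hu; have [Uu Vu] := UV u hu; have [_ u2 u3 u4] := Hr _ hu.
  have Au : A (e, (u, f u)) by split.
  have c2 := @chain2_derive _ _ pk (fun p => F (e, p)) V f u (derive1 f u) oV Vu
    (fun w p Vp => @smooth_derivable _ _ _ _ _ w p sFe Vp) (smooth_cont (smooth_D _ sFe) Vu)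
    (smooth_is_derive1 sf Uu).
  have slice w : 'D_w (fun p => F (e, p)) (u, f u) = 'D_(0, w) F (e, (u, f u)).
    have /is_derive_slice2 h := @smooth_is_derive _ _ _ _ _ (0, w) _ sF Au.
    exact: derive_val.
  rewrite (derive1_val c2) !slice.
  have [_ er2 er3 _] := Hr _ er.
  have [_] := H2 e u er2 u2; rewrite F11 => /ltW h2.
  have [_ h3'] := H3 e u er3 u3.
  rewrite F01 in h3'.
  have h3 := ltW h3'.
  rewrite subr0 in h3.
  have h4 : nm (derive1 f u) <= N.
    have h := ltW (H4 u u4); have h' := nmBrK pk (derive1 f u) (derive1 f t1).
    by rewrite /N; move: h h'; lra.
  rewrite addrAC; apply: le_trans (nmDK pk _ _) _; rewrite nmM.
  have : nm (derive1 f u) * nm ('D_(0, (0, 1)) F (e, (u, f u))) <= N * (1 / (4 * N)).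
    by apply: ler_pM; rewrite ?nmK_ge0.
  have -> : N * (1 / (4 * N)) = 1 / 4 by field; rewrite gt_eqF.
  by move: h2; lra.
have [inj [si ssi Hsi]] := inverse r0 ssg dsg.
have F0 : F (0, (t1, f t1)) = t1 by rewrite /F Phi0.
have Hz z : nm (z - t1) < r / 8 -> nm (z - sg t1) < r / 4.
  move=> hz; have [_] := H5 e t1 e5 ltac:(by rewrite subrr nmK0); rewrite F0 -/(sg t1) => h.
  have := triK pk z t1 (sg t1); rewrite (nmCK _ t1); move: hz h; lra.
have siz z : nm (z - t1) < r / 8 -> nm (si z - t1) < r /\ sg (si z) = z.
  by move=> /Hz /Hsi.
have ssi' : smooth [set t : K | nm (t - t1) < r / 8] si by apply: smooth_sub ssi => z /Hz.
pose g z := ze (si z).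
have sg' : smooth [set t : K | nm (t - t1) < r / 8] g.
  by apply: (smooth_comp oBr8 _ ssi' sze) => z /siz [].
exists g; split; last first.
  move=> z hz; have [h1 h2] := siz z hz; have [h3 h4] := UV _ h1; exists (si z); split=> //.
    by rewrite (surjective_pairing (Phi _)); congr pair.
  have := inj (si z) z h1 (rr z hz); rewrite h2; exact.
(* Only the part of the curve landing over the small ball is kept, so that its image is exactly the
   graph of [g] there. *)
pose D0 := [set u : K | nm (u - t1) < r /\ nm (sg u - t1) < r / 8].
have oD0 : open D0.
  apply/(openPK (pk := pk)) => u [h1 h2].
  have [a a0 Ha] := (openPK (pk := pk) _).1 oBr u h1.
  have [b b0 Hb] := (contPK (pk := pk) sg u).1 (smooth_cont ssg h1) (r / 8 - nm (sg u - t1))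
    ltac:(by rewrite subr_gt0).
  exists (Num.min a b); first by rewrite lt_min a0 b0.
  move=> w; rewrite lt_min => /andP[/Ha hw /Hb hb]; split=> //.
  have := triK pk (sg w) (sg u) t1; move: hb; lra.
have [_ _ _ mp] := maps e be.
have D0U : D0 `<=` U by move=> u [/UV []].
apply: (mp D0 _ f g oD0 oBr8 (smooth_sub D0U sf) sg' _ _).1.
- by move=> _ [u [/UV [_ h] _] <-].
- apply/seteqP; split=> [_ [_ [u [h1 h2] <-] <-]|_ [z hz <-]].
    exists (sg u) => //=; rewrite (surjective_pairing (Phi _)); congr pair.
    rewrite /g; have [h3 h4] := siz _ h2.
    suff -> : si (sg u) = u by [].
    apply/eqP; rewrite -subr_eq0 -(nm_eq0 (pk := pk)).
    have := inj _ _ h3 h1; rewrite h4 subrr nmK0 mulr0 => h5.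
    by rewrite eq_le h5 nmK_ge0.
  have [h1 h2] := siz z hz; exists (si z, f (si z)).
    by exists (si z) => //; split=> //=; rewrite h2.
  by rewrite [LHS](surjective_pairing (Phi _)); congr pair.
- exact: solution_sub D0U sol.
Qed.

(** The moved solutions satisfy [g e = f + e * characteristic + o (e)] pointwise, and differences of
    solutions solve the homogeneous equation, so [var_limit] applies. *)
Lemma flow_solution (U : set K) f : open U -> solution E U f -> (forall t, U t -> J (f t)) ->
  hom U (fun t => (v (t, f t)).2 - (v (t, f t)).1 * derive1 f t).
Proof.
move=> oU sol UJ; have [UD sf _] := sol; apply: solution_local => // t1 U1.
have B1 : B (t1, f t1) by split; [exact: UD|exact: UJ].
have [dl [V [Phi [dl0 V1 VB lf maps]]]] := gv B1.
have [r r0 [UV [e0 e00 H]]] := flow_image oU sol U1 dl0 V1 lf maps.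
have [oV sPhi Phi0 Bder _] := lf.
set W := [set t | nm (t - t1) < r] in UV H *.
exists W; first by rewrite /W /= subrr nmK0.
have domW : domain W by exact: domain_ball.
have oW : open W by have [] := domW.
have WU : W `<=` U by move=> t /UV [].
have /choice [g Hg] : forall e, exists g : K -> K, nm e < e0 -> solution E W g /\
    forall z, W z -> exists u, [/\ U u, V (u, f u), Phi (e, (u, f u)) = (z, g z) &
     nm (u - z) <= 2 * nm (z - (Phi (e, (z, f z))).1)].
  move=> e; case: (ltP (nm e) e0) => h; last by exists f.
  by have [_ [g Hg]] := H e h; exists g.
have W1 : W t1 by rewrite /W /= subrr nmK0.
apply: (@var_limit _ _ pk n E rho q d phi0 domD sq sd gE gH W t1
  (fun e t => g e t - f t) _ e0) => //.
- exact: subset_trans WU UD.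
- move=> s _ hs; have [sg _] := Hg s hs.
  exact: sol_diff sq gE gH _ _ _ oW sg (solution_sub WU sol).
move=> z Wz e e_gt0; have [Uz Vz] := UV z Wz.
pose B' := U `*` J; have oB' : open B' by exact: open_prod.
have B'B : B' `<=` B by move=> p [/UD h1 h2].
have svB : smooth B' v := smooth_sub B'B sv.
pose Y (p : K * K) := (v p).2 - derive1 f p.1 * (v p).1.
have sY : smooth B' Y.
  apply: smoothB => //; first exact: smooth_psnd.
  apply: smoothM => //; last exact: smooth_pfst.
  apply: (smooth_comp oB' (U' := U)) => [p [] //||]; first exact: smooth_fst.
  exact: smooth_derive1.
have B'z : B' (z, f z) by split=> //; exact: UJ.
have [h1 h10 H1] := (openP (pk := pk) B').1 oB' _ B'z.
have [h2 h20 H2] := (contP (pk := pk) Y _).1 (smooth_cont sY B'z) e e_gt0.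
have [h hh0 Hh] : exists2 h : R, 0 < h & forall x, x < h -> x < h1 /\ x < h2.
  exists (Num.min h1 h2); first by rewrite lt_min h10 h20.
  by move=> x; rewrite lt_min => /andP[-> ->].
have bE s : ball (0 : K) dl s <-> nm s < nm dl := ball0E s dl0.
pose A := ball (0 : K) dl `*` V.
have oA : open A by apply: open_prod => //; exact: ball_open.
have Az : A (0, (z, f z)) by split=> //=; exact: ballxx.
have sF := smooth_pfst oA sPhi; have sG := smooth_psnd oA sPhi.
have cfz := smooth_cont sf Uz.
have [k1 k10 K1] := curve_cont oA Az sF cfz hh0.
have [k2 k20 K2] := curve_cont oA Az sG cfz hh0.
have [k kk0 Hk] : exists2 k : R, 0 < k & forall x, x < k -> x < k1 /\ x < k2.
  exists (Num.min k1 k2); first by rewrite lt_min k10 k20.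
  by move=> x; rewrite lt_min => /andP[-> ->].
have [k3 k30 K3] := curve_cont oA Az sF cfz (e := k / 2) ltac:(by rewrite divr_gt0).
exists (Num.min (Num.min k k3) e0); first by rewrite !lt_min kk0 k30 e00.
move=> s _; rewrite !lt_min => /andP[/andP[sk sk3] se0].
have [_ /(_ z Wz) [u [Uu Vu Pu uz]]] := Hg s se0.
have uzk : nm (u - z) < k.
  have [_] := K3 s z sk3 ltac:(by rewrite subrr nmK0).
  rewrite Phi0 //= (nmCK _ _ z) => h'; apply: le_lt_trans uz _.
  by rewrite mulrC -ltr_pdivlMr.
(* The flow line that ends at [(z, g s z)] is followed from its start on the graph of [f]. Its
   height above that graph vanishes at time 0, is [g s z - f z] at time [s], and has the
   characteristic as derivative; differentiating [g] in the parameter is avoided. *)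
pose w (s' : K) := (Phi (s', (u, f u))).2 - f (Phi (s', (u, f u))).1.
have seg (x : R) : 0 <= x <= 1 -> nm (0 + io x * (s - 0)) < k.
  move=> hx; have := @seg_le _ _ pk 0 s x hx; rewrite !subr0 => h'.
  exact: le_lt_trans h' sk.
have dw s' : nm s' < k -> exists2 l : K, is_derive (s' : K) 1 (w : K -> K) l & nm (l - Y (z, f z)) <= e.
  move=> /[dup] hs /Hk [hs1 hs2]; have [ku1 ku2] := Hk _ uzk.
  have [[bs _] F1] := K1 s' u hs1 ku1; have [_ G1] := K2 s' u hs2 ku2.
  rewrite Phi0 //= in F1; rewrite Phi0 //= in G1.
  have near : nm (Phi (s', (u, f u)) - (z, f z)) < h by rewrite nm_pair gt_max F1 G1.
  have [near1 near2] := Hh _ near.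
  have B'P := H1 _ near1; have [_ dP] := Bder s' (u, f u) bs Vu.
  have YP := H2 _ near2.
  exists (Y (Phi (s', (u, f u)))); last exact: ltW.
  have U1' : U (Phi (s', (u, f u))).1 by have [] := B'P.
  apply: dval (dB (is_derive_snd dP) (dcomp (is_derive_fst dP) (smooth_is_derive1 sf U1'))) _.
  by rewrite /Y mulrC.
have M : nm (w s - w 0 - Y (z, f z) * (s - 0)) <= e * nm (s - 0).
  apply: (MVTlin (pk := pk)) => x hx; have [l dl' hl] := dw _ (seg x hx).
    exact: (@ex_derive _ _ _ _ _ _ _ dl').
  by rewrite (derive1_val dl').
have w0 : w 0 = 0 by rewrite /w Phi0 //= subrr.
have ws : w s = g s z - f z by rewrite /w Pu.
have -> : g s z - f z - s * ((v (z, f z)).2 - (v (z, f z)).1 * derive1 f z) =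
    g s z - f z - Y (z, f z) * s by rewrite /Y mulrC [derive1 f z * _]mulrC.
by move: M; rewrite w0 ws !subr0.
Qed.

End FlowOnSolutions.

(** * Orders of vanishing *)

Section Growth.
Context {R : realType} {K : numFieldType} {pk : kpkg R K}.
Local Notation nm := (@nm R K pk _).
Local Notation io := (io pk).

(** The first nonzero Taylor term, of order [i < m], would dominate [C * x ^+ m] for small [x]; real
    increments suffice to see this. *)
Lemma flat_jets (U : set K) (h : K -> K) (t1 : K) m (C r : R) : open U -> U t1 -> smooth U h ->
  0 < r -> (forall t, nm (t - t1) < r -> nm (h t) <= C * nm (t - t1) ^+ m) ->
  forall i, (i < m)%N -> derive1n i h t1 = 0.
Proof.
move=> oU U1 sh r0 H; elim/ltn_ind => i IH im.
have IH' j : (j < i)%N -> derive1n j h t1 = 0 by move=> ji; apply: IH => //; exact: ltn_trans im.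
set L := derive1n i h t1; have f0 : 0 < i`!%:R :> R by rewrite ltr0n fact_gt0.
suff : L / i`!%:R = 0.
  move=> /eqP; rewrite mulf_eq0 invr_eq0 pnatr_eq0 -[(i`! == 0)%N]negbK -lt0n fact_gt0 orbF.
  by move/eqP.
apply: (@nm_small _ _ pk) => e e0; have e2 : 0 < e / 2 by rewrite divr_gt0.
have [d d0 T] := taylor (pk := pk) oU U1 sh IH' e2.
have C0 : 0 <= Num.max C 0 by rewrite le_max lexx orbT.
pose c1 := Num.max C 0 + 1; have c10 : 0 < c1 by rewrite ltr_wpDl.
pose x := Num.min (Num.min (d / 2) (r / 2)) (Num.min 1 (e / 2 / c1)).
have x0 : 0 < x by rewrite !lt_min ltr01 !divr_gt0.
have [xd xr x1 xe] : [/\ x <= d / 2, x <= r / 2, x <= 1 & x <= e / 2 / c1].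
  by split; rewrite /x !ge_min lexx ?orbT.
have E : (t1 + io x) - t1 = io x by rewrite addrC addKr.
have nx : nm (io x : K) = x by rewrite nm_io gtr0_norm.
have := T (t1 + io x); have := H (t1 + io x); rewrite E nx => h1 h2.
have {}h1 := h1 ltac:(by move: xr r0; lra); have {}h2 := h2 ltac:(by move: xd d0; lra).
have xi0 : 0 < x ^+ i by rewrite exprn_gt0.
have h3 : nm (h (t1 + io x)) <= e / 2 * x ^+ i.
  apply: le_trans h1 _; apply: le_trans (_ : c1 * x ^+ m <= _).
    by rewrite ler_wpM2r ?exprn_ge0 ?(ltW x0) // /c1 ler_wpDr // le_max lexx.
  apply: le_trans (_ : c1 * x ^+ i.+1 <= _).
    by rewrite ler_pM2l // ler_wiXn2l // ltW.
  by rewrite exprS mulrA ler_pM2r // mulrC -ler_pdivlMr.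
have : nm (L / i`!%:R * io x ^+ i) <= e * x ^+ i.
  have := nmBK pk (h (t1 + io x)) (h (t1 + io x) - L / i`!%:R * io x ^+ i).
  by rewrite subKr => h4; apply: le_trans h4 _; move: h2 h3; lra.
by rewrite nmM nmX nx ler_pM2r.
Qed.

Lemma jet_growth (U : set K) (h : K -> K) (t1 : K) m : open U -> U t1 -> smooth U h ->
  (forall i, (i < m)%N -> derive1n i h t1 = 0) -> derive1n m h t1 = 1 ->
  exists c r : R, [/\ 0 < c, 0 < r & forall t, nm (t - t1) < r ->
    c * nm (t - t1) ^+ m <= nm (h t) <= 2 * nm (t - t1) ^+ m].
Proof.
move=> oU U1 sh hi hm; pose c : R := (m`!%:R)^-1 / 2.
have f0 : 0 < m`!%:R :> R by rewrite ltr0n fact_gt0.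
have fi0 : 0 < m`!%:R^-1 :> R by rewrite invr_gt0.
have fi1 : m`!%:R^-1 <= 1 :> R by rewrite invf_le1 // -[1]/(1%:R) ler_nat fact_gt0.
have c0 : 0 < c by rewrite divr_gt0.
have [r r0 T] := taylor (pk := pk) oU U1 sh hi c0.
exists c, r; split=> // t /T; rewrite hm mul1r.
set y := _ ^+ m => h1.
have nt : nm y = nm (t - t1) ^+ m by rewrite nmX.
set w := m`!%:R^-1 * y in h1 *.
have h3 := nmDK pk w (h t - w); rewrite (_ : w + (h t - w) = h t) in h3; last by ring.
have h2 := nmDK pk (h t) (w - h t); rewrite (_ : h t + (w - h t) = w) in h2; last by ring.
move: h2 h3; rewrite [nm (w - h t)](nmCK _ w).
rewrite (nmM m`!%:R^-1 y) nmV nm_nat nt => h2 h3.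
have y0 : 0 <= nm (t - t1) ^+ m by rewrite exprn_ge0 ?nmK_ge0.
move: h1 h2 h3 y0; rewrite /c; set z := _ ^+ m => h1 h2 h3 z0.
have h4 : m`!%:R^-1 * z <= z by rewrite ler_piMl.
have h5 : m`!%:R^-1 / 2 * z = m`!%:R^-1 * z / 2 by rewrite mulrAC.
have h6 : 0 <= m`!%:R^-1 * z by rewrite mulr_ge0 // ltW.
rewrite h5 in h1 *; apply/andP; split; move: h1 h2 h3 h4 z0 h6; lra.
Qed.

(** [FF q n k g - g^(k)] has order less than [k], so both families have the same first nonzero
    jet. *)
Lemma FF_jets_d1n (U : set K) q n (g : K -> K) (t1 : K) m : open U -> U t1 -> smooth U q ->
  smooth U g -> (forall i, (i < m)%N -> FF q n i g t1 = 0) ->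
  (forall i, (i < m)%N -> derive1n i g t1 = 0) /\ derive1n m g t1 = FF q n m g t1.
Proof.
move=> oU U1 sq sg hF.
have key k : (forall i, (i < k)%N -> derive1n i g t1 = 0) -> derive1n k g t1 = FF q n k g t1.
  move=> hk; have := low_eval (FF_d1n_low1 oU n k sq) oU sg U1.
  by move=> /(_ _)/eqP; rewrite subr_eq0 => H; apply/esym/eqP/H => i ik; rewrite FF0; exact: hk.
have H i : (i < m)%N -> derive1n i g t1 = 0.
  elim/ltn_ind: i => i IH im; rewrite key; first exact: hF.
  by move=> j ji; apply: IH => //; exact: ltn_trans im.
by split=> //; exact: key.
Qed.

Lemma d1n_jets_FF (U : set K) q n (g : K -> K) (t1 : K) m : open U -> U t1 -> smooth U q ->
  smooth U g -> (forall i, (i < m)%N -> derive1n i g t1 = 0) ->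
  forall i, (i < m)%N -> FF q n i g t1 = 0.
Proof.
move=> oU U1 sq sg h i im.
have s0 : smooth U (fun=> 0 : K) by exact: smooth_cst.
apply: (low_eval (FF_low oU s0 0 n i sq) oU sg U1) => k ki.
by rewrite FF0; apply: h; apply: leq_trans im.
Qed.

End Growth.

(** * First and second variation of the symmetry condition *)

Section Forward.
Context {R : realType} {K : numFieldType} {pk : kpkg R K}.
Local Notation nm := (@nm R K pk _).
Local Notation io := (io pk).

Lemma linear_lim0 (F : K -> K) (t1 : K) (C r : R) : {for t1, continuous F} -> 0 < r ->
  (forall t, t != t1 -> nm (t - t1) < r -> nm (F t) <= C * nm (t - t1)) -> F t1 = 0.
Proof.
move=> cF r0 H; apply: (@nm_small _ _ pk) => e e0; have e2 : 0 < e / 2 by rewrite divr_gt0.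
have [d d0 Hd] := (contPK (pk := pk) F t1).1 cF _ e2.
have C0 : 0 <= Num.max C 0 by rewrite le_max lexx orbT.
pose c1 := Num.max C 0 + 1; have c10 : 0 < c1 by rewrite ltr_wpDl.
pose x := Num.min (Num.min (d / 2) (r / 2)) (e / 2 / c1).
have x0 : 0 < x by rewrite !lt_min !divr_gt0.
have [xd xr xe] : [/\ x <= d / 2, x <= r / 2 & x <= e / 2 / c1].
  by split; rewrite /x !ge_min lexx ?orbT.
have E1 : (t1 + io x) - t1 = io x by rewrite addrC addKr.
have nx : nm (io x : K) = x by rewrite nm_io gtr0_norm.
have ne : t1 + io x != t1 by rewrite -subr_eq0 E1 -(nm_gt0 (pk := pk)) nx.
have := Hd (t1 + io x); have := H _ ne; rewrite E1 nx => h1 h2.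
have {}h1 := h1 ltac:(by move: xr r0; lra); have {}h2 := h2 ltac:(by move: xd d0; lra).
have h3 : C * x <= e / 2.
  apply: le_trans (_ : c1 * x <= _); last by rewrite mulrC -ler_pdivlMr.
  by rewrite ler_pM2r // /c1 ler_wpDr // le_max lexx.
by have := nmBrK pk (F t1) (F (t1 + io x)); rewrite (nmCK _ (F t1)); move: h1 h2 h3; lra.
Qed.

(** The worst term [g * g'] has exponent [n' + (n' - 1)], which reaches [n' + 1] exactly when
    [n' >= 2]. Here the order of the equation, at least three, enters. *)
Lemma product_growth (n' : nat) (A Bb g g' N y : R) : (2 <= n')%N -> 0 <= A <= N -> 0 <= Bb <= N ->
  0 <= y <= 1 -> 0 <= g <= 2 * y ^+ n' -> 0 <= g' <= 2 * y ^+ n'.-1 ->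
  g * (A * g + Bb * g') <= 8 * N * y ^+ n'.+1.
Proof.
move=> n2 /andP[A0 AN] /andP[B0 BN] /andP[y0 y1] /andP[g0 gy] /andP[g'0 gy'].
have N0 : 0 <= N by exact: le_trans AN.
have gy2 : g <= 2 * y ^+ n'.-1.
  by apply: le_trans gy _; rewrite ler_pM2l // ler_wiXn2l // leq_pred.
have h1 : A * g + Bb * g' <= N * (2 * y ^+ n'.-1) + N * (2 * y ^+ n'.-1).
  by apply: lerD; apply: ler_pM.
apply: le_trans (ler_pM g0 _ gy h1) _; first by rewrite addr_ge0 ?mulr_ge0.
have -> : 2 * y ^+ n' * (N * (2 * y ^+ n'.-1) + N * (2 * y ^+ n'.-1)) =
    8 * N * (y ^+ n' * y ^+ n'.-1) by ring.
rewrite -exprD ler_wpM2l ?mulr_ge0 // ler_wiXn2l // -addn1 leq_add2l.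
by case: (n') n2 => [|[]].
Qed.

Variables (n : nat) (E : lode K n.+1) (rho q : K -> K) (d : nat -> K -> K) (phi0 : K -> K).
Hypotheses (domD : domain (dom E)) (sq : smooth (dom E) q) (sd : forall j, smooth (dom E) (d j)).
Hypothesis gE : gauge E rho phi0 (Pop q n d).
Hypothesis gH : gauge (homogeneous E) rho (fun=> 0) (Pop q n d).
Let D := dom E.
Let oD : open D. Proof. by have [] := domD. Qed.
Local Notation hom := (solution (homogeneous E)).

Lemma variation (W : set K) t1 (N : K -> K -> K) (Q : K -> K) (dl : R) : domain W -> W t1 ->
  W `<=` D -> 0 < dl -> (forall s, nm s < dl -> hom W (N s)) ->
  (forall t, W t -> is_derive (0 : K) 1 (fun s : K => N s t) (Q t)) -> hom W Q.
Proof.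
move=> domW W1 WD dl0 hN dN; have [_ oW _] := domW.
apply: (@var_limit _ _ pk n E rho q d phi0 domD sq sd gE gH W t1
  (fun s t => N s t - N 0 t) Q dl) => //.
  move=> s _ hs; apply: (@solution_ext _ _ _ _ (fun t => 1 * N s t + (-1) * N 0 t)) => //.
    by move=> t _; rewrite mul1r mulN1r.
  by apply: (hom_comb sq gE gH _ _ oW); apply: hN; rewrite ?nmK0.
move=> t Wt e e0; have [h h0 H] := (derivPK (pk := pk) _ _ _).1 (dN t Wt) e e0.
by exists h => // s _ hs; have := H s; rewrite subr0 [s * Q t]mulrC; exact.
Qed.

Lemma near_graph (J U : set K) (f g : K -> K) t1 : open J -> open U -> U t1 -> J (f t1) ->
  smooth U f -> smooth U g -> exists r dl : R, [/\ 0 < r, 0 < dl &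
    forall t s : K, nm (t - t1) < r -> nm s < dl -> U t /\ J (f t + s * g t)].
Proof.
move=> oJ oU U1 J1 sf sg.
have [a a0 Ha] := (openPK (pk := pk) J).1 oJ _ J1.
have [b b0 Hb] := (openPK (pk := pk) U).1 oU _ U1.
have a2 : 0 < a / 2 by rewrite divr_gt0.
have [c c0 Hc] := (contPK (pk := pk) f t1).1 (smooth_cont sf U1) _ a2.
have [e e0 He] := (contPK (pk := pk) g t1).1 (smooth_cont sg U1) 1 ltr01.
pose N := nm (g t1) + 1; have N0 : 0 < N by rewrite ltr_wpDl // nmK_ge0.
exists (Num.min (Num.min b c) e), (a / 2 / N); split.
- by rewrite !lt_min b0 c0 e0.
- by rewrite divr_gt0.
move=> t s; rewrite !lt_min => /andP[/andP[/Hb Ut /Hc hc] /He he] hs; split=> //.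
apply: Ha; have -> : f t + s * g t - f t1 = (f t - f t1) + s * g t by ring.
apply: le_lt_trans (nmDK pk _ _) _; rewrite nmM.
have gN : nm (g t) <= N.
  by have := nmBrK pk (g t) (g t1); rewrite /N; move: he; lra.
have : nm s * nm (g t) <= a / 2 / N * N by apply: ler_pM; rewrite ?nmK_ge0 // ltW.
by rewrite divfK ?gt_eqF //; move: hc; lra.
Qed.

Lemma vertical_derive (B : set (K * K)) (X : K * K -> K) (t x p : K) : smooth B X -> B (t, x) ->
  is_derive (0 : K) 1 (fun s : K => X (t, x + s * p)) (p * 'D_(0, 1) X (t, x)).
Proof.
move=> sX Bp; have /is_derive_slice2 h := @smooth_is_derive _ _ _ _ _ ((0, 1) : K * K) _ sX Bp.
have dl : is_derive (0 : K) 1 (fun s : K => x + s * p) p.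
  apply: dval (dD (dC x 0) (dM (dI 0) (dC p 0))) _.
  by rewrite mul1r mul0r add0r addr0.
apply: (dcomp (f := fun s : K => x + s * p) (g := fun x => X (t, x)) dl).
by rewrite mul0r addr0.
Qed.

Variables (J : set K) (domJ : domain J) (v : vfield K).
Hypotheses (sv : smooth (dom E `*` J) v) (gv : generates_symmetries E (dom E `*` J) v).
Let oJ : open J. Proof. by have [] := domJ. Qed.
Let B := D `*` J.
Let oB : open B. Proof. exact: (open_prod (pk := pk)). Qed.
Let ta (p : K * K) := (v p).1.
Let xi (p : K * K) := (v p).2.
Let sta : smooth B ta. Proof. exact: smooth_pfst. Qed.
Let sxi : smooth B xi. Proof. exact: smooth_psnd. Qed.
Let tax := 'D_((0, 1) : K * K) ta.
Let xix := 'D_((0, 1) : K * K) xi.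
Let taxx := 'D_((0, 1) : K * K) tax.
Let xixx := 'D_((0, 1) : K * K) xix.
Let stax : smooth B tax. Proof. exact: smooth_D. Qed.
Let sxix : smooth B xix. Proof. exact: smooth_D. Qed.

(** The derivative at [s = 0] of the characteristic along the solutions [f + s g]. *)
Lemma variation1 (U : set K) f g : open U -> solution E U f -> (forall t, U t -> J (f t)) ->
  hom U g -> hom U (fun t => (xix (t, f t) - tax (t, f t) * derive1 f t) * g t
    - ta (t, f t) * derive1 g t).
Proof.
move=> oU solf UJ homg; have [UD sf _] := solf; have [_ sg _] := homg.
apply: solution_local => // t1 U1.
have [r [dl [r0 dl0 H]]] := near_graph oJ oU U1 (UJ t1 U1) sf sg.
pose W := [set t : K | nm (t - t1) < r].
have domW : domain W by exact: domain_ball.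
have W1 : W t1 by rewrite /W /= subrr nmK0.
have WU : W `<=` U by move=> t Wt; have [] := H t 0 Wt ltac:(by rewrite nmK0).
exists W => //; have [_ oW _] := domW.
pose fs s t := f t + s * g t.
apply: (variation (t1 := t1) (dl := dl) (N := fun s t =>
  (v (t, fs s t)).2 - (v (t, fs s t)).1 * derive1 (fs s) t)) => //.
- exact: subset_trans WU UD.
- move=> s hs; apply: (flow_solution (pk := pk) domD sq sd gE gH domJ sv gv oW).
    by apply: solution_sub WU _; exact: (sol_add sq gE gH s oU solf homg).
  by move=> t Wt; have [] := H t s Wt hs.
move=> t Wt; have Ut := WU t Wt; have Bt : B (t, f t) by split; [exact: UD|exact: UJ].
have e s : derive1 f t + s * derive1 g t = derive1 (fs s) t.
  by rewrite (der1D sf _ Ut) ?(der1Z s sg Ut) //; exact: smoothZ.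
have := dB (vertical_derive (g t) sxi Bt)
  (dM (vertical_derive (g t) sta Bt) (dD (dC (derive1 f t) 0) (dM (dI 0) (dC (derive1 g t) 0)))).
move=> h; apply: dval (dfun h _) _; first by move=> s; rewrite e.
rewrite !mul0r !addr0 add0r mul1r /xix /tax.
by move: ('D__ xi _) ('D__ ta _) => X T; ring.
Qed.

(** The first variation in the direction [g], differentiated once more in the same direction; terms
    quadratic in [g] remain. *)
Lemma variation2 (U : set K) f g : open U -> solution E U f -> (forall t, U t -> J (f t)) ->
  hom U g -> hom U (fun t => (xixx (t, f t) - taxx (t, f t) * derive1 f t) * g t ^+ 2
    - 2 * tax (t, f t) * g t * derive1 g t).
Proof.
move=> oU solf UJ homg; have [UD sf _] := solf; have [_ sg _] := homg.
apply: solution_local => // t1 U1.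
have [r [dl [r0 dl0 H]]] := near_graph oJ oU U1 (UJ t1 U1) sf sg.
pose W := [set t : K | nm (t - t1) < r].
have domW : domain W by exact: domain_ball.
have W1 : W t1 by rewrite /W /= subrr nmK0.
have WU : W `<=` U by move=> t Wt; have [] := H t 0 Wt ltac:(by rewrite nmK0).
exists W => //; have [_ oW _] := domW.
pose fs s t := f t + s * g t.
apply: (variation (t1 := t1) (dl := dl) (N := fun s t =>
  (xix (t, fs s t) - tax (t, fs s t) * derive1 (fs s) t) * g t
    - ta (t, fs s t) * derive1 g t)) => //.
- exact: subset_trans WU UD.
- move=> s hs; apply: variation1 => //.
  + by apply: solution_sub WU _; exact: (sol_add sq gE gH s oU solf homg).
  + by move=> t Wt; have [] := H t s Wt hs.
  + exact: solution_sub WU homg.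
move=> t Wt; have Ut := WU t Wt; have Bt : B (t, f t) by split; [exact: UD|exact: UJ].
have e s : derive1 f t + s * derive1 g t = derive1 (fs s) t.
  by rewrite (der1D sf _ Ut) ?(der1Z s sg Ut) //; exact: smoothZ.
have := dB (dM (dB (vertical_derive (g t) sxix Bt)
  (dM (vertical_derive (g t) stax Bt) (dD (dC (derive1 f t) 0) (dM (dI 0) (dC (derive1 g t) 0)))))
    (dC (g t) 0)) (dM (vertical_derive (g t) sta Bt) (dC (derive1 g t) 0)).
move=> h; apply: dval (dfun h _) _; first by move=> s; rewrite e.
rewrite !mul0r !mulr0 !addr0 add0r mul1r /xixx /taxx.
by move: ('D__ xix _) ('D__ tax _) => X T; rewrite /tax; move: ('D__ ta _) => Y; ring.
Qed.

Hypothesis n2 : (2 <= n)%N.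
Let srho : smooth D rho. Proof. by have [] := gE. Qed.
Let rho0 t : D t -> rho t != 0. Proof. by move=> Dt; have [_ h _ _ _] := gE; exact: h. Qed.
Let sphi0 : smooth D phi0. Proof. by have [] := gE. Qed.

Lemma solution_through t1 x1 : D t1 -> exists2 f, f t1 = x1 & solution E D f.
Proof.
move=> D1; have [g [sg jg hg]] := hom_jets domD sq sd gE gH (fun=> (x1 - phi0 t1) / rho t1) D1.
have g1 : g t1 = (x1 - phi0 t1) / rho t1 by have := jg 0%N isT; rewrite FF00.
exists (fun t => phi0 t + rho t * g t).
  by rewrite g1 mulrCA divff ?mulr1 ?rho0 // addrC subrK.
apply/(solP gE gH oD (@subset_refl _ _)).
  by apply: smoothD => //; exact: smoothM.
by apply: solution_ext hg => // t _; rewrite addrC addKr.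
Qed.

(** Take [g] vanishing at [t1] to order exactly [n]. The second variation, of the form
    [g * (A g - Bb g')], has all its first [n + 1] jets zero and so vanishes near [t1]. Off [t1]
    this gives [A g = Bb g']; as [g / g'] tends to zero, first [Bb] and then [A] must vanish at
    [t1]. The second claim presupposes [tax = 0] everywhere because it also needs [taxx = 0]. *)
Lemma determining_second t1 x1 : B (t1, x1) ->
  tax (t1, x1) = 0 /\ ((forall p, B p -> tax p = 0) -> xixx (t1, x1) = 0).
Proof.
move=> Bp; have [/= D1 J1] := Bp.
have [f f1 solf] := solution_through x1 D1; have [_ sf _] := solf.
have [g [sg jg hg]] := hom_jets domD sq sd gE gH (fun i => (i == n)%:R) D1.
have srg : smooth D (fun t => rho t * g t) by exact: smoothM.
have J1f : J (f t1) by rewrite f1.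
have [r [dl [r0 dl0 Hr]]] := near_graph oJ oD D1 J1f sf srg.
pose W := [set t : K | nm (t - t1) < r].
have domW : domain W by exact: domain_ball.
have W1 : W t1 by rewrite /W /= subrr nmK0.
have WD : W `<=` D by move=> t Wt; have [] := Hr t 0 Wt ltac:(by rewrite nmK0).
have WJ t : W t -> J (f t).
  by move=> Wt; have [_] := Hr t 0 Wt ltac:(by rewrite nmK0); rewrite mul0r addr0.
have WB t : W t -> B (t, f t) by move=> Wt; split; [exact: WD|exact: WJ].
have [_ oW _] := domW.
have homH := variation2 oW (solution_sub WD solf) WJ (solution_sub WD hg).
have sfW := smooth_sub WD sf; have sgW := smooth_sub WD sg; have srW := smooth_sub WD srho.
have sqW := smooth_sub WD sq.
have schain (X : K * K -> K) : smooth B X -> smooth W (fun t => X (t, f t)).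
  by move=> sX; exact: (chain2_smooth (pk := pk) oB oW WB sX sfW).
pose a t := xixx (t, f t) - taxx (t, f t) * derive1 f t; pose b t := tax (t, f t).
have sb : smooth W b by exact: schain.
have sa : smooth W a.
  apply: smoothB => //; first by apply: schain; exact: smooth_D.
  by apply: smoothM => //; [apply: schain; exact: smooth_D|exact: smooth_derive1].
(* The coefficients of the second variation in the direction [rho * g], after division by [rho]. *)
pose A t := a t * rho t - 2 * b t * derive1 rho t; pose Bb t := 2 * b t * rho t.
have sA : smooth W A.
  apply: smoothB => //; first exact: smoothM.
  by apply: smoothM => //; [exact: smoothZ|exact: smooth_derive1].
have sBb : smooth W Bb by apply: smoothM => //; exact: smoothZ.
have sg'W := smooth_derive1 sgW.
pose h t := g t * (A t * g t - Bb t * derive1 g t).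
have sh : smooth W h by apply: smoothM => //; apply: smoothB => //; exact: smoothM.
have jF i : (i < n)%N -> FF q n i g t1 = 0.
  by move=> hi; rewrite jg ?ltn_eqF // ltnW.
have [j0 j1] := FF_jets_d1n oW W1 sqW sgW jF.
rewrite jg // eqxx in j1.
have [c1 [r1 [c10 r10 G1]]] := jet_growth (pk := pk) oW W1 sgW j0 j1.
have j0' i : (i < n.-1)%N -> derive1n i (derive1 g) t1 = 0.
  by move=> hi; rewrite -derive1Sn j0 // -ltn_predRL.
have j1' : derive1n n.-1 (derive1 g) t1 = 1 by rewrite -derive1Sn prednK // ltnW.
have [c2 [r2 [c20 r20 G2]]] := jet_growth (pk := pk) oW W1 sg'W j0' j1'.
have [r3 r30 C3] := (contPK (pk := pk) A t1).1 (smooth_cont sA W1) 1 ltr01.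
have [r4 r40 C4] := (contPK (pk := pk) Bb t1).1 (smooth_cont sBb W1) 1 ltr01.
pose N := nm (A t1) + nm (Bb t1) + 1.
have A1 := nmK_ge0 pk (A t1); have B1 := nmK_ge0 pk (Bb t1).
have [r5 r50 H5] : exists2 r5 : R, 0 < r5 & forall x, x < r5 ->
    [/\ x < r, x < r1, x < r2, x < r3 & x < r4 /\ x < 1].
  exists (Num.min (Num.min (Num.min r r1) (Num.min r2 r3)) (Num.min r4 1)).
    by rewrite !lt_min r0 r10 r20 r30 r40 ltr01.
  by move=> x; rewrite !lt_min => /andP[/andP[/andP[-> ->] /andP[-> ->]] /andP[-> ->]].
have bd t : nm (t - t1) < r5 -> [/\ W t, nm (A t) <= N, nm (Bb t) <= N,
    c1 * nm (t - t1) ^+ n <= nm (g t) <= 2 * nm (t - t1) ^+ n &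
    c2 * nm (t - t1) ^+ n.-1 <= nm (derive1 g t) <= 2 * nm (t - t1) ^+ n.-1 /\ nm (t - t1) <= 1].
  move=> /H5 [x0 x1' x2 x3 [x4 x5]]; split=> //.
  - by have := nmBrK pk (A t) (A t1); have := C3 t x3; rewrite /N; move: A1 B1; lra.
  - by have := nmBrK pk (Bb t) (Bb t1); have := C4 t x4; rewrite /N; move: A1 B1; lra.
  - exact: G1.
  - by split; [exact: G2|exact: ltW].
have h0 t : W t -> h t = 0.
  apply: (@Pop_unique _ _ pk W t1 q n d h) => //.
  - by move=> j; exact: smooth_sub WD (sd j).
  - apply: (d1n_jets_FF n oW W1 sqW sh) => i hi.
    apply: (flat_jets (pk := pk) (C := 8 * N) (m := n.+1) oW W1 sh r50) => // s hs.
    have [Ws AN BN /andP[_ g2] [/andP[_ g2'] y1]] := bd s hs.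
    rewrite /h nmM; apply: le_trans (_ : nm (g s) * (nm (A s) * nm (g s) +
        nm (Bb s) * nm (derive1 g s)) <= _).
      by apply: ler_wpM2l; rewrite ?nmK_ge0 // -!nmM; exact: nmBK.
    by apply: product_growth; rewrite ?nmK_ge0.
  - move=> s Ws; have [UW sH _] := homH; rewrite -((homP gH oW UW sH).1 homH s Ws).
    apply: (Pop_ext q n d oW) Ws => u Wu; rewrite (der1M srho sg (WD u Wu)).
    by rewrite /h /A /Bb /a /b; have := rho0 (WD u Wu) => ru; field.
have eqn t : t != t1 -> nm (t - t1) < r5 -> A t * g t = Bb t * derive1 g t.
  move=> tt ht; have [Wt _ _ /andP[g1 _] _] := bd t ht.
  have y0 : 0 < nm (t - t1) by rewrite nm_gt0 subr_eq0.
  have gt0 : g t != 0.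
    by rewrite -(nm_gt0 (pk := pk)); apply: lt_le_trans g1; rewrite mulr_gt0 // exprn_gt0.
  have /eqP := h0 t Wt; rewrite mulf_eq0 (negbTE gt0) /= subr_eq0 => /eqP; exact.
have r1D := rho0 D1.
(* From [|g'| >= c2 y^(n-1)] and [|g| <= 2 y^n] the relation [A g = Bb g'] gives [Bb = O (y)], with
   [y] the distance to [t1]. *)
have Bb1 : Bb t1 = 0.
  apply: (linear_lim0 (C := N * 2 / c2) (r := r5)) => //; first exact: smooth_cont sBb W1.
  move=> t tt ht; have e := eqn t tt ht.
  have [Wt AN BN /andP[_ g2] [/andP[g1' _] _]] := bd t ht.
  have y0 : 0 < nm (t - t1) by rewrite nm_gt0 subr_eq0.
  have yn0 : 0 < nm (t - t1) ^+ n.-1 by rewrite exprn_gt0.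
  have e1 : nm (Bb t) * (c2 * nm (t - t1) ^+ n.-1) <= N * (2 * nm (t - t1) ^+ n).
    apply: le_trans (_ : nm (Bb t) * nm (derive1 g t) <= _).
      by rewrite ler_wpM2l ?nmK_ge0.
    by rewrite -nmM -e nmM; apply: ler_pM; rewrite ?nmK_ge0.
  rewrite -(ler_pM2r yn0) -(ler_pM2r c20).
  have -> : N * 2 / c2 * nm (t - t1) * nm (t - t1) ^+ n.-1 * c2 = N * (2 * nm (t - t1) ^+ n).
    rewrite -[in RHS](prednK (ltnW n2)) exprS; field; exact: lt0r_neq0.
  by move: e1; rewrite mulrA mulrAC.
have b1 : tax (t1, x1) = 0.
  move: Bb1; rewrite /Bb /b f1 => /eqP; rewrite !mulf_eq0 (negbTE r1D) orbF pnatr_eq0 /=.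
  by move/eqP.
split=> // tax0; have b0 t : W t -> b t = 0 by move=> Wt; apply: tax0; exact: WB.
have A1' : A t1 = 0.
  apply: (linear_lim0 (C := 0) (r := r5)) => //; first exact: smooth_cont sA W1.
  move=> t tt ht; have e := eqn t tt ht; have [Wt _ _ /andP[g1 _] _] := bd t ht.
  have y0 : 0 < nm (t - t1) by rewrite nm_gt0 subr_eq0.
  have gt0 : g t != 0.
    by rewrite -(nm_gt0 (pk := pk)); apply: lt_le_trans g1; rewrite mulr_gt0 // exprn_gt0.
  move/eqP: e; rewrite /Bb b0 // mulr0 !mul0r mulf_eq0 (negbTE gt0) orbF => /eqP ->.
  by rewrite nmK0.
have taxx0 : taxx (t1, x1) = 0.
  rewrite /taxx (derive_ext ((0, 1) : K * K) oB Bp (g := fun=> 0)); last exact: tax0.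
  exact: derive_cst.
have alg (x y z w : K) : (x - 0 * y) * z - 2 * 0 * w = x * z by ring.
move: A1'; rewrite /A /a (b0 t1 W1) f1 taxx0 alg => /eqP.
by rewrite mulf_eq0 (negbTE r1D) orbF => /eqP.
Qed.

End Forward.

(** * The general form of a symmetry field *)

Section Generator.
Context {R : realType} {K : numFieldType} {pk : kpkg R K}.
Local Notation nm := (@nm R K pk _).
Local Notation io := (io pk).

(* In the coordinate [u = (x - phi0) / rho] this is
   [tau d/dt + ((n/2 tau' + c) u + psi / rho) d/du]. *)
Definition gen (n : nat) (rho phi0 tau : K -> K) (c : K) (psi : K -> K) : vfield K :=
  fun p => (tau p.1, (n%:R / 2 * derive1 tau p.1 + c + tau p.1 * derive1 rho p.1 / rho p.1)
    * (p.2 - phi0 p.1) + tau p.1 * derive1 phi0 p.1 + psi p.1).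

(* [n] is the order of the equation minus one, so [theta q tau = 0] says that [tau] solves the
   second symmetric power of y'' + q y = 0, and the [eop] equations constrain the
   remaining coefficients. *)
Definition symm (D : set K) (n : nat) (q : K -> K) (d : nat -> K -> K) (tau : K -> K) : Prop :=
  [/\ smooth D tau, forall t, D t -> theta q tau t = 0 &
    forall j t, D t -> eop n d tau j t = 0].

Variables (n : nat) (E : lode K n.+1) (rho q : K -> K) (d : nat -> K -> K) (phi0 : K -> K).
Hypotheses (domD : domain (dom E)) (sq : smooth (dom E) q) (sd : forall j, smooth (dom E) (d j)).
Hypotheses (n2 : (2 <= n)%N) (dn : forall j, (n.-1 <= j)%N -> d j = fun=> 0).
Hypothesis gE : gauge E rho phi0 (Pop q n d).
Hypothesis gH : gauge (homogeneous E) rho (fun=> 0) (Pop q n d).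
Let D := dom E.
Let oD : open D. Proof. by have [] := domD. Qed.
Local Notation hom := (solution (homogeneous E)).
Let srho : smooth D rho. Proof. by have [] := gE. Qed.
Let rho0 t : D t -> rho t != 0. Proof. by move=> Dt; have [_ h _ _ _] := gE; exact: h. Qed.
Let sphi0 : smooth D phi0. Proof. by have [] := gE. Qed.

Variables (J : set K) (domJ : domain J) (v : vfield K).
Hypotheses (sv : smooth (dom E `*` J) v) (gv : generates_symmetries E (dom E `*` J) v).

(** With [tau_x = 0] and [xi_xx = 0] the field is [tau(t) d/dt + (al(t) x + be(t)) d/dx]. The
    variations apply only to solutions with values in [J], which exist near each point; the
    equations so obtained no longer involve those solutions and are glued by [solution_local]. *)
Lemma forward : exists (tau : K -> K) (c : K) (psi : K -> K),
  [/\ symm D n q d tau, hom D psi &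
    forall p, (D `*` J) p -> v p = gen n rho phi0 tau c psi p].
Proof.
have [[xs Jxs] oJ _] := domJ; pose B := D `*` J.
have oB : open B by exact: (open_prod (pk := pk)).
have det := determining_second (pk := pk) domD sq sd gE gH domJ sv gv n2.
pose ta (p : K * K) := (v p).1; pose xi (p : K * K) := (v p).2.
have sta : smooth B ta by exact: smooth_pfst.
have sxi : smooth B xi by exact: smooth_psnd.
pose tax := 'D_((0, 1) : K * K) ta; pose xix := 'D_((0, 1) : K * K) xi.
have sxix : smooth B xix by exact: smooth_D.
have tax0 p : B p -> tax p = 0 by case: p => t x /det [].
have xixx0 p : B p -> 'D_((0, 1) : K * K) xix p = 0.
  by case: p => t x /det [_]; apply.
have dv (X : K * K -> K) t x : smooth B X -> B (t, x) ->
    is_derive x 1 (fun x => X (t, x)) ('D_((0, 1) : K * K) X (t, x)).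
  by move=> sX Bp; apply/is_derive_slice2; exact: (smooth_is_derive _ sX).
pose tau t := ta (t, xs); pose al t := xix (t, xs).
have slice (X : K * K -> K) : smooth B X -> smooth D (fun t => X (t, xs)).
  by move=> sX; apply: smooth_sub (smooth_slice1 xs oB sX) => t Dt.
have stau : smooth D tau by exact: slice.
have sal : smooth D al by exact: slice.
have taE t x : B (t, x) -> ta (t, x) = tau t.
  move=> [/= Dt Jx]; apply: (const_of_der0 (g := fun x => ta (t, x)) domJ) => // y Jy.
  by apply: dval (dv _ _ _ sta _) _; [|exact: tax0].
have xixE t x : B (t, x) -> xix (t, x) = al t.
  move=> [/= Dt Jx]; apply: (const_of_der0 (g := fun x => xix (t, x)) domJ) => // y Jy.
  by apply: dval (dv _ _ _ sxix _) _; [|exact: xixx0].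
pose be t := xi (t, xs) - al t * xs.
have xiE t x : B (t, x) -> xi (t, x) = al t * x + be t.
  move=> [/= Dt Jx].
  have H : xi (t, x) - al t * x = xi (t, xs) - al t * xs; last by rewrite /be -H addrC subrK.
  apply: (const_of_der0 (g := fun x => xi (t, x) - al t * x) domJ) => // y Jy.
 apply: dval (dB (dv _ _ _ sxi _) (dZ (al t) (dI y))) _; first by [].
  have e2 := xixE t y (conj Dt Jy); rewrite /xix in e2.
  by rewrite e2 mulr1 subrr.
have local_sol t1 : D t1 -> exists f W, [/\ W t1, open W, W `<=` D, solution E W f &
    forall t, W t -> J (f t)].
  move=> D1; have [f f1 solf] := solution_through domD sq sd gE gH xs D1.
  have [_ sf _] := solf; have J1 : J (f t1) by rewrite f1.
  have [r [dl [r0 dl0 H]]] := near_graph (pk := pk) oJ oD D1 J1 sf sf.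
  exists f, [set t : K | nm (t - t1) < r]; split.
  - by rewrite /= subrr nmK0.
  - by have [] := domain_ball (pk := pk) t1 r0.
  - by move=> t Wt; have [] := H t 0 Wt ltac:(by rewrite nmK0).
  - by apply: solution_sub solf => t Wt; have [] := H t 0 Wt ltac:(by rewrite nmK0).
  - by move=> t Wt; have [_] := H t 0 Wt ltac:(by rewrite nmK0); rewrite mul0r addr0.
have homM U g : open U -> hom U g -> hom U (fun t => al t * g t - tau t * derive1 g t).
  move=> oU hg; have [UD _ _] := hg; apply: solution_local => // t1 U1.
  have [f [W [W1 oW WD solf WJ]]] := local_sol t1 (UD _ U1).
  have oI : open (W `&` U) by exact: openI.
  exists (W `&` U) => //.
  have IW : W `&` U `<=` W by move=> t [].
  have IU : W `&` U `<=` U by move=> t [].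
  have := variation1 (pk := pk) domD sq sd gE gH domJ sv gv oI (solution_sub IW solf)
    (fun t It => WJ t (IW t It)) (solution_sub IU hg).
  apply: solution_ext => // t [Wt Ut]; have Bt : B (t, f t) by split; [exact: WD|exact: WJ].
  have e1 := tax0 _ Bt; have e2 := xixE _ _ Bt; have e3 := taE _ _ Bt.
  rewrite /tax in e1; rewrite /xix in e2; rewrite /ta in e3.
  by rewrite e1 mul0r subr0 e2 e3.
(* The characteristic along [f] minus the linear operator [al - tau d/dt] applied to [f - phi0]; the
   dependence on [f] cancels. *)
pose psi t := al t * phi0 t + be t - tau t * derive1 phi0 t.
have homN : hom D psi.
  apply: solution_local => // t1 D1.
  have [f [W [W1 oW WD solf WJ]]] := local_sol t1 D1; exists W => //.
  have [_ sf _] := solf; have sp := smooth_sub WD sphi0.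
  have h1 := flow_solution (pk := pk) domD sq sd gE gH domJ sv gv oW solf WJ.
  have h2 := homM W _ oW ((solP gE gH oW WD sf).1 solf).
  apply: solution_ext (hom_comb sq gE gH 1 (-1) oW h1 h2) => // t Wt.
  have Bt : B (t, f t) by split; [exact: WD|exact: WJ].
  rewrite (der1B sf sp Wt) -/(ta (t, f t)) -/(xi (t, f t)) (taE _ _ Bt) (xiE _ _ Bt) /psi.
  by ring.
(* Conjugating [al - tau d/dt] by multiplication with [rho] changes [al] into [a1]. *)
pose a1 t := al t - tau t * derive1 rho t / rho t.
have srho' := smooth_derive1 srho.
have sa1 : smooth D a1.
  apply: smoothB => //; apply: smoothM => //; first exact: smoothM.
  exact: smoothV.
have PM g : smooth D g -> (forall t, D t -> Pop q n d g t = 0) ->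
    forall t, D t -> Pop q n d (Mop a1 tau g) t = 0.
  move=> sg Pg; have sr : smooth D (fun t => rho t * g t) by exact: smoothM.
  have hr : hom D (fun t => rho t * g t).
    apply/(homP gH oD (@subset_refl _ _) sr) => t Dt; rewrite -(Pg t Dt).
    apply: (Pop_ext q n d oD) Dt => s Ds.
    by rewrite mulrAC divff ?mul1r ?rho0.
  have hM := homM D _ oD hr; have [_ sM _] := hM => t Dt.
  rewrite -((homP gH oD (@subset_refl _ _) sM).1 hM t Dt).
  apply: (Pop_ext q n d oD) Dt => s Ds; rewrite (der1M srho sg Ds) /Mop /a1.
  by have := rho0 Ds => r0; field.
have [c [alE th0 e0]] := necessity (pk := pk) domD sq sd n2 dn sa1 stau PM.
exists tau, c, psi; split=> // -[t x] Bt; have [/= Dt Jx] := Bt.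
rewrite [LHS]surjective_pairing -/(ta (t, x)) -/(xi (t, x)) (taE _ _ Bt) (xiE _ _ Bt) /gen /=.
congr pair; rewrite -(alE t Dt) /a1 /psi subrK.
by ring.
Qed.

End Generator.

(** * Integrating the fields *)
Section Pflow.
Context {R : realType} {K : numFieldType} {pk : kpkg R K}.
Local Notation nm := (@nm R K pk _).
Local Notation io := (io pk).

(* The local flow [(t, u) |-> (om e t, m e t * u)] of [tau d/dt + al u d/du],
   preserving the kernel of [P]. *)
Record pflow (D : set K) (P : (K -> K) -> K -> K) (tau al : K -> K) (W : set K) (dl : R)
    (om m : K -> K -> K) : Prop := Pflow {
  pf_smooth : forall (V : normedModType K) (A : set V) (S T : V -> K), open A -> smooth A S ->
    smooth A T -> (forall p, A p -> nm (S p) < dl /\ W (T p)) ->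
    smooth A (fun p => om (S p) (T p)) /\ smooth A (fun p => m (S p) (T p));
  pf_0 : forall t, W t -> om 0 t = t;
  pf_m0 : forall t, W t -> m 0 t = 1;
  pf_dom : forall e t : K, nm e < dl -> W t -> D (om e t);
  pf_der : forall e t : K, nm e < dl -> W t -> is_derive e 1 (fun e : K => om e t) (tau (om e t));
  pf_mder : forall e t : K, nm e < dl -> W t -> is_derive e 1 (fun e : K => m e t) (al (om e t) * m e t);
  pf_group : forall e1 e2 t : K, nm e1 < dl -> nm e2 < dl -> nm (e1 + e2) < dl -> W t ->
    W (om e2 t) -> om e1 (om e2 t) = om (e1 + e2) t;
  pf_inj : forall e : K, nm e < dl -> {in W &, injective (om e)};
  pf_jac : forall e t : K, nm e < dl -> W t -> derive1 (om e) t != 0;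
  pf_mneq0 : forall e t : K, nm e < dl -> W t -> m e t != 0;
  pf_inv : forall (e : K) W' U' (h : K -> K), nm e < dl -> open W' -> W' `<=` W -> open U' -> U' `<=` D ->
    smooth U' h -> (forall t, W' t -> U' (om e t)) -> forall t, W' t ->
    (P (fun t => (m e t)^-1 * h (om e t)) t = 0 <-> P h (om e t) = 0) }.

(** The substitution [z = T t], [u = chi t * w] carries the field to [htau d/dz + alz w d/dw] and
    the equation [P = 0] to [Q = 0], so a flow for [Q] is conjugated back. *)
Lemma pflow_straight (D U : set K) (P Q : (K -> K) -> K -> K) (tau al htau alz T chi : K -> K)
    (t1 : K) (Wz : set K) (dlz : R) (mu M : K -> K -> K) :
  open U -> U `<=` D -> U t1 -> smooth U T -> derive1 T t1 != 0 -> smooth U chi ->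
  (forall t, U t -> chi t != 0) -> (forall t, U t -> tau t * derive1 T t = htau (T t)) ->
  (forall t, U t -> al t = alz (T t) + derive1 chi t * tau t / chi t) ->
  (forall W g h, open W -> (forall t, W t -> g t = h t) -> forall t, W t -> P g t = P h t) ->
  (forall W U' h, open W -> W `<=` U -> open U' -> smooth U' h -> (forall t, W t -> U' (T t)) ->
    forall t, W t -> (P (fun t => chi t * h (T t)) t = 0 <-> Q h (T t) = 0)) ->
  open Wz -> Wz (T t1) -> 0 < dlz -> pflow setT Q htau alz Wz dlz mu M ->
  exists (W : set K) (dl : R) (om m : K -> K -> K),
    [/\ open W, W t1, W `<=` D, 0 < dl & pflow D P tau al W dl om m].
Proof.
move=> oU UD U1 sT T1 schi chi0 htauE alE loc PQ oWz Wz1 dlz0 fz.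
have [r [r' [Ti [r0 r'0 Hr Tinj [sTi HTi]]]]] := local_inverse (pk := pk) oU U1 sT T1.
set z1 := T t1 in Wz1 sTi HTi.
pose Bz := [set z : K | nm (z - z1) < r'].
have oBz : open Bz by have [] := domain_ball (pk := pk) z1 r'0.
have [w1 w10 H1] := (openPK (pk := pk) Wz).1 oWz z1 Wz1.
have [w2 w20 H2] := (contPK (pk := pk) T t1).1 (smooth_cont sT U1) _ w10.
have n00 : nm (0 : K) < dlz by rewrite nmK0.
have sc (S : set K) (e : K) : smooth S (fun=> e) by exact: smooth_cst.
have sid (S : set K) : smooth S (fun z : K => z) by exact: smooth_id.
pose A := [set p : K * K | nm p.1 < dlz /\ U p.2 /\ Wz (T p.2)].
have oA : open A.
  apply/(openP (pk := pk)) => -[e t] [/= h1 [h2 h3]].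
  have [a a0 Ha] := (openPK (pk := pk) U).1 oU t h2.
  have [b b0 Hb] := (openPK (pk := pk) Wz).1 oWz _ h3.
  have [c c0 Hc] := (contPK (pk := pk) T t).1 (smooth_cont sT h2) _ b0.
  exists (Num.min (Num.min a c) (dlz - nm e)); first by rewrite !lt_min a0 c0 subr_gt0.
  move=> [e' t'] h; have h' := le_lt_trans (nm_fst pk ((e', t') - (e, t))) h.
  have h'' := le_lt_trans (nm_snd pk ((e', t') - (e, t))) h.
  move: h' h''; rewrite !lt_min /= => /andP[_ k1] /andP[/andP[/Ha k2 /Hc /Hb k3] _].
  split=> //=; have := nmBrK pk e' e; move: k1; lra.
have A1 : A (0, t1) by [].
have s1 (S : set (K * K)) : smooth S (fun p : K * K => p.1) by exact: smooth_fst.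
have s2 (S : set (K * K)) : smooth S (fun p : K * K => p.2) by exact: smooth_snd.
have [smu _] := pf_smooth fz oA (s1 A) (smooth_comp oA (fun p Ap => proj1 (proj2 Ap)) (s2 A) sT)
  (fun p Ap => conj (proj1 Ap) (proj2 (proj2 Ap))).
have [w3 w30 H3] := (contP (pk := pk) _ _).1 (smooth_cont smu A1) r' r'0.
rewrite /= (pf_0 fz) // -/z1 in H3.
have [w w0 Hw] : exists2 w : R, 0 < w & forall x, x < w -> [/\ x < w2, x < w3, x < r & x < dlz].
  exists (Num.min (Num.min w2 w3) (Num.min r dlz)); first by rewrite !lt_min w20 w30 r0 dlz0.
  by move=> x; rewrite !lt_min => /andP[/andP[-> ->] /andP[-> ->]].
(* The radius keeps [mu e (T t)] in the ball on which the inverse [Ti] of [T] is available, for all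
   small [e] at once. *)
pose W := [set t : K | nm (t - t1) < w].
have oW : open W by have [] := domain_ball (pk := pk) t1 w0.
have WU t : W t -> U t by move=> /Hw [_ _ /Hr []].
have Wr t : W t -> nm (t - t1) < r by move=> /Hw [].
have WWz t : W t -> Wz (T t) by move=> /Hw [/H2 /H1].
have ez (e : K) : nm e < w -> nm e < dlz by move=> /Hw [].
have muB (e t : K) : nm e < w -> W t -> Bz (mu e (T t)).
  move=> he Wt; have [_ e3 _ _] := Hw _ he; have [_ t3 _ _] := Hw _ Wt.
  apply: (H3 (e, t)); rewrite nm_pair /= gt_max subr0 e3; exact: t3.
have WBz t : W t -> Bz (T t).
  move=> Wt; have := muB 0 t ltac:(by rewrite nmK0) Wt.
  by rewrite (pf_0 fz) //; exact: WWz.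
have TiT t : nm (t - t1) < r -> Bz (T t) -> Ti (T t) = t.
  by move=> h1 /HTi [h2 h3]; exact: Tinj.
have TiU z : Bz z -> U (Ti z) by move=> /HTi [/Hr []].
have dTi z : Bz z -> is_derive z 1 Ti (derive1 T (Ti z))^-1.
  move=> hz; have [h1 h2] := HTi z hz; have [h3 h4] := Hr _ h1.
  have := dcomp (smooth_is_derive1 sTi hz) (smooth_is_derive1 sT h3).
  have E : is_derive z 1 (fun x => T (Ti x)) 1.
    by apply: (is_derive_ext oBz hz _ (dI z)) => x /HTi [].
  move=> /derive1_val; rewrite (derive1_val E) => e.
  apply: dval (smooth_is_derive1 sTi hz) _.
  by apply: (mulIf h4); rewrite -e mulVf.
pose om e t := Ti (mu e (T t)); pose m e t := M e (T t) * chi (om e t) / chi t.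
have omU e t : nm e < w -> W t -> U (om e t) by move=> he Wt; apply: TiU; exact: muB.
have Tom e t : nm e < w -> W t -> T (om e t) = mu e (T t).
  by move=> he Wt; have [] := HTi _ (muB e t he Wt).
have dom e t : nm e < w -> W t -> is_derive (e : K) 1 (fun e : K => om e t) (tau (om e t)).
  move=> he Wt; have bz := muB e t he Wt; have uo := omU e t he Wt.
  have D1 := dcomp (f := fun e : K => mu e (T t)) (pf_der fz (ez e he) (WWz t Wt)) (dTi _ bz).
  apply: (dval D1).
  have [h1 _] := HTi _ bz; have [_ h4] := Hr _ h1.
  by rewrite -/(om e t) -(Tom e t he Wt) -htauE // mulfK.
exists W, w, om, m; split=> //; first by rewrite /W /= subrr nmK0.
  by move=> t /WU /UD.
split=> //.
- move=> V A' S T' oA' sS sT' H'.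
  have Hz p : A' p -> nm (S p) < dlz /\ Wz (T (T' p)).
    by move=> /H' [/ez h /WWz].
  have sTT : smooth A' (fun p => T (T' p)).
    by apply: (smooth_comp oA' _ sT' sT) => p /H' [_ /WU].
  have [sm1 sm2] := pf_smooth fz oA' sS sTT Hz.
  have som : smooth A' (fun p => om (S p) (T' p)).
    by apply: (smooth_comp oA' _ sm1 sTi) => p /H' [h1 h2]; exact: muB.
  split=> //; apply: smoothM => //.
    apply: smoothM => //; apply: (smooth_comp oA' _ som schi) => p /H' [h1 h2].
    exact: omU.
  apply: smoothV => //; first by move=> p /H' [_ /WU /chi0].
  by apply: (smooth_comp oA' _ sT' schi) => p /H' [_ /WU].
- by move=> t Wt; rewrite /om (pf_0 fz) ?TiT //; [exact: Wr|exact: WBz|exact: WWz].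
- move=> t Wt; rewrite /m /om (pf_0 fz) ?TiT //; [|exact: Wr|exact: WBz|exact: WWz].
  by rewrite (pf_m0 fz) ?mul1r ?divff //; [exact: chi0 (WU t Wt)|exact: WWz].
- by move=> e t he Wt; apply: UD; exact: omU.
- move=> e t he Wt; have uo := omU e t he Wt.
  have Dd := dcomp (dom e t he Wt) (smooth_is_derive1 schi uo).
  apply: dval (dM (dM (pf_mder fz (ez e he) (WWz t Wt)) Dd) (dC (chi t)^-1 e)) _.
  rewrite /m alE // Tom //; have := chi0 _ uo; have := chi0 _ (WU t Wt).
  by move=> h1 h2; rewrite -/(om e t); field; rewrite h1 h2.
- move=> e1 e2 t h1 h2 h12 Wt W2; rewrite {1}/om Tom // (pf_group fz) //; try exact: ez.
    exact: WWz.
  by rewrite -(Tom e2 t) //; exact: WWz.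
- move=> e he t t' /set_mem Wt /set_mem Wt' /(congr1 T); rewrite !Tom // => h.
  apply: Tinj; [exact: Wr|exact: Wr|].
  by apply: (pf_inj fz (ez e he) _ _ h); apply/mem_set; exact: WWz.
- move=> e t he Wt; have bz := muB e t he Wt; have [h1 _] := HTi _ bz; have [_ h4] := Hr _ h1.
  have [sm _] := pf_smooth fz oWz (sc Wz e) (sid Wz)
    (fun z Wzz => conj (ez e he) Wzz).
  have Dd := dcomp (smooth_is_derive1 sT (WU t Wt)) (smooth_is_derive1 sm (WWz t Wt)).
  rewrite (derive1_val (dcomp Dd (dTi _ bz))).
  rewrite !mulf_neq0 ?invr_neq0 //; first by have [_] := Hr t (Wr t Wt).
  by have := pf_jac fz (ez e he) (WWz t Wt).
- move=> e t he Wt; rewrite /m !mulf_neq0 ?invr_neq0 //.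
  + by apply: (pf_mneq0 fz); [exact: ez|exact: WWz].
  + by apply: chi0; exact: omU.
  + by apply: chi0; exact: WU.
move=> e W' U' h he oW' W'W oU' U'D sh H t W't.
pose hh z := h (Ti z) / chi (Ti z).
have open_pre (S : set K) : open S -> open [set z | Bz z /\ S (Ti z)].
  move=> oS; apply/(openPK (pk := pk)) => z [h1 h2].
  have [a a0 Ha] := (openPK (pk := pk) Bz).1 oBz z h1.
  have [b b0 Hb] := (openPK (pk := pk) S).1 oS _ h2.
  have [c c0 Hc] := (contPK (pk := pk) Ti z).1 (smooth_cont sTi h1) _ b0.
  exists (Num.min a c); first by rewrite lt_min a0 c0.
  by move=> x; rewrite lt_min => /andP[/Ha ? /Hc /Hb].
pose U2 := [set z | Bz z /\ U' (Ti z)].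
have oU2 : open U2 by exact: open_pre.
have U2B : U2 `<=` Bz by move=> z [].
have shh : smooth U2 hh.
  apply: smoothM => //.
    by apply: (smooth_comp oU2 (U' := U')) => [z [] //||//]; exact: smooth_sub U2B sTi.
  apply: smoothV => //; first by move=> z [/TiU /chi0].
  by apply: (smooth_comp oU2 _ (smooth_sub U2B sTi) schi) => z [/TiU].
pose U1s := [set z | Bz z /\ W' (Ti z)] `&` Wz.
have oU1s : open U1s by apply: openI => //; exact: open_pre.
have U1mu z : U1s z -> U2 (mu e z).
  move=> [[bz Wz'] _]; have Wt' := W'W _ Wz'; have [_ e2] := HTi z bz.
  have := muB e _ he Wt'; rewrite e2 => h1; split=> //.
  by have := H _ Wz'; rewrite /om e2.
have W'U1 s : W' s -> U1s (T s).
  move=> Ws; have Ws' := W'W s Ws; split; last exact: WWz.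
  by split; [exact: WBz|rewrite TiT //; [exact: Wr|exact: WBz]].
have hcst : forall z, U1s z -> nm e < dlz /\ Wz z by move=> z [_ ?]; split=> //; exact: ez.
have [smu1 sM1] := pf_smooth fz oU1s (sc U1s e) (sid U1s) hcst.
pose k z := (M e z)^-1 * hh (mu e z).
have sk : smooth U1s k.
  apply: smoothM => //; last exact: (smooth_comp oU1s U1mu smu1 shh).
  by apply: smoothV => // z /hcst [h1 h2]; exact: (pf_mneq0 fz).
have e1 s : W' s -> (m e s)^-1 * h (om e s) = chi s * k (T s).
  move=> Ws; have Ws' := W'W s Ws; rewrite /m /k /hh -/(om e s).
  have a := chi0 _ (WU s Ws'); have b := chi0 _ (omU e s he Ws').
  have c := pf_mneq0 fz (ez e he) (WWz s Ws').
  by field; rewrite a b c.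
rewrite (loc W' _ _ oW' e1 t W't).
have W'U : W' `<=` U by move=> s /W'W /WU.
rewrite (PQ W' U1s k oW' W'U oU1s sk W'U1 t W't).
rewrite (pf_inv fz (ez e he) oU1s (fun z Hz => proj2 Hz) oU2 (fun _ _ => I) shh U1mu (W'U1 t W't)).
have Wt := W'W t W't; rewrite -(Tom e t he Wt).
(* A neighbourhood of [om e t] on which the relation between [P] and [Q] can be used in the opposite
   direction. *)
pose W2 := [set s | nm (s - t1) < r /\ U2 (T s)].
have oW2 : open W2.
  apply/(openPK (pk := pk)) => s [h1 h2].
  have oBr : open [set s : K | nm (s - t1) < r] by have [] := domain_ball (pk := pk) t1 r0.
  have [a a0 Ha] := (openPK (pk := pk) _).1 oBr s h1.
  have [b b0 Hb] := (openPK (pk := pk) U2).1 oU2 _ h2.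
  have [Us _] := Hr s h1.
  have [c c0 Hc] := (contPK (pk := pk) T s).1 (smooth_cont sT Us) _ b0.
  exists (Num.min a c); first by rewrite lt_min a0 c0.
  by move=> x; rewrite lt_min => /andP[/Ha ? /Hc /Hb].
have W2U : W2 `<=` U by move=> s [/Hr []].
have W2o : W2 (om e t).
  have bz := muB e t he Wt; have [h1 _] := HTi _ bz; split=> //.
  by rewrite Tom //; apply: U1mu; exact: W'U1.
rewrite -(PQ W2 U2 hh oW2 W2U oU2 shh (fun s Hs => proj2 Hs) _ W2o).
rewrite (loc W2 (fun s => chi s * hh (T s)) h oW2 _ _ W2o) // => s [hs [hb _]].
rewrite /hh TiT // mulrCA divff ?mulr1 //; apply: chi0.
by have [] := Hr s hs.
Qed.

End Pflow.

(** * Model flows: translations and Moebius maps *)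

Section Cases.
Context {R : realType} {K : numFieldType} {pk : kpkg R K}.
Local Notation nm := (@nm R K pk _).
Local Notation io := (io pk).

Lemma derive1n_affine (U W : set K) (h : K -> K) (a b : K) k : open W -> open U -> smooth U h ->
  (forall t, W t -> U (a * t + b)) -> forall t, W t ->
  derive1n k (fun t => h (a * t + b)) t = a ^+ k * derive1n k h (a * t + b).
Proof.
move=> oW oU sh WU; elim: k => [|k IH] t Wt; first by rewrite mul1r.
rewrite derive1nS (derive1_ext oW Wt IH) exprS.
have D : is_derive t 1 (fun t : K => a * t + b) a.
  by apply: dval (dD (dZ a (dI t)) (dC b t)) _; rewrite mulr1 addr0.
have sk := smooth_derive1n k sh.
rewrite (derive1_val (dZ (a ^+ k) (dcomp D (smooth_is_derive1 sk (WU t Wt))))).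
by rewrite mulrCA mulrA.
Qed.

Lemma derive1n_Z (W : set K) (h : K -> K) (a : K) k : open W -> smooth W h ->
  forall t, W t -> derive1n k (fun t => a * h t) t = a * derive1n k h t.
Proof.
move=> oW sh; elim: k => [|k IH] t Wt //.
by rewrite derive1nS (derive1_ext oW Wt IH) (der1Z a (smooth_derive1n k sh) Wt).
Qed.

Definition ccop (n : nat) (k : nat -> K) (h : K -> K) (z : K) : K :=
  derive1n n.+1 h z + \sum_(j < n.+1) k j * derive1n j h z.

Lemma pflow_shift n k : pflow (pk := pk) setT (ccop n k) (fun=> 1) (fun=> 0) setT 1
  (fun e z => z + e) (fun _ _ => 1).
Proof.
split=> //.
- move=> V A S T oA sS sT _; split; last exact: smooth_cst.
  exact: smoothD.
- by move=> t _; rewrite addr0.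
- by move=> e t _ _; apply: dval (dD (dC t e) (dI e)) _; rewrite add0r.
- by move=> e t _ _; rewrite mul0r; exact: dC.
- by move=> e1 e2 t _ _ _ _ _; rewrite addrAC addrA.
- by move=> e _ t t' _ _ /addIr.
- move=> e t _ _; have D : is_derive t 1 (fun z : K => z + e) 1.
    by apply: dval (dD (dI t) (dC e t)) _; rewrite addr0.
  by rewrite (derive1_val D) oner_neq0.
move=> e W' U' h _ oW' _ oU' _ sh H t Wt.
have E j : derive1n j (fun t => 1^-1 * h (t + e)) t = derive1n j h (t + e).
  rewrite (_ : (fun t => _) = (fun t => h (1 * t + e))).
    rewrite (derive1n_affine (U := U') (W := W')) ?expr1n ?mul1r //.
    by move=> s Ws; rewrite mul1r; exact: H.
  by apply/funext => s; rewrite invr1 !mul1r.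
by rewrite /ccop E; under eq_bigr do rewrite E.
Qed.

(** The exponential is taken from the equation [G' = b G], which makes sense over both fields; the
    addition law is uniqueness for the difference of its two sides. *)
Lemma exp_exists (b : K) : exists G : K -> K, [/\ G 0 = 1, smooth setT G, forall e, G e != 0,
  forall e : K, is_derive e 1 G (b * G e) & forall e1 e2, G (e1 + e2) = G e1 * G e2].
Proof.
have oT : open [set: K] by exact: openT.
have [G [G0 sG Gn dG]] := scalar_exists (pk := pk) (domain_setT (K := K)) (I : setT (0 : K))
  (smooth_cst setT b).
exists G; split=> [//|//|e|e|e1 e2]; [exact: Gn|exact: dG|].
have D (e : K) : is_derive e 1 (fun e : K => G (e + e2) - G e * G e2) (b * (G (e + e2) - G e * G e2)).
  have D1 : is_derive e 1 (fun e : K => e + e2) 1.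
    by apply: dval (dD (dI e) (dC e2 e)) _; rewrite addr0.
  apply: dval (dB (dcomp D1 (dG (e + e2) I)) (dM (dG e I) (dC (G e2) e))) _.
  by ring.
apply/eqP; rewrite -subr_eq0; apply/eqP.
apply: (scalar_unique (pk := pk) (f := fun=> b) (chi := fun e => G (e + e2) - G e * G e2)
  (t0 := 0) (domain_setT (K := K))) => //.
- by move=> e _; exact: cst_continuous.
- by rewrite add0r G0 mul1r subrr.
Qed.

(** The flow is [z |-> G z / (1 - a s z)] with [G = exp (b e)] and [s] the primitive of [G]
    vanishing at 0. The multiplier is [exp ((c + n b / 2) e)] times the [n]-th power of
    [1 / (1 - a s z)]. The constant term of the quadratic field is zero because the coordinate is
    centred at a zero of [tau]. *)
Lemma pflow_moebius n (a b c : K) : exists (dl : R) (mu M : K -> K -> K), 0 < dl /\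
  pflow (pk := pk) setT (derive1n n.+1) (fun z => b * z + a * z ^+ 2)
    (fun z => n%:R / 2 * (b + 2 * a * z) + c) [set z | nm z < 1] dl mu M.
Proof.
have oT : open [set: K] by exact: openT.
have [G [G0 sG Gn dG GD]] := exp_exists b.
have [F [F0 sF Fn dF _]] := exp_exists (c + n%:R * b / 2).
have [s s0 ds] := primitive (pk := pk) (domain_setT (K := K)) (I : setT (0 : K)) sG.
have ss : smooth setT s.
  apply: smooth1P => //; first by move=> t _; have := ds t I => h; exact: ex_derive.
  by apply: (smooth_ext oT _ sG) => t _; rewrite (derive1_val (ds t I)).
have sD e1 e2 : s (e1 + e2) = s e1 * G e2 + s e2.
  have D (e : K) : setT e -> is_derive e 1 (fun e : K => s (e + e2) - s e * G e2) 0.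
    move=> _; have D1 : is_derive e 1 (fun e : K => e + e2) 1.
      by apply: dval (dD (dI e) (dC e2 e)) _; rewrite addr0.
    apply: dval (dB (dcomp D1 (ds (e + e2) I)) (dM (ds e I) (dC (G e2) e))) _.
    by rewrite GD; ring.
  have := const_of_der0 (pk := pk) (domain_setT (K := K)) D (I : setT e1) (I : setT 0).
  by rewrite add0r s0 mul0r subr0 => <-; rewrite [RHS]addrC subrK.
have GE x : G x = 1 + b * s x.
  have D (e : K) : setT e -> is_derive e 1 (fun e : K => G e - b * s e) 0.
    by move=> _; apply: dval (dB (dG e) (dZ b (ds e I))) _; rewrite subrr.
  have := const_of_der0 (pk := pk) (domain_setT (K := K)) D (I : setT x) (I : setT 0).
  by rewrite s0 G0 mulr0 subr0 => <-; rewrite subrK.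
have na : 0 < nm a + 1 by rewrite ltr_wpDl // nmK_ge0.
have i0 : 0 < (nm a + 1)^-1 by rewrite invr_gt0.
(* For [e] below [dl] one has [|a s| < 1], so the denominator [y] has no zero on the unit disc. *)
have [dl dl0 Hdl] := (contPK (pk := pk) s 0).1 (smooth_cont ss I) _ i0.
pose y (e z : K) := 1 - a * s e * z.
have yn (e z : K) : nm e < dl -> nm z < 1 -> y e z != 0.
  move=> he hz; apply/eqP => /eqP; rewrite subr_eq0 => /eqP h.
  have := Hdl e; rewrite subr0 s0 subr0 => /(_ he) hs.
  have : nm (a * s e * z) < 1.
    rewrite !nmM; apply: (@le_lt_trans _ _ (nm a * nm (s e))).
      by rewrite ler_piMr ?mulr_ge0 ?nmK_ge0 // ltW.
    apply: (@le_lt_trans _ _ (nm a / (nm a + 1))).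
      by rewrite ler_wpM2l ?nmK_ge0 // ltW.
    by rewrite ltr_pdivrMr // mul1r ltrDl.
  by rewrite -h nm1 ltxx.
pose W := [set z : K | nm z < 1].
have oW : open W.
  have [_ h _] := domain_ball (pk := pk) (0 : K) ltr01.
  by rewrite (_ : W = [set q : K | nm (q - 0) < 1]) //; apply/seteqP; split=> z; rewrite /W /= subr0.
pose mu e z := G e * z / y e z; pose M e z := F e * (y e z)^-1 ^+ n.
have dmuz (e z : K) : nm e < dl -> W z -> is_derive z 1 (mu e) (G e / y e z ^+ 2).
  move=> he Wz; have h := yn e z he Wz.
  have dy : is_derive z 1 (y e) (- (a * s e)).
    by apply: dval (dB (dC 1 z) (dZ (a * s e) (dI z))) _; rewrite mulr1 sub0r.
  apply: dval (dM (dZ (G e) (dI z)) (dV h dy)) _.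
  by move: h; rewrite /y => h; field.
exists dl, mu, M; split=> //; split=> //.
- move=> V A S T oA sS sT H.
  have sc (h : K -> K) : smooth setT h -> smooth A (fun p => h (S p)).
    by move=> sh; exact: (smooth_comp oA (U' := setT) (fun _ _ => I) sS sh).
  have sy : smooth A (fun p => (y (S p) (T p))^-1).
    apply: smoothV => //; first by move=> p /H [h1 h2]; exact: yn.
    apply: smoothB => //; first exact: smooth_cst.
    by apply: smoothM => //; apply: smoothM => //; [exact: smooth_cst|exact: sc].
  split; apply: smoothM => //; [|exact: sc|exact: smoothX].
  by apply: smoothM => //; exact: sc.
- by move=> t _; rewrite /mu /y G0 s0 mulr0 mul0r subr0 invr1 mul1r mulr1.
- by move=> t _; rewrite /M /y F0 s0 mulr0 mul0r subr0 invr1 mul1r expr1n.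
- move=> e t he Wt; have h := yn e t he Wt.
  have dy : is_derive e 1 (fun e : K => y e t) (- (a * G e * t)).
    apply: dval (dB (dC 1 e) (dM (dZ a (ds e I)) (dC t e))) _; by ring.
  have dW := dV (f := fun e : K => y e t) h dy.
  have dMM := dM (dM (dG e) (dC t e)) dW.
  apply: (dval dMM).
  by rewrite /mu; move: h; rewrite GE /y => h; field.
- move=> e t he Wt; have h := yn e t he Wt.
  have dy : is_derive e 1 (fun e : K => y e t) (- (a * G e * t)).
    apply: dval (dB (dC 1 e) (dM (dZ a (ds e I)) (dC t e))) _; by ring.
  have dW := dV (f := fun e : K => y e t) h dy.
  have dMM := dM (dF e) (dX n dW).
  apply: (dval dMM).
  rewrite /M /mu; move: h; move: (y e t) (F e) (G e) => Y f g h.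
  case: (n) => [|k]; first by rewrite !mul0r !expr0; field.
  by rewrite /= exprS; field.
- move=> e1 e2 t h1 h2 h12 Wt W2; have k1 := yn _ _ h1 W2; have k2 := yn _ _ h2 Wt.
  have k12 := yn _ _ h12 Wt; rewrite /mu /y sD GD in k12 k1 *; move: k1 k2 k12; rewrite /mu /y.
  move: (G e1) (G e2) (s e1) (s e2) => g1 g2 s1 s2 k1 k2 k12.
  have e : 1 - a * s1 * (g2 * t / (1 - a * s2 * t)) =
      (1 - a * (s1 * g2 + s2) * t) / (1 - a * s2 * t) by field.
  by rewrite e; field; rewrite k2 k12.
- move=> e he z z' /set_mem Wz /set_mem Wz'; have k1 := yn _ _ he Wz; have k2 := yn _ _ he Wz'.
  rewrite /mu => h; apply: (mulfI (Gn e)).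
  have {h} := congr1 (fun x => x * (y e z * y e z')) h.
  rewrite [RHS]mulrACA mulrC.
  have -> : y e z * y e z' * (G e * z / y e z) = G e * z * y e z' by field.
  have -> : G e * z' * y e z * ((y e z')^-1 * y e z') = G e * z' * y e z by field.
  rewrite /y => h; apply/eqP; rewrite -subr_eq0; apply/eqP.
  have -> : G e * z - G e * z' = G e * z * (1 - a * s e * z') - G e * z' * (1 - a * s e * z) by ring.
  by rewrite h subrr.
- move=> e t he Wt; rewrite (derive1_val (dmuz e t he Wt)).
  by rewrite mulf_neq0 ?Gn // invr_neq0 // expf_neq0 // yn.
- by move=> e t he Wt; rewrite /M mulf_neq0 ?Fn // expf_neq0 // invr_neq0 // yn.
move=> e W' U' h he oW' W'W oU' _ sh H t W't.
have y0 z : W' z -> y e z != 0 by move=> /W'W; exact: yn.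
(* As a function of [z], [y e] is affine and so solves [y'' = 0], and [T' = 1 / y ^+ 2]. Thus
   invariance of [h^(n+1) = 0] under Moebius maps is the case [q = 0] of [FF_straight_top], followed
   by the scaling [G e]. *)
pose T z := z / y e z; pose h1 w := h (G e * w + 0).
have dy (z : K) : is_derive z 1 (y e) (- (a * s e)).
  by apply: dval (dB (dC 1 z) (dZ (a * s e) (dI z))) _; rewrite mulr1 sub0r.
have sy : smooth W' (y e).
  apply: smoothB => //; first exact: smooth_cst.
  by apply: smoothZ => //; exact: smooth_id.
have syV : smooth W' (fun z => (y e z)^-1) by exact: smoothV.
have sT : smooth W' T by apply: smoothM => //; exact: smooth_id.
have dT (z : K) : W' z -> derive1 T z = (y e z ^+ 2)^-1.
  move=> Wz; rewrite (derive1_val (dM (dI z) (dV (y0 z Wz) (dy z)))).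
  by have := y0 z Wz; rewrite /y => k; field.
have y2 (z : K) : W' z -> derive1n 2 (y e) z = - (fun=> 0 : K) z * y e z.
  move=> Wz; rewrite oppr0 mul0r derive1nS.
  have E u : W' u -> derive1n 1 (y e) u = - (a * s e) by move=> _; rewrite derive1n1 (derive1_val (dy u)).
  by rewrite (derive1_ext oW' Wz E); exact: derive1_val (dC _ _).
have U1o : open [set w : K | U' (G e * w + 0)].
  apply/(openPK (pk := pk)) => w hw.
  have [r r0 Hr] := (openPK (pk := pk) U').1 oU' _ hw.
  exists (r / nm (G e)); first by rewrite divr_gt0 // nm_gt0.
  move=> w' hw'; apply: Hr; rewrite !addr0 -mulrBr nmM mulrC -ltr_pdivlMr //.
  by rewrite nm_gt0.
have sh1 : smooth [set w : K | U' (G e * w + 0)] h1.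
  apply: (smooth_comp U1o _ _ sh) => //; apply: smoothD => //; last exact: smooth_cst.
  by apply: smoothZ => //; exact: smooth_id.
have TU z : W' z -> [set w : K | U' (G e * w + 0)] (T z).
  by move=> /H; rewrite /mu /T /= addr0 mulrA.
have S := FF_straight_top n oW' (smooth_cst W' 0) sy sT y0 y2 dT U1o sh1 TU.
have E z : W' z -> (M e z)^-1 * h (mu e z) = (F e)^-1 * (y e z ^+ n * h1 (T z)).
  move=> Wz; rewrite /M /h1 /mu /T addr0 mulrA invfM -exprVn invrK -mulrA.
  by rewrite [RHS]mulrA.
have sg : smooth W' (fun z => y e z ^+ n * h1 (T z)).
  apply: smoothM => //; first exact: smoothX.
  exact: (smooth_comp oW' TU sT sh1).
rewrite (derive1n_ext n.+1 oW' E W't) (derive1n_Z _ n.+1 oW' sg W't).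
have := S t W't; rewrite FF0 => ->.
rewrite (derive1n_affine n.+1 U1o oU' sh (fun w hw => hw) (TU t W't)).
have -> : G e * T t + 0 = mu e t by rewrite addr0 /mu /T mulrA.
set X := derive1n _ _ _; split=> [/eqP|->]; last by rewrite !mulr0.
rewrite !mulf_eq0 !expf_eq0 !invr_eq0 (negbTE (Fn e)) (negbTE (y0 t W't)) (negbTE (Gn e)).
by rewrite !andbF /= => /eqP.
Qed.

End Cases.

Lemma quadratic_coordinate_alg (F : numFieldType) (N a b c y y' z p : F) : y != 0 -> p != 0 ->
  N / 2 * (2 * y * y' * (b * z + a * z ^+ 2) + y ^+ 2 * (b / y ^+ 2 + a * (2 * z / y ^+ 2))) + c =
  N / 2 * (b + 2 * a * z) + c + N * p * y' * (y ^+ 2 * (b * z + a * z ^+ 2)) / (y * p).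
Proof. by move=> y0 p0; field; rewrite y0 p0. Qed.

(** * Flows for all admissible [tau] *)

Section PflowExists.
Context {R : realType} {K : numFieldType} {pk : kpkg R K}.
Local Notation nm := (@nm R K pk _).
Local Notation io := (io pk).

Lemma smooth_primitive (U : set K) (f : K -> K) (t1 : K) : domain U -> U t1 -> smooth U f ->
  exists F, [/\ F t1 = 0, smooth U F & forall t, U t -> is_derive t 1 F (f t)].
Proof.
move=> domU U1 sf; have [_ oU _] := domU.
have [F F0 dF] := primitive (pk := pk) domU U1 sf; exists F; split=> //.
apply: smooth1P => //; first by move=> t /dF h; exact: ex_derive.
by apply: (smooth_ext oU _ sf) => t /dF /derive1_val.
Qed.

Lemma neq0_ball (D : set K) (f : K -> K) (t1 : K) : open D -> D t1 -> smooth D f -> f t1 != 0 ->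
  exists U : set K, [/\ domain U, U t1, U `<=` D & forall t, U t -> f t != 0].
Proof.
move=> oD D1 sf f1; have [a a0 Ha] := (openPK (pk := pk) D).1 oD t1 D1.
have nf : 0 < nm (f t1) by rewrite nm_gt0.
have [b b0 Hb] := (contPK (pk := pk) f t1).1 (smooth_cont sf D1) _ nf.
have m0 : 0 < Num.min a b by rewrite lt_min a0 b0.
exists [set t : K | nm (t - t1) < Num.min a b]; split.
- exact: domain_ball.
- by rewrite /= subrr nmK0.
- by move=> t; rewrite /= lt_min => /andP[/Ha].
- move=> t; rewrite /= lt_min => /andP[_ /Hb h]; apply/eqP => ft.
  by move: h; rewrite ft sub0r nmNK ltxx.
Qed.

Variables (D : set K) (domD : domain D) (n : nat) (q : K -> K) (d : nat -> K -> K).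
Hypotheses (sq : smooth D q) (sd : forall j, smooth D (d j)) (n2 : (2 <= n)%N).
Hypothesis dn : forall j, (n.-1 <= j)%N -> d j = fun=> 0.
Let oD : open D. Proof. by have [] := domD. Qed.

(* Near a point where [y'' + q y = 0], [y = 1] and [y' = 0], the coordinate
   [T] with [T' = 1 / y^2] turns a solution of [theta q tau = 0] into a quadratic. *)
Lemma quadratic_coordinate (tau : K -> K) t1 : smooth D tau -> (forall t, D t -> theta q tau t = 0) ->
  D t1 -> tau t1 = 0 -> exists (U : set K) (y T : K -> K) (a b : K),
  [/\ domain U, U t1, U `<=` D, smooth U y & smooth U T] /\ [/\ forall t, U t -> y t != 0,
    forall t, U t -> derive1n 2 y t = - q t * y t, forall t, U t -> derive1 T t = (y t ^+ 2)^-1,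
    T t1 = 0 & forall t, U t -> tau t = y t ^+ 2 * (b * T t + a * T t ^+ 2)].
Proof.
move=> stau th D1 tau1.
have s0 (S : set K) : smooth S (fun=> 0 : K) by exact: smooth_cst.
have [y [sy jy Py]] := Pop_exists (pk := pk) 1 (fun i => (i == 0%N)%:R) domD D1 sq
  (fun _ : nat => s0 D) (s0 D).
have y1 : y t1 = 1 by have := jy 0%N isT; rewrite FF00.
have y1' : derive1 y t1 = 0 by have := jy 1%N isT; rewrite FF01.
have y2 t : D t -> derive1n 2 y t = - q t * y t.
  move=> /Py; rewrite /Pop big1 ?addr0; last by move=> j _; rewrite mul0r.
  rewrite FFS FF01 /= FF00 /kap mul1r => /eqP; rewrite addr_eq0 => /eqP h.
  by rewrite ?derive1nS ?derive1n1 h mulNr.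
have y1n : y t1 != 0 by rewrite y1 oner_neq0.
have [U [domU U1 UD yn]] := neq0_ball oD D1 sy y1n; have [_ oU _] := domU.
have syU := smooth_sub UD sy; have sqU := smooth_sub UD sq; have stU := smooth_sub UD stau.
have sf : smooth U (fun t => (y t ^+ 2)^-1).
  by apply: smoothV => //; [move=> t /yn; exact: expf_neq0|exact: smoothX].
have [T [T0 sT dT]] := smooth_primitive domU U1 sf.
have dT' t : U t -> derive1 T t = (y t ^+ 2)^-1 by move=> /dT /derive1_val.
(* At [t1] one has [T = 0], [y = 1] and [y' = 0], so the jets of [y ^+ 2 * h (T)] are the
   derivatives of [h] at 0; these are matched with the jets of [tau]. *)
pose b := derive1 tau t1; pose a := derive1n 2 tau t1 / 2.
pose h z := b * z + a * z ^+ 2.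
have dh z : derive1 h z = b + 2 * a * z.
  apply: derive1_val; apply: dval (dD (dZ b (dI z)) (dZ a (dX 2 (dI z)))) _.
  by rewrite /= expr1; ring.
have d2h z : derive1n 2 h z = 2 * a.
  rewrite derive1nS derive1n1 (_ : derive1 h = fun z => b + 2 * a * z); last by apply/funext.
  by apply: derive1_val; apply: dval (dD (dC b z) (dZ (2 * a) (dI z))) _; ring.
have d3h z : derive1n 3 h z = 0.
  rewrite derive1nS (_ : derive1n 2 h = fun=> 2 * a); last by apply/funext.
  exact: derive1_val (dC _ _).
have oT : open [set: K] by exact: openT.
have sh : smooth setT h.
  apply: smoothD => //; apply: smoothZ => //; first exact: smooth_id.
  by apply: smoothX => //; exact: smooth_id.
have y2U t : U t -> derive1n 2 y t = - q t * y t by move=> /UD /y2.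
have TI t : U t -> setT (T t) by [].
(* Because [h''' = 0], this also solves the symmetric square of [y'' + q y], and by uniqueness it
   coincides with [tau]. *)
pose g t := y t ^+ 2 * h (T t).
have sg : smooth U g.
  by apply: smoothM => //; [exact: smoothX|exact: (smooth_comp oU TI sT sh)].
have jg i : (i < 3)%N -> FF q 2 i g t1 = derive1n i h 0.
  move=> i3; rewrite (FF_straight oU sqU syU sT yn y2U dT' oT sh TI) //; last exact: ltnW.
  rewrite big_ord_recr /= big1 ?add0r => [|j _].
    by rewrite Cf_diag subnn T0 y1 invr1 !expr1n !mul1r.
  by rewrite y1' expr0n subn_eq0 leqNgt ltn_ord /= mulr0 mul0r mulr0.
exists U, y, T, a, b; split=> //; split=> // t Ut.
have e : 1 * tau t + (-1) * g t = 0.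
  apply: (@Pop_unique _ _ pk U t1 q 2 (fun _ _ => 0) (fun t => 1 * tau t + (-1) * g t)) => //.
  - by apply: smoothD => //; exact: smoothZ.
  - move=> i i3; rewrite (FF_lin 2 i 1 (-1) oU sqU stU sg U1) jg // mul1r mulN1r.
    apply/eqP; rewrite subr_eq0; apply/eqP.
    case: i i3 => [|[|[|]]] // _.
    + by rewrite FF00 tau1 /= /h mulr0 expr0n mulr0 addr0.
    + by rewrite FF01 /= dh mulr0 addr0.
    + rewrite d2h FFS FF01 /= FF00 tau1 mulr0 addr0 /a mulrC divfK ?pnatr_eq0 //.
  - move=> s Us; rewrite (Pop_lin 2 _ _ _ oU sqU stU sg Us) -(thetaE oD sq stau (UD s Us)).
    rewrite th ?mulr0 ?add0r; last exact: UD.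
    rewrite /Pop big1 ?addr0; last by move=> j _; rewrite mul0r.
    by rewrite (FF_straight_top 2 oU sqU syU sT yn y2U dT' oT sh TI Us) d3h !mulr0.
by move/eqP: e; rewrite mul1r mulN1r subr_eq0 => /eqP ->.
Qed.

Lemma Pop_d0 g t : (forall j t, D t -> d j t = 0) -> D t ->
  Pop q n d g t = FF q n n.+1 g t.
Proof. by move=> d0 Dt; rewrite /Pop big1 ?addr0 // => j _; rewrite d0 // mul0r. Qed.

(** Three cases. If [tau] vanishes identically, the flow only scales [u] by an exponential. If
    [tau t1] is nonzero, it is a translation in the coordinate with [T' = 1 / tau]. If a nonzero
    [tau] vanishes at [t1], rigidity gives [d = 0] and the flow is a Moebius map. *)
Lemma pflow_exists (tau : K -> K) (c : K) t1 : symm D n q d tau -> D t1 ->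
  exists (W : set K) (dl : R) (om m : K -> K -> K), [/\ open W, W t1, W `<=` D, 0 < dl &
    pflow (pk := pk) D (Pop q n d) tau (fun t => n%:R / 2 * derive1 tau t + c) W dl om m].
Proof.
move=> [stau th ee] D1.
have loc W g h : open W -> (forall t, W t -> g t = h t) -> forall t, W t ->
  Pop q n d g t = Pop q n d h t by exact: Pop_ext.
have stau' := smooth_derive1 stau.
have [tau0|/existsNP [t2 /not_implyP [D2 /eqP tau2]]] := EM (forall t, D t -> tau t = 0).
  have tau'0 t : D t -> derive1 tau t = 0.
    by move=> Dt; rewrite (derive1_ext oD Dt tau0); exact: derive1_val (dC _ _).
  have [G [G0 sG Gn dG GD]] := exp_exists (pk := pk) c.
  exists D, 1, (fun _ t => t), (fun e _ => G e); split=> //; split=> //.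
  - move=> V A S T oA sS sT _; split=> //.
    exact: (smooth_comp oA (U' := setT) (fun _ _ => I) sS sG).
  - by move=> e t _ Dt; rewrite tau0 //; exact: dC.
  - by move=> e t _ Dt; rewrite tau'0 // mulr0 add0r; exact: dG.
  - by move=> e _ t t' _ _.
  - move=> e t _ Dt; rewrite (derive1_val (dI t)); exact: oner_neq0.
  move=> e W' U' h _ oW' W'D oU' U'D sh H t Wt; have sh' := smooth_sub H sh.
  have E s : W' s -> (G e)^-1 * h s = (G e)^-1 * h s + 0 * h s by rewrite mul0r addr0.
  rewrite (loc _ _ _ oW' E t Wt) (Pop_lin n d _ _ oW' (smooth_sub W'D sq) sh' sh' Wt) mul0r addr0.
  split=> [/eqP|->]; last by rewrite mulr0.
  by rewrite mulf_eq0 invr_eq0 (negbTE (Gn e)) => /eqP.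
have [tau1|tau1] := eqVneq (tau t1) 0; last first.
  have [U [domU U1 UD taun]] := neq0_ball oD D1 stau tau1; have [_ oU _] := domU.
  have stU := smooth_sub UD stau; have sdU j := smooth_sub UD (sd j); have sqU := smooth_sub UD sq.
  have sV : smooth U (fun t => (tau t)^-1) by exact: smoothV.
  have [T [T0 sT dT]] := smooth_primitive domU U1 sV.
  have sf : smooth U (fun t => (n%:R / 2 * derive1 tau t + c) / tau t).
    apply: smoothM => //; apply: smoothD => //; last exact: smooth_cst.
    by apply: smoothZ => //; exact: smooth_sub stau'.
  have [chi [chi1 schi chin dchi]] := scalar_exists (pk := pk) domU U1 sf.
  have dn0 t : U t -> d n.+1 t = 0.
    by move=> _; rewrite dn //; apply: leq_trans (leq_pred n) _.
  have [k Hk] := straighten (pk := pk) domU sqU sdU dn0 stU schi sT taun chin dT dchi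
    (fun t Ut => th t (UD t Ut)) (fun j t Ut => ee j t (UD t Ut)).
  apply: (pflow_straight (pk := pk) (U := U) (Q := ccop n k) (htau := fun=> 1) (alz := fun=> 0)
    (T := T) (chi := chi) (t1 := t1) (Wz := setT) (dlz := 1) (mu := fun e z => z + e)
    (M := fun _ _ => 1)) => //.
  - by rewrite (derive1_val (dT t1 U1)) invr_neq0 // taun.
  - by move=> t Ut; rewrite (derive1_val (dT t Ut)) divff // taun.
  - move=> t Ut; rewrite (derive1_val (dchi t Ut)) add0r.
    by have := chin t Ut; have := taun t Ut => h1 h2; field; rewrite h1 h2.
  - move=> W U' h oW WU oU' sh WU' t Wt; rewrite (Hk W U') //.
    have h1 := chin t (WU t Wt); have h2 := taun t (WU t Wt).
    rewrite -/(ccop n k h (T t)); split=> [/eqP|->]; last by rewrite mulr0.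
    by rewrite !mulf_eq0 (negbTE h1) expf_eq0 invr_eq0 (negbTE h2) andbF => /eqP.
  - exact: openT.
  - exact: pflow_shift.
have d0 : forall j t, D t -> d j t = 0.
  apply: (rigidity (pk := pk) domD sq sd _ stau th ee D1 tau1 D2 tau2) => j hj t Dt.
  by rewrite dn.
have [U [y [T [a [b [[domU U1 UD sy sT] [yn y2 dT T0 tauE]]]]]]] := quadratic_coordinate stau th D1 tau1.
have [_ oU _] := domU; have sqU := smooth_sub UD sq.
have [dl [mu [M [dl0 fz]]]] := pflow_moebius (pk := pk) n a b c.
have oW : open [set z : K | nm z < 1].
  have [_ h _] := domain_ball (pk := pk) (0 : K) ltr01.
  rewrite (_ : [set z : K | nm z < 1] = [set q : K | nm (q - 0) < 1]) //.
  by apply/seteqP; split=> z; rewrite /= subr0.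
apply: (pflow_straight (pk := pk) (U := U) (T := T) (chi := fun t => y t ^+ n) (t1 := t1) _ _ _ _
  _ _ _ _ _ _ _ oW _ dl0 fz) => //.
- by rewrite dT // invr_neq0 // expf_neq0 // yn.
- exact: smoothX.
- by move=> t Ut; rewrite expf_neq0 // yn.
- by move=> t Ut; rewrite dT // tauE //; have := yn t Ut; move: (y t) => Y h; field.
- move=> t Ut; have y0 := yn t Ut.
  have dy := smooth_is_derive1 sy Ut; have dT' := smooth_is_derive1 sT Ut.
  rewrite (derive1_ext oU Ut tauE) (derive1_val (dX n dy)) tauE //.
  rewrite (derive1_val (dM (dX 2 dy) (dD (dZ b dT') (dZ a (dX 2 dT'))))) dT //=.
  have -> : y t ^+ n = y t * y t ^+ n.-1 by rewrite -exprS prednK // ltnW.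
  rewrite !expr1; apply: quadratic_coordinate_alg => //; exact: expf_neq0.
- move=> W U' h oW' WU oU' sh WU' t Wt; rewrite (Pop_d0 (fun t => y t ^+ n * h (T t)) d0 (UD t (WU t Wt))).
  have y0 := yn t (WU t Wt).
  rewrite (FF_straight_top n oW' (smooth_sub WU sqU) (smooth_sub WU sy) (smooth_sub WU sT)
    (fun t Ht => yn t (WU t Ht)) (fun t Ht => y2 t (WU t Ht)) (fun t Ht => dT t (WU t Ht))
    oU' sh WU' Wt).
  split=> [/eqP|->]; last by rewrite mulr0.
  by rewrite !mulf_eq0 !expf_eq0 invr_eq0 (negbTE y0) !andbF => /eqP.
- by rewrite /= T0 nmK0.
Qed.

End PflowExists.

(** * Fields of the general form generate symmetries *)

Section Backward.
Context {R : realType} {K : numFieldType} {pk : kpkg R K}.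
Local Notation nm := (@nm R K pk _).
Local Notation io := (io pk).

Lemma ball_dl (dl : R) (e : K) : 0 < dl -> ball (0 : K) (io dl) e <-> nm e < dl.
Proof.
move=> h; have h0 : 0 < io dl by rewrite -(rmorph0 io) io_lt.
by rewrite (ball0E (pk := pk) e h0) nm_io gtr0_norm.
Qed.

Variables (n : nat) (E : lode K n.+1) (rho q : K -> K) (d : nat -> K -> K) (phi0 : K -> K).
Hypotheses (domD : domain (dom E)) (sq : smooth (dom E) q) (sd : forall j, smooth (dom E) (d j)).
Hypotheses (n2 : (2 <= n)%N) (dn : forall j, (n.-1 <= j)%N -> d j = fun=> 0).
Hypothesis gE : gauge E rho phi0 (Pop q n d).
Hypothesis gH : gauge (homogeneous E) rho (fun=> 0) (Pop q n d).
Let D := dom E.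
Let oD : open D. Proof. by have [] := domD. Qed.
Local Notation hom := (solution (homogeneous E)).
Let srho : smooth D rho. Proof. by have [] := gE. Qed.
Let rho0 t : D t -> rho t != 0. Proof. by move=> Dt; have [_ h _ _ _] := gE; exact: h. Qed.
Let sphi0 : smooth D phi0. Proof. by have [] := gE. Qed.

Lemma gen_smooth (B : set (K * K)) tau c psi : open B -> (forall p, B p -> D p.1) ->
  smooth D tau -> smooth D psi -> smooth B (gen n rho phi0 tau c psi).
Proof.
move=> oB BD stau spsi.
have s1 : smooth B (fun p : K * K => p.1) by exact: smooth_fst.
have s2 : smooth B (fun p : K * K => p.2) by exact: smooth_snd.
have sp (h : K -> K) : smooth D h -> smooth B (fun p : K * K => h p.1).
  by move=> sh; exact: (smooth_comp oB BD s1 sh).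
have st' := smooth_derive1 stau; have sp' := smooth_derive1 sphi0; have sr' := smooth_derive1 srho.
have srV : smooth D (fun t => (rho t)^-1) by exact: smoothV.
apply: smooth_pair => //; first exact: sp.
apply: smoothD => //; last exact: sp.
apply: smoothD => //; last by apply: smoothM => //; exact: sp.
apply: smoothM => //; last by apply: smoothB => //; exact: sp.
apply: smoothD => //.
  apply: smoothD => //; last exact: smooth_cst.
  by apply: smoothM => //; [exact: smooth_cst|exact: sp].
by apply: smoothM => //; [apply: smoothM => //; exact: sp|exact: (sp _ srV)].
Qed.

(* Variation of constants: the kernel of [P] is invariant under [Mop al tau], hence the inhomogeneous
   evolution [C' = A C + p] on coordinates gives the translation part of the flow. *)
Lemma kernel_evolution tau c psi t1 : D t1 -> symm D n q d tau -> hom D psi ->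
  exists (C : 'I_n.+1 -> K -> K) (g : 'I_n.+1 -> K -> K),
  [/\ forall j, smooth setT (C j), forall j, C j 0 = 0, forall j, smooth D (g j),
    (forall j t, D t -> Pop q n d (g j) t = 0) &
    exists C' : 'I_n.+1 -> K -> K, (forall j (e : K), is_derive e 1 (C j) (C' j e)) /\
    forall e t, D t -> \sum_j C' j e * g j t =
      \sum_j C j e * Mop (fun t => n%:R / 2 * derive1 tau t + c) tau (g j) t + psi t / rho t].
Proof.
move=> D1 [stau th ee] hpsi; have [phi [hphi span _]] := hom_basis domD sq sd gE gH D1.
pose g (j : nat) t := phi j t / rho t; pose al t := n%:R / 2 * derive1 tau t + c.
have sphi j : smooth D (phi j) by have [] := hphi j.
have sg j : smooth D (g j) by apply: smoothM => //; exact: smoothV.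
have Pg j t : D t -> Pop q n d (g j) t = 0.
  exact: ((homP gH oD (@subset_refl _ _) (sphi j)).1 (hphi j)).
have sal : smooth D al.
  apply: smoothD => //; last exact: smooth_cst.
  by apply: smoothZ => //; exact: smooth_derive1.
have sM j : smooth D (Mop al tau (g j)) by exact: Mop_smooth.
have hM j : hom D (fun t => rho t * Mop al tau (g j) t).
  have sr : smooth D (fun t => rho t * Mop al tau (g j) t) by exact: smoothM.
  apply/(homP gH oD (@subset_refl _ _) sr) => t Dt.
  have e s : D s -> rho s * Mop al tau (g j) s / rho s = Mop al tau (g j) s.
    by move=> Ds; rewrite mulrAC divff ?mul1r ?rho0.
  rewrite (Pop_ext q n d oD e Dt).
  have dn0 s : D s -> d n.+1 s = 0 by move=> _; rewrite dn //; apply: leq_trans (leq_pred n) _.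
  rewrite (Pop_sym oD sq sal stau (sg j) sd dn0 (c := c) (fun _ _ => erefl) th ee Dt).
  rewrite (derive1_ext oD Dt (Pg j)).
  by rewrite Pg // (derive1_val (dC 0 t)) !mulr0 subr0.
have /choice [A HA] : forall j : nat, exists a : nat -> K, forall t, D t ->
    rho t * Mop al tau (g j) t = \sum_(i < n.+1) a i * phi i t.
  by move=> j; exact: span D1 (hM j).
have [p Hp] := span D psi domD D1 hpsi.
have s0 (x : K) : smooth [set: K] (fun _ : K => x) by exact: smooth_cst.
have [C [C0 sC dC']] := lin_exists (pk := pk) (A := fun i j : 'I_n.+1 => fun=> A j i)
  (B := fun i : 'I_n.+1 => fun=> p i) (fun=> 0) (domain_setT (K := K)) (I : setT (0 : K))
  (fun i j => s0 (A j i)) (fun i => s0 (p i)).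
exists C, (fun j => g j); split=> //; first by move=> j t; exact: Pg.
exists (fun i e => \sum_(j < n.+1) A j i * C j e + p i); split; first by move=> i e; exact: dC'.
move=> e t Dt; have r0 := rho0 Dt.
have -> : psi t / rho t = \sum_(i < n.+1) p i * g i t.
  by rewrite Hp // mulr_suml; apply: eq_bigr => i _; rewrite mulrA.
have M j : Mop al tau (g j) t = \sum_(i < n.+1) A j i * g i t.
  apply: (mulfI r0); rewrite HA // mulr_sumr; apply: eq_bigr => i _.
  by rewrite /g; field.
under [X in _ = X + _]eq_bigr => j _ do rewrite M mulr_sumr.
rewrite exchange_big -big_split /=; apply: eq_bigr => i _.
by rewrite mulrDl mulr_suml; congr (_ + _); apply: eq_bigr => j _; rewrite mulrA [C j e * _]mulrC.
Qed.

(** In the gauge coordinate the flow is [(t, u) |-> (om e t, m e t * u + k e (om e t))], where [k e]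
    stays in the kernel of [P] and solves [dk/de = Mop k + psi / rho] with [k 0 = 0]. *)
Lemma backward (J : set K) tau c psi v : domain J -> symm D n q d tau -> hom D psi ->
  (forall p, (D `*` J) p -> v p = gen n rho phi0 tau c psi p) -> lie_algebra E J v.
Proof.
move=> domJ symt hpsi vE; have [_ oJ _] := domJ; have [stau th ee] := symt.
have [_ spsi _] := hpsi.
pose B := D `*` J; have oB : open B by exact: (open_prod (pk := pk)).
have sgen : smooth B (gen n rho phi0 tau c psi) by apply: gen_smooth => // p [].
split; first by apply: (smooth_ext oB _ sgen) => p Bp; rewrite vE.
move=> [t1 x1] B1; have [/= D1 J1] := B1.
have [W [dl [om [m [oW W1 WD dl0 fl]]]]] := pflow_exists (pk := pk) domD sq sd n2 dn c symt D1.
have [C [g [sC C0 sg Pg [C' [dC' CM]]]]] := kernel_evolution c D1 symt hpsi.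
pose al t := n%:R / 2 * derive1 tau t + c.
pose k e t := \sum_j C j e * g j t.
have k0 t : k 0 t = 0 by rewrite /k big1 // => j _; rewrite C0 mul0r.
have sk e : smooth D (k e) by apply: smooth_sum => // j _; exact: smoothZ.
pose X1 e t := rho (om e t) * m e t / rho t.
pose X0 e t := rho (om e t) * (k e (om e t) - m e t * phi0 t / rho t) + phi0 (om e t).
pose Phi (ep : K * (K * K)) : K * K :=
  (om ep.1 ep.2.1, X1 ep.1 ep.2.1 * ep.2.2 + X0 ep.1 ep.2.1).
pose A0 := [set p : K * (K * K) | nm p.1 < dl /\ (W `*` J) p.2].
have oA0 : open A0.
  have -> : A0 = [set e : K | nm (e - 0) < dl] `*` (W `*` J).
    by apply/seteqP; split=> -[e p] [/= h1 h2]; split=> //=; rewrite ?subr0 // -[e]subr0.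
  apply: (open_prod (pk := pk)); first by have [] := domain_ball (pk := pk) (0 : K) dl0.
  exact: (open_prod (pk := pk)).
have sPhi : smooth A0 Phi.
  have pr1 : smooth A0 (fun p : K * (K * K) => p.1) by exact: smooth_fst.
  have pr2 : smooth A0 (fun p : K * (K * K) => p.2) by exact: smooth_snd.
  have pt := smooth_pfst oA0 pr2; have px := smooth_psnd oA0 pr2.
  have [so sm] := pf_smooth fl oA0 pr1 pt (fun p Hp => conj (proj1 Hp) (proj1 (proj2 Hp))).
  have oD' p : A0 p -> D (om p.1 p.2.1) by move=> [h1 [h2 _]]; exact: (pf_dom fl).
  have tD p : A0 p -> D p.2.1 by move=> [_ [/WD]].
  have so' (h : K -> K) : smooth D h -> smooth A0 (fun p => h (om p.1 p.2.1)).
    by move=> sh; exact: (smooth_comp oA0 oD' so sh).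
  have st' (h : K -> K) : smooth D h -> smooth A0 (fun p => h p.2.1).
    by move=> sh; exact: (smooth_comp oA0 tD pt sh).
  have srV : smooth D (fun t => (rho t)^-1) by exact: smoothV.
  have sX1 : smooth A0 (fun p => X1 p.1 p.2.1).
    by apply: smoothM => //; [apply: smoothM => //; exact: so'|exact: (st' _ srV)].
  have skk : smooth A0 (fun p => k p.1 (om p.1 p.2.1)).
    apply: smooth_sum => // j _; apply: smoothM => //; last exact: so'.
    exact: (smooth_comp oA0 (U' := setT) (fun _ _ => I) pr1 (sC j)).
  have sX0 : smooth A0 (fun p => X0 p.1 p.2.1).
    apply: smoothD => //; last exact: so'.
    apply: smoothM => //; first exact: so'.
    apply: smoothB => //; apply: smoothM => //; last exact: (st' _ srV).
    by apply: smoothM => //; exact: st'.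
  by apply: smooth_pair => //; apply: smoothD => //; exact: smoothM.
have Phi0 p : W p.1 -> Phi (0, p) = p.
  case: p => t x /= Wt; rewrite /Phi /= /X1 /X0 (pf_0 fl) // (pf_m0 fl) // k0.
  by congr pair; have r0 := rho0 (WD t Wt); field.
have A01 : A0 (0, (t1, x1)) by split=> //=; rewrite nmK0.
have P1 : Phi (0, (t1, x1)) = (t1, x1) by exact: Phi0.
have [b b0 Hb] := (openP (pk := pk) B).1 oB _ B1.
have [h h0 Hh] := (contP (pk := pk) Phi _).1 (smooth_cont sPhi A01) b b0.
have oWJ : open (W `*` J) by exact: (open_prod (pk := pk)).
have [w w0 Hw] := (openP (pk := pk) _).1 oWJ (t1, x1) (conj W1 J1).
pose dl' := Num.min dl h; have dl'0 : 0 < dl' by rewrite lt_min dl0 h0.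
have [Hdl Hdlh] : (forall x, x < dl' -> x < dl) /\ (forall x, x < dl' -> x < h).
  by split=> x; rewrite lt_min => /andP[].
pose V := [set p : K * K | nm (p - (t1, x1)) < Num.min w h].
have VW p : V p -> W p.1 /\ J p.2 by rewrite /V /= lt_min => /andP[/Hw].
have Vh p : V p -> nm (p - (t1, x1)) < h by rewrite /V /= lt_min => /andP[].
have oV : open V.
  apply/(openP (pk := pk)) => p Vp; exists (Num.min w h - nm (p - (t1, x1))); first by rewrite subr_gt0.
  move=> p'; rewrite ltrBrDr => h'; apply: le_lt_trans h'.
  exact: nm_tri.
have VB : V `<=` B by move=> p /VW [/WD].
have bE (e : K) : ball (0 : K) (io dl') e <-> nm e < dl' := ball_dl e dl'0.
have PB (e : K) p : nm e < dl' -> V p -> B (Phi (e, p)).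
  move=> he Vp; apply: Hb; rewrite -P1; apply: Hh; rewrite nm_pair /= gt_max subr0.
  by rewrite Hdlh //; exact: Vh.
(* The second component in the gauge coordinate; it satisfies a scalar linear equation in [e]. *)
pose Z e t x := m e t * ((x - phi0 t) / rho t) + k e (om e t).
have PhiZ e t x : W t -> Phi (e, (t, x)) = (om e t, rho (om e t) * Z e t x + phi0 (om e t)).
  move=> Wt; rewrite /Phi /= /X1 /X0 /Z; congr pair; have r0 := rho0 (WD t Wt).
  by field.
have dZ' (e t x : K) : nm e < dl -> W t -> is_derive e 1 (fun e : K => Z e t x)
    (al (om e t) * Z e t x + psi (om e t) / rho (om e t)).
  move=> he Wt; have Do := pf_dom fl he Wt; have dom' := pf_der fl he Wt.
  have d1 : is_derive e 1 (fun e : K => k e (om e t))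
      (\sum_j (C' j e * g j (om e t) + C j e * (tau (om e t) * derive1 (g j) (om e t)))).
    apply: dsum => j.
    have dg := dcomp dom' (smooth_is_derive1 (sg j) Do).
    exact: (dM (f := C j) (g := fun e : K => g j (om e t)) (dC' j e) dg).
  apply: dval (dD (dM (pf_mder fl he Wt) (dC ((x - phi0 t) / rho t) e)) d1) _.
  (* The transport term [tau g'] from moving [om e t] cancels the one inside [Mop], leaving
     [al * k]. *)
  have -> : \sum_j (C' j e * g j (om e t) + C j e * (tau (om e t) * derive1 (g j) (om e t))) =
      al (om e t) * k e (om e t) + psi (om e t) / rho (om e t).
    rewrite big_split /= CM // addrAC; congr (_ + _).
    rewrite -big_split /k mulr_sumr /=; apply: eq_bigr => j _.
    by rewrite /Mop -/(al _) mulrBr subrK mulrCA.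
  rewrite /Z -/(al _); move: (al _) (k e _) (psi _ / _) ((x - phi0 t) / _) => a1 a2 a3 a4.
  by rewrite mulr0 addr0 mulrDr !mulrA addrA.
exists (io dl'), V, Phi; split=> //.
- by rewrite -(rmorph0 io) io_lt.
- by rewrite /V /= subrr nm0 lt_min w0 h0.
- split=> //.
  + apply: smooth_sub sPhi => -[e p] [/= /bE /Hdl he /VW [h1 h2]]; split=> //.
  + by move=> p /VW [h1 _]; exact: Phi0.
  + move=> e p /bE he Vp; split; first exact: PB.
    have [Wt Jx] := VW p Vp; rewrite vE; last exact: PB.
    have hed := Hdl _ he; case: p Vp Wt Jx => t x Vp /= Wt Jx.
    have Do := pf_dom fl hed Wt; have dom' := pf_der fl hed Wt.
    apply: (dfun (f := fun e : K => (om e t, rho (om e t) * Z e t x + phi0 (om e t)))); last first.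
      by move=> e'; rewrite PhiZ.
    have d2 := dD (dM (dcomp dom' (smooth_is_derive1 srho Do)) (dZ' e t x hed Wt))
      (dcomp dom' (smooth_is_derive1 sphi0 Do)).
    apply: dval (is_derive_pair dom' d2) _; rewrite PhiZ // /gen /=; congr pair.
    have := rho0 Do; rewrite /al addrK; move: (derive1 tau _) (Z e t x) => T z r0.
    by field.
  + move=> e1 e2 [t x] /bE h1 /bE h2 /bE h12 Vp V2.
    have [/= Wt Jx] := VW _ Vp; have W2 : W (om e2 t) by have [] := VW _ V2.
    have k1 := Hdl _ h1; have k2 := Hdl _ h2; have k12 := Hdl _ h12.
    rewrite (PhiZ e2) // (PhiZ (e1 + e2)) // PhiZ // (pf_group fl) //.
    congr (_, _ * _ + _).
    set x2 := rho (om e2 t) * _ + _.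
    (* The convex set of times [e] for which both [e] and [e + e2] are admissible. On it both sides
       of the group law solve the same scalar linear equation and agree at [e = 0]. *)
    pose S := [set e : K | nm (e - 0) < dl] `&` [set e : K | nm (e - (- e2)) < dl].
    have domS : domain S.
      apply: (domainI (p := 0)); try exact: domain_ball.
        by rewrite /= subrr nmK0.
      by rewrite /= opprK add0r.
    pose u e := Z e (om e2 t) x2 - Z (e + e2) t x.
    have du (e : K) : S e -> is_derive e 1 u (al (om e (om e2 t)) * u e).
      move=> [/=]; rewrite subr0 opprK => s1 s2.
      have D1' : is_derive e 1 (fun e : K => e + e2) 1.
        by apply: dval (dD (dI e) (dC e2 e)) _; rewrite addr0.
      have D2' := dcomp (g := fun e : K => Z e t x) D1' (dZ' _ t x s2 Wt).
      apply: dval (dB (dZ' e _ x2 s1 W2) D2') _.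
      by rewrite mul1r (pf_group fl) // /u; ring.
    have S0 : S 0 by rewrite /S /= subrr nmK0 opprK add0r.
    have S1 : S e1 by rewrite /S /= subr0 opprK.
    apply/eqP; rewrite -subr_eq0; apply/eqP; rewrite -/(u e1).
    apply: (scalar_unique (pk := pk) (f := fun e => al (om e (om e2 t))) domS S0 _ du) => //.
      move=> e [/=]; rewrite subr0 => s1 _.
      pose Be := [set e : K | nm (e - 0) < dl].
      have oBe : open Be by have [] := domain_ball (pk := pk) (0 : K) dl0.
      have Bee (x' : K) : Be x' -> nm x' < dl by rewrite /Be /= subr0.
      have sal : smooth D al.
        apply: smoothD => //; last exact: smooth_cst.
        by apply: smoothZ => //; exact: smooth_derive1.
      have [so _] := pf_smooth fl oBe (@smooth_id K _ Be) (smooth_cst Be (om e2 t))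
        (fun x' Hx => conj (Bee x' Hx) W2).
      have sc := smooth_comp oBe (fun x' Hx => pf_dom fl (Bee x' Hx) W2) so sal.
      by apply: (smooth_cont sc); rewrite /Be /= subr0.
    rewrite /u add0r /Z (pf_m0 fl) // (pf_0 fl) // k0 addr0 mul1r /x2.
    by rewrite addrK mulrC mulKf ?subrr // rho0 //; exact: WD.
move=> e /bE he; have hed := Hdl _ he.
have [so sm] := pf_smooth fl oW (smooth_cst W e) (@smooth_id K _ W) (fun t Wt => conj hed Wt).
apply: (@tri_maps K _ E E rho phi0 _ rho phi0 _ V W (om e) (m e) (k e) (X1 e) (X0 e) gE gE) => //.
- by move=> p /VW [].
- exact: (pf_inj fl).
- by move=> t Wt; exact: (pf_jac fl).
- by move=> t Wt; exact: (pf_dom fl).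
- by move=> t Wt; exact: (pf_mneq0 fl).
move=> W' U' h' oW' W'W oU' U'D sh H t W't.
have skU : smooth U' (k e) by exact: smooth_sub (sk e).
have shk : smooth U' (fun z => h' z - k e z) by exact: smoothB.
rewrite (pf_inv fl (h := fun z => h' z - k e z) hed oW' W'W oU' U'D shk H W't).
have Uo := H t W't; have sqU := smooth_sub U'D sq.
(* [k e] lies in the kernel of [Pop], so subtracting it does not affect the condition. *)
have e1 z : U' z -> h' z - k e z = 1 * h' z + (-1) * k e z by rewrite mul1r mulN1r.
rewrite (Pop_ext q n d oU' e1 Uo) (Pop_lin n d _ _ oU' sqU sh skU Uo).
rewrite (Pop_sum n d (fun j => C j e) oU' sqU (fun j => smooth_sub U'D (sg j)) Uo).
rewrite [X in -1 * X]big1 ?mulr0 ?addr0 ?mul1r // => j _.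
by rewrite Pg ?mulr0 //; exact: U'D.
Qed.

End Backward.

(** * Dimension of the symmetry algebra *)
Section Dimension.
Context {K : numFieldType}.

(** If [m < n], the coefficient matrix has a nonzero row vector in its left kernel, which is a
    linear relation among the [e i]. *)
Lemma vfree_le (B : set (K * K)) n m (e : 'I_n -> vfield K) (e' : 'I_m -> vfield K) :
  vfree B e -> (forall i, vspan B e' (e i)) -> (n <= m)%N.
Proof.
move=> fe se; rewrite leqNgt; apply/negP => mn.
have /choice [A HA] := se.
pose M := \matrix_(i < n, j < m) A i j.
have : kermx M != 0.
  rewrite kermx_eq0 /row_free; apply/eqP => rk; have := rank_leq_col M.
  by rewrite rk leqNgt mn.
move=> /rowV0Pn [u /sub_kermxP uM /eqP u0]; apply: u0; apply/rowP => i; rewrite mxE.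
apply: (fe (fun i => u 0 i)) => p Bp.
under eq_bigr => k _ do rewrite (HA k p Bp) scaler_sumr.
rewrite exchange_big big1 // => j _; under eq_bigr => k _ do rewrite scalerA.
rewrite -scaler_suml; have /rowP/(_ j) := uM; rewrite !mxE => h.
rewrite (_ : \sum_k u 0 k * A k j = 0) ?scale0r //.
by rewrite -[RHS]h; apply: eq_bigr => k _; rewrite mxE.
Qed.

Lemma vspan_mem (B : set (K * K)) n (e : 'I_n -> vfield K) i : vspan B e (e i).
Proof.
exists (fun j => (j == i)%:R) => p _; rewrite (bigD1 i) //= eqxx scale1r big1 ?addr0 //.
by move=> j /negbTE ->; rewrite scale0r.
Qed.

Lemma has_dim_unique (B : set (K * K)) g n m : has_dim B g n -> has_dim B g m -> n = m.
Proof.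
move=> [e [fe ->]] [e' [fe' ee]]; apply/eqP; rewrite eqn_leq; apply/andP; split.
  by apply: (vfree_le (e' := e') fe) => i; rewrite -ee; exact: vspan_mem.
by apply: (vfree_le (e' := e) fe') => i; rewrite ee; exact: vspan_mem.
Qed.

Lemma pair_sum (I : finType) (f g : I -> K) :
  \sum_i ((f i, g i) : K * K) = (\sum_i f i, \sum_i g i).
Proof. by elim/big_ind3: _ => // a b [c c'] a' b' [e e'] -> ->. Qed.

End Dimension.

(** * The space of admissible [tau] *)

Section Symmetries.
Context {R : realType} {K : numFieldType} {pk : kpkg R K}.
Local Notation nm := (@nm R K pk _).
Local Notation io := (io pk).

Variables (D : set K) (domD : domain D) (n : nat) (q : K -> K) (d : nat -> K -> K).
Hypotheses (sq : smooth D q) (sd : forall j, smooth D (d j)) (n2 : (2 <= n)%N).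
Hypothesis dn : forall j, (n.-1 <= j)%N -> d j = fun=> 0.
Let oD : open D. Proof. by have [] := domD. Qed.
Let S := symm D n q d.

Lemma symm_comb a b tau sig : S tau -> S sig -> S (fun t => a * tau t + b * sig t).
Proof.
move=> [st tht et] [ss ths es].
have sl : smooth D (fun t => a * tau t + b * sig t) by apply: smoothD => //; exact: smoothZ.
have d1 t : D t -> derive1 (fun t => a * tau t + b * sig t) t = a * derive1 tau t + b * derive1 sig t.
  by move=> Dt; rewrite (der1D _ _ Dt) ?(der1Z _ _ Dt) //; exact: smoothZ.
have st' := smooth_derive1 st; have ss' := smooth_derive1 ss.
split=> [|t Dt|j t Dt]; first exact: sl.
  by rewrite (thetaE oD sq sl Dt) (Pop_lin 2 _ a b oD sq st ss Dt) -(thetaE oD sq st Dt) -(thetaE oD sq ss Dt) (tht t Dt) (ths t Dt) !mulr0 addr0.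
have d2 : derive1n 2 (fun t => a * tau t + b * sig t) t = a * derive1n 2 tau t + b * derive1n 2 sig t.
  change (derive1 (derive1 (fun t => a * tau t + b * sig t)) t =
    a * derive1 (derive1 tau) t + b * derive1 (derive1 sig) t).
  rewrite (derive1_ext oD Dt d1).
  by rewrite (der1D _ _ Dt) ?(der1Z _ _ Dt) //; exact: smoothZ.
have := et j t Dt; have := es j t Dt; rewrite /eop (d1 t Dt) d2.
move: (derive1n 2 tau t) (derive1n 2 sig t) (derive1 tau t) (derive1 sig t) (derive1 (d j) t)
  (d j t) (d j.+1 t) (kap n j.+1 : K) => A1 B1 A2 B2 A3 A4 A5 k e1 e2.
transitivity (a * (tau t * A3 + (n.+1%:R - j%:R) * A2 * A4 + k / 2 * A1 * A5) +
  b * (sig t * A3 + (n.+1%:R - j%:R) * B2 * A4 + k / 2 * B1 * A5)); first by ring.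
by rewrite e1 e2 !mulr0 addr0.
Qed.

Lemma symm_0 : S (fun=> 0).
Proof.
have s0 : smooth D (fun=> 0 : K) by exact: smooth_cst.
have z : derive1 (fun=> 0 : K) = fun=> 0 :> K by apply/funext => t; exact: derive1_val (dC _ _).
split=> [|t _|j t _]; first exact: s0.
  by rewrite /theta !derive1nS derive1n0 !z !mulr0 !addr0.
by rewrite /eop !derive1nS derive1n0 !z !mulr0 !mul0r !addr0.
Qed.

Lemma symm_ext tau sig : (forall t, D t -> tau t = sig t) -> S tau -> S sig.
Proof.
move=> e [st tht et]; have ss := smooth_ext oD e st; split=> [|t Dt|j t Dt]; first exact: ss.
  by rewrite (thetaE oD sq ss Dt) -(Pop_ext q 2 _ oD e Dt) -(thetaE oD sq st Dt) tht.
by rewrite /eop -(e t Dt) -(derive1_ext oD Dt e) -(derive1n_ext 2 oD e Dt); exact: et.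
Qed.

Lemma symm_sum s (c : 'I_s -> K) (b : 'I_s -> K -> K) : (forall i, S (b i)) ->
  S (fun t => \sum_i c i * b i t).
Proof.
elim: s c b => [|s IH] c b Sb.
  by apply: symm_ext symm_0 => t _; rewrite big_ord0.
apply: (symm_ext (tau := fun t => 1 * (\sum_(i < s) c (widen_ord (leqnSn s) i) *
   b (widen_ord (leqnSn s) i) t) + c ord_max * b ord_max t)).
  by move=> t _; rewrite big_ord_recr mul1r.
by apply: symm_comb => //; apply: IH.
Qed.

Lemma symm_vanishing tau t0 t1 : S tau -> D t0 -> tau t0 = 0 -> D t1 -> tau t1 != 0 ->
  forall j t, D t -> d j t = 0.
Proof.
move=> [st th ee] D0 z0 D1 z1; apply: (rigidity (pk := pk) domD sq sd _ st th ee D0 z0 D1 z1).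
by move=> j hj t _; rewrite dn.
Qed.

Definition symm_basis s (b : 'I_s -> K -> K) : Prop :=
  [/\ forall i, S (b i),
    forall c : 'I_s -> K, (forall t, D t -> \sum_i c i * b i t = 0) -> forall i, c i = 0 &
    forall tau, S tau -> exists c : 'I_s -> K, forall t, D t -> tau t = \sum_i c i * b i t].

(** Two independent elements have a combination that vanishes at a point but not identically, which
    forces [d = 0]. The equations [eop] are then void, and [S] is the kernel of [theta q], with a
    basis dual to the three jets at [t1]. *)
Lemma symm_dim : exists s (b : 'I_s -> K -> K), symm_basis b /\
  [\/ s = 0%N, s = 1%N | s = 3 /\ forall j t, D t -> d j t = 0].
Proof.
have [S0|/existsNP [tau1 /not_implyP [S1 /existsNP [t1 /not_implyP [D1 /eqP tau1n]]]]] :=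
  EM (forall tau, S tau -> forall t, D t -> tau t = 0).
  exists 0%N, (fun i _ => 0); split; last by constructor 1.
  split=> [i|c _ i|tau St]; [by case: i|by case: i|exists (fun=> 0) => t Dt].
  by rewrite big_ord0; exact: S0.
have [Sm|/existsNP [tau2 /not_implyP [S2 /forallNP nm2]]] :=
  EM (forall tau, S tau -> exists c, forall t, D t -> tau t = c * tau1 t).
  exists 1%N, (fun _ => tau1); split; last by constructor 2.
  split=> // [c h i|tau /Sm [c Hc]]; last by exists (fun=> c) => t Dt; rewrite big_ord1; exact: Hc.
  have /eqP := h t1 D1; rewrite big_ord1 mulf_eq0 (negbTE tau1n) orbF => /eqP.
  by rewrite (ord1 i).
have d0 : forall j t, D t -> d j t = 0.
  (* It vanishes at [t1] by construction; vanishing identically would make [tau2] a multiple of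
     [tau1]. *)
  pose sg t := tau2 t1 * tau1 t + (- tau1 t1) * tau2 t.
  have [z|/existsNP [t2 /not_implyP [D2 /eqP nz]]] := EM (forall t, D t -> sg t = 0).
    case: (nm2 (tau2 t1 / tau1 t1)) => t Dt; apply: (mulfI tau1n).
    have /eqP := z t Dt; rewrite /sg mulNr subr_eq0 => /eqP <-.
    by rewrite mulrA [in RHS]mulrCA divff // mulr1.
  have Ssg : S sg by exact: symm_comb.
  have z1 : sg t1 = 0 by rewrite /sg mulNr mulrC subrr.
  exact: symm_vanishing Ssg D1 z1 D2 nz.
have s0 : smooth D (fun=> 0 : K) by exact: smooth_cst.
have /choice [b Hb] : forall i : 'I_3, exists g, [/\ smooth D g,
    forall k, (k < 3)%N -> FF q 2 k g t1 = (k == i)%:R &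
    forall t, D t -> Pop q 2 (fun _ _ => 0) g t = 0].
  by move=> i; exact: (Pop_exists (pk := pk) 2 (fun k => (k == i)%:R) domD D1 sq (fun _ : nat => s0) s0).
have sb i : smooth D (b i) by have [] := Hb i.
have jet (c : 'I_3 -> K) (k : 'I_3) : FF q 2 k (fun t => \sum_i c i * b i t) t1 = c k.
  rewrite (FF_sum 2 k c oD sq sb D1) (bigD1 k) //= big1 ?addr0 => [|i ik].
    by have [_ h _] := Hb k; rewrite h // eqxx mulr1.
  by have [_ h _] := Hb i; rewrite h // (_ : (k == i :> nat) = false) ?mulr0 //; apply/negbTE; rewrite eq_sym.
exists 3, b; split; last by constructor 3.
split=> [i|c h i|tau [st th _]].
- split=> [|t Dt|j t Dt]; first exact: sb.
    by have [_ _ h] := Hb i; rewrite (thetaE oD sq (sb i) Dt) h.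
  have z : derive1 (d j) t = 0 by rewrite (derive1_ext oD Dt (d0 j)); exact: derive1_val (dC _ _).
  by rewrite /eop z !d0 // !mulr0 !addr0.
- rewrite -(jet c i) (FF_ext q 2 i oD h D1).
  have e t : D t -> 0 = 0 * 0 + 0 * 0 :> K by rewrite mulr0 addr0.
  by rewrite (FF_ext q 2 i oD e D1) (FF_lin 2 i 0 0 oD sq s0 s0 D1) !mul0r addr0.
- pose c (k : 'I_3) := FF q 2 k tau t1; exists c => t Dt.
  have sS : smooth D (fun t => \sum_i c i * b i t).
    by apply: smooth_sum => // i _; exact: smoothZ.
  have e : 1 * tau t + (-1) * (\sum_i c i * b i t) = 0.
    apply: (@Pop_unique _ _ pk D t1 q 2 (fun _ _ => 0)
      (fun t => 1 * tau t + (-1) * (\sum_i c i * b i t))) => //.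
    + by apply: smoothD => //; exact: smoothZ.
    + move=> k k3; rewrite (FF_lin 2 k 1 (-1) oD sq st sS D1) (jet c (Ordinal k3)).
      by rewrite /c mul1r mulN1r subrr.
    + move=> s Ds; rewrite (Pop_lin 2 _ _ _ oD sq st sS Ds) -(thetaE oD sq st Ds) th // mulr0 add0r.
      rewrite (Pop_sum 2 _ c oD sq sb Ds) big1 ?mulr0 // => i _.
      by have [_ _ h] := Hb i; rewrite h // mulr0.
  by move/eqP: e; rewrite mul1r mulN1r subr_eq0 => /eqP.
Qed.

End Symmetries.

(** * Bases of the symmetry algebra and reductions of the equation *)

Section Final.
Context {R : realType} {K : numFieldType} {pk : kpkg R K}.
Local Notation nm := (@nm R K pk _).
Local Notation io := (io pk).

Variables (n : nat) (E : lode K n.+1) (rho q : K -> K) (d : nat -> K -> K) (phi0 : K -> K).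
Hypotheses (domD : domain (dom E)) (sq : smooth (dom E) q) (sd : forall j, smooth (dom E) (d j)).
Hypotheses (n2 : (2 <= n)%N) (dn : forall j, (n.-1 <= j)%N -> d j = fun=> 0).
Hypothesis gE : gauge E rho phi0 (Pop q n d).
Hypothesis gH : gauge (homogeneous E) rho (fun=> 0) (Pop q n d).
Variables (J : set K) (domJ : domain J).
Let D := dom E.
Let oD : open D. Proof. by have [] := domD. Qed.
Local Notation hom := (solution (homogeneous E)).
Let srho : smooth D rho. Proof. by have [] := gE. Qed.
Let rho0 t : D t -> rho t != 0. Proof. by move=> Dt; have [_ h _ _ _] := gE; exact: h. Qed.
Let sphi0 : smooth D phi0. Proof. by have [] := gE. Qed.
Let B := D `*` J.
Let S := symm D n q d.
Let G := gen n rho phi0.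

Lemma sol_phi0 : solution E D phi0.
Proof.
apply/(solP gE gH oD (@subset_refl _ _) sphi0).
apply/(homP gH oD (@subset_refl _ _)); first by apply: smoothB.
have s0 : smooth D (fun=> 0 : K) by exact: smooth_cst.
move=> t Dt; have e s : D s -> (phi0 s - phi0 s) / rho s = 0 * 0 + 0 * 0.
  by move=> _; rewrite subrr !mul0r addr0.
by rewrite (Pop_ext q n d oD e Dt) (Pop_lin n d _ _ oD sq s0 s0 Dt) !mul0r addr0.
Qed.

Lemma gen_ext tau tau' c psi psi' p : (forall t, D t -> tau t = tau' t) ->
  (forall t, D t -> psi t = psi' t) -> D p.1 -> G tau c psi p = G tau' c psi' p.
Proof.
by move=> e1 e2 Dp; rewrite /G /gen (derive1_ext oD Dp e1) e1 // e2.
Qed.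

Lemma gen_sum s m (ca : 'I_s -> K) (b : 'I_s -> K -> K) (c0 : K) (cj : 'I_m -> K)
    (phi : 'I_m -> K -> K) p : (forall i, smooth D (b i)) -> D p.1 ->
  \sum_i ca i *: G (b i) 0 (fun=> 0) p + (c0 *: G (fun=> 0) 1 (fun=> 0) p +
    \sum_j cj j *: G (fun=> 0) 0 (phi j) p) =
  G (fun t => \sum_i ca i * b i t) c0 (fun t => \sum_j cj j * phi j t) p.
Proof.
move=> sb Dp; have z t : derive1 (fun=> 0 : K) t = 0 by exact: derive1_val (dC _ _).
case: p Dp => t x /= Dt; rewrite /G /gen /= z.
have -> : derive1 (fun t => \sum_i ca i * b i t) t = \sum_i ca i * derive1 (b i) t.
  rewrite (der1sum (U := D)) //; last by move=> i; exact: smoothZ.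
  by apply: eq_bigr => i _; rewrite (der1Z _ (sb i) Dt).
have e1 i : ca i *: ((b i t, (n%:R / 2 * derive1 (b i) t + 0 + b i t * derive1 rho t / rho t) *
    (x - phi0 t) + b i t * derive1 phi0 t + 0) : K * K) = (ca i * b i t,
    (n%:R / 2 * (x - phi0 t)) * (ca i * derive1 (b i) t) +
    (derive1 rho t / rho t * (x - phi0 t) + derive1 phi0 t) * (ca i * b i t)).
  congr pair; rewrite /GRing.scale /=.
  move: (derive1 (b i) t) (derive1 rho t) (derive1 phi0 t) (rho t)^-1 => A1 A2 A3 A4; ring.
under eq_bigr do rewrite e1.
rewrite pair_sum big_split /= -!mulr_sumr.
have e2 j : cj j *: ((0, (n%:R / 2 * 0 + 0 + 0 * derive1 rho t / rho t) * (x - phi0 t)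
    + 0 * derive1 phi0 t + phi j t) : K * K) = (0, cj j * phi j t).
  by congr pair; rewrite /GRing.scale /= !(mulr0, mul0r, add0r, addr0).
under [X in _ + (_ + X)]eq_bigr do rewrite e2.
rewrite pair_sum big1_eq [LHS]surjective_pairing; congr pair; rewrite /= /GRing.scale /=.
  by rewrite mulr0 !addr0.
move: (derive1 rho t) (derive1 phi0 t) (rho t)^-1 (\sum_i ca i * b i t)
  (\sum_i ca i * derive1 (b i) t) (\sum_j cj j * phi j t) => A1 A2 A3 A4 A5 A6; ring.
Qed.

Lemma hom_sum m (c : 'I_m -> K) (phi : 'I_m -> K -> K) : (forall j, hom D (phi j)) ->
  hom D (fun t => \sum_j c j * phi j t).
Proof.
elim: m c phi => [|m IH] c phi hphi.
  apply: (@solution_ext _ _ _ _ (fun t => phi0 t - phi0 t)) => //.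
    by move=> t _; rewrite big_ord0 subrr.
  exact: (sol_diff sq gE gH oD sol_phi0 sol_phi0).
apply: (@solution_ext _ _ _ _ (fun t => 1 * (\sum_(i < m) c (widen_ord (leqnSn m) i) *
   phi (widen_ord (leqnSn m) i) t) + c ord_max * phi ord_max t)) => //.
  by move=> t _; rewrite big_ord_recr mul1r.
by apply: (hom_comb sq gE gH _ _ oD) => //; exact: IH.
Qed.

(** By [forward] and [backward] the algebra is the image of the triples [(tau, c, psi)] under the
    linear map [gen], injective for functions restricted to [D]. The three factors contribute [s], 1
    and [n + 1]. *)
Lemma lie_has_dim s (b : 'I_s -> K -> K) : symm_basis D n q d b ->
  has_dim B (lie_algebra E J) (s + (1 + n.+1))%N.
Proof.
move=> [Sb fb spanb]; have [[ts Ds] _ _] := domD; have [[x1 Jx1] oJ _] := domJ.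
have [phi [hphi spanphi freephi]] := hom_basis domD sq sd gE gH Ds.
pose e (i : 'I_(s + (1 + n.+1))%N) : vfield K := match fintype.split i with
  | inl a => G (b a) 0 (fun=> 0)
  | inr k => match fintype.split k with
    | inl _ => G (fun=> 0) 1 (fun=> 0)
    | inr j => G (fun=> 0) 0 (phi j)
    end
  end.
have split_l m1 m2 (a : 'I_m1) : fintype.split (lshift m2 a) = inl a :> ('I_m1 + 'I_m2)%type := unsplitK (inl a).
have split_r m1 m2 (a : 'I_m2) : fintype.split (rshift m1 a) = inr a :> ('I_m1 + 'I_m2)%type := unsplitK (inr a).
have sb i : smooth D (b i) by have [] := Sb i.
have esum (c : 'I_(s + (1 + n.+1))%N -> K) p : D p.1 -> \sum_i c i *: e i p =
    G (fun t => \sum_i c (lshift _ i) * b i t) (c (rshift s (lshift _ ord0)))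
      (fun t => \sum_(j < n.+1) c (rshift s (rshift 1 j)) * phi j t) p.
  move=> Dp; rewrite -gen_sum // big_split_ord /=; congr (_ + _).
    by apply: eq_bigr => i _; rewrite /e split_l.
  rewrite big_split_ord /= big_ord1; congr (_ + _).
    by rewrite /e split_r split_l.
  by apply: eq_bigr => i _; rewrite /e !split_r.
exists e; split.
- move=> c Hc; have H p : B p -> G (fun t => \sum_i c (lshift _ i) * b i t)
      (c (rshift s (lshift _ ord0)))
      (fun t => \sum_(j < n.+1) c (rshift s (rshift 1 j)) * phi j t) p = 0.
    by move=> Bp; have [Dp _] := Bp; rewrite -esum //; exact: Hc.
  have ca0 : forall i, c (lshift _ i) = 0.
    by apply: fb => t Dt; have := H (t, x1) (conj Dt Jx1); rewrite /G /gen => -[].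
  have H2 t x : D t -> J x -> c (rshift s (lshift _ ord0)) * (x - phi0 t) +
      \sum_(j < n.+1) c (rshift s (rshift 1 j)) * phi j t = 0.
    move=> Dt Jx; have := H (t, x) (conj Dt Jx).
    rewrite (@gen_ext _ (fun=> 0) _ _ (fun t => \sum_(j < n.+1) c (rshift s (rshift 1 j)) * phi j t)) //.
      rewrite /G /gen /= => -[]; rewrite (derive1_val (dC 0 t)) !mul0r mulr0 !addr0 add0r; exact.
    by move=> u Du; rewrite big1 // => i _; rewrite ca0 mul0r.
  (* Two values of [x] in [J] over the same [t] separate the coefficient of [x - phi0] from
     [psi]. *)
  have c00 : c (rshift s (lshift _ ord0)) = 0.
    have [r r0 Hr] := (openPK (pk := pk) J).1 oJ x1 Jx1.
    pose x2 := x1 + io (r / 2).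
    have ex : x2 - x1 = io (r / 2) by rewrite /x2 addrC addKr.
    have r2 : 0 < r / 2 by rewrite divr_gt0.
    have nx : nm (x2 - x1) = r / 2 by rewrite ex nm_io gtr0_norm.
    have J2 : J x2 by apply: Hr; rewrite nx ltr_pdivrMr // ltr_pMr // ltr1n.
    have h1 := H2 ts x1 Ds Jx1; have h2 := H2 ts x2 Ds J2.
    have : c (rshift s (lshift _ ord0)) * (x2 - x1) = 0.
      move: h1 h2; move: (\sum_(j < n.+1) _) (c _) => X a0 h1 h2.
      have -> : a0 * (x2 - x1) = (a0 * (x2 - phi0 ts) + X) - (a0 * (x1 - phi0 ts) + X) by ring.
      by rewrite h1 h2 subrr.
    have x0 : x2 - x1 != 0 by rewrite -(nm_gt0 (pk := pk)) nx.
    by move/eqP; rewrite mulf_eq0 (negbTE x0) orbF => /eqP.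
  have cj0 (j : 'I_n.+1) : c (rshift s (rshift 1 j)) = 0.
    pose cc (j : nat) := c (rshift s (rshift 1 (inord j))).
    have := freephi cc D oD (@subset_refl _ _) Ds; rewrite -/D => /(_ _ j (ltn_ord j)).
    rewrite /cc inord_val; apply => t Dt; have := H2 t x1 Dt Jx1.
    by rewrite c00 mul0r add0r; under [X in _ -> X = _]eq_bigr do rewrite inord_val.
  move=> i; rewrite -(splitK i); case: (fintype.split i) => [a|k] /=; first exact: ca0.
  rewrite -(splitK k); case: (fintype.split k) => [u|j] /=; last exact: cj0.
  by rewrite (ord1 u).
- apply/seteqP; split=> [v [sv gv]|v [c Hc]].
    have [tau [c0 [psi [St hpsi vE]]]] := forward domD sq sd n2 dn gE gH domJ sv gv.
    have [ca Hca] := spanb tau St; have [cj Hcj] := spanphi D psi domD Ds hpsi.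
    exists (fun i => match fintype.split i with
      | inl a => ca a
      | inr k => match fintype.split k with inl _ => c0 | inr j => cj j end end).
    move=> p Bp; have [Dp _] := Bp; rewrite vE // esum //; rewrite split_r split_l.
    apply: gen_ext => // t Dt; first by rewrite Hca //; apply: eq_bigr => i _; rewrite split_l.
    by rewrite Hcj //; apply: eq_bigr => i _; rewrite !split_r.
  apply: (backward domD sq sd n2 dn gE gH
    (tau := fun t => \sum_i c (lshift _ i) * b i t) (c := c (rshift s (lshift _ ord0)))
    (psi := fun t => \sum_(j < n.+1) c (rshift s (rshift 1 j)) * phi j t)) => //.
  + exact: symm_sum.
  + exact: hom_sum.
  + by move=> p Bp; have [Dp _] := Bp; rewrite Hc // esum.
Qed.

(** With [s = 0] only [tau = 0] is left. Replacing [phi0] by another particular solution [f] changes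
    the field by [c0 * (phi0 - f)], which is a homogeneous solution and is absorbed into [psi]. *)
Lemma lie_linearity (b : 'I_0 -> K -> K) : symm_basis D n q d b ->
  lie_algebra E J = linearity_algebra E J.
Proof.
move=> [_ _ span0]; have [[ts Ds] _ _] := domD.
have [phi [hphi spanphi freephi]] := hom_basis domD sq sd gE gH Ds.
have z t : derive1 (fun=> 0 : K) t = 0 by exact: derive1_val (dC _ _).
have G0 c psi p : G (fun=> 0) c psi p = (0, c * (p.2 - phi0 p.1) + psi p.1).
  by rewrite /G /gen z !mul0r mulr0 !addr0 add0r.
have ffree : fundamental E (fun j : 'I_n.+1 => phi j).
  split=> [i|c Hc i]; first exact: hphi.
  pose cc (j : nat) := c (inord j).
  have := freephi cc D oD (@subset_refl _ _) Ds; rewrite -/D => /(_ _ i (ltn_ord i)).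
  rewrite /cc inord_val; apply => t Dt; rewrite -[RHS](Hc t Dt).
  by apply: eq_bigr => j _; rewrite inord_val.
apply/seteqP; split=> [v [sv gv]|v [f [psi [solf [hpsi _] [c0 [c vE]]]]]].
  have [tau [c0 [psi [St hpsi vE]]]] := forward domD sq sd n2 dn gE gH domJ sv gv.
  have [ca Hca] := span0 tau St; have [cj Hcj] := spanphi D psi domD Ds hpsi.
  exists phi0, (fun j : 'I_n.+1 => phi j); split=> //; first exact: sol_phi0.
  exists c0, (fun j : 'I_n.+1 => cj j) => p Bp; have [Dp _] := Bp; rewrite vE //.
  rewrite -Hcj // -G0; apply: gen_ext => // t Dt.
  by rewrite Hca // big_ord0.
have hs := sol_diff sq gE gH oD sol_phi0 solf.
have hp := hom_sum c hpsi.
apply: (backward domD sq sd n2 dn gE gH (tau := fun=> 0) (c := c0)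
  (psi := fun t => c0 * (phi0 t - f t) + 1 * (\sum_i c i * psi i t))) => //.
- exact: symm_0.
- exact: (hom_comb sq gE gH _ _ oD).
- move=> p Bp; rewrite -/G G0 vE // mul1r; congr pair; ring.
Qed.

(** The transformation is [(t, x) |-> (T t, (x - phi0) / (rho chi))], restricted to a ball on which
    [T] is injective; the target equation is its own normal form with trivial gauge. *)
Lemma straight_maps (U : set K) (T chi : K -> K) (k : nat -> K) t1 : open U -> U `<=` D ->
  smooth U T -> (forall t, U t -> derive1 T t != 0) -> smooth U chi ->
  (forall t, U t -> chi t != 0) -> U t1 ->
  (forall W U' h, open W -> W `<=` U -> open U' -> smooth U' h -> (forall t, W t -> U' (T t)) ->
    forall t, W t -> (Pop q n d (fun t => chi t * h (T t)) t = 0 <-> ccop n k h (T t) = 0)) ->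
  exists (W : set K) (X1 X0 : K -> K), [/\ open W, W t1, [/\ smooth W T, smooth W X1 & smooth W X0],
    forall t, W t -> derive1 T t * X1 t != 0 &
    maps_lode (W `*` setT) (fun p => (T p.1, X1 p.1 * p.2 + X0 p.1)) E
      (Lode setT (fun i : 'I_n.+1 => cst (k i)) (cst 0))].
Proof.
move=> oU UD sT T' schi chi0 U1 H.
have [r [_ [_ [r0 _ Hr Tinj _]]]] := local_inverse (pk := pk) oU U1 sT (T' t1 U1).
pose W := [set t : K | nm (t - t1) < r].
have WU : W `<=` U by move=> t /Hr [].
have oW : open W by have [] := domain_ball (pk := pk) t1 r0.
have oT : open [set: K] by exact: openT.
have WD : W `<=` D by move=> t /WU /UD.
have srV : smooth W (fun t => (rho t)^-1).
  by apply: smoothV => //; [move=> t /WD /rho0|exact: smooth_sub srho].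
have scV : smooth W (fun t => (chi t)^-1).
  by apply: smoothV => //; [move=> t /WU /chi0|exact: smooth_sub schi].
(* The neutral factors and summands reproduce the formulas of [tri_maps] for [rho' = 1], [phi0' = 0]
   and [k = 0]. *)
pose X1 t := 1 * (chi t)^-1 / rho t.
pose X0 t := 1 * (0 - (chi t)^-1 * phi0 t / rho t) + 0.
have s1 (c : K) (A : set K) : smooth A (fun _ : K => c) by exact: smooth_cst.
exists W, X1, X0; split=> //; first by rewrite /W /= subrr nmK0.
- have sp := smooth_sub WD sphi0.
  split; first exact: smooth_sub sT.
    exact (smoothM oW (smoothM oW (s1 1 W) scV) srV).
  exact (smoothD oW (smoothM oW (s1 1 W) (smoothB oW (s1 0 W)
    (smoothM oW (smoothM oW scV sp) srV))) (s1 0 W)).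
- move=> t Wt; rewrite mulf_neq0 ?T' //; first exact: WU.
  by rewrite /X1 mul1r mulf_neq0 // invr_neq0 ?chi0 ?rho0 //; [exact: WU|exact: WD].
have gC : gauge (Lode setT (fun i : 'I_n.+1 => cst (k i)) (cst 0)) (fun=> 1) (fun=> 0) (ccop n k).
  split=> //=.
    move=> A g h oA e t At; rewrite /ccop (derive1n_ext _ oA e At); congr (_ + _).
    by apply: eq_bigr => j _; rewrite (derive1n_ext _ oA e At).
  move=> A f oA _ sf; rewrite (_ : (fun t => _) = f); last first.
    by apply/funext => t; rewrite subr0 divr1.
  by split=> [[_ _ h] t At|h]; [exact: h|split].
apply: (@tri_maps K _ E _ rho phi0 _ (fun=> 1) (fun=> 0) _ (W `*` setT) W T (fun t => (chi t)^-1)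
  (fun=> 0) X1 X0 gE gC) => //.
- by apply: (open_prod (pk := pk)) => //; exact: openT.
- by move=> p [].
- exact: smooth_sub sT.
- by move=> t t' /set_mem Wt /set_mem Wt'; exact: Tinj.
- by move=> t /WU /T'.
- by move=> t /WU /chi0; exact: invr_neq0.
move=> W' U' h oW' W'W oU' _ sh TU t W't.
have W'U : W' `<=` U by move=> s /W'W /WU.
have e s : W' s -> (chi s)^-1^-1 * (h (T s) - 0) = chi s * h (T s) by rewrite invrK subr0.
by rewrite (Pop_ext q n d oW' e W't); exact: (H W' U').
Qed.

Lemma straight_similar tau : S tau -> (forall t, D t -> tau t != 0) ->
  exists2 E' : lode K n.+1, const_coef_lode E' & similar E E'.
Proof.
move=> [stau th ee] taun; have [[ts Ds] _ _] := domD; have stau' := smooth_derive1 stau.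
have sV : smooth D (fun t => (tau t)^-1) by exact: smoothV.
have [T [T0 sT dT]] := smooth_primitive (pk := pk) domD Ds sV.
have sf : smooth D (fun t => (n%:R / 2 * derive1 tau t + 0) / tau t).
  apply: smoothM => //; apply: smoothD => //; last exact: smooth_cst.
  exact: smoothZ.
have [chi [chi1 schi chin dchi]] := scalar_exists (pk := pk) domD Ds sf.
have dn0 t : D t -> d n.+1 t = 0.
  by move=> _; rewrite dn //; apply: leq_trans (leq_pred n) _.
have [k Hk] := straighten (pk := pk) domD sq sd dn0 stau schi sT taun chin dT dchi th ee.
exists (Lode setT (fun i : 'I_n.+1 => cst (k i)) (cst 0)).
  by split=> //= [i|]; [exists (k i)|exists 0].
move=> p [/= Dp _].
have [||W [X1 [X0 [oW Wt _ _ mp]]]] := @straight_maps D T chi k p.1 oD (@subset_refl _ _) sT _ schi chin Dp.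
- by move=> t Dt; rewrite (derive1_val (dT t Dt)) invr_neq0 // taun.
- move=> W U' h oW WD oU' sh WU' t Wt; rewrite (Hk W U') //.
  have h1 := chin t (WD t Wt); have h2 := taun t (WD t Wt).
  rewrite -/(ccop n k h (T t)); split=> [/eqP|->]; last by rewrite mulr0.
  by rewrite !mulf_eq0 (negbTE h1) expf_eq0 invr_eq0 (negbTE h2) andbF => /eqP.
by exists (W `*` setT), (fun p => (T p.1, X1 p.1 * p.2 + X0 p.1)).
Qed.

Lemma elementary_maps : (forall j t, D t -> d j t = 0) -> reduced_to_elementary E.
Proof.
move=> d0 t1 D1; have s0 : smooth D (fun=> 0 : K) by exact: smooth_cst.
(* Only [y] and [T] of the quadratic coordinate are wanted, and with [tau = 0] they are available
   around every point. *)
have [_ th _] := symm_0 D n q d.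
have [U [y [T [a [b [[domU U1 UD sy sT] [yn y2 dT T0 _]]]]]]] :=
  quadratic_coordinate (pk := pk) domD sq s0 th D1 erefl.
have [_ oU _] := domU; have sqU := smooth_sub UD sq.
have [|||||W [X1 [X0 [oW Wt sm jac mp]]]] :=
  @straight_maps U T (fun t => y t ^+ n) (fun=> 0) t1 oU UD sT.
- by move=> t Ut; rewrite dT // invr_neq0 // expf_neq0 // yn.
- exact: smoothX.
- by move=> t Ut; rewrite expf_neq0 // yn.
- exact: U1.
- move=> W U' h oW' WU oU' sh WU' t Wt; rewrite (Pop_d0 _ _ _ d0 (UD t (WU t Wt))).
  have y0 := yn t (WU t Wt).
  rewrite (FF_straight_top n oW' (smooth_sub WU sqU) (smooth_sub WU sy) (smooth_sub WU sT)
    (fun t Ht => yn t (WU t Ht)) (fun t Ht => y2 t (WU t Ht)) (fun t Ht => dT t (WU t Ht))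
    oU' sh WU' Wt).
  rewrite /ccop big1 ?addr0; last by move=> j _; rewrite mul0r.
  split=> [/eqP|->]; last by rewrite mulr0.
  by rewrite !mulf_eq0 !expf_eq0 invr_eq0 (negbTE y0) !andbF => /eqP.
by exists W, T, X1, X0.
Qed.

Lemma elementary_similar : (forall j t, D t -> d j t = 0) ->
  exists2 E' : lode K n.+1, const_coef_lode E' & similar E E'.
Proof.
move=> d0; exists (elementary K n.+1).
  by split=> //= [i|]; exists 0.
move=> p [/= Dp _]; have [W [T [X1 [X0 [oW Wt _ _ mp]]]]] := elementary_maps d0 Dp.
by exists (W `*` setT), (fun p => (T p.1, X1 p.1 * p.2 + X0 p.1)).
Qed.

End Final.

Theorem proposition26 (R : realType) (K : numFieldType)
    (hK : K = R :> numFieldType \/ K = R[i] :> numFieldType)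
    (r : nat) (hr : (3 <= r)%N) (E : lode K r) (hD : domain (dom E))
    (hE : smooth_lode E) (J : set K) (hJ : domain J) :
  let B := dom E `*` J in
  let g := lie_algebra E J in
  [/\ exists2 n, n \in [:: r.+1; r.+2; r.+4] & has_dim B g n,
      has_dim B g r.+1 -> g = linearity_algebra E J,
      forall n, (r.+2 <= n)%N -> has_dim B g n ->
        exists2 E' : lode K r, const_coef_lode E' & similar E E'
    & has_dim B g r.+4 -> reduced_to_elementary E].
Proof.
(* The package is data, while [hK] is a disjunction of propositions; the existential keeps the case
   analysis inside [Prop]. *)
move=> B g; have [pk _] : exists pk : kpkg R K, True.
  by case: hK => ->; [exists (kpkg_real R)|exists (kpkg_complex R)].
case: r hr E hD hE @B @g => [//|n] n2 E hD hE B g; rewrite ltnS in n2.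
have [rho [q [d [phi0 [sq sd dn gE gH]]]]] := gauge_exists (pk := pk) n2 hD hE.
have [s [b [bas cases]]] := symm_dim (pk := pk) hD sq sd dn.
have dim := lie_has_dim (pk := pk) hD sq sd n2 dn gE gH hJ bas.
(* A basis element [tau] either has no zero on the domain and gives the coordinate with
   [T' = 1 / tau], or it has one, and then [d = 0] and the elementary equation serves as target. *)
have simE : (0 < s)%N -> exists2 E' : lode K n.+1, const_coef_lode E' & similar E E'.
  move=> s0; have [Sb fb _] := bas; pose i0 := Ordinal s0.
  have [t1 [D1 b1]] : exists t1, dom E t1 /\ b i0 t1 != 0.
    apply: contrapT => /forallNP H; suff /eqP : (1 : K) = 0 by rewrite oner_eq0.
    have := fb (fun i => (i == i0)%:R) _ i0; rewrite eqxx; apply => t Dt.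
    rewrite (bigD1 i0) //= ?eqxx big1 ?addr0 => [|i /negbTE ->]; last by rewrite mul0r.
    by apply/eqP; apply: contrapT => /negP nb; apply: (H t); rewrite mul1r in nb.
  have [z|/existsNP [t0 /not_implyP [D0 /negP/negPn/eqP b0]]] := EM (forall t, dom E t -> b i0 t != 0).
    exact: (straight_similar (pk := pk) hD sq sd dn gE (Sb i0) z).
  apply: (elementary_similar (pk := pk) hD sq gE).
  exact: (symm_vanishing (pk := pk) hD sq sd dn (Sb i0) D0 b0 D1 b1).
(* The dimension is brought to the form [(s + n).+2], that is [r + 1 + s] with [r = n + 1];
   comparison with a given dimension by [has_dim_unique] then determines [s]. *)
rewrite !addnA addn1 addSn addnS in dim.
split.
- exists (s + n).+2 => //; rewrite !inE.
  by case: cases => [->|->|[-> _]]; rewrite ?add0n ?add1n ?addSn ?add0n eqxx ?orbT.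
- move=> h; have := has_dim_unique dim h => -[e]; have s0 : s = 0%N by apply/eqP; rewrite -(eqn_add2r n) e.
  by move: b bas {dim simE cases}; rewrite s0 => b bas; exact: (lie_linearity (pk := pk) hD sq sd n2 dn gE gH hJ bas).
- move=> m hm h; have e := has_dim_unique dim h; apply: simE.
  by move: hm; rewrite -e !ltnS -{1}[n]add0n ltn_add2r.
- move=> h; have := has_dim_unique dim h => -[e]; have s3 : s = 3 by apply/eqP; rewrite -(eqn_add2r n) e.
  case: cases => [s0|s0|[_ d0]]; [by rewrite s0 in s3|by rewrite s0 in s3|].
  exact: (elementary_maps (pk := pk) hD sq gE d0).
Qed.
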